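(* Let $k\ge2$ and $n-k\ge2$, let $L=\Sigma_{n-k,n-k,\dots,n-k,n-k-1}$ be a line in $G(k,n)$, and let $\Gamma$ be a set of $r$ points contained in $L$. Let $X_\Gamma$ be the blow-up of $G(k,n)$ along $\Gamma$. Then $\overline{\mathrm{Eff}}_1(X_\Gamma)$ is S-generated.
   Context: Work over an algebraically closed field of characteristic zero. $G(k,n)$ is the Grassmannian of $k$-dimensional subspaces of a fixed $n$-dimensional vector space, of dimension $k(n-k)$. $\Sigma_{n-k,\dots,n-k,n-k-1}$ is a one-dimensional Schubert variety: the set of $k$-dimensional subspaces $W$ with $\Phi\subset W\subset\Lambda$, for fixed subspaces $\Phi\subset\Lambda$ of dimensions $k-1$ and $k+1$; its class is the one-dimensional Schubert class, equivalently the class of a line in the Plücker embedding. $N_1(X_\Gamma)$ is the real vector space of 1-cycles on $X_\Gamma$ modulo numerical equivalence, and $\overline{\mathrm{Eff}}_1(X_\Gamma)\subset N_1(X_\Gamma)$ is the closed convex cone of pseudoeffective classes (limits of classes of effective curves). $\overline{\mathrm{Eff}}_1(X_\Gamma)$ is called S-generated if it is the cone spanned by the classes of lines contained in the exceptional divisors (each isomorphic to $\mathbb{P}^{k(n-k)-1}$) and the classes of strict transforms of the one-dimensional Schubert class on $G(k,n)$, possibly passing through points of $\Gamma$, i.e. strict transforms of curves in $G(k,n)$ having the one-dimensional Schubert class. *)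

(* Defs.v *)
From HB Require Import structures.
From mathcomp Require Import all_boot all_order all_algebra.
From mathcomp Require Import all_classical all_reals all_analysis.
From mathcomp Require Import -(notations) mpoly.

Set Implicit Arguments.
Unset Strict Implicit.
Unset Printing Implicit Defensive.

Import Order.TTheory GRing.Theory Num.Theory.
Import numFieldNormedType.Exports.

Local Open Scope classical_set_scope.
Local Open Scope ring_scope.

(* Classical algebraic geometry in the product (P^(N-1))^s of s projective
   spaces over K.  A point of the product is represented by any matrix
   z : 'M[K]_(s, N) whose rows are nonzero, row i z being a vector of homogeneous
   coordinates of the i-th component; two matrices represent the same point when
   their rows are proportional.  A subset of the product is represented by the
   set of all representatives of its points. *)

Definition ppoint (K : fieldType) (s N : nat) : set 'M[K]_(s, N) :=
  [set z | forall i, row i z != 0].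

Definition mpolyM (K : fieldType) (s N : nat) := mpoly (s * N) K.

Definition mevalM (K : fieldType) (s N : nat) (p : mpolyM K s N)
    (z : 'M[K]_(s, N)) : K :=
  meval (fun l => mxvec z 0 l) p.

(* The multidegree d gives the degree in each of the s groups of N variables. *)
Definition mhomog (K : fieldType) (s N : nat) (d : 'I_s -> nat)
    (p : mpolyM K s N) : Prop :=
  forall m : multinom (s * N), m \in msupp p ->
  forall i : 'I_s,
    (\sum_(j < N) m (mxvec_index i j))%N = d i.

Definition zclosed (K : fieldType) (s N : nat) (Z : set 'M[K]_(s, N)) : Prop :=
  exists S : set (mpolyM K s N),
    (forall p, S p -> exists d, mhomog d p) /\
    Z = [set z | ppoint z /\ forall p, S p -> mevalM p z = 0].

Definition zclosure (K : fieldType) (s N : nat) (A : set 'M[K]_(s, N)) :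
    set 'M[K]_(s, N) :=
  [set z | forall Z, zclosed Z -> A `<=` Z -> Z z].

Definition irred_closed (K : fieldType) (s N : nat)
    (Z : set 'M[K]_(s, N)) : Prop :=
  [/\ zclosed Z, Z !=set0 &
    forall Z1 Z2, zclosed Z1 -> zclosed Z2 -> Z `<=` Z1 `|` Z2 ->
      Z `<=` Z1 \/ Z `<=` Z2].

Definition is_point (K : fieldType) (s N : nat) (Z : set 'M[K]_(s, N)) : Prop :=
  exists2 z, ppoint z &
    Z = [set w | forall i, (row i w == row i z)%MS].

(* Irreducible closed subsets of Krull dimension 1. *)
Definition is_curve (K : fieldType) (s N : nat) (C : set 'M[K]_(s, N)) : Prop :=
  [/\ irred_closed C, ~ is_point C &
    forall Z, irred_closed Z -> Z `<=` C -> Z = C \/ is_point Z].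

(* A rational function on C is represented by any K-valued function that agrees
   with a quotient of multihomogeneous polynomials of equal multidegree on a
   nonempty open subset of C; its values elsewhere are irrelevant. *)

Definition gen_eq (K : fieldType) (s N : nat) (C : set 'M[K]_(s, N))
    (f g : 'M[K]_(s, N) -> K) : Prop :=
  exists Z, [/\ zclosed Z, ~ (C `<=` Z) &
    forall z, C z -> ~ Z z -> f z = g z].

Definition ratfun (K : fieldType) (s N : nat) (C : set 'M[K]_(s, N))
    (f : 'M[K]_(s, N) -> K) : Prop :=
  exists d (p q : mpolyM K s N),
    [/\ mhomog d p, mhomog d q, exists2 z, C z & mevalM q z != 0 &
      gen_eq C f (fun z => mevalM p z / mevalM q z)].

Definition ratfun_neq0 (K : fieldType) (s N : nat) (C : set 'M[K]_(s, N))
    (f : 'M[K]_(s, N) -> K) : Prop :=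
  ratfun C f /\ ~ gen_eq C f (fun=> 0).

(* Normalized discrete valuations of K(C)/K, that is, points of the
   normalization of C.  The value 0 is imposed outside K(C)^* so that distinct v
   are distinct valuations. *)
Record place (K : fieldType) (s N : nat) (C : set 'M[K]_(s, N))
    (v : ('M[K]_(s, N) -> K) -> int) : Prop := Place {
  place_out : forall f, ~ ratfun_neq0 C f -> v f = 0;
  place_ext : forall f g, ratfun_neq0 C f -> gen_eq C f g -> v f = v g;
  place_mul : forall f g, ratfun_neq0 C f -> ratfun_neq0 C g ->
    v (f \* g) = v f + v g;
  place_add : forall f g, ratfun_neq0 C f -> ratfun_neq0 C g ->
    ratfun_neq0 C (f \+ g) -> Num.min (v f) (v g) <= v (f \+ g);
  place_cst : forall c : K, c != 0 -> v (fun=> c) = 0;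
  place_norm : exists2 f, ratfun_neq0 C f & v f = 1 }.

(* The valuation ring of v dominates the local ring of C at the point z. *)
Definition center (K : fieldType) (s N : nat) (C : set 'M[K]_(s, N))
    (v : ('M[K]_(s, N) -> K) -> int) (z : 'M[K]_(s, N)) : Prop :=
  C z /\
  forall d (p q : mpolyM K s N), mhomog d p -> mhomog d q ->
    (exists2 y, C y & mevalM p y != 0) -> mevalM q z != 0 ->
    let f := fun y => mevalM p y / mevalM q y in
    0 <= v f /\ (mevalM p z = 0 -> 0 < v f).

Definition regular_on (K : fieldType) (s N : nat) (U : set 'M[K]_(s, N))
    (f : 'M[K]_(s, N) -> K) : Prop :=
  forall z, U z -> exists d (p q : mpolyM K s N) Z,
    [/\ mhomog d p, mhomog d q, zclosed Z, ~ Z z &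
      forall y, U y -> ~ Z y ->
        mevalM q y != 0 /\ f y = mevalM p y / mevalM q y].

(* A line bundle on X, given by transition functions; a section is a family
   (s_i) with s_i = g_ij s_j. *)
Record line_bundle (K : fieldType) (s N : nat) (X : set 'M[K]_(s, N)) :=
  LineBundle {
  lb_size : nat;
  lb_open : 'I_lb_size -> set 'M[K]_(s, N);
  lb_trans : 'I_lb_size -> 'I_lb_size -> 'M[K]_(s, N) -> K;
  lb_openP : forall i, lb_open i `<=` X /\ zclosed (X `\` lb_open i);
  lb_cover : forall z, X z -> exists i, lb_open i z;
  lb_regular : forall i j,
    regular_on (lb_open i `&` lb_open j) (lb_trans i j);
  lb_unit : forall i j z, lb_open i z -> lb_open j z -> lb_trans i j z != 0;
  lb_cocycle : forall i j l z, lb_open i z -> lb_open j z -> lb_open l z ->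
    lb_trans i j z * lb_trans j l z = lb_trans i l z }.

(* Nonzero rational sections of the restriction of L to a curve C in X. *)
Definition ratsection (K : fieldType) (s N : nat) (X : set 'M[K]_(s, N))
    (L : line_bundle X) (C : set 'M[K]_(s, N))
    (sigma : 'I_(lb_size L) -> 'M[K]_(s, N) -> K) : Prop :=
  (forall i, C `&` lb_open i !=set0 -> ratfun_neq0 C (sigma i)) /\
  (forall i j, C `&` lb_open i !=set0 -> C `&` lb_open j !=set0 ->
     gen_eq C (sigma i) (lb_trans i j \* sigma j)).
Arguments ratsection {K s N X} L C sigma.

(* The order of sigma at v is v (sigma i) for any i such that the center of v is
   in the i-th open set. *)
Definition ord_section (K : fieldType) (s N : nat) (X : set 'M[K]_(s, N))
    (L : line_bundle X) (C : set 'M[K]_(s, N))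
    (sigma : 'I_(lb_size L) -> 'M[K]_(s, N) -> K)
    (v : ('M[K]_(s, N) -> K) -> int) : int :=
  xget 0 [set e | exists i z, [/\ center C v z, lb_open i z & e = v (sigma i)]].
Arguments ord_section {K s N X} L C sigma v.

(* The intersection number L.C: the degree on the normalization of C of the
   divisor of any nonzero rational section. *)
Definition degree (K : fieldType) (s N : nat) (X : set 'M[K]_(s, N))
    (L : line_bundle X) (C : set 'M[K]_(s, N)) : int :=
  xget 0 [set e | exists2 sigma, ratsection L C sigma &
    e = \sum_(v \in place C) ord_section L C sigma v].

(* A real 1-cycle modulo numerical equivalence is identified with the function
   mapping each line bundle to its intersection number with the cycle. *)

Definition curve_class (R : realType) (K : fieldType) (s N : nat)
    (X C : set 'M[K]_(s, N)) : line_bundle X -> R :=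
  fun L => (degree L C)%:~R.
Arguments curve_class R {K s N} X C L.

Definition curve_classes (R : realType) (K : fieldType) (s N : nat)
    (X : set 'M[K]_(s, N)) : set (line_bundle X -> R) :=
  [set curve_class R X C | C in [set C | is_curve C /\ C `<=` X]].
Arguments curve_classes R {K s N} X.

Definition span_of (R : realType) (T : Type) (S : set (T -> R)) : set (T -> R) :=
  [set a | exists m (c : 'I_m -> R) (b : 'I_m -> T -> R),
    (forall i, S (b i)) /\ a = (fun t => \sum_i c i * b i t)].

Definition cone_of (R : realType) (T : Type) (S : set (T -> R)) : set (T -> R) :=
  [set a | exists m (c : 'I_m -> R) (b : 'I_m -> T -> R),
    [/\ forall i, 0 <= c i, forall i, S (b i) &
        a = (fun t => \sum_i c i * b i t)]].

Definition N1 (R : realType) (K : fieldType) (s N : nat)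
    (X : set 'M[K]_(s, N)) : set (line_bundle X -> R) :=
  span_of (curve_classes R X).
Arguments N1 R {K s N} X.

(* Closure in N1.  As N1 is finite-dimensional, the topology of pointwise
   convergence on line bundles induces on it its vector space topology. *)
Definition pseudoeff1 (R : realType) (K : fieldType) (s N : nat)
    (X : set 'M[K]_(s, N)) : set (line_bundle X -> R) :=
  N1 R X `&`
  closure (cone_of (curve_classes R X) : set {ptws line_bundle X -> R}).
Arguments pseudoeff1 R {K s N} X.

(* The blow-up of a projective variety X at points p_a of X is the closure of
   the graph of the product of the linear projections from the p_a.  The matrix
   cokermx (p a) has kernel the line of p a, so x |-> x *m cokermx (p a) is the
   projection from p a onto a linear subspace of dimension N - 2 in P^(N-1). *)

Definition graph_pt (K : fieldType) (r N : nat) (p : 'I_r -> 'rV[K]_N)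
    (x : 'rV[K]_N) : 'M[K]_(1 + r, N) :=
  col_mx x (\matrix_(a < r) (x *m cokermx (p a))).

Definition strict_transform (K : fieldType) (r N : nat) (p : 'I_r -> 'rV[K]_N)
    (C : set 'rV[K]_N) : set 'M[K]_(1 + r, N) :=
  zclosure [set graph_pt p x |
    x in [set x | C x /\ forall a, ~~ (x <= p a)%MS]].

Definition blowup (K : fieldType) (r N : nat) (X : set 'rV[K]_N)
    (p : 'I_r -> 'rV[K]_N) : set 'M[K]_(1 + r, N) :=
  strict_transform p X.

Definition exceptional (K : fieldType) (r N : nat) (X : set 'rV[K]_N)
    (p : 'I_r -> 'rV[K]_N) (a : 'I_r) : set 'M[K]_(1 + r, N) :=
  [set z | blowup X p z /\ (usubmx z <= p a)%MS].

(* The component row (rshift 1 a) embeds the exceptional divisor over p a as a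
   linear subspace of P^(N-1). *)
Definition exceptional_line (K : fieldType) (r N : nat) (X : set 'rV[K]_N)
    (p : 'I_r -> 'rV[K]_N) (a : 'I_r) (C : set 'M[K]_(1 + r, N)) : Prop :=
  [/\ is_curve C, C `<=` exceptional X p a &
    exists2 U : 'M[K]_(2, N), row_free U &
      [set row (rshift 1 a) z | z in C] = [set y | y != 0 /\ (y <= U)%MS]].

(* Pluecker coordinates of the row space of a k x n matrix, indexed by the
   increasing maps 'I_k -> 'I_n. *)

Definition increasing (k n : nat) : {set {ffun 'I_k -> 'I_n}} :=
  finset (fun f : {ffun 'I_k -> 'I_n} =>
    [forall a : 'I_k, forall b : 'I_k, (a < b)%N ==> (f a < f b)%N]).

Definition pluecker (K : fieldType) (k n : nat) (A : 'M[K]_(k, n)) :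
    'rV[K]_#|increasing k n| :=
  \row_(i < #|increasing k n|)
    \det (colsub (enum_val i : {ffun 'I_k -> 'I_n}) A).

Definition grassmannian (K : fieldType) (k n : nat) :
    set 'rV[K]_#|increasing k n| :=
  [set x | exists (A : 'M[K]_(k, n)) (c : K),
    [/\ row_free A, c != 0 & x = c *: pluecker A]].
Arguments grassmannian : clear implicits.

(* The subspaces W with Phi <= W <= Lam. *)
Definition schubert_line (K : fieldType) (k n : nat)
    (Phi : 'M[K]_(k.-1, n)) (Lam : 'M[K]_(k.+1, n)) :
    set 'rV[K]_#|increasing k n| :=
  [set x | exists (A : 'M[K]_(k, n)) (c : K),
    [/\ row_free A, (Phi <= A <= Lam)%MS, c != 0 & x = c *: pluecker A]].

Definition schubert_flag (K : fieldType) (k n : nat)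
    (Phi : 'M[K]_(k.-1, n)) (Lam : 'M[K]_(k.+1, n)) : Prop :=
  [/\ row_free Phi, row_free Lam & (Phi <= Lam)%MS].

Definition schubert_curve (R : realType) (K : fieldType) (k n : nat)
    (C : set 'rV[K]_#|increasing k n|) : Prop :=
  [/\ is_curve C, C `<=` grassmannian K k n &
    exists (Phi : 'M[K]_(k.-1, n)) (Lam : 'M[K]_(k.+1, n)),
      schubert_flag Phi Lam /\
      curve_class R (grassmannian K k n) C
        = curve_class R (grassmannian K k n) (schubert_line Phi Lam)].
Arguments schubert_curve R {K k n} C.

Definition S_generated (R : realType) (K : fieldType) (k n r : nat)
    (p : 'I_r -> 'rV[K]_#|increasing k n|) : Prop :=
  let G := grassmannian K k n in
  let X := blowup G p in
  pseudoeff1 R X =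
  cone_of ([set curve_class R X C |
              C in [set C | exists a, exceptional_line G p a C]] `|`
           [set curve_class R X (strict_transform p C) |
              C in [set C | schubert_curve R C]]).
Arguments S_generated R {K k n r} p.

(* Main.v *)
From HB Require Import structures.
From mathcomp Require Import all_boot all_order all_algebra all_fingroup.
From mathcomp Require Import all_classical all_reals all_analysis.
From mathcomp Require Import -(notations) mpoly.
From mathcomp Require Import -(notations) finmap.
From mathcomp Require Import ring zify.
Require Import Defs.

(** Let X be the blow-up of the Grassmannian G at the points p_1, ..., p_r of the line L.
    It is the closure of the graph of the projections from the p_a, in a product of 1 + r
    projective spaces.  So a curve C in X has degrees d_0(C), ..., d_r(C) >= 0 with respect
    to the bundles O(1) of the factors ([fdeg], [O1]).  The theorem follows from two facts.

    First, every line bundle on X has degree a_0 d_0(C) + ... + a_r d_r(C) on C, with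
    integers a_i that do not depend on C ([degree_formula]).  In terms of the hyperplane
    class H and the exceptional divisors E_a, the d_i are the degrees of H and of the
    H - E_a, and the formula replaces the knowledge of the Picard group of X.

    Second, for every i there is a generator b_i of the cone on which d_i is positive and the
    other d_j vanish.  For i = 0 it is the strict transform of L: this line passes through
    all the p_a, and is contracted to a point by the projection from any of its points
    ([strict_line_degree]).  For i = a it is a line in E_a ([exceptional_line_ex]).

    Hence the class of C is the sum of the classes of the b_i with coefficients
    d_i(C) / d_i(b_i) >= 0.  The coefficients are linear in the class of C, the d_i being
    degrees of line bundles, so this description persists for limits of classes
    ([closure_cone]), and the pseudoeffective cone is spanned by the classes of the b_i.

    The degree formula rests on two ingredients.  One is the theory of places of a function
    field of transcendence degree one, with the fact that principal divisors have degree 0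
    ([sum_places]); the function field of a curve is of this kind by [curve_algdep].  Thus
    a degree can be computed from any rational section, place by place ([degreeP]).

    The other one is a trivialization of the bundle on explicit charts, which exists because
    polynomial rings are factorial ([chart_trivial]).  A first chart sends a k x n matrix A to
    its row space.  Replacing A by B A multiplies the trivializing section by a power of
    det B, because it does so along unipotent lines and along one torus ([weight_ex]).  A
    chart around E_b sends (t, Y) to the row space of A_b + t Y, where A_b is a matrix of p_b.
    The two trivializations differ there by a power of t, since their quotient is a unit for t
    nonzero outside a set of codimension at least two ([compare_charts]).  Up to sign,
    these exponents are the coefficients of the bundle along H and E_b.  Indeed, at a place of C, one
    normalizes the matrix of the generic point of C so that it reduces to a point where the
    trivialization is a unit.  The order of the section is then read off the normalization,
    and is a combination of the minimal valuations of the components of the generic point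
    ([generic_place]); for curves contained in E_b one works at t = 0 ([fibre_place]).
    Summing over the places gives the formula. *)

Set Implicit Arguments.
Unset Strict Implicit.
Unset Printing Implicit Defensive.
Import Order.TTheory GRing.Theory Num.Theory.

Local Open Scope classical_set_scope.
Local Open Scope ring_scope.

(** * Unique factorization in polynomial rings *)

Section Factorization.
Variable R : idomainType.
Implicit Types a b c p q : R.

Definition divides a b : Prop := exists c, b = c * a.

Record prime_elt p : Prop := PrimeElt {
  prime_elt_neq0 : p != 0;
  prime_elt_nunit : p \isn't a GRing.unit;
  prime_eltM : forall a b, divides p (a * b) -> divides p a \/ divides p b }.

(** Working with products of primes instead of irreducible elements makes
    uniqueness of the factorization automatic. *)
Definition factors a : Prop :=
  exists (u : R) (s : seq R),
    [/\ u \is a GRing.unit, forall p, p \in s -> prime_elt p &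
        a = u * \prod_(p <- s) p].

Lemma divides_refl a : divides a a. Proof. by exists 1; rewrite mul1r. Qed.

Lemma divides_trans a b c : divides a b -> divides b c -> divides a c.
Proof. by move=> [x ->] [y ->]; exists (y * x); rewrite mulrA. Qed.

Lemma divides_mull a b c : divides a b -> divides a (c * b).
Proof. by move=> [x ->]; exists (c * x); rewrite mulrA. Qed.

Lemma divides_mulr a b c : divides a b -> divides a (b * c).
Proof. by rewrite mulrC; apply: divides_mull. Qed.

Lemma dividesD a b c : divides a b -> divides a c -> divides a (b + c).
Proof. by move=> [x ->] [y ->]; exists (x + y); rewrite mulrDl. Qed.

Lemma prime_elt_ndiv_unit p u : prime_elt p -> u \is a GRing.unit -> ~ divides p u.
Proof.
move=> pp uu [x ux]; move: uu; rewrite ux unitrM => /andP[_].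
by rewrite (negbTE (prime_elt_nunit pp)).
Qed.

Lemma divides_prod (I : eqType) (r : seq I) (F : I -> R) p :
  prime_elt p -> divides p (\prod_(i <- r) F i) ->
  exists2 i, i \in r & divides p (F i).
Proof.
move=> pp; elim: r => [|i r IH].
  by rewrite big_nil => /(prime_elt_ndiv_unit pp (unitr1 _)).
rewrite big_cons => /(prime_eltM pp)[pi|/IH[j jr pj]].
  by exists i => //; rewrite mem_head.
by exists j => //; rewrite inE jr orbT.
Qed.

Lemma prime_divides_assoc p q : prime_elt p -> prime_elt q -> divides p q ->
  exists2 u, u \is a GRing.unit & q = u * p.
Proof.
move=> pp pq [x xq]; exists x => //.
have : divides q (x * p) by rewrite -xq; apply: divides_refl.
move=> /(prime_eltM pq)[[y xy]|[y yp]].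
  move: xq; rewrite xy -mulrA (mulrC q) mulrA -{1}(mul1r q) => /(mulIf (prime_elt_neq0 pq)) yp.
  exfalso; have : p \is a GRing.unit.
    by apply/unitrPr; exists y; rewrite mulrC.
  by rewrite (negbTE (prime_elt_nunit pp)).
apply/unitrPr; exists y.
move: xq; rewrite yp mulrA -{1}(mul1r q) => /(mulIf (prime_elt_neq0 pq)) //.
Qed.

Lemma factorsM a b : factors a -> factors b -> factors (a * b).
Proof.
move=> [u [s [uu sp ->]]] [v [t [vu tp ->]]]; exists (u * v), (s ++ t); split.
- by rewrite unitrM uu.
- by move=> p; rewrite mem_cat => /orP[/sp|/tp].
- by rewrite big_cat /= mulrACA.
Qed.

Lemma factors_prime p : prime_elt p -> factors p.
Proof.
move=> pp; exists 1, [:: p]; split; rewrite ?unitr1 ?big_seq1 ?mul1r //.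
by move=> q; rewrite inE => /eqP->.
Qed.

Lemma factors_unit u : u \is a GRing.unit -> factors u.
Proof. by move=> uu; exists u, [::]; split; rewrite // big_nil mulr1. Qed.

(** A prime that divides the product is associated to one of the factors. *)
Lemma factors_cancel (w : R) (s : seq R) p b :
  (forall q, q \in s -> prime_elt q) -> prime_elt p -> ~ divides p w ->
  w * \prod_(q <- s) q = b * p ->
  exists u s', [/\ u \is a GRing.unit, {subset s' <= s}, (size s').+1 = size s
    & b = (w * u) * \prod_(q <- s') q].
Proof.
move=> sp pp npw E.
have : divides p (w * \prod_(q <- s) q) by rewrite E; exists b.
move=> /(prime_eltM pp)[//|/(divides_prod pp)[q qs pq]].
have [u uu qE] := prime_divides_assoc pp (sp _ qs) pq.
exists u, (rem q s); split => //.
- exact: mem_rem.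
- by rewrite size_rem // prednK //; case: (s) qs.
- apply: (mulIf (prime_elt_neq0 pp)); rewrite -E (perm_big _ (perm_to_rem qs)) big_cons.
  by rewrite /= {1}qE !mulrA -!mulrA; congr (_ * (_ * _)); rewrite mulrC.
Qed.

Lemma nunit_prime_divides a : factors a -> a \isn't a GRing.unit ->
  exists2 p, prime_elt p & divides p a.
Proof.
move=> [u [[|p s] [uu sp ->]]]; first by rewrite big_nil mulr1 uu.
move=> _; exists p; first by apply: sp; rewrite mem_head.
by rewrite big_cons; apply: divides_mull; apply: divides_mulr; apply: divides_refl.
Qed.

End Factorization.

Definition ufd (R : idomainType) : Prop := forall a : R, a != 0 -> factors a.

Lemma ufd_field (K : fieldType) : ufd K.
Proof. by move=> a a0; apply: factors_unit; rewrite unitfE. Qed.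

Section Gauss.
Variable R : idomainType.
Hypothesis ufdR : ufd R.
Implicit Types (c p : R) (f g h : {poly R}).

Definition primitive f : Prop := forall p, prime_elt p -> ~ divides p%:P f.

Lemma divides_polyC p f : divides p%:P f <-> forall i, divides p f`_i.
Proof.
split=> [[g ->] i|H]; first by rewrite mulrC coefCM; exists g`_i; rewrite mulrC.
pose c i := projT1 (cid (H i)).
exists (\poly_(i < size f) c i); apply/polyP => i; rewrite mulrC coefCM coef_poly.
case: ltnP => [_|sf]; last by rewrite mulr0 nth_default.
by rewrite mulrC /c; case: cid.
Qed.

(** Reducing modulo p: the lowest coefficients of f and g outside (p) multiply
    to a coefficient of f * g outside (p). *)
Lemma prime_polyC p : prime_elt p -> prime_elt p%:P.
Proof.
move=> pp; split; first by rewrite polyC_eq0 (prime_elt_neq0 pp).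
  rewrite poly_unitE coefC /= size_polyC (prime_elt_neq0 pp) /=.
  exact: prime_elt_nunit.
move=> f g; rewrite divides_polyC => fg; apply: contrapT => /not_orP[nf ng].
have wit h : ~ divides p%:P h -> exists i, ~ divides p h`_i /\
    forall j, (j < i)%N -> divides p h`_j.
  rewrite divides_polyC -existsNP => -[n Hn].
  have ex : exists n, `[< ~ divides p h`_n >] by exists n; apply/asboolP.
  case: (ex_minnP ex) => i /asboolP ndi min; exists i; split=> // j ji.
  apply: contrapT => ndj; have /asboolP/min := ndj; by rewrite leqNgt ji.
have [i [ni mi]] := wit _ nf; have [j [nj mj]] := wit _ ng.
have := fg (i + j)%N; rewrite coefM.
have ij : (i < (i + j).+1)%N by rewrite ltnS leq_addr.
rewrite (bigD1 (Ordinal ij)) //= addKn => H.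
suff /(prime_eltM pp)[] : divides p (f`_i * g`_j) by [].
set S := \sum_(_ < _ | _) _ in H.
have pS : divides p S.
  rewrite /S; elim/big_rec: _ => [|k x /eqP kn px]; first by exists 0; rewrite mul0r.
  apply: dividesD => //.
  have [ki|ik|ki] := ltngtP (k : nat) i.
  - by apply: divides_mulr; apply: mi.
  - apply: divides_mull; apply: mj.
    by rewrite ltn_subLR ?(ltnW ik) // ?ltn_add2r // -ltnS.
  - by exfalso; apply: kn; apply: val_inj.
have -> : f`_i * g`_j = f`_i * g`_j + S + (-1) * S by rewrite mulN1r addrK.
by apply: dividesD => //; apply: divides_mull.
Qed.

Lemma factors_polyC c : c != 0 -> factors c%:P.
Proof.
move=> /ufdR[u [s [uu sp ->]]]; rewrite polyCM; apply: factorsM.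
  apply: factors_unit; rewrite poly_unitE size_polyC coefC eqxx uu andbT.
  by case: (eqVneq u 0) uu => [->|]; rewrite ?unitr0.
elim: s sp => [|p s IH] sp; rewrite ?big_nil ?big_cons.
  by apply: factors_unit; rewrite unitr1.
rewrite polyCM; apply: factorsM; last by apply: IH => q qs; apply: sp; rewrite inE qs orbT.
by apply: factors_prime; apply: prime_polyC; apply: sp; rewrite mem_head.
Qed.

Lemma primitive_part f : f != 0 ->
  exists c f0, [/\ c != 0, f = c%:P * f0 & primitive f0].
Proof.
move=> f0; have := ufdR (a := lead_coef f); rewrite lead_coef_eq0 => /(_ f0).
move=> [u [s [uu sp E]]].
have [n sn] := ubnP (size s); elim: n => // n IH in f f0 u s uu sp E sn *.
have [prf|] := pselect (primitive f); first by exists 1, f; rewrite oner_neq0 mul1r.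
move=> /existsNP[p /not_implyP[pp /contrapT[g fE]]].
have g0 : g != 0 by apply: contra_neq f0 => g0; rewrite fE g0 mul0r.
have lE : u * \prod_(q <- s) q = lead_coef g * p.
  by rewrite -E fE lead_coefM lead_coefC.
have [v [s' [vu ss' sz' E']]] := factors_cancel sp pp (prime_elt_ndiv_unit pp uu) lE.
have := IH g g0 (u * v) s'; rewrite unitrM uu vu => /(_ isT).
case=> [q /ss' /sp //|//||c [h [c0 gE ph]]]; first by rewrite -ltnS sz'.
exists (p * c), h; split=> //; first by rewrite mulf_neq0 // (prime_elt_neq0 pp).
by rewrite fE gE polyCM mulrC mulrA.
Qed.

(** The prime factors of c can be cancelled one after the other: each stays prime
    as a constant, and does not divide f. *)
Lemma primitive_dividesC f c g : primitive f -> c != 0 ->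
  divides f (c%:P * g) -> divides f g.
Proof.
move=> pf /ufdR[u [s [uu sp ->]]]; elim: s sp g => [|p s IH] sp g.
  rewrite big_nil mulr1 => -[q qE]; exists (u^-1%:P * q).
  by rewrite -mulrA -qE mulrA -polyCM mulVr // mul1r.
rewrite big_cons mulrCA polyCM -mulrA => -[q qE].
have pp : prime_elt p by apply: sp; rewrite mem_head.
have : divides p%:P (q * f) by rewrite -qE; apply: divides_mulr; apply: divides_refl.
move=> /(prime_eltM (prime_polyC pp))[[q' q'E]|/(pf _ pp)//].
apply: IH => [r rs|]; first by apply: sp; rewrite inE rs orbT.
exists q'; have p0 : p%:P != 0 by rewrite polyC_eq0 (prime_elt_neq0 pp).
by apply: (mulfI p0); rewrite qE q'E; ring.
Qed.

(** Pseudo-division by an element of minimal degree of the ideal (f, g) leaves no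
    remainder. This is Euclid's algorithm over the fraction field, with
    denominators cleared. *)
Lemma ideal_min_degree f g : f != 0 ->
  exists d u v c, [/\ d != 0, d = u * f + v * g, c != 0,
    divides d (c%:P * f) & divides d (c%:P * g)].
Proof.
move=> f0.
pose Q n := `[< exists d u v, [/\ d != 0, d = u * f + v * g & size d = n] >].
have ex : exists n, Q n.
  exists (size f); apply/asboolP; exists f, 1, 0; by rewrite mul1r mul0r addr0.
case: (ex_minnP ex) => n /asboolP[d [u [v [d0 dE sd]]]] min.
have div h : (exists u v, h = u * f + v * g) ->
    exists2 c, c != 0 & divides d (c%:P * h).
  move=> [u' [v' hE]]; have := Pdiv.Idomain.divp_eq h d.
  set q := (h %/ d)%R; set r := (h %% d)%R; set c := lead_coef d ^+ _ => E.
  exists c; first by rewrite expf_neq0 // lead_coef_eq0.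
  exists q; rewrite mul_polyC E; suff -> : r = 0 by rewrite addr0.
  apply/eqP/negPn/negP => r0.
  have : Q (size r).
    apply/asboolP; exists r, (c *: u' - q * u), (c *: v' - q * v); split=> //.
    have -> : r = c *: h - q * d by rewrite E [_ + r]addrC addrK.
    rewrite hE dE scalerDr !mulrBl !mulrDr !scalerAl !mulrA opprD.
    by rewrite addrACA.
  move=> /min; rewrite leqNgt -sd => /negP; apply.
  by rewrite /r ltn_modp.
have [c1 c10 d1] : exists2 c, c != 0 & divides d (c%:P * f).
  by apply: div; exists 1, 0; rewrite mul1r mul0r addr0.
have [c2 c20 d2] : exists2 c, c != 0 & divides d (c%:P * g).
  by apply: div; exists 0, 1; rewrite mul1r mul0r add0r.
exists d, u, v, (c1 * c2); split; rewrite ?mulf_neq0 //.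
  by rewrite (mulrC c1) polyCM -mulrA; apply: divides_mull.
by rewrite polyCM -mulrA; apply: divides_mull.
Qed.

Definition irreducible_elt f : Prop :=
  forall g h, f = g * h -> size g = 1%N \/ size h = 1%N.

(** The primitive part of the generator found in [ideal_min_degree] divides f, so
    it is constant or associated to f, and the second case is excluded because it
    also divides g. *)
Lemma irreducible_bezout f g : primitive f -> irreducible_elt f -> f != 0 ->
  ~ divides f g -> exists c u v, c != 0 /\ c%:P = u * f + v * g.
Proof.
move=> pf irf f0 nfg.
have [d [u [v [c [d0 dE c0 df dg]]]]] := ideal_min_degree g f0.
have [e [d1 [e0 d1E pd1]]] := primitive_part d0.
have d1d : divides d1 d by rewrite d1E; apply: divides_mull; apply: divides_refl.
have [q fE] := primitive_dividesC pd1 c0 (divides_trans d1d df).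
have [sq|sd1] := irf _ _ fE; last first.
  have /size_poly1P[x x0 xE] : size d1 == 1%N by rewrite sd1.
  exists (e * x), u, v.
  by rewrite mulf_neq0 // polyCM -xE -d1E.
case: nfg; have d1g := primitive_dividesC pd1 c0 (divides_trans d1d dg).
apply: divides_trans d1g.
have /size_poly1P[x x0 xE] : size q == 1%N by rewrite sq.
have ux : x \is a GRing.unit.
  apply/negPn/negP => nx; have [p pp [y yE]] := nunit_prime_divides (ufdR x0) nx.
  apply: (pf p pp); exists (y%:P * d1).
  by rewrite fE xE yE polyCM mulrAC.
by exists (x^-1%:P); rewrite fE xE mulrA -polyCM mulVr // mul1r.
Qed.

(** Gauss's lemma: a primitive polynomial splits, by induction on the degree, into
    primitive irreducible ones, and these are prime by [irreducible_bezout]. *)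
Lemma ufd_poly : ufd {poly R}.
Proof.
move=> f; have [n sn] := ubnP (size f); elim: n => // n IH in f sn *.
move=> f0; have [c [g [c0 fE pg]]] := primitive_part f0.
rewrite fE; apply: factorsM; first exact: factors_polyC.
have sg : size g = size f by rewrite fE size_Cmul.
have g0 : g != 0 by rewrite -size_poly_gt0 sg size_poly_gt0.
have [sf|sf] := leqP (size g) 1.
  rewrite (size1_polyC sf); apply: factors_polyC.
  by move: g0; rewrite {1}(size1_polyC sf) polyC_eq0.
have [irg|] := pselect (irreducible_elt g); last first.
  move=> /existsNP[a /existsNP[b /not_implyP[abE /not_orP[sa sb]]]].
  have a0 : a != 0 by apply: contra_neq g0 => a0; rewrite abE a0 mul0r.
  have b0 : b != 0 by apply: contra_neq g0 => b0; rewrite abE b0 mulr0.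
  have := size_mul a0 b0; rewrite -abE sg.
  move: a0 b0; rewrite -!size_poly_gt0 => a0 b0 E.
  rewrite abE; apply: factorsM; apply: IH; rewrite -?size_poly_gt0 //.
    rewrite ltnS in sn; apply: leq_trans sn.
    move: sb a0 b0 E; case: (size b) => [|[|k]] //; case: (size a) => // l _ _ _ ->.
    by rewrite !addnS /= ltnS leq_addr.
  rewrite ltnS in sn; apply: leq_trans sn.
  move: sa a0 b0 E; case: (size a) => [|[|k]] //; case: (size b) => // l _ _ _ ->.
  by rewrite addnS /= !addSn !ltnS leq_addl.
apply: factors_prime; split=> //.
  rewrite poly_unitE; apply/negP => /andP[/eqP s1]; by rewrite s1 in sf.
move=> a b gab; apply: contrapT => /not_orP[na nb]; apply: nb.
have [d [u [v [d0 dE]]]] := irreducible_bezout pg irg g0 na.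
apply: (primitive_dividesC pg d0); rewrite dE mulrDl; apply: dividesD.
  by rewrite mulrAC; apply: divides_mull; apply: divides_refl.
by rewrite -mulrA; apply: divides_mull.
Qed.

Lemma prime_poly_primitive f : prime_elt f -> (1 < size f)%N ->
  primitive f /\ irreducible_elt f.
Proof.
move=> pf sf; have f0 := prime_elt_neq0 pf.
have key g h : f = g * h -> divides f g -> size h = 1%N.
  move=> fE [x gE].
  have : f * 1 = f * (x * h) by rewrite mulr1 {1}fE gE -!mulrA; rewrite mulrCA.
  move=> /(mulfI f0) E; have : h \is a GRing.unit.
    by apply/unitrPr; exists x; rewrite mulrC.
  by rewrite poly_unitE => /andP[/eqP].
have irr : irreducible_elt f.
  move=> g h fE; have : divides f (g * h) by rewrite -fE; apply: divides_refl.
  move=> /(prime_eltM pf)[/(key _ _ fE)|]; first by right.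
  by move=> fh; left; apply: key fh; rewrite mulrC.
split=> // p pp [g fE].
have pg : divides f (g * p%:P) by rewrite -fE; apply: divides_refl.
have [fg|[x xE]] := prime_eltM pf pg.
  have [x gE] := fg.
  have : f * 1 = f * (x * p%:P) by rewrite mulr1 {1}fE gE -!mulrA mulrCA.
  move=> /(mulfI f0) E; apply: (negP (prime_elt_nunit pp)).
  have : p%:P \is a GRing.unit by apply/unitrPr; exists x; rewrite mulrC.
  by rewrite poly_unitE coefC /= => /andP[].
have x0 : x != 0.
  by apply: contra_neq (prime_elt_neq0 pp) => x0; apply/eqP; rewrite -polyC_eq0 xE x0 mul0r.
have := size_mul x0 f0; rewrite -xE size_polyC (prime_elt_neq0 pp).
move: sf x0; rewrite -size_poly_gt0; case: (size f) => [|[|k]] //; case: (size x) => // l _ _.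
by rewrite !addnS.
Qed.

End Gauss.

(** * Iterated polynomial rings *)

(** Polynomials in m variables, as iterated univariate polynomials: the variable of
    index m is the outermost one. In this form the Gauss lemma and the elimination
    of the last variable apply directly. *)
Fixpoint tower (K : idomainType) (m : nat) : idomainType :=
  if m is m'.+1 then {poly (tower K m')} : idomainType else K.

Fixpoint towC (K : idomainType) (m : nat) : {rmorphism K -> tower K m} :=
  if m is m'.+1 return {rmorphism K -> tower K m}
  then GRing.RMorphism.clone _ _ (polyC \o towC K m') _
  else GRing.RMorphism.clone _ _ idfun _.

Fixpoint towX (K : idomainType) (m i : nat) : tower K m :=
  if m is m'.+1 return tower K m
  then (if i == m' then 'X else (towX K m' i)%:P) else 0.

Section Evaluation.
Variables (K : idomainType) (R : comNzRingType) (io : {rmorphism K -> R}).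

Fixpoint ev (y : nat -> R) (m : nat) : {rmorphism tower K m -> R} :=
  if m is m'.+1 return {rmorphism tower K m -> R}
  then GRing.RMorphism.clone _ _ (horner_eval (y m') \o map_poly (ev y m')) _
  else io.

Lemma evS y m (P : tower K m.+1) : ev y m.+1 P = (map_poly (ev y m) P).[y m].
Proof. by []. Qed.

Lemma ev_polyC y m (P : tower K m) : ev y m.+1 (P%:P : {poly tower K m}) = ev y m P.
Proof. by rewrite evS map_polyC /= hornerC. Qed.

Lemma evX y m i : (i < m)%N -> ev y m (towX K m i) = y i.
Proof.
elim: m => // m IH; rewrite ltnS leq_eqVlt /= => /orP[/eqP->|im].
  by rewrite eqxx horner_evalE map_polyX hornerX.
by rewrite (ltn_eqF im) horner_evalE map_polyC hornerC; apply: IH.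
Qed.

Lemma evC y m c : ev y m (towC K m c) = io c.
Proof. by elim: m => // m IH; rewrite /= horner_evalE map_polyC hornerC. Qed.

Lemma eq_ev y y' m (P : tower K m) : (forall i, (i < m)%N -> y i = y' i) ->
  ev y m P = ev y' m P.
Proof.
elim: m P => // m IH P yy'; rewrite !evS yy' //; congr horner.
by apply: eq_map_poly => Q; apply: IH => i im; apply: yy'; rewrite ltnS ltnW.
Qed.

End Evaluation.

Lemma ev_comp (K : idomainType) (R S : comNzRingType) (io : {rmorphism K -> R})
    (f : {rmorphism R -> S}) (y : nat -> R) m (P : tower K m) :
  f (ev io y m P) = ev (GRing.RMorphism.clone _ _ (f \o io) _) (f \o y) m P.
Proof.
elim: m P => // m IH P; rewrite !evS -horner_map /=; congr horner.
by rewrite -map_poly_comp; apply: eq_map_poly => Q; apply: IH.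
Qed.

Lemma eq_ev_io (K : idomainType) (R : comNzRingType) (io io' : {rmorphism K -> R})
    (y y' : nat -> R) m (P : tower K m) :
  io =1 io' -> (forall i, (i < m)%N -> y i = y' i) -> ev io y m P = ev io' y' m P.
Proof.
move=> E; elim: m P => [|m IH] P yy'; first exact: E.
rewrite !evS yy' //; congr horner.
by apply: eq_map_poly => Q; apply: IH => i im; apply: yy'; rewrite ltnS ltnW.
Qed.

Lemma ufd_tower (K : fieldType) m : ufd (tower K m).
Proof. by elim: m => [|m IH]; [apply: ufd_field|apply: ufd_poly]. Qed.

Definition upd (K : Type) (y : nat -> K) (m : nat) (c : K) : nat -> K :=
  fun i => if i == m then c else y i.

Lemma ev_upd (K : idomainType) (R : comNzRingType) (io : {rmorphism K -> R})
    y m c (P : tower K m.+1) :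
  ev io (upd y m c) m.+1 P = (map_poly (ev io y m) P).[c].
Proof.
rewrite evS /upd eqxx; congr horner; apply: eq_map_poly => Q.
by apply: eq_ev => i im; rewrite (ltn_eqF im).
Qed.

Fact comb_comb (S : comNzRingType) (k q a b a' b' u g : S) :
  (k * a - q * b) * u + (k * a' - q * b') * g =
  k * (a * u + a' * g) - q * (b * u + b' * g).
Proof. by ring. Qed.

Definition idrm (R : nzRingType) : {rmorphism R -> R} :=
  GRing.RMorphism.clone _ _ idfun _.

Section ClosedField.
Variable K : closedFieldType.
Notation evK := (ev (idrm K)).

Lemma closed_root (p : {poly K}) : (1 < size p)%N -> exists c, p.[c] = 0.
Proof. move=> sp; have /closed_rootP[c rc] : size p != 1%N by rewrite gtn_eqF.
by exists c; apply/rootP. Qed.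

Lemma closed_nonroot (p : {poly K}) : p != 0 -> exists c, p.[c] != 0.
Proof. by move/closed_nonrootP => [c rc]; exists c. Qed.

Lemma tower_nonzero m (P : tower K m) : P != 0 -> exists c, evK c m P != 0.
Proof.
elim: m P => [|m IH] P P0; first by exists (fun=> 0).
have [c lc] : exists c, evK c m (lead_coef P) != 0.
  by apply: IH; rewrite lead_coef_eq0.
have : map_poly (evK c m) P != 0.
  apply: contra_neq lc => E; have /polyP/(_ (size P).-1) := E.
  by rewrite coef_map coef0.
by move=> /closed_nonroot[d dP]; exists (upd c m d); rewrite ev_upd.
Qed.

Lemma tower_eq m (P Q : tower K m) : (forall c, evK c m P = evK c m Q) -> P = Q.
Proof.
move=> H; apply/eqP; rewrite -subr_eq0; apply/negPn/negP => /tower_nonzero[c].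
by rewrite rmorphB /= H subrr eqxx.
Qed.

(** A polynomial h that vanishes at the zeros of a prime p is divisible by p. If p
    does not divide h, Bezout gives a nonzero polynomial w in one variable less
    which is a combination of p and h. Over a point where w and the leading
    coefficient of p do not vanish, p has a zero, and h cannot vanish there. *)
Lemma prime_point m (p h : tower K m) : prime_elt p -> ~ divides p h ->
  exists c, evK c m p = 0 /\ evK c m h != 0.
Proof.
elim: m p h => [|m IH] p h pp nph.
  by move: (prime_elt_nunit pp) (prime_elt_neq0 pp); rewrite unitfE => /negbTE->.
have p0 := prime_elt_neq0 pp.
have [sp|sp] := leqP (size p) 1.
  have pE := size1_polyC sp; set q := (p : {poly _})`_0 in pE.
  have pq : prime_elt q.
    split; first by move: p0; rewrite pE polyC_eq0.
      by move: (prime_elt_nunit pp); rewrite pE poly_unitE size_polyC coefC;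
        move: p0; rewrite pE polyC_eq0 => ->.
    move=> a b [c abE].
    have : divides (p : {poly _}) (a%:P * b%:P) by exists c%:P; rewrite pE -!polyCM abE.
    by move=> /(prime_eltM pp)[]; rewrite pE => /divides_polyC/(_ 0%N);
      rewrite coefC; [left|right].
  have [i npi] : exists i, ~ divides q (h : {poly _})`_i.
    by apply/existsNP => H; apply: nph; rewrite pE; apply/divides_polyC.
  have [c [qc hc]] := IH _ _ pq npi.
  have : map_poly (evK c m) h != 0.
    by apply: contra_neq hc => E; have /polyP/(_ i) := E; rewrite coef_map coef0.
  move=> /closed_nonroot[d hd]; exists (upd c m d); rewrite !ev_upd.
  by rewrite pE map_polyC hornerC; split.
have [prp irp] := prime_poly_primitive pp sp.
have [w [u [v [w0 wE]]]] := irreducible_bezout (@ufd_tower K m) prp irp p0 nph.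
have : w * lead_coef p != 0 by rewrite mulf_neq0 // lead_coef_eq0.
move=> /tower_nonzero[c]; rewrite rmorphM mulf_eq0 negb_or => /andP[wc lc].
have [d pd] : exists d, (map_poly (evK c m) p).[d] = 0.
  by apply: closed_root; rewrite size_map_poly_id0.
exists (upd c m d); split; first by rewrite ev_upd.
apply: contraNneq wc => hd; have := congr1 (fun q : tower K m.+1 => evK (upd c m d) m.+1 q) wE.
rewrite rmorphD !rmorphM hd.
have -> : evK (upd c m d) m.+1 p = 0 by rewrite ev_upd.
by rewrite !mulr0 addr0 ev_upd map_polyC hornerC => /eqP.
Qed.

(** ** Specialization of points *)

Section Specialization.
Variables (F : fieldType) (io : {rmorphism K -> F}).
Notation evF := (ev io).

Definition specializes m (y : nat -> F) (c : nat -> K) : Prop :=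
  forall P : tower K m, evF y m P = 0 -> evK c m P = 0.

Lemma map_evF_specializes m y c (P : tower K m.+1) : specializes m y c ->
  map_poly (evF y m) P = 0 -> map_poly (evK c m) P = 0.
Proof.
move=> yc /polyP E; apply/polyP => i; rewrite coef_map coef0 /=.
by apply: yc; have := E i; rewrite coef_map coef0.
Qed.

Lemma map_evF_coef m y (P : tower K m.+1) : map_poly (evF y m) P != 0 ->
  exists i, evF y m (P : {poly _})`_i != 0.
Proof.
move=> P0; apply: contrapT => H; move/eqP: P0; apply; apply/polyP => i.
by rewrite coef_map coef0 /=; apply/eqP/negPn/negP => Pi; apply: H; exists i.
Qed.

Lemma map_evK_neq0 m c (P : tower K m.+1) i : evK c m (P : {poly _})`_i != 0 ->
  map_poly (evK c m) P != 0.
Proof. by apply: contra_neq => /polyP/(_ i); rewrite coef_map coef0. Qed.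

(** An element of minimal degree with nonzero image over F keeps its degree there:
    a leading term with zero image could be dropped. *)
Lemma min_size_lead m y (Q : tower K m.+1 -> Prop) :
  (forall P P' : tower K m.+1, Q P ->
     map_poly (evF y m) P = map_poly (evF y m) P' -> Q P') ->
  (exists P, Q P /\ map_poly (evF y m) P != 0) ->
  exists g : {poly tower K m}, [/\ Q g, evF y m (lead_coef g) != 0 &
    forall P : {poly tower K m}, Q P -> (size P < size g)%N ->
      map_poly (evF y m) P = 0].
Proof.
move=> Qext [P [QP P0]].
pose B n := `[< exists g : {poly tower K m},
  [/\ Q g, map_poly (evF y m) g != 0 & size g = n] >].
have ex : exists n, B n by exists (size (P : {poly _})); apply/asboolP; exists P.
case: (ex_minnP ex) => n /asboolP[g [Qg g0 sg]] min; exists g; split=> //; last first.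
  move=> p Qp sp; apply/eqP/negPn/negP => p0.
  have /min : B (size p) by apply/asboolP; exists p.
  by rewrite leqNgt -sg sp.
apply/negP => /eqP l0.
pose g' : {poly tower K m} := \poly_(i < (size g).-1) g`_i.
have gg' : map_poly (evF y m) g = map_poly (evF y m) g'.
  apply/polyP => i; rewrite !coef_map coef_poly /=.
  case: ltnP => // gi; rewrite raddf0.
  have [->|ni] := eqVneq i (size g).-1; first exact: l0.
  rewrite nth_default ?raddf0 //; move: gi ni; case: (size g) => //= k.
  by rewrite leq_eqVlt eq_sym => /orP[/eqP->|//]; rewrite eqxx.
have /min : B (size g').
  by apply/asboolP; exists g'; split=> //; [apply: Qext gg'|rewrite -gg'].
rewrite -sg leqNgt => /negP; apply; apply: (leq_ltn_trans (size_poly _ _)).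
rewrite prednK // size_poly_gt0; apply: contra_neq g0 => ->.
exact: (raddf0 (map_poly (evF y m))).
Qed.

(** Points with coordinates in F specialize to points over K, one coordinate at a
    time. If the new coordinate satisfies no relation, any value outside finitely
    many will do. Otherwise let g be a relation of minimal degree: all relations
    are multiples of g up to the leading coefficient of g, so a root of the
    specialized g may be taken. The condition on u is kept because, modulo g, some
    multiple of u is a nonzero constant w: the generator d of the ideal (u, g) does
    not vanish at y, hence has degree 0 by minimality of g. *)
Lemma specialize_extend m y (u : tower K m.+1) : evF y m.+1 u != 0 ->
  exists2 v : tower K m, evF y m v != 0 &
    forall c, specializes m y c -> evK c m v != 0 ->
    exists d, specializes m.+1 y (upd c m d) /\ evK (upd c m d) m.+1 u != 0.
Proof.
move=> u0; have mu0 : map_poly (evF y m) u != 0.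
  by apply: contra_neq u0 => E; rewrite evS E horner0.
have [trans|] := pselect (forall P : tower K m.+1,
    evF y m.+1 P = 0 -> map_poly (evF y m) P = 0).
  have [i ui] := map_evF_coef mu0; exists ((u : {poly _})`_i) => // c yc ci.
  have [d ud] := closed_nonroot (map_evK_neq0 ci).
  exists d; rewrite ev_upd; split=> // P /trans/(map_evF_specializes yc) E.
  by rewrite ev_upd E horner0.
move=> /existsNP[g1 /not_implyP[g1y /eqP g1n]].
have [g [gy lg ming]] := @min_size_lead m y (fun P => evF y m.+1 P = 0)
  (fun P P' PE E => etrans (congr1 (horner^~ (y m)) (esym E)) PE)
  (ex_intro _ g1 (conj g1y g1n)).
have mg0 : map_poly (evF y m) g != 0.
  apply: contra_neq lg => /polyP/(_ (size g).-1).
  by rewrite coef_map coef0.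
have mapM (a : tower K m) (p : {poly tower K m}) :
    map_poly (evF y m) (a *: p) = evF y m a *: map_poly (evF y m) p.
  by rewrite map_polyZ.
pose J (P : tower K m.+1) := exists P' A B : {poly tower K m},
  P' = A * u + B * g /\ map_poly (evF y m) P' = map_poly (evF y m) P.
have JE (P : {poly tower K m}) : J P -> exists A B : {poly tower K m},
   map_poly (evF y m) P = map_poly (evF y m) (A * u + B * g).
  by move=> [P' [A [B [PE <-]]]]; exists A, B; rewrite PE.
have [d [Jd ld mind]] : exists d : {poly tower K m}, [/\ J d, evF y m (lead_coef d) != 0 &
    forall P : {poly tower K m}, J P -> (size P < size d)%N ->
      map_poly (evF y m) P = 0].
  apply: min_size_lead.
    by move=> P P' [Q [A [B [QE E]]]] PP'; exists Q, A, B; rewrite E.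
  by exists g; split=> //; exists g, 0, 1; rewrite mul0r mul1r add0r.
have d0 : d != 0 by apply: contra_neq ld => ->; rewrite lead_coef0 raddf0.
have [A [B dAB]] := JE _ Jd.
have red (h : {poly tower K m}) : J h -> exists k (q : {poly tower K m}),
    [/\ map_poly (evF y m) (lead_coef d ^+ k *: h) = map_poly (evF y m) (q * d) &
     exists2 r : {poly tower K m}, (size r < size d)%N & lead_coef d ^+ k *: h = q * d + r].
  move=> Jh; have := Pdiv.Idomain.divp_eq h d.
  set k := Pdiv.IdomainDefs.scalp _ _; set q := (h %/ d)%R; set r := (h %% d)%R => E.
  have sr : (size r < size d)%N by rewrite /r ltn_modp.
  exists k, q; split; last by exists r.
  rewrite E rmorphD /= (mind r) ?addr0 //.
  have [A' [B' hAB]] := JE _ Jh.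
  exists ((lead_coef d ^+ k *: A' - q * A) * u + (lead_coef d ^+ k *: B' - q * B) * g).
  exists (lead_coef d ^+ k *: A' - q * A), (lead_coef d ^+ k *: B' - q * B); split=> //.
  have -> : r = lead_coef d ^+ k *: h - q * d by rewrite E [_ + r]addrC addrK.
  rewrite !(rmorphB, rmorphD, rmorphM) /= !mapM dAB hAB !(rmorphD, rmorphM) /=.
  by rewrite -!mul_polyC; apply: comb_comb.
have [k1 [q1 [E1 _]]] : exists k (q : {poly tower K m}),
    [/\ map_poly (evF y m) (lead_coef d ^+ k *: u) = map_poly (evF y m) (q * d) &
     exists2 r : {poly tower K m}, (size r < size d)%N &
       lead_coef d ^+ k *: (u : {poly _}) = q * d + r].
  by apply: red; exists u, 1, 0; rewrite mul0r mul1r addr0.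
have [k2 [q2 [E2 [r2 sr2 E2']]]] : exists k (q : {poly tower K m}),
    [/\ map_poly (evF y m) (lead_coef d ^+ k *: g) = map_poly (evF y m) (q * d) &
     exists2 r : {poly tower K m}, (size r < size d)%N & lead_coef d ^+ k *: g = q * d + r].
  by apply: red; exists g, 0, 1; rewrite mul0r mul1r add0r.
have dy : evF y m.+1 d != 0.
  have := congr1 (horner^~ (y m)) E1.
  rewrite mapM rmorphM hornerZ hornerM -!evS rmorphXn => E.
  have : evF y m (lead_coef d) ^+ k1 * evF y m.+1 u != 0.
    by rewrite mulf_neq0 ?expf_neq0.
  by rewrite E mulf_eq0 negb_or => /andP[].
have q2y : evF y m.+1 q2 = 0.
  have := congr1 (horner^~ (y m)) E2.
  rewrite mapM rmorphM hornerZ hornerM -!evS gy mulr0 => /esym/eqP.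
  by rewrite mulf_eq0 (negbTE dy) orbF => /eqP.
have lgd (h : {poly tower K m}) k : map_poly (evF y m) h != 0 ->
    map_poly (evF y m) (lead_coef d ^+ k *: h) != 0.
  by rewrite mapM scaler_eq0 rmorphXn expf_eq0 (negbTE ld) andbF.
have q20 : map_poly (evF y m) q2 != 0.
  by have := lgd _ k2 mg0; rewrite E2 rmorphM mulf_eq0 negb_or => /andP[].
have sd1 : size d = 1%N.
  apply/eqP; rewrite eqn_leq size_poly_gt0 d0 andbT leqNgt; apply/negP => sd.
  suff /eqP : map_poly (evF y m) q2 = 0 by rewrite (negbTE q20).
  apply: (ming _ q2y).
  have sgd : (size d <= size g)%N.
    rewrite leqNgt; apply/negP => sgd; move/eqP: mg0; apply; apply: (mind _ _ sgd).
    by exists g, 0, 1; rewrite mul0r mul1r add0r.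
  have q2n : q2 != 0 by apply: contra_neq q20 => ->; apply: (raddf0 (map_poly (evF y m))).
  have sz : (size q2 + size d).-1 = size g.
    rewrite -size_mul //.
    have -> : q2 * d = lead_coef d ^+ k2 *: g - r2 by rewrite E2' addrK.
    rewrite size_polyDl ?size_polyN size_scale //.
      by rewrite expf_neq0 // lead_coef_eq0.
      exact: leq_trans sgd.
    by rewrite expf_neq0 // lead_coef_eq0.
  rewrite -sz; move: sd; case: (size d) => [|[|l]] // _.
  by rewrite !addnS /= ltnS leq_addr.
have dE := size1_polyC (eq_leq sd1); set w := d`_0 in dE.
have wy : evF y m w != 0 by move: dy; rewrite dE ev_polyC.
exists (lead_coef g * w); first by rewrite rmorphM mulf_neq0.
move=> c yc; rewrite rmorphM mulf_eq0 negb_or => /andP[lgc wc].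
have sg : (1 < size g)%N.
  rewrite ltnNge; apply/negP => /size1_polyC gE; move: gy lg.
  by rewrite gE ev_polyC lead_coefC => ->; rewrite eqxx.
have [d1 gd1] : exists d1, (map_poly (evK c m) g).[d1] = 0.
  by apply: closed_root; rewrite size_map_poly_id0.
exists d1; split.
  move=> P Py; have := Pdiv.Idomain.divp_eq (P : {poly tower K m}) g.
  set q := (_ %/ g)%R; set r := (_ %% g)%R => E.
  have g0 : g != 0 by rewrite -size_poly_gt0 (ltn_trans _ sg).
  have sr : (size r < size g)%N by rewrite /r ltn_modp.
  have ry : evF y m.+1 r = 0.
    have -> : r = lead_coef g ^+ Pdiv.IdomainDefs.scalp P g *: (P : {poly tower K m}) - q * g.
      by rewrite E [_ + r]addrC addrK.
    rewrite -mul_polyC (rmorphB (evF y m.+1)) !(rmorphM (evF y m.+1)).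
    by rewrite Py gy !mulr0 subrr.
  have rc := map_evF_specializes yc (ming _ ry sr).
  have := congr1 (fun p : tower K m.+1 => evK (upd c m d1) m.+1 p) E.
  rewrite -mul_polyC rmorphD !rmorphM ev_upd map_polyC hornerC.
  rewrite !ev_upd gd1 mulr0 add0r rc horner0 => /eqP.
  rewrite mulf_eq0 => /orP[|/eqP //].
  move=> /eqP lgk; have := expf_neq0 (scalp (P : {poly tower K m}) g) lgc.
  by rewrite -(rmorphXn (evK c m)) lgk eqxx.
apply: contraNneq wc => ud.
have : map_poly (evF y m) (d - (A * u + B * g)) = 0.
  by rewrite rmorphB /= -dAB subrr.
move/(map_evF_specializes yc) => /(congr1 (horner^~ d1)).
rewrite horner0 rmorphB rmorphD !rmorphM /= hornerD hornerN hornerD !hornerM.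
rewrite -!ev_upd ud !ev_upd gd1 !mulr0 addr0 subr0 dE map_polyC hornerC.
by move=> /eqP.
Qed.

Lemma specialize_extend_many m n y (u : tower K (m + n)) : evF y (m + n) u != 0 ->
  exists2 v : tower K m, evF y m v != 0 &
    forall c, specializes m y c -> evK c m v != 0 ->
    exists c', [/\ forall i, (i < m)%N -> c' i = c i, specializes (m + n) y c' &
      evK c' (m + n) u != 0].
Proof.
elim: n u => [|n IH].
  rewrite addn0 => u u0; exists u => // c yc uc; by exists c.
rewrite addnS => u /specialize_extend[v vy H].
have [w wy Hw] := IH v vy; exists w => // c yc wc.
have [c' [cc' yc' vc']] := Hw c yc wc; have [d [yd ud]] := H c' yc' vc'.
exists (upd c' (m + n) d); split=> // i im.
by rewrite /upd ltn_eqF ?cc' // ltn_addr.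
Qed.

End Specialization.
End ClosedField.

(** * Places of an algebraic function field in one variable *)

(** A normalized discrete valuation of F, trivial on K. The value at 0 is set to 0, so that two places are equal when they agree on
    nonzero elements. *)
Record aplace (K : closedFieldType) (F : fieldType) (io : {rmorphism K -> F})
    (v : F -> int) : Prop := APlace {
  av0 : v 0 = 0;
  avM : forall x y, x != 0 -> y != 0 -> v (x * y) = v x + v y;
  avD : forall x y, x != 0 -> y != 0 -> x + y != 0 ->
    Num.min (v x) (v y) <= v (x + y);
  avC : forall c, c != 0 -> v (io c) = 0;
  avN : exists2 x, x != 0 & v x = 1 }.

Definition pair_pt (F : Type) (x y : F) (i : nat) : F := if i is 0 then x else y.

Definition algdep (K : closedFieldType) (F : fieldType) (io : {rmorphism K -> F})
    (x y : F) : Prop :=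
  exists P : tower K 2, P != 0 /\ ev io (pair_pt x y) 2 P = 0.

(** v f >= m, with the convention that 0 has infinite valuation. *)
Definition vge (F : fieldType) (v : F -> int) (m : int) (f : F) : bool :=
  (f == 0) || (m <= v f).

Section Valuation.
Variables (K : closedFieldType) (F : fieldType) (io : {rmorphism K -> F}).
Variables (v : F -> int) (pv : aplace io v).
Implicit Types (x y f : F) (m : int).

Lemma av1 : v 1 = 0.
Proof. by rewrite -(rmorph1 io) (avC pv) ?oner_neq0. Qed.

Lemma avV x : x != 0 -> v x^-1 = - v x.
Proof.
move=> x0; apply/eqP; rewrite -addr_eq0 addrC -(avM pv) ?invr_neq0 //.
by rewrite divff // av1.
Qed.

Lemma avX x n : x != 0 -> v (x ^+ n) = v x *+ n.
Proof.
move=> x0; elim: n => [|n IH]; first by rewrite expr0 av1.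
by rewrite exprS (avM pv) ?expf_neq0 // IH mulrS.
Qed.

Lemma avNx x : x != 0 -> v (- x) = v x.
Proof.
move=> x0; rewrite -mulN1r (avM pv) ?oppr_eq0 ?oner_neq0 //.
by rewrite -(rmorph1 io) -rmorphN (avC pv) ?add0r // oppr_eq0 oner_neq0.
Qed.

Lemma vge0 m : vge v m 0. Proof. by rewrite /vge eqxx. Qed.

Lemma vgeP m x : x != 0 -> vge v m x = (m <= v x).
Proof. by rewrite /vge => /negbTE->. Qed.

Lemma vge_trans m m' x : m' <= m -> vge v m x -> vge v m' x.
Proof. by rewrite /vge => mm /orP[->//|/(le_trans mm) ->]; rewrite orbT. Qed.

Lemma vgeD m x y : vge v m x -> vge v m y -> vge v m (x + y).
Proof.
rewrite /vge; have [->|x0] := eqVneq x 0; first by rewrite add0r.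
have [->|y0] := eqVneq y 0; first by rewrite addr0 (negbTE x0).
have [//|s0] := eqVneq (x + y) 0 => /= mx my.
by apply: le_trans (avD pv x0 y0 s0); rewrite le_min mx.
Qed.

Lemma vgeN m x : vge v m (- x) = vge v m x.
Proof.
by rewrite /vge oppr_eq0; have [->|x0] := eqVneq x 0; rewrite //= avNx.
Qed.

Lemma vgeB m x y : vge v m x -> vge v m y -> vge v m (x - y).
Proof. by move=> mx my; apply: vgeD; rewrite ?vgeN. Qed.

Lemma vgeM m m' x y : vge v m x -> vge v m' y -> vge v (m + m') (x * y).
Proof.
rewrite /vge mulf_eq0; have [//|x0] := eqVneq x 0.
by have [//|y0] := eqVneq y 0 => /= mx my; rewrite (avM pv) // lerD.
Qed.

Lemma vge0M x y : vge v 0 x -> vge v 0 y -> vge v 0 (x * y).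
Proof. by move=> a b; have := vgeM a b; rewrite addr0. Qed.

Lemma vgeC c : vge v 0 (io c).
Proof.
by rewrite /vge fmorph_eq0; have [//|c0] := eqVneq c 0; rewrite (avC pv).
Qed.

Lemma vgeX x n : vge v 0 x -> vge v 0 (x ^+ n).
Proof.
move=> x0; elim: n => [|n IH]; first by rewrite expr0 -(rmorph1 io) vgeC.
by rewrite exprS; apply: vge0M.
Qed.

Lemma vge_sum m (I : Type) (r : seq I) (P : pred I) (f : I -> F) :
  (forall i, P i -> vge v m (f i)) -> vge v m (\sum_(i <- r | P i) f i).
Proof.
by move=> H; elim/big_ind: _ => //; [apply: vge0|apply: vgeD].
Qed.

Lemma avD_lt x y : x != 0 -> y != 0 -> v x < v y -> x + y != 0 /\ v (x + y) = v x.
Proof.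
move=> x0 y0 xy; have s0 : x + y != 0.
  apply: contraTneq xy => /eqP; rewrite addr_eq0 => /eqP->.
  by rewrite avNx // ltxx.
split=> //; have := avD pv x0 y0 s0; rewrite min_l ?(ltW xy) // => h.
apply/eqP; rewrite eq_le h andbT leNgt; apply/negP => h'.
have := avD pv s0 (y := - y); rewrite oppr_eq0 addrK => /(_ y0 x0).
by rewrite avNx // ge_min !leNgt h' xy.
Qed.

Lemma avD_vge x y : x != 0 -> vge v (v x + 1) y -> x + y != 0 /\ v (x + y) = v x.
Proof.
move=> x0; rewrite /vge; have [->|y0] := eqVneq y 0; first by rewrite addr0.
by move=> /= h; apply: avD_lt => //; rewrite -lezD1.
Qed.

Lemma av_prod (I : Type) (r : seq I) (P : pred I) (f : I -> F) :
  (forall i, P i -> f i != 0) ->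
  v (\prod_(i <- r | P i) f i) = \sum_(i <- r | P i) v (f i).
Proof.
move=> H; elim: r => [|i r IH]; first by rewrite !big_nil av1.
rewrite !big_cons; case: ifP => // Pi; rewrite (avM pv) ?IH ?H //.
by elim/big_ind: _ => //; [rewrite oner_neq0|apply: mulf_neq0].
Qed.

Lemma vge_ev n (y : nat -> F) (P : tower K n) :
  (forall i, (i < n)%N -> vge v 0 (y i)) -> vge v 0 (ev io y n P).
Proof.
elim: n P => [|n IH] P H; first exact: vgeC.
rewrite evS horner_coef; apply: vge_sum => i _; rewrite coef_map.
apply: vge0M; last by apply: vgeX; apply: H.
by apply: IH => j jm; apply: H; rewrite ltnS ltnW.
Qed.

Lemma red_vge0 x a : vge v 1 (x - io a) -> vge v 0 x.
Proof.
move=> h; rewrite -(subrK (io a) x); apply: vgeD (vgeC _).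
exact: vge_trans h.
Qed.

Lemma redM x a y b : vge v 1 (x - io a) -> vge v 1 (y - io b) ->
  vge v 1 (x * y - io (a * b)).
Proof.
move=> hx hy; have -> : x * y - io (a * b) = (x - io a) * y + io a * (y - io b).
  by rewrite rmorphM; ring.
apply: vgeD; last by have := vgeM (vgeC a) hy; rewrite add0r.
by have := vgeM hx (red_vge0 hy); rewrite addr0.
Qed.

Lemma redD x a y b : vge v 1 (x - io a) -> vge v 1 (y - io b) ->
  vge v 1 (x + y - io (a + b)).
Proof. by move=> hx hy; rewrite rmorphD opprD addrACA; apply: vgeD. Qed.

Lemma redC a : vge v 1 (io a - io a). Proof. by rewrite subrr vge0. Qed.

Lemma red_ev n (y : nat -> F) (c : nat -> K) (P : tower K n) :
  (forall i, (i < n)%N -> vge v 1 (y i - io (c i))) ->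
  vge v 1 (ev io y n P - io (ev (idrm K) c n P)).
Proof.
elim: n P => [|n IH] P H; first exact: redC.
elim/poly_ind: P => [|P a IHP]; first by rewrite !rmorph0 subrr vge0.
rewrite (rmorphD (ev io y n.+1)) (rmorphM (ev io y n.+1)).
rewrite (rmorphD (ev (idrm K) c n.+1)) (rmorphM (ev (idrm K) c n.+1)).
apply: redD.
  apply: redM => //.
  by rewrite !evS !map_polyX !hornerX; apply: H.
by rewrite !ev_polyC; apply: IH => j jm; apply: H; rewrite ltnS ltnW.
Qed.

Lemma red_unit x a : a != 0 -> vge v 1 (x - io a) -> x != 0 /\ v x = 0.
Proof.
move=> a0 h; have ia : io a != 0 by rewrite fmorph_eq0.
have := avD_vge ia (y := x - io a); rewrite (avC pv a0) add0r => /(_ h).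
by rewrite addrC subrK.
Qed.

Lemma red_uniq x a b : vge v 1 (x - io a) -> vge v 1 (x - io b) -> a = b.
Proof.
move=> ha hb; have := vgeB hb ha.
have -> : x - io b - (x - io a) = io (a - b) by rewrite rmorphB; ring.
rewrite /vge fmorph_eq0 subr_eq0 => /orP[/eqP//|h].
by apply/eqP/negPn/negP => ab; move: h; rewrite (avC pv) ?subr_eq0.
Qed.

End Valuation.

Lemma max_int_seq (T : eqType) (s : seq T) (f : T -> int) :
  exists M : nat, forall w, w \in s -> f w <= M%:Z.
Proof.
elim: s => [|w s [M H]]; first by exists 0%N.
exists (M + `|f w|)%N => u; rewrite inE => /orP[/eqP->|/H]; lia.
Qed.

Section Kernel.
Variable R : idomainType.
Local Notation "x %:F" := (@FracField.tofrac R x).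

Lemma fraction_common_denom n (v : 'rV[{fraction R}]_n) :
  exists d (w : 'rV[R]_n), d != 0 /\ forall i, v 0 i * d%:F = (w 0 i)%:F.
Proof.
have H x : exists a b : R, b != 0 /\ x * b%:F = a%:F.
  elim/quotW: x => r; exists (frac r).1, (frac r).2; split; first exact: denom_ratioP.
  rewrite /GRing.mul /= !piE; apply/eqmodP.
  by rewrite /= FracField.equivfE /FracField.mulf !numden_Ratio ?mulr1 ?oner_neq0 ?mulf_neq0 ?denom_ratioP // mulrC.
have /choice[a /choice[b bab]] := fun i => H (v 0 i).
have b0 i : b i != 0 by have [] := bab i.
have ab i : v 0 i * (b i)%:F = (a i)%:F by have [] := bab i.
exists (\prod_i b i), (\row_i (a i * \prod_(j | j != i) b j)); split.
  by apply/prodf_neq0.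
by move=> i; rewrite mxE (bigD1 i) //= !tofracM mulrA ab.
Qed.

Lemma idomain_kernel n m (B : 'M[R]_(n, m)) : (m < n)%N ->
  exists2 c : 'rV[R]_n, c != 0 & c *m B = 0.
Proof.
move=> mn; pose BF := map_mx (@FracField.tofrac R) B.
have : kermx BF != 0.
  rewrite kermx_eq0 -row_leq_rank -ltnNge; apply: leq_ltn_trans mn.
  exact: rank_leq_col.
move=> /rowV0Pn[v vk v0].
have vB : v *m BF = 0 by apply/sub_kermxP.
have [d [w [d0 dw]]] := fraction_common_denom v.
exists w.
  apply: contra_neq v0 => w0; apply/rowP => i; have := dw i.
  rewrite w0 !mxE tofrac0 => /eqP; rewrite mulf_eq0 tofrac_eq0 (negbTE d0) orbF.
  by move/eqP.
apply/rowP => j; have := congr1 (fun M : 'rV_m => M 0 j * d%:F) vB; rewrite !mxE mul0r.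
rewrite mulr_suml => H; apply/eqP; rewrite -tofrac_eq0 rmorph_sum; apply/eqP.
rewrite -[RHS]H; apply: eq_bigr => i _; rewrite !mxE /= tofracM -dw mulrAC.
by [].
Qed.
End Kernel.

Lemma polyX_content (K : fieldType) (Q : {poly {poly K}}) : Q != 0 ->
  exists k (R : {poly {poly K}}),
    Q = R * ('X^k)%:P /\ exists j, (R`_j)`_0 != 0.
Proof.
have [n sn] := ubnP (\sum_(i < size Q) size (Q`_i)%R)%N; elim: n Q sn => // n IH Q sn Q0.
have [[j Qj]|/forallNP H] := pselect (exists j, (Q`_j)`_0 != 0).
  by exists 0%N, Q; rewrite expr0 mulr1; split=> //; exists j.
pose Q' : {poly {poly K}} := \poly_(i < size Q) drop_poly 1 Q`_i.
have QE : Q = Q' * 'X%:P.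
  apply/polyP => i; rewrite coefMC coef_poly.
  case: ltnP => [iQ|?]; last by rewrite mul0r nth_default.
  apply/polyP => l; rewrite coefMX; case: l => [|l] /=.
    by apply/eqP/negPn/negP; apply: H.
  by rewrite coef_drop_poly addn1.
have Q'0 : Q' != 0 by apply: contra_neq Q0 => Q'0; rewrite QE Q'0 mul0r.
have sz : size Q' = size Q by rewrite QE mulrC size_Cmul // polyX_eq0.
have lQ : (0 < size Q)%N by rewrite size_poly_gt0.
have [|k [R [Q'E Rj]]] := IH Q' _ Q'0.
  rewrite ltnS in sn; rewrite sz; apply: leq_trans sn.
  have lt : ((size Q).-1 < size Q)%N by rewrite prednK.
  rewrite (bigD1 (Ordinal lt)) //= [X in (_ < X)%N](bigD1 (Ordinal lt)) //=.
  have szi i : size Q`_i = (size (Q'`_i)%R + (Q'`_i != 0)%R)%N.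
    rewrite QE coefMC; have [->|Qi] := eqVneq Q'`_i 0.
      by rewrite mul0r size_poly0.
    by rewrite size_mulX //= addn1.
  rewrite -addSn leq_add //; last by apply: leq_sum => i _; rewrite [X in (_ <= X)%N]szi leq_addr.
  by rewrite [X in (_ < X)%N]szi -{3}sz -lead_coefE lead_coef_eq0 Q'0 addn1.
by exists k.+1, R; rewrite exprSr polyCM mulrA -Q'E.
Qed.

Section FunctionField.
Variables (K : closedFieldType) (F : fieldType) (io : {rmorphism K -> F}).
Hypothesis Fdep : forall x y : F, algdep io x y.
Variables (ng : nat) (g : nat -> F).
Hypothesis Fgen : forall f : F, exists P Q : tower K ng,
  ev io g ng Q != 0 /\ f = ev io g ng P / ev io g ng Q.
Implicit Types (x y f : F).

Definition nonconst x := forall c, x != io c.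

Fact kx_key : unit. Proof. by []. Qed.

(** The inclusion of K[x] into F, locked so that its values keep their shape. *)
Definition kx x : {rmorphism {poly K} -> F} := locked_with kx_key
  (GRing.RMorphism.clone {poly K} F (horner_eval x \o map_poly io) _).

Lemma kxX x : kx x 'X = x.
Proof. by rewrite /kx unlock /= horner_evalE map_polyX hornerX. Qed.

Lemma kxC x c : kx x c%:P = io c.
Proof. by rewrite /kx unlock /= horner_evalE map_polyC hornerC. Qed.

Lemma kxE x p : kx x p = \sum_(i < size p) io p`_i * x ^+ i.
Proof.
rewrite /kx unlock /= horner_evalE horner_coef size_map_poly; apply: eq_bigr => i _.
by rewrite coef_map.
Qed.

Lemma kx_wide x (p : {poly K}) n : (size p <= n)%N ->
  kx x p = \sum_(i < n) io p`_i * x ^+ i.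
Proof.
move=> pn; rewrite /kx unlock /= horner_evalE (@horner_coef_wide _ n) ?size_map_poly //.
by apply: eq_bigr => i _; rewrite coef_map.
Qed.

Lemma nonconst_trans x p : nonconst x -> p != 0 -> kx x p != 0.
Proof.
move=> nx p0; have [r pE] := closed_field_poly_normal p.
rewrite pE -mul_polyC rmorphM kxC mulf_neq0 //.
  by rewrite fmorph_eq0 lead_coef_eq0.
rewrite rmorph_prod; elim/big_ind: _ => [||c _]; first exact: oner_neq0.
  exact: mulf_neq0.
by rewrite rmorphB kxX kxC subr_eq0.
Qed.

Lemma nonconst_neq0 x : nonconst x -> x != 0.
Proof. by move/(_ 0); rewrite rmorph0. Qed.

Lemma nonconstV x : nonconst x -> nonconst x^-1.
Proof.
move=> nx c; apply: contra_neq (nx c^-1) => E.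
by rewrite fmorphV -E invrK.
Qed.

(** Linear span and independence over the subfield K(x), without denominators: F is
    viewed as a module over {poly K} through [kx]. *)
Definition spanK x (I : finType) (w : I -> F) f : Prop :=
  exists (a : {poly K}) (c : I -> {poly K}), a != 0 /\
    kx x a * f = \sum_i kx x (c i) * w i.

Definition indepK x n (u : 'I_n -> F) : Prop :=
  forall c : 'I_n -> {poly K}, \sum_i kx x (c i) * u i = 0 -> forall i, c i = 0.

Section Span.
Variables (x : F) (nx : nonconst x).

Lemma spanK0 (I : finType) (w : I -> F) : spanK x w 0.
Proof.
exists 1, (fun=> 0); rewrite oner_neq0 mulr0; split=> //.
by rewrite big1 // => i _; rewrite rmorph0 mul0r.
Qed.

Lemma spanKD (I : finType) (w : I -> F) f h :
  spanK x w f -> spanK x w h -> spanK x w (f + h).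
Proof.
move=> [a [c [a0 E]]] [b [d [b0 E']]].
exists (a * b), (fun i => b * c i + a * d i); rewrite mulf_neq0 //; split=> //.
have -> : kx x (a * b) * (f + h) = kx x b * (kx x a * f) + kx x a * (kx x b * h).
  by rewrite rmorphM; ring.
rewrite E E' !mulr_sumr -big_split /=; apply: eq_bigr => i _.
by rewrite (rmorphD (kx x)) !(rmorphM (kx x)) mulrDl !mulrA.
Qed.

Lemma spanKZ (I : finType) (w : I -> F) b f :
  spanK x w f -> spanK x w (kx x b * f).
Proof.
move=> [a [c [a0 E]]]; exists a, (fun i => b * c i); split=> //.
rewrite mulrCA E mulr_sumr; apply: eq_bigr => i _.
by rewrite rmorphM mulrA.
Qed.

Lemma spanKV (I : finType) (w : I -> F) b f : b != 0 ->
  spanK x w (kx x b * f) -> spanK x w f.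
Proof.
move=> b0 [a [c [a0 E]]]; exists (a * b), c; rewrite mulf_neq0 //; split=> //.
by rewrite rmorphM -mulrA.
Qed.

Lemma spanK_sum (I : finType) (w : I -> F) (J : Type) (r : seq J) (P : pred J)
    (f : J -> F) : (forall j, P j -> spanK x w (f j)) ->
  spanK x w (\sum_(j <- r | P j) f j).
Proof. by move=> H; elim/big_ind: _ => //; [apply: spanK0|apply: spanKD]. Qed.

Lemma spanK_gen (I : finType) (w : I -> F) i : spanK x w (w i).
Proof.
exists 1, (fun j => (j == i)%:R); rewrite oner_neq0; split=> //.
rewrite (bigD1 i) //= eqxx !(rmorph1 (kx x)) mul1r big1 ?addr0 // => j ji.
by rewrite (negbTE ji) rmorph0 mul0r.
Qed.

Lemma spanKM (I J : finType) (w : I -> F) (w' : J -> F) f h :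
  spanK x w f -> spanK x w' h ->
  spanK x (fun ij : I * J => w ij.1 * w' ij.2) (f * h).
Proof.
move=> [a [c [a0 E]]] [b [d [b0 E']]].
exists (a * b), (fun ij => c ij.1 * d ij.2); rewrite mulf_neq0 //; split=> //.
rewrite rmorphM mulrACA E E' mulr_suml.
under eq_bigr do rewrite mulr_sumr.
rewrite pair_big /=; apply: eq_bigr => ij _; rewrite rmorphM; ring.
Qed.

Lemma alg_relation y : exists2 Q : {poly {poly K}}, Q != 0 &
  \sum_(i < size Q) kx x Q`_i * y ^+ i = 0.
Proof.
have [P [P0 Py]] := Fdep x y; exists P => //.
have E (p : {poly K}) : ev io (pair_pt x y) 1 p = kx x p by rewrite /kx unlock.
rewrite -[RHS]Py evS horner_coef size_map_poly_id0; last first.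
  by rewrite E; apply: nonconst_trans => //; rewrite lead_coef_eq0.
by apply: eq_bigr => i _; rewrite coef_map -E.
Qed.

(** The algebraic relation of y over K(x) expresses high powers through lower ones. *)
Lemma algebraic_powers y : exists d (w : 'I_d -> F), forall i, spanK x w (y ^+ i).
Proof.
have [Q P0 PyE] := alg_relation y.
have sQ : (0 < size Q)%N by rewrite size_poly_gt0.
exists (size Q).-1, (fun i => y ^+ i).
elim/ltn_ind => i IH.
have [id|di] := ltnP i (size Q).-1; first exact: (spanK_gen _ (Ordinal id)).
apply: (@spanKV _ _ (lead_coef Q)); first by rewrite lead_coef_eq0.
have -> : kx x (lead_coef Q) * y ^+ i =
    - \sum_(j < (size Q).-1) kx x Q`_j * y ^+ (i - (size Q).-1 + j).
  apply/eqP; rewrite -subr_eq0 opprK; apply/eqP.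
  have := PyE; rewrite lead_coefE; move: sQ di; case: (size Q) => // l _ di.
  rewrite big_ord_recr /= =>  /(congr1 (fun z => y ^+ (i - l) * z)).
  rewrite mulr0 mulrDr => E; rewrite -[RHS]E addrC mulr_sumr; congr (_ + _).
    by apply: eq_bigr => j _; rewrite exprD mulrCA.
  by rewrite mulrCA -exprD subnK.
rewrite -mulN1r -(rmorph1 (kx x)) -rmorphN; apply: spanKZ; apply: spanK_sum => j _.
apply: spanKZ; apply: IH; move: (ltn_ord j) di; lia.
Qed.

Lemma spanK_tower m (y : nat -> F) : exists (I : finType) (w : I -> F),
  forall P : tower K m, spanK x w (ev io y m P).
Proof.
elim: m => [|m [I [w IH]]].
  exists unit, (fun=> 1) => P; exists 1, (fun=> P%:P); rewrite oner_neq0; split=> //.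
  by rewrite rmorph1 mul1r (bigD1 tt) //= big1 ?addr0 ?kxC ?mulr1 // => -[].
have [d [w' H]] := algebraic_powers (y m).
exists (I * 'I_d)%type, (fun ij => w ij.1 * w' ij.2) => P.
rewrite evS horner_coef; apply: spanK_sum => i _; rewrite coef_map.
by apply: (spanKM (IH _) (H i)).
Qed.

(** F is finite over K(x): monomials in the generators are spanned by products of
    finitely many powers of each, and the inverse of an algebraic element is a
    polynomial in it, up to a coefficient in K[x]. *)
Lemma spanK_all : exists (I : finType) (w : I -> F), forall f, spanK x w f.
Proof.
have [I [w H]] := spanK_tower ng g; exists I, w => f.
have [P [Q [Q0 ->]]] := Fgen f; set q := ev io g ng Q in Q0 *.
have [R D0 RE] := alg_relation q.
(* the lowest nonzero coefficient of the equation of q inverts q *)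
have exR : exists i, R`_i != 0 by exists (size R).-1; rewrite -lead_coefE lead_coef_eq0.
case: (ex_minnP exR) => k Rk mink.
have ksz : (k < size R)%N by rewrite ltnNge; apply: contraNN Rk => ?; rewrite nth_default.
apply: (@spanKV _ _ R`_k) => //.
have -> : kx x R`_k * (ev io g ng P / q) =
    - \sum_(i < size R | (k < i)%N) kx x R`_i * (ev io g ng (P * Q ^+ (i - k.+1))).
  apply: (mulfI (expf_neq0 k.+1 Q0)); rewrite mulrN mulr_sumr.
  have -> : q ^+ k.+1 * (kx x R`_k * (ev io g ng P / q)) =
      ev io g ng P * (kx x R`_k * q ^+ k).
    by rewrite exprSr; field.
  have -> : \sum_(i < size R | (k < i)%N) q ^+ k.+1 *
      (kx x R`_i * ev io g ng (P * Q ^+ (i - k.+1))) =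
      ev io g ng P * \sum_(i < size R | (k < i)%N) kx x R`_i * q ^+ i.
    rewrite mulr_sumr; apply: eq_bigr => i ki.
    rewrite (rmorphM (ev io g ng)) (rmorphXn (ev io g ng)) -/q.
    have -> : q ^+ i = q ^+ k.+1 * q ^+ (i - k.+1) by rewrite -exprD subnKC.
    by move: (q ^+ k.+1) (q ^+ (i - k.+1)) => A B; ring.
  rewrite -mulrN; congr (_ * _); apply/eqP; rewrite -addr_eq0; apply/eqP.
  move: (RE); rewrite (bigID (fun i : 'I_(size R) => (k < i)%N)) /= => RE'.
  rewrite -[RHS]RE' [RHS]addrC.
  congr (_ + _).
  rewrite [RHS](bigD1 (Ordinal ksz)) /= ?ltnn // big1 ?addr0 // => i.
  rewrite -leqNgt => /andP[ik /eqP ink].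
  have [->|Ri] := eqVneq R`_i 0; first by rewrite rmorph0 mul0r.
  exfalso; apply: ink; apply: val_inj; apply/eqP.
  by rewrite eqn_leq ik mink.
rewrite -mulN1r -(rmorph1 (kx x)) -rmorphN; apply: spanKZ; apply: spanK_sum => i _.
by apply: spanKZ.
Qed.

Lemma indepK_bound : exists D, forall n (u : 'I_n -> F), indepK x u -> (n <= D)%N.
Proof.
have [I [w H]] := spanK_all; exists #|I| => n u ind.
rewrite leqNgt; apply/negP => In.
have /choice[a /choice[C aCP]] := fun i => H (u i).
have a0 i : a i != 0 by have [] := aCP i.
have aC i : kx x (a i) * u i = \sum_j kx x (C i j) * w j by have [] := aCP i.
have [c c0 cB] := idomain_kernel (\matrix_(i < n, j < #|I|) C i (enum_val j)) In.
have /rV0Pn[i ci] := c0.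
have /ind/(_ i)/eqP : \sum_i kx x (c 0 i * a i) * u i = 0.
  under eq_bigr do rewrite rmorphM -mulrA aC mulr_sumr.
  rewrite exchange_big big1 // => j _.
  have /(congr1 (fun M : 'rV_#|I| => kx x (M 0 (enum_rank j)))) := cB; rewrite !mxE rmorph0 => E.
  rewrite -[RHS](mul0r (w j)) -[in RHS]E rmorph_sum mulr_suml; apply: eq_bigr => k _.
  by rewrite !mxE enum_rankK rmorphM mulrA.
by rewrite mulf_eq0 (negbTE ci) (negbTE (a0 i)).
Qed.

End Span.

(** The residue field of a place is K: reducing an algebraic relation between f and
    a uniformizer gives a polynomial over K of which f is a root modulo v, and K is
    algebraically closed. *)
Lemma place_residue v f : aplace io v -> vge v 0 f ->
  exists c, vge v 1 (f - io c).
Proof.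
move=> pv f0; have [t t0 vt] := avN pv.
have [->|fn0] := eqVneq f 0; first by exists 0; rewrite rmorph0 subrr vge0.
have [P [P0 Py]] := Fdep t f; pose Q : {poly {poly K}} := P.
have E (p : {poly K}) : ev io (pair_pt t f) 1 p = kx t p by rewrite /kx unlock.
(* divide by the power of X dividing all coefficients *)
have [k [R [QE [j Rj]]]] := polyX_content P0.
have relR : \sum_(i < size R) kx t R`_i * f ^+ i = 0.
  have : ev io (pair_pt t f) 2 R * t ^+ k = 0.
    have := Py; rewrite QE (rmorphM (ev io (pair_pt t f) 2)) => Py'.
    rewrite -[RHS]Py'; congr (_ * _).
    by rewrite ev_polyC E rmorphXn kxX.
  move=> /eqP; rewrite mulf_eq0 expf_eq0 (negbTE t0) andbF orbF => /eqP R0.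
  rewrite -[RHS]R0 evS (@horner_coef_wide _ (size R)) ?size_poly //.
  by apply: eq_bigr => i _; rewrite coef_map -E.
pose p : {poly K} := \poly_(i < size R) (R`_i)`_0.
have p0 : p != 0.
  apply: contra_neq Rj => /polyP/(_ j); rewrite coef_poly coef0; case: ltnP => // js _.
  by rewrite (nth_default _ js) coef0.
have vt1 : vge v 1 t by rewrite /vge vt lexx orbT.
have redt (q : {poly K}) : vge v 1 (kx t q - io q`_0).
  elim/poly_ind: q => [|q c _]; first by rewrite coef0 !rmorph0 subrr vge0.
  rewrite rmorphD rmorphM kxX kxC coefD coefMX coefC add0r /= addrK.
  have := vgeM pv (_ : vge v 0 (kx t q)) vt1; rewrite add0r; apply.
  rewrite -E; apply: (vge_ev pv) => -[] // _ /=.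
  exact: vge_trans vt1.
have pf : vge v 1 (kx f p).
  rewrite (kx_wide _ (size_poly _ _)).
  rewrite -(subrK (\sum_(i < size R) kx t R`_i * f ^+ i) (\sum_(i < size R) _)).
  rewrite -sumrB [X in _ + X]relR addr0.
  apply: (vge_sum pv) => i _.
  rewrite -mulrBl -opprB mulNr (vgeN pv).
  have := vgeM pv (redt R`_i) (vgeX pv i f0); rewrite addr0.
  by rewrite coef_poly ltn_ord.
have [r pE] := closed_field_poly_normal p.
apply: contrapT => /forallNP Hc.
have un c : f - io c != 0 /\ v (f - io c) = 0.
  have := Hc c; rewrite /vge; case: eqVneq => //= d0 /negP; rewrite -ltNge => vd.
  split=> //; apply/eqP; rewrite eq_le -ltzD1 add0r vd.
  by have := vgeB pv f0 (vgeC pv c); rewrite vgeP.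
move: pf; rewrite pE -mul_polyC rmorphM kxC rmorph_prod.
under eq_bigr do rewrite rmorphB kxX kxC.
have l0 : io (lead_coef p) != 0 by rewrite fmorph_eq0 lead_coef_eq0.
have pr0 : \prod_(i <- r) (f - io i) != 0.
  by elim/big_ind: _ => [||c _]; [rewrite oner_neq0|apply: mulf_neq0|case: (un c)].
rewrite vgeP ?mulf_neq0 // (avM pv) // (av_prod pv); last by move=> i _; case: (un i).
rewrite big1 => [|c _]; last by case: (un c).
by rewrite (avC pv) // lead_coef_eq0.
Qed.

(** ** Existence of places *)

Section ExistPlace.
Variables (y : F) (ny : nonconst y).

(** The subrings of F containing K and y but not the inverse of y. A maximal one
    turns out to be the valuation ring of a place at which y vanishes. *)
Record valring (S : set F) : Prop := Valring {
  vrC : forall c, S (io c);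
  vrD : forall a b, S a -> S b -> S (a + b);
  vrM : forall a b, S a -> S b -> S (a * b);
  vry : S y;
  vryV : ~ S y^-1 }.

(** Zorn's lemma. The empty set has to be admitted, being the union of the empty chain;
    it is not maximal because K[y] has the required properties. *)
Lemma max_valring : exists S, valring S /\
  forall S', (S `<` S')%classic -> ~ valring S'.
Proof.
have [] := @Zorn_bigcup F (fun S => S = set0 \/ valring S).
  move=> H HV tot; have [[S0 [HS0 [a S0a]]]|noS] := pselect (exists S0, H S0 /\ S0 !=set0); last first.
    left; apply/seteqP; split=> // a [S HS Sa]; apply: noS; exists S; split=> //.
    by exists a.
  have vS0 S : H S -> S !=set0 -> valring S.
    by move=> /HV[->|//] [b].
  right; split.
  - by move=> c; exists S0 => //; apply: (vrC (vS0 _ HS0 (ex_intro _ a S0a))).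
  - move=> b c [S1 H1 S1b] [S2 H2 S2c].
    have [S12|S21] := tot _ _ H1 H2.
      by exists S2 => //; apply: (vrD (vS0 _ H2 (ex_intro _ c S2c))) => //; apply: S12.
    by exists S1 => //; apply: (vrD (vS0 _ H1 (ex_intro _ b S1b))) => //; apply: S21.
  - move=> b c [S1 H1 S1b] [S2 H2 S2c].
    have [S12|S21] := tot _ _ H1 H2.
      by exists S2 => //; apply: (vrM (vS0 _ H2 (ex_intro _ c S2c))) => //; apply: S12.
    by exists S1 => //; apply: (vrM (vS0 _ H1 (ex_intro _ b S1b))) => //; apply: S21.
  - by exists S0 => //; apply: (vry (vS0 _ HS0 (ex_intro _ a S0a))).
  - by move=> [S HS Sy]; apply: (vryV (vS0 _ HS (ex_intro _ _ Sy))).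
move=> S [[S0|vS] max]; last first.
  by exists S; split=> // S' /max nS' vS'; apply: nS'; right.
have vK : valring [set f | exists p, f = kx y p].
  split.
  - by move=> c; exists c%:P; rewrite kxC.
  - by move=> _ _ [p ->] [q ->]; exists (p + q); rewrite rmorphD.
  - by move=> _ _ [p ->] [q ->]; exists (p * q); rewrite rmorphM.
  - by exists 'X; rewrite kxX.
  - move=> [p pE]; have y0 := nonconst_neq0 ny.
    have := nonconst_trans ny (p := p * 'X - 1).
    rewrite rmorphB rmorphM rmorph1 kxX -pE mulVf // subrr eqxx => H.
    suff : false by []; apply: H; apply/eqP => /polyP/(_ 0%N).
    by rewrite coefB coefMX coef1 coef0 sub0r => /eqP; rewrite oppr_eq0 oner_eq0.
exfalso; apply: (max [set f | exists p, f = kx y p]); last by right.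
rewrite S0; split; first by [].
by move=> /(_ (kx y 0)) H; apply: H; exists 0.
Qed.

Variables (S : set F) (vS : valring S).
Hypothesis maxS : forall S', (S `<` S')%classic -> ~ valring S'.

Lemma vrN a : S a -> S (- a).
Proof.
by move=> Sa; rewrite -mulN1r -(rmorph1 io) -rmorphN; apply: (vrM vS) => //; apply: vrC.
Qed.

Lemma vr_sum (I : Type) (r : seq I) (P : pred I) (f : I -> F) :
  (forall i, P i -> S (f i)) -> S (\sum_(i <- r | P i) f i).
Proof.
move=> H; elim/big_ind: _ => //; last exact: vrD.
by rewrite -(rmorph0 io); apply: vrC.
Qed.

Lemma vr1 : S 1. Proof. by rewrite -(rmorph1 io); apply: vrC. Qed.

Lemma vrX a n : S a -> S (a ^+ n).
Proof. by move=> Sa; elim: n => [|n IH]; [rewrite expr0; apply: vr1|rewrite exprS; apply: vrM]. Qed.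

(** By maximality, adjoining z to S must make y invertible. *)
Lemma vr_adjoin z : ~ S z -> exists p : {poly F}, (forall i, S p`_i) /\ p.[z] = y^-1.
Proof.
move=> nz; pose S' := [set f | exists p : {poly F}, (forall i, S p`_i) /\ p.[z] = f].
have S0 : S 0 by rewrite -(rmorph0 io); apply: vrC.
have SS' : (S `<` S')%classic.
  split; first by move=> f Sf; exists f%:P; rewrite hornerC; split=> // i; rewrite coefC; case: ifP.
  move=> /(_ z) H; apply: nz; apply: H; exists 'X; rewrite hornerX; split=> // i.
  by rewrite coefX; case: (i == 1)%N; [apply: vr1|].
apply: contrapT => H; apply: (maxS SS'); split.
- by move=> c; apply: SS'.1; apply: vrC.
- move=> _ _ [p [Sp <-]] [q [Sq <-]]; exists (p + q); rewrite hornerD; split=> // i.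
  by rewrite coefD; apply: vrD.
- move=> _ _ [p [Sp <-]] [q [Sq <-]]; exists (p * q); rewrite hornerM; split=> // i.
  by rewrite coefM; apply: vr_sum => j _; apply: vrM.
- by apply: SS'.1; apply: vry.
- by move=> [p Hp]; apply: H; exists p.
Qed.

(** The classical argument for valuation rings: if neither z nor its inverse is in
    S, both satisfy an equation 1 = sum a_i z^i with a_i in y S; of two such
    equations of minimal degrees, the shorter one can be used to lower the degree
    of the longer one. *)
Lemma vr_total z : z != 0 -> S z \/ S z^-1.
Proof.
move=> z0; apply: contrapT => /not_orP[nz nzV].
have y0 := nonconst_neq0 ny.
(* relations 1 = sum a_i z^i of minimal degree with a_i in y S *)
pose rel w n := `[< exists p : {poly F}, [/\ forall i, S (p`_i / y), p.[w] = 1 & size p = n] >].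
have exrel w : ~ S w -> exists n, rel w n.
  move=> /vr_adjoin[p [Sp pw]]; exists (size (y *: p)); apply/asboolP; exists (y *: p).
  by rewrite hornerZ pw divff //; split=> // i; rewrite coefZ mulrAC divff // mul1r.
case: (ex_minnP (exrel _ nz)) => n /asboolP[p [Sp pz sp]] minn.
case: (ex_minnP (exrel _ nzV)) => m /asboolP[q [Sq qz sq]] minm.
have Syy a : S (a / y) -> S a.
  by move=> Sa; rewrite -(divfK y0 a); apply: (vrM vS) => //; apply: vry.
(* the smaller degree can be used to lower the larger one *)
have step w (p1 q1 : {poly F}) : w != 0 -> (size q1 <= size p1)%N ->
    (forall i, S (p1`_i / y)) -> (forall i, S (q1`_i / y)) ->
    p1.[w] = 1 -> q1.[w^-1] = 1 -> ~ S w ->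
    exists p2 : {poly F}, [/\ forall i, S (p2`_i / y), p2.[w] = 1 & (size p2 < size p1)%N].
  move=> w0 qp Sp1 Sq1 p1w q1w nw.
  have sp1 : (1 < size p1)%N.
    rewrite ltnNge; apply/negP => /size1_polyC p1E; apply: (vryV vS).
    by have := Sp1 0%N; move: p1w; rewrite p1E hornerC coefC /= => ->; rewrite mul1r.
  have sp0 : (0 < size p1)%N by rewrite (ltn_trans _ sp1).
  pose b := q1`_0; pose a := lead_coef p1; pose d := (size p1).-1.
  (* p1 - b p1 + b, with the top term of (1 - b) p1 replaced *)
  pose p2 : {poly F} := (1 - b) *: \poly_(i < d) p1`_i + b%:P +
    a *: \poly_(i < d) (if (d - i < size q1)%N then q1`_(d - i) else 0).
  exists p2; split.
  - move=> i; rewrite /p2 !coefD !coefZ !coef_poly coefC mulrDl.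
    have S0 : S 0 by rewrite -(rmorph0 io); apply: vrC.
    apply: (vrD vS); last first.
      case: ltnP => _; last by rewrite mulr0 mul0r.
      case: ifP => _; last by rewrite mulr0 mul0r.
      by rewrite -mulrA; apply: (vrM vS) => //; apply: Syy; apply: Sp1.
    rewrite mulrDl; apply: (vrD vS); last by case: (i == 0)%N; rewrite ?mul0r //; apply: Sq1.
    case: ltnP => _; last by rewrite mulr0 mul0r.
    rewrite -mulrA; apply: (vrM vS) => //; apply: (vrD vS); first exact: vr1.
    by apply: vrN; apply: Syy; apply: Sq1.
  - rewrite /p2 !hornerD !hornerZ hornerC.
    have E1 : (\poly_(i < d) p1`_i).[w] = 1 - a * w ^+ d.
      rewrite horner_poly -[X in X - _]p1w horner_coef /a lead_coefE -/d.
      by rewrite -[in X in _ = X - _](prednK sp0) big_ord_recr /= addrK.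
    have E2 : (\poly_(i < d) (if (d - i < size q1)%N then q1`_(d - i) else 0)).[w] =
        w ^+ d * (1 - b).
      have -> : \poly_(i < d) (if (d - i < size q1)%N then q1`_(d - i) else 0) =
          \poly_(i < d) q1`_(d - i).
        by apply/polyP => i; rewrite !coef_poly; case: ifP => // _; case: ltnP => // ?;
           rewrite nth_default.
      rewrite horner_poly -{1}q1w (@horner_coef_wide _ d.+1); last first.
        by rewrite /d prednK.
      rewrite big_ord_recl /= expr0 mulr1 -/b [_ - b]addrC addKr mulr_sumr.
      rewrite (reindex_inj rev_ord_inj) /=; apply: eq_bigr => i _.
      rewrite subKn // exprVn mulrCA; congr (_ * _).
      have -> : w ^+ d = w ^+ (d - i.+1) * w ^+ i.+1 by rewrite -exprD subnK.
      by rewrite mulfK // expf_neq0.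
    rewrite E1 E2; ring.
  - rewrite -(prednK sp0) ltnS -/d /p2; apply: (leq_trans (size_polyD _ _)).
    rewrite geq_max (leq_trans (size_scale_leq _ _)) ?size_poly // andbT.
    apply: (leq_trans (size_polyD _ _)).
    rewrite geq_max (leq_trans (size_scale_leq _ _)) ?size_poly //=.
    by apply: (leq_trans (size_polyC_leq1 _)); rewrite -ltnS /d prednK.
have [mn|nm] := leqP (size q) (size p).
  have [p2 [H1 H2 H3]] := step _ _ _ z0 mn Sp Sq pz qz nz.
  have /minn : rel z (size p2) by apply/asboolP; exists p2.
  by rewrite leqNgt -sp H3.
have zV0 : z^-1 != 0 by rewrite invr_neq0.
have pz' : p.[z^-1^-1] = 1 by rewrite invrK.
have [p2 [H1 H2 H3]] := step _ _ _ zV0 (ltnW nm) Sq Sp qz pz' nzV.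
have /minm : rel z^-1 (size p2) by apply/asboolP; exists p2.
by rewrite leqNgt -sq H3.
Qed.

(** The non-units of S. *)
Definition vmax z := S z /\ (z = 0 \/ ~ S z^-1).

Lemma vmaxMl a b : S a -> vmax b -> vmax (a * b).
Proof.
move=> Sa [Sb nb]; split; first exact: vrM.
have [->|a0] := eqVneq a 0; first by left; rewrite mul0r.
have [->|b0] := eqVneq b 0; first by left; rewrite mulr0.
right=> Sab; case: nb => [/eqP|]; first by rewrite (negbTE b0).
apply; have -> : b^-1 = a * (a * b)^-1 by rewrite invfM mulrA divff ?mul1r.
exact: vrM.
Qed.

Lemma vmaxD a b : vmax a -> vmax b -> vmax (a + b).
Proof.
move=> ma mb.
have [->|a0] := eqVneq a 0; first by rewrite add0r.
have [->|b0] := eqVneq b 0; first by rewrite addr0.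
have ab0 : a / b != 0 by rewrite mulf_neq0 ?invr_neq0.
have [Sab|Sba] := vr_total ab0.
  have -> : a + b = (a / b + 1) * b by rewrite mulrDl mul1r divfK.
  by apply: vmaxMl mb; apply: (vrD vS) => //; apply: vr1.
have -> : a + b = (1 + (a / b)^-1) * a.
  by rewrite mulrDl mul1r invf_div divfK.
by apply: vmaxMl ma; apply: (vrD vS) => //; apply: vr1.
Qed.

Lemma vmax_sum (I : Type) (r : seq I) (P : pred I) (f : I -> F) :
  (forall i, P i -> vmax (f i)) -> vmax (\sum_(i <- r | P i) f i).
Proof.
move=> H; elim/big_ind: _ => //; last exact: vmaxD.
by split; [rewrite -(rmorph0 io); apply: vrC|left].
Qed.

Lemma vmaxN a : vmax a -> vmax (- a).
Proof.
by move=> ma; rewrite -mulN1r; apply: vmaxMl ma; apply: vrN; apply: vr1.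
Qed.

Lemma vmaxC c : vmax (io c) -> c = 0.
Proof.
move=> [_ [/eqP|]]; first by rewrite fmorph_eq0 => /eqP.
by rewrite -fmorphV => H; case: H; apply: vrC.
Qed.

Lemma vmax_kx x p : S x -> S (kx x p).
Proof.
move=> Sx; rewrite kxE; apply: vr_sum => i _; apply: (vrM vS); first exact: vrC.
exact: vrX.
Qed.

Lemma vmax_nonconst x : x != 0 -> vmax x -> nonconst x.
Proof.
move=> x0 mx c; apply: contra_neq x0 => xc; move: mx; rewrite xc => /vmaxC->.
by rewrite rmorph0.
Qed.

(** In a relation over K[f 0], consider the last term whose coefficient is not
    divisible by f 0: it is a unit times its f i, and every other term is in the
    maximal ideal times that f i. *)
Lemma vmax_chain_indep n (f : nat -> F) : (forall i, f i != 0) -> vmax (f 0%N) ->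
  (forall i, vmax (f i)) ->
  (forall i j, (i < j <= n)%N -> vmax (f i / f j)) ->
  indepK (f 0%N) (fun i : 'I_n.+1 => f i).
Proof.
move=> f0 m0 mf chain c; set x := f 0%N in m0 *.
have Sx : S x by case: m0.
have [N sN] : exists N, forall i, (size (c i) <= N)%N.
  exists (\max_i size (c i)) => i; exact: leq_bigmax.
elim: N c sN => [|N IH] c sN E i.
  by apply/eqP; rewrite -size_poly_leq0.
suff H0 : forall i, (c i)`_0 = 0.
  have cX j : c j = drop_poly 1 (c j) * 'X.
    apply/polyP => -[|l]; rewrite coefMX ?H0 //= coef_drop_poly addn1 //.
  rewrite cX (IH (fun j => drop_poly 1 (c j))) ?mul0r //.
    by move=> j; rewrite size_drop_poly leq_subLR add1n.
  apply: (mulIf (f0 0%N)); rewrite mul0r mulr_suml -[RHS]E.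
  by apply: eq_bigr => j _; rewrite [in RHS]cX rmorphM kxX mulrAC.
have [//|/existsNP[j0 /eqP nj0]] := pselect (forall i, (c i)`_0 = 0).
pose Q l := [exists j : 'I_n.+1, (j == l :> nat) && ((c j)`_0 != 0)].
have exQ : exists l, Q l by exists j0; apply/existsP; exists j0; rewrite eqxx.
have bQ l : Q l -> (l <= n)%N by move=> /existsP[j /andP[/eqP<- _]]; rewrite -ltnS.
case: (ex_maxnP exQ bQ) => l /existsP[j /andP[/eqP jl nj]] max.
have : vmax (kx x (c j)).
  have -> : kx x (c j) = - \sum_(i < n.+1 | i != j) kx x (c i) * (f i / f j).
    apply: (mulIf (f0 j)); rewrite mulNr mulr_suml.
    apply/eqP; rewrite -addr_eq0; apply/eqP; rewrite -[RHS]E [RHS](bigD1 j) //=.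
    congr (_ + _); apply: eq_bigr => k _; rewrite -mulrA divfK //.
  apply: vmaxN; apply: vmax_sum => k kj.
  have [kltj|] := ltnP k j.
    by apply: vmaxMl (chain _ _ _); [exact: vmax_kx|rewrite kltj -ltnS ltn_ord].
  rewrite leq_eqVlt eq_sym => /orP[|jk]; first by rewrite (negbTE (_ : k != j :> nat)).
  have ck0 : (c k)`_0 = 0.
    apply/eqP/negPn/negP => nk; have /max : Q k by apply/existsP; exists k; rewrite eqxx.
    by rewrite leqNgt -jl jk.
  have -> : c k = drop_poly 1 (c k) * 'X.
    by apply/polyP => -[|u]; rewrite coefMX ?ck0 //= coef_drop_poly addn1.
  have -> : kx x (drop_poly 1 (c k) * 'X) * (f k / f j) =
      kx x (drop_poly 1 (c k)) * (x / f j) * f k.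
    by rewrite rmorphM kxX; ring.
  apply: vmaxMl (mf k); apply: (vrM vS); first exact: vmax_kx.
  have [j0'|j1] := posnP j; first by rewrite j0' divff ?f0 //; apply: vr1.
  have jn : (0 < j <= n)%N by rewrite j1 -ltnS ltn_ord.
  by case: (chain 0%N j jn).
have -> : kx x (c j) = io (c j)`_0 + kx x (drop_poly 1 (c j)) * x.
  have cE : c j = ((c j)`_0)%:P + drop_poly 1 (c j) * 'X.
    by apply/polyP => -[|u]; rewrite coefD coefMX coefC ?addr0 //= add0r coef_drop_poly addn1.
  by rewrite [in LHS]cE rmorphD rmorphM kxC kxX.
move=> H; have : vmax (io (c j)`_0).
  rewrite -[X in vmax X](addrK (kx x (drop_poly 1 (c j)) * x)).
  by apply: vmaxD H _; apply: vmaxN; apply: vmaxMl m0; apply: vmax_kx.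
by move=> /vmaxC c0; rewrite c0 eqxx in nj.
Qed.

Lemma vmax_chain_bound x : x != 0 -> vmax x -> exists D, forall n (f : nat -> F),
  f 0%N = x -> (forall i, f i != 0) -> (forall i, vmax (f i)) ->
  (forall i, (i < n)%N -> vmax (f i / f i.+1)) -> (n <= D)%N.
Proof.
move=> x0 mx; have [D HD] := indepK_bound (vmax_nonconst x0 mx).
exists D => n f f0x f0 mf chain; apply: ltnW; apply: HD.
rewrite -f0x; apply: vmax_chain_indep => //.
move=> i j /andP[ij jn]; elim: j ij jn => // j IHj; rewrite ltnS leq_eqVlt.
move=> /orP[/eqP->|ij] jn; first exact: chain.
have -> : f i / f j.+1 = (f i / f j) * (f j / f j.+1) by rewrite mulrA divfK.
apply: vmaxMl; last exact: chain.
by case: (IHj ij (ltnW jn)).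
Qed.

Lemma vmax_y : vmax y.
Proof. by split; [apply: vry|right; apply: vryV]. Qed.

(** An infinite chain of elements, each in the maximal ideal times the next one,
    would contradict [vmax_chain_bound]. *)
Lemma vmax_uniformizer : exists t, [/\ t != 0, vmax t &
  forall z, vmax z -> S (z / t)].
Proof.
apply: contrapT => H.
have next t : t != 0 /\ vmax t -> exists t', (t' != 0 /\ vmax t') /\ vmax (t / t').
  move=> [t0 mt]; apply: contrapT => H'; apply: H; exists t; split=> // z mz.
  have [->|z0] := eqVneq z 0; first by rewrite mul0r -(rmorph0 io); apply: vrC.
  apply: contrapT => nzt; apply: H'; exists z; split=> //; split.
    have zt0 : z / t != 0 by rewrite mulf_neq0 ?invr_neq0.
    by have [|] := vr_total zt0; rewrite ?invf_div.
  by right; rewrite invf_div.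
have y0 := nonconst_neq0 ny.
pose G := {t | t != 0 /\ vmax t}.
have /choice[nx Hnx] : forall t : G, exists t' : G, vmax (sval t / sval t').
  by move=> [t Ht]; have [t' [Ht' H']] := next t Ht; exists (exist _ t' Ht').
pose f i : F := sval (iter i nx (exist _ y (conj y0 vmax_y) : G)).
have [D HD] := vmax_chain_bound y0 vmax_y.
have := HD D.+1 f erefl; rewrite ltnn => H'.
suff : false by []; apply: H' => [i|i|i _].
- by rewrite /f; case: (iter _ _ _) => t [].
- by rewrite /f; case: (iter _ _ _) => t [].
- by rewrite /f iterS; apply: Hnx.
Qed.

(** Every nonzero element is a unit times a power of the uniformizer, since it
    cannot be divisible by all powers, again by [vmax_chain_bound]; the exponent is
    the valuation. *)
Lemma vr_place : exists2 v, aplace io v & 0 < v y.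
Proof.
have [t [t0 mt tS]] := vmax_uniformizer.
have y0 := nonconst_neq0 ny.
pose U z := z != 0 /\ S z /\ S z^-1.
have UM a b : U a -> U b -> U (a * b).
  move=> [a0 [Sa Sa']] [b0 [Sb Sb']]; split; first exact: mulf_neq0.
  by rewrite invfM; split; apply: (vrM vS).
have UV a : U a -> U a^-1 by move=> [a0 [Sa Sa']]; split; rewrite ?invr_eq0 ?invrK.
have ntU : ~ U t by move=> [_ [_ St]]; case: mt => _ [/eqP|//]; rewrite (negbTE t0).
have tz (e : int) : t ^ e != 0 by rewrite expfz_neq0.
have Ut e : U (t ^ e) -> e = 0.
  have pos n : U (t ^ n%:Z) -> n = 0%N.
    case: n => // n; rewrite -exprnP exprS => -[_ [_]]; rewrite invfM => St.
    exfalso; apply: ntU; split=> //; split; first by case: mt.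
    have -> : t^-1 = t^-1 * (t ^+ n)^-1 * t ^+ n by rewrite mulfVK // expf_neq0.
    by apply: (vrM vS) => //; apply: vrX; case: mt.
  by case: e => n; [move/pos->|rewrite NegzE -invr_expz => /UV; rewrite invrK => /pos].
have unif z : z != 0 -> exists e, U (z / t ^ e).
  have posS : forall z, z != 0 -> S z -> exists e : nat, U (z / t ^+ e).
    move=> {}z z0 Sz; apply: contrapT => /forallNP H.
    have mz e : vmax (z / t ^+ e).
      elim: e => [|e [IH _]].
        by rewrite expr0 divr1; split=> //; right=> Sz'; apply: (H 0%N); rewrite expr0 divr1.
      have /tS : vmax (z / t ^+ e).
        split=> //; right=> Sz'; apply: (H e); split=> //.
        by rewrite mulf_neq0 ?invr_neq0 ?expf_neq0.
      rewrite -mulrA -invfM -exprSr => Sze; split=> //; right=> Sz'.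
      by apply: (H e.+1); split=> //; rewrite mulf_neq0 ?invr_neq0 ?expf_neq0.
    have m0 : vmax z by have := mz 0%N; rewrite expr0 divr1.
    have [D HD] := vmax_chain_bound z0 m0.
    pose f i := if i is j.+1 then t ^+ (D.+1 - j).+1 else z.
    have := HD D.+1 f erefl; rewrite ltnn => H'.
    suff : false by []; apply: H' => [[|i]|[|i]|[|i] iD] /=; rewrite ?expf_neq0 //.
    - by rewrite exprSr; apply: (vmaxMl _ mt); apply: vrX; case: mt.
    - have -> : (D.+1 - i).+1 = (D.+1 - i.+1).+2 by lia.
      by rewrite [t ^+ _.+2]exprS mulfK ?expf_neq0.
  move=> z0; have [Sz|Sz] := vr_total z0.
    by have [e He] := posS z z0 Sz; exists e.
  have [|e He] := posS z^-1 _ Sz; first by rewrite invr_eq0.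
  exists (- e%:Z); rewrite -invr_expz invrK -(invrK (z * _)); apply: UV.
  by rewrite invfM.
pose v z := if z == 0 then 0 else xget 0 [set e : int | U (z / t ^ e)].
have vP z : z != 0 -> U (z / t ^ (v z)).
  move=> z0; have [e He] := unif z z0; rewrite /v (negbTE z0).
  by case: xgetP => [e' _ //|/(_ e)].
have vuniq z e : z != 0 -> U (z / t ^ e) -> v z = e.
  move=> z0 He; have := UM _ _ (UV _ (vP z z0)) He.
  have -> : (z / t ^ v z)^-1 * (z / t ^ e) = t ^ (v z - e).
    rewrite expfzDr // -invr_expz invfM invrK mulrACA mulVf // mul1r //.
  by move/Ut => /eqP; rewrite subr_eq0 => /eqP.
have vS0 z : z != 0 -> (S z <-> 0 <= v z).
  move=> z0; have [u0 [Su Su']] := vP z z0; split=> [Sz|vz].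
    rewrite leNgt; apply/negP => vz.
    have St : S (t ^ v z).
      have -> : t ^ v z = z * (z / t ^ v z)^-1 by rewrite invf_div mulrC divfK.
      exact: vrM.
    apply: ntU; split=> //; split; first by case: mt.
    have : exists n : nat, v z = - (n.+1)%:Z by exists (absz (v z)).-1; lia.
    move=> [n nE]; have -> : t^-1 = t ^ v z * t ^+ n.
      by rewrite nE -invr_expz -exprnP exprSr invfM mulrAC mulVf ?mul1r // expf_neq0.
    by apply: (vrM vS) => //; apply: vrX; case: mt.
  rewrite -(divfK (tz (v z)) z); apply: (vrM vS) => //.
  by case: (v z) vz => // n _; rewrite -exprnP; apply: vrX; case: mt.
have vM a b : a != 0 -> b != 0 -> v (a * b) = v a + v b.
  move=> a0 b0; apply: vuniq; first exact: mulf_neq0.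
  by rewrite expfzDr // invfM mulrACA; apply: UM; apply: vP.
have U1 : U 1 by split; [rewrite oner_neq0|rewrite invr1; split; apply: vr1].
have v1 : v 1 = 0 by apply: vuniq; rewrite ?oner_neq0 // expr0z divr1.
have vV a : a != 0 -> v a^-1 = - v a.
  move=> a0; apply/eqP; rewrite -addr_eq0 addrC -vM ?invr_neq0 //.
  by rewrite divff // v1.
have vD a b : a != 0 -> b != 0 -> a + b != 0 -> v a <= v b -> v a <= v (a + b).
  move=> a0 b0 ab0 ab.
  have Sba : S (b / a).
    by apply/vS0; rewrite ?mulf_neq0 ?invr_neq0 // vM ?invr_neq0 // vV // subr_ge0.
  have : S ((a + b) / a).
    by rewrite mulrDl divff //; apply: (vrD vS) => //; apply: vr1.
  by move/vS0; rewrite mulf_neq0 ?invr_neq0 // vM ?invr_neq0 // vV // subr_ge0; apply.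
exists v; last first.
  have vy : 0 <= v y by apply/vS0 => //; apply: vry.
  rewrite lt_neqAle vy andbT eq_sym; apply/eqP => v0.
  by have := vP y y0; rewrite v0 expr0z divr1 => -[_ [_ /(vryV vS)]].
split.
- by rewrite /v eqxx.
- exact: vM.
- move=> a b a0 b0 ab0; have [ab|ba] := leP (v a) (v b); first exact: vD.
  by rewrite addrC; apply: vD; rewrite 1?addrC // ltW.
- move=> c c0; apply: vuniq; first by rewrite fmorph_eq0.
  rewrite expr0z divr1; split; first by rewrite fmorph_eq0.
  by rewrite -fmorphV; split; apply: vrC.
- by exists t => //; apply: vuniq => //; rewrite expr1z divff.
Qed.

End ExistPlace.

Lemma exists_zero y : nonconst y -> exists2 v, aplace io v & 0 < v y.
Proof.
move=> ny; have [S [vS maxS]] := max_valring ny.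
exact: (vr_place ny vS maxS).
Qed.

Lemma exists_pole x : nonconst x -> exists2 v, aplace io v & v x < 0.
Proof.
move=> nx; have [v pv vx] := exists_zero (nonconstV nx).
by exists v => //; rewrite (avV pv) ?nonconst_neq0 // oppr_gt0 in vx.
Qed.

(** ** Approximation *)

(** If no such u existed, one of the valuation rings would contain the other. But then
    the two valuations are proportional, hence equal. *)
Lemma place_separate v w : aplace io v -> aplace io w -> v <> w ->
  exists u, [/\ u != 0, 0 < v u & w u < 0].
Proof.
(* a place whose valuation ring contains that of w is w *)
have sub v1 v2 : aplace io v1 -> aplace io v2 -> v1 <> v2 ->
    exists f, [/\ f != 0, 0 <= v2 f & v1 f < 0].
  move=> p1 p2 n12; apply: contrapT => H; apply: n12.
  have H' f : f != 0 -> 0 <= v2 f -> 0 <= v1 f.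
    move=> f0 f2; rewrite leNgt; apply/negP => f1; apply: H; by exists f.
  have [t t0 v2t] := avN p2.
  have E f : f != 0 -> v1 f = v2 f * v1 t.
    move=> f0; have u0 : f / t ^ (v2 f) != 0 by rewrite mulf_neq0 ?invr_neq0 ?expfz_neq0.
    have vz v' e : aplace io v' -> v' (t ^ e) = e * v' t.
      move=> p'; case: e => n; first by rewrite -exprnP (avX p') // -mulr_natl natz.
      by rewrite NegzE -invr_expz (avV p') ?expfz_neq0 // -exprnP (avX p') // -mulr_natl mulNr natz.
    have vu2 : v2 (f / t ^ (v2 f)) = 0.
      by rewrite (avM p2) ?invr_neq0 ?expfz_neq0 // (avV p2) ?expfz_neq0 // vz // v2t mulr1 subrr.
    have := H' _ u0; rewrite vu2 lexx => /(_ isT) g1.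
    have := H' (f / t ^ (v2 f))^-1; rewrite invr_neq0 // (avV p2) // vu2 oppr0 lexx.
    move=> /(_ isT isT); rewrite (avV p1) // oppr_ge0 => g2.
    have : v1 (f / t ^ v2 f) = 0 by apply/eqP; rewrite eq_le g1 g2.
    by rewrite (avM p1) ?invr_neq0 ?expfz_neq0 // (avV p1) ?expfz_neq0 // vz // => /eqP;
       rewrite subr_eq0 => /eqP.
  have t1 : 0 <= v1 t by apply: H' => //; rewrite v2t.
  have [s s0 v1s] := avN p1; have := E s s0; rewrite v1s => vt.
  have {}t1 : v1 t = 1.
    move: t1 vt; case: (v1 t) => // -[|[|n]] _ //; move: (v2 s) => e; first lia.
    by have [e0|e0] := leP e 0; nia.
  apply/funext => f; have [->|f0] := eqVneq f 0; first by rewrite (av0 p1) (av0 p2).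
  by rewrite E // t1 mulr1.
move=> pv pw vw; have [f [f0 wf vf]] := sub v w pv pw vw.
have [h [h0 vh wh]] := sub w v pw pv (fun e => vw (esym e)).
exists (h / f); rewrite mulf_neq0 ?invr_neq0 //; split=> //.
  by rewrite (avM pv) ?invr_neq0 // (avV pv) //; lia.
by rewrite (avM pw) ?invr_neq0 // (avV pw) //; lia.
Qed.

(** Induction on s: if the element found for s fails at w, add to it a large power
    of an element that separates v from w, the power being chosen so that no
    cancellation occurs. *)
Lemma place_separate_seq v (s : seq (F -> int)) : aplace io v ->
  (forall w, w \in s -> aplace io w) -> v \notin s ->
  exists u, [/\ u != 0, 0 < v u & forall w, w \in s -> w u < 0].
Proof.
move=> pv; elim: s => [|w s IH] ps vs.
  by have [t t0 vt] := avN pv; exists t; split; rewrite ?vt.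
rewrite inE negb_or in vs; case/andP: vs => /eqP vw vs.
have pw : aplace io w by apply: ps; rewrite mem_head.
have [|u1 [u10 vu1 su1]] := IH _ vs; first by move=> w' ws; apply: ps; rewrite inE ws orbT.
have [wu1|wu1] := ltP (w u1) 0.
  by exists u1; split=> // w'; rewrite inE => /orP[/eqP->|/su1].
have [u2 [u20 vu2 wu2]] := place_separate pv pw vw.
have [M HM] := max_int_seq s (fun w' => - w' u1).
pose r := M.+1; have r2 : u2 ^+ r != 0 by rewrite expf_neq0.
have small w' : w' \in s -> w' (u2 ^+ r) != w' u1.
  move=> ws; have pw' : aplace io w' by apply: ps; rewrite inE ws orbT.
  rewrite (avX pw') // -mulr_natl natz; have := HM _ ws; have := su1 _ ws.
  rewrite /r; move: (w' u1) (w' u2) => a b.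
  by have [b0|b0|->] := ltgtP b 0; nia.
have wr : w (u2 ^+ r) < 0 by rewrite (avX pw) // pmulrn_llt0.
have [n12 w12] := avD_lt pw r2 u10 (lt_le_trans wr wu1).
exists (u2 ^+ r + u1); split=> //.
  have := avD pv r2 u10 n12; apply: lt_le_trans.
  by rewrite lt_min vu1 andbT (avX pv) // pmulrn_lgt0.
move=> w'; rewrite inE => /orP[/eqP->|ws]; first by rewrite w12.
have pw' : aplace io w' by apply: ps; rewrite inE ws orbT.
have [lt|gt|eq] := ltgtP (w' (u2 ^+ r)) (w' u1).
- have [_ ->] := avD_lt pw' r2 u10 lt; exact: lt_trans (su1 _ ws).
- by have [_] := avD_lt pw' u10 r2 gt; rewrite addrC => ->; apply: su1.
- by have := small _ ws; rewrite eq eqxx.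
Qed.

(** Apply [place_separate_seq] to get u, and take the inverse of 1 + u^(M+1). *)
Lemma place_approx v (s : seq (F -> int)) (M : nat) : aplace io v ->
  (forall w, w \in s -> aplace io w) -> v \notin s ->
  exists z, [/\ z != 0, v z = 0 & forall w, w \in s -> M%:Z <= w z].
Proof.
move=> pv ps vs; have [u [u0 vu su]] := place_separate_seq pv ps vs.
have uM : u ^+ M.+1 != 0 by rewrite expf_neq0.
have n1 : (1 : F) != 0 by rewrite oner_neq0.
have lt1 : v 1 < v (u ^+ M.+1) by rewrite (av1 pv) (avX pv) // pmulrn_lgt0.
have [n2 v2] := avD_lt pv n1 uM lt1.
exists (1 + u ^+ M.+1)^-1; split; rewrite ?invr_neq0 ?(avV pv) // ?v2 ?(av1 pv) ?oppr0 //.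
move=> w ws; have pw := ps w ws; have wu := su w ws.
have lt2 : w (u ^+ M.+1) < w 1 by rewrite (av1 pw) (avX pw) // pmulrn_llt0.
have [_ w2] := avD_lt pw uM n1 lt2.
by rewrite (avV pw) // addrC w2 (avX pw) // -mulr_natl natz; move: (w u) wu => a; nia.
Qed.

(** ** Zeros, poles, and the product formula *)

Definition indepKI x (I : finType) (u : I -> F) : Prop :=
  forall c : I -> {poly K}, \sum_i kx x (c i) * u i = 0 -> forall i, c i = 0.

Lemma indepKI_ord x (I : finType) (u : I -> F) : indepKI x u ->
  indepK x (fun i : 'I_#|I| => u (enum_val i)).
Proof.
move=> H c E i; rewrite -(enum_valK i); apply: (H (fun j => c (enum_rank j))).
rewrite (reindex (@enum_val I predT)) /=; last first.
  by exists enum_rank => j _; rewrite ?enum_valK ?enum_rankK.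
by rewrite -[RHS]E; apply: eq_bigr => j _; rewrite enum_valK.
Qed.

Lemma kx_vge0 v x p : aplace io v -> vge v 0 x -> vge v 0 (kx x p).
Proof.
move=> pv vx; rewrite kxE; apply: (vge_sum pv) => i _.
by apply: (vge0M pv); [apply: (vgeC pv)|apply: (vgeX pv)].
Qed.

Lemma kx_unit v x (p : {poly K}) : aplace io v -> vge v 1 x -> p`_0 != 0 ->
  kx x p != 0 /\ v (kx x p) = 0.
Proof.
move=> pv vx p0; apply: (red_unit pv p0).
have -> : kx x p - io p`_0 = kx x (drop_poly 1 p) * x.
  have pE : p = (p`_0)%:P + drop_poly 1 p * 'X.
    by apply/polyP => -[|u]; rewrite coefD coefMX coefC ?addr0 //= add0r coef_drop_poly addn1.
  by rewrite {1}pE rmorphD rmorphM kxC kxX addrAC subrr add0r.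
have := vgeM pv (_ : vge v 0 (kx x (drop_poly 1 p))) vx; rewrite add0r; apply.
by apply: kx_vge0 => //; apply: vge_trans vx.
Qed.

(** Zeros v_1, ..., v_r of x, with multiplicities e_i, yield sum_i e_i elements
    linearly independent over K(x): the powers t_i^a, a < e_i, of uniformizers,
    made highly divisible at the other zeros. Their values at v_i are distinct
    modulo the values of K(x), which are multiples of e_i. *)
Lemma zeros_indep x (s : seq (F -> int)) : nonconst x -> uniq s ->
  (forall v, v \in s -> aplace io v) -> (forall v, v \in s -> 0 < v x) ->
  exists (I : finType) (u : I -> F),
    indepKI x u /\ #|I| = (\sum_(v <- s) absz (v x))%N.
Proof.
move=> nx us ps xs; have x0 := nonconst_neq0 nx.
have tz v : v \in s -> exists tz : F * F, [/\ tz.1 != 0, tz.2 != 0, v tz.1 = 1, v tz.2 = 0 &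
    forall w a, w \in s -> w != v -> (a <= absz (v x))%N -> w x <= w (tz.1 ^+ a * tz.2)].
  move=> vs; have pv := ps v vs; have [t t0 vt] := avN pv.
  have [M HM] := max_int_seq s (fun w => w x + (absz (v x) * absz (w t))%:Z).
  have [w ws|| z [z0 vz Hz]] := @place_approx v [seq w <- s | w != v] M pv.
  - by apply: ps; move: ws; rewrite mem_filter => /andP[].
  - by rewrite mem_filter /= eqxx.
  exists (t, z); split=> // w a ws wv av; have pw := ps w ws.
  have := Hz w; rewrite mem_filter /= wv ws => /(_ isT).
  have := HM w ws; rewrite (avM pw) ?expf_neq0 // (avX pw) // -mulr_natl natz.
  move: (absz (v x)) av (w t) (w z) (w x) => e ae wt wz wx; nia.
have /choice[TZ HTZ] : forall v, exists tz : F * F, v \in s ->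
    [/\ tz.1 != 0, tz.2 != 0, v tz.1 = 1, v tz.2 = 0 &
    forall w a, w \in s -> w != v -> (a <= absz (v x))%N -> w x <= w (tz.1 ^+ a * tz.2)].
  move=> v; have [vs|nvs] := boolP (v \in s); last by exists (0, 0).
  by have [z Hz] := tz v vs; exists z.
pose V (i : 'I_(size s)) := nth (fun=> 0) s i.
have Vs i : V i \in s by apply: mem_nth.
pose I : finType := {i : 'I_(size s) & 'I_(absz (V i x))}.
pose u (j : I) := (TZ (V (tag j))).1 ^+ (tagged j) * (TZ (V (tag j))).2.
exists I, u; split; last first.
  rewrite card_tagged sumnE big_map big_enum /= (big_nth (fun=> 0)) big_mkord.
  by apply: eq_bigr => i _; rewrite card_ord.
have u0 j : u j != 0.
  by rewrite /u; case: (HTZ _ (Vs (tag j))) => *; rewrite mulf_neq0 ?expf_neq0.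
move=> c; have [N sN] : exists N, forall i, (size (c i) <= N)%N.
  exists (\max_i size (c i)) => i; exact: leq_bigmax.
elim: N c sN => [|N IH] c sN E i.
  by apply/eqP; rewrite -size_poly_leq0.
suff H0 : forall i, (c i)`_0 = 0.
  have cX j : c j = drop_poly 1 (c j) * 'X.
    by apply/polyP => -[|l]; rewrite coefMX ?H0 //= coef_drop_poly addn1.
  rewrite cX (IH (fun j => drop_poly 1 (c j))) ?mul0r //.
    by move=> j; rewrite size_drop_poly leq_subLR add1n.
  apply: (mulIf x0); rewrite mul0r mulr_suml -[RHS]E.
  by apply: eq_bigr => j _; rewrite [in RHS]cX rmorphM kxX mulrAC.
have [//|/existsNP[[i0 a0] /eqP nj0]] := pselect (forall i, (c i)`_0 = 0).
pose v := V i0; have vs : v \in s by apply: Vs.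
have pv := ps v vs; have vx := xs v vs.
pose mk i (b : 'I_(absz (V i x))) : I := existT _ i b.
pose Q a := [exists b : 'I_(absz (V i0 x)), (b == a :> nat) && ((c (mk i0 b))`_0 != 0)].
have exQ : exists a, Q a by exists a0; apply/existsP; exists a0; rewrite eqxx.
case: (ex_minnP exQ) => a /existsP[b /andP[/eqP ba nb]] min.
have vx1 : vge v 1 x by rewrite vgeP // -gtz0_ge1.
have vx0 : vge v 0 x by apply: vge_trans vx1.
pose j : I := mk i0 b.
have [t0 z0 vt vz _] := HTZ v vs.
have [k0 vk] := kx_unit pv vx1 nb.
have vu : v (kx x (c j) * u j) = a.
  rewrite (avM pv) // vk add0r /u /= (avM pv) ?expf_neq0 // (avX pv) // vz vt addr0.
  by rewrite ba natz.
have : vge v (a + 1)%:Z (kx x (c j) * u j).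
  have -> : kx x (c j) * u j = - \sum_(k | k != j) kx x (c k) * u k.
    apply/eqP; rewrite -addr_eq0; apply/eqP.
    by rewrite -[RHS]E [RHS](bigD1 j).
  rewrite (vgeN pv); apply: (vge_sum pv) => k kj.
  have aV : (a < absz (v x))%N by rewrite -ba ltn_ord.
  have avx : (a + 1)%:Z <= v x by move: (v x) aV vx => e; clear; lia.
  case: k kj => k d kj; rewrite -/(mk k d); rewrite -/(mk k d) in kj; have [kE|nk] := eqVneq k i0; last first.
    have := vgeM pv (kx_vge0 (c (mk k d)) pv vx0) (_ : vge v (v x) (u (mk k d))).
    rewrite add0r => H; apply: (vge_trans avx (H _)).
    rewrite vgeP //; case: (HTZ _ (Vs k)) => _ _ _ _; apply => //; last exact: ltnW.
    by rewrite /v /V nth_uniq // eq_sym.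
  subst k; have dj : d != b by apply: contra_neq kj => ->.
  have ud : v (u (mk i0 d)) = d :> int.
    by rewrite /u /= (avM pv) ?expf_neq0 // (avX pv) // vz vt addr0 natz.
  have [da|ad] := ltnP d a.
    have cd0 : (c (mk i0 d))`_0 = 0.
      apply/eqP/negPn/negP => nd; have /min : Q d by apply/existsP; exists d; rewrite eqxx.
      by rewrite leqNgt da.
    have -> : c (mk i0 d) = drop_poly 1 (c (mk i0 d)) * 'X.
      by apply/polyP => -[|l]; rewrite coefMX ?cd0 //= coef_drop_poly addn1.
    rewrite rmorphM kxX -mulrA.
    have := vgeM pv (kx_vge0 (drop_poly 1 (c (mk i0 d))) pv vx0)
      (_ : vge v (v x + d%:Z) (x * u (mk i0 d))).
    rewrite add0r => H; apply: (vge_trans _ (H _)).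
      by apply: (le_trans avx); rewrite lerDl.
    by rewrite /vge (avM pv x0 (u0 _)) ud lexx orbT.
  have := vgeM pv (kx_vge0 (c (mk i0 d)) pv vx0) (_ : vge v d%:Z (u (mk i0 d))).
  rewrite add0r => H; apply: (vge_trans _ (H _)); last by rewrite vgeP // ud.
  rewrite lez_nat addn1 ltn_neqAle ad andbT; apply: contra_neq dj => ad'.
  by apply: val_inj; rewrite /= -ad' ba.
by rewrite /vge vu mulf_eq0 (negbTE k0) (negbTE (u0 _)) /= lez_nat addn1 ltnn.
Qed.

(** The space of functions with poles bounded by A has dimension at most deg A + 1:
    functions without poles are constant by [exists_pole], and allowing one more
    pole adds at most one dimension because the residue field is K. *)
Lemma bounded_poles_dep (A : seq (F -> int)) : (forall v, v \in A -> aplace io v) ->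
  forall n (f : 'I_n -> F),
  (forall i v, aplace io v -> vge v (- (count_mem v A)%:Z) (f i)) ->
  (size A + 1 < n)%N ->
  exists c : 'I_n -> K, (exists i, c i != 0) /\ \sum_i io (c i) * f i = 0.
Proof.
elim: A => [|v A IH] pA n f fA sA.
  have fc i : exists c, f i = io c.
    apply: contrapT => /forallNP H; have nf : nonconst (f i) by move=> c; apply/eqP.
    have [v pv vf] := exists_pole nf.
    by have := fA i v pv; rewrite /= oppr0 vgeP ?nonconst_neq0 // leNgt vf.
  case: n => [|[|n]] // in f fA sA fc *.
  have [a fa] := fc ord0; have [b fb] := fc (lift ord0 ord0).
  have [a0|a0] := eqVneq a 0.
    exists (fun i => (i == ord0)%:R); split; first by exists ord0; rewrite eqxx oner_neq0.
    rewrite (bigD1 ord0) //= fa a0 rmorph0 mulr0 add0r big1 // => i /negbTE->.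
    by rewrite rmorph0 mul0r.
  exists (fun i => if i == ord0 then b else if i == lift ord0 ord0 then - a else 0).
  split; first by exists (lift ord0 ord0); rewrite /= ?eqxx oppr_eq0.
  rewrite big_ord_recl big_ord_recl /= big1 ?addr0; last by move=> i _; rewrite rmorph0 mul0r.
  by rewrite fa fb rmorphN; ring.
have pv : aplace io v by apply: pA; rewrite mem_head.
have pA' w : w \in A -> aplace io w by move=> wA; apply: pA; rewrite inE wA orbT.
have fA' i w : aplace io w -> w != v -> vge w (- (count_mem w A)%:Z) (f i).
  by move=> pw wv; have := fA i w pw; rewrite /= eq_sym (negbTE wv).
pose m : int := - (count_mem v A)%:Z.
have cA : count_mem v (v :: A) = (count_mem v A).+1 by rewrite /= eqxx.
have [H|/existsNP[i0 /negP ni0]] := pselect (forall i, vge v m (f i)).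
  apply: IH => //; last by apply: leq_trans sA; rewrite /= addSn ltnW.
  move=> i w pw; have [->|wv] := eqVneq w v; [exact: H|exact: fA'].
have f0 : f i0 != 0 by apply: contraNneq ni0 => ->; rewrite vge0.
have vf : v (f i0) = m - 1.
  move: ni0 (fA i0 v pv); rewrite !vgeP // cA /m.
  by move: (v (f i0)) (count_mem v A) => e q; lia.
have red i : exists c, vge v m (f i - io c * f i0).
  have : vge v 0 (f i / f i0).
    have := vgeM pv (fA i v pv) (_ : vge v (- v (f i0)) (f i0)^-1).
    rewrite vgeP ?invr_neq0 // (avV pv) // lexx vf cA => /(_ isT).
    by apply: vge_trans; rewrite /m; move: (count_mem v A) => q; lia.
  move=> /(place_residue pv)[c Hc]; exists c.
  have -> : f i - io c * f i0 = (f i / f i0 - io c) * f i0 by rewrite mulrBl divfK.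
  have := vgeM pv Hc (_ : vge v (v (f i0)) (f i0)); rewrite vgeP // lexx => /(_ isT).
  by rewrite vf; apply: vge_trans; lia.
have /choice[c Hc] := red.
case: n => // n in f fA sA fA' i0 f0 ni0 vf red c Hc *.
have [||d [[j dj] dE]] := IH pA' n (fun j => f (lift i0 j) - io (c (lift i0 j)) * f i0).
- move=> i w pw; have [->|wv] := eqVneq w v; first exact: Hc.
  apply: (vgeB pw); first exact: fA'.
  by have := vgeM pw (vgeC pw (c (lift i0 i))) (fA' i0 w pw wv); rewrite add0r.
- by move: sA; rewrite /= addSn ltnS.
exists (fun i => if unlift i0 i is Some j then d j else - \sum_j d j * c (lift i0 j)).
split; first by exists (lift i0 j); rewrite liftK.
rewrite (bigD1_ord i0) //= unlift_none -[RHS]dE.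
under [X in _ + X]eq_bigr do rewrite liftK.
rewrite rmorphN rmorph_sum /= mulNr mulr_suml -sumrN -big_split /=.
by apply: eq_bigr => i _; rewrite rmorphM; ring.
Qed.

Lemma zeros_bound x : nonconst x -> exists D, forall s : seq (F -> int), uniq s ->
  (forall v, v \in s -> aplace io v /\ 0 < v x) -> (size s <= D)%N.
Proof.
move=> nx; have [D HD] := indepK_bound nx; exists D => s us Hs.
have [||I [u [iu cI]]] := zeros_indep nx us.
- by move=> v /Hs[].
- by move=> v /Hs[].
apply: leq_trans (HD _ _ (indepKI_ord iu)); rewrite cI -sum1_size !big_seq.
by apply: leq_sum => v /Hs[_]; rewrite absz_gt0; lia.
Qed.

Lemma finite_zeros x : nonconst x -> finite_set [set v | aplace io v /\ 0 < v x].
Proof.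
move=> nx; have [D HD] := zeros_bound nx; apply: contrapT => inf.
have [B BA] := @infinite_set_fset _ _ D.+1 inf; rewrite ltnNge => /negP; apply.
apply: HD; first exact: fset_uniq.
by move=> v vB; apply: BA.
Qed.

Lemma zero_list x : nonconst x -> exists Z : seq (F -> int), [/\
  forall v, v \in Z -> aplace io v,
  forall v, aplace io v -> (count_mem v Z)%:Z = Num.max 0 (v x) &
  exists (I : finType) (u : I -> F), indepKI x u /\ #|I| = size Z].
Proof.
move=> nx; have [Z0 Z0E] := finite_fsetP.1 (finite_zeros nx).
have Z0P v : v \in (Z0 : seq _) = `[< aplace io v /\ 0 < v x >].
  by apply/idP/asboolP => [vZ|vZ]; [have : [set` Z0] v by []; rewrite -Z0E|
    have : [set` Z0] v by rewrite -Z0E].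
pose Z := flatten [seq nseq (absz (v x)) v | v <- (Z0 : seq _)].
exists Z; split.
- move=> v /flattenP[l /mapP[w]]; rewrite Z0P => /asboolP[pw _] ->.
  by rewrite mem_nseq => /andP[_ /eqP->].
- move=> v pv; rewrite count_flatten -map_comp sumnE big_map.
  under eq_bigr do rewrite /= count_nseq.
  have [vZ|nvZ] := boolP (v \in (Z0 : seq _)).
    have /asboolP[_ vx] : `[< aplace io v /\ 0 < v x >] by rewrite -Z0P.
    rewrite (bigD1_seq v) ?fset_uniq //= eqxx mul1n big1 ?addn0.
      by rewrite max_r ?ltW // gtz0_abs.
    by move=> w /negbTE wv; rewrite wv.
  rewrite big_seq big1 => [|w wZ].
    rewrite max_l //; rewrite Z0P in nvZ; move/asboolPn: nvZ => nvZ.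
    by rewrite leNgt; apply/negP => vx; apply: nvZ.
  by rewrite /= (_ : (w == v) = false) //; apply: contraNF nvZ => /eqP<-.
- have [||I [u [iu cI]]] := zeros_indep nx (fset_uniq Z0).
  + by move=> v; rewrite Z0P => /asboolP[].
  + by move=> v; rewrite Z0P => /asboolP[].
  exists I, u; split=> //; rewrite cI size_flatten /shape -map_comp sumnE big_map.
  by apply: eq_bigr => v _; rewrite /= size_nseq.
Qed.

(** The pole divisor of x has degree at least the degree of F over K(x): if u_1,
    ..., u_n are independent over K(x), with poles bounded by C, then x^j u_i, j <=
    l, are n (l + 1) independent functions with poles bounded by l times the poles
    of x, plus C. Compare with [bounded_poles_dep] for l large. *)
Lemma poles_ge x (I : finType) (u : I -> F) (B : seq (F -> int)) :
  nonconst x -> indepKI x u -> (forall v, v \in B -> aplace io v) ->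
  (forall v, aplace io v -> (count_mem v B)%:Z = Num.max 0 (- v x)) ->
  (#|I| <= size B)%N.
Proof.
move=> nx iu pB cB; have x0 := nonconst_neq0 nx.
have [C pC HC] : exists2 C : seq (F -> int), (forall v, v \in C -> aplace io v) &
    forall i v, aplace io v -> vge v (- (count_mem v C)%:Z) (u i).
  have each i : exists2 C : seq (F -> int), (forall v, v \in C -> aplace io v) &
      forall v, aplace io v -> vge v (- (count_mem v C)%:Z) (u i).
    have [[c uc]|nu] := pselect (exists c, u i = io c).
      by exists [::] => // v pv; rewrite uc oppr0; apply: (vgeC pv).
    have nui : nonconst (u i) by move=> c; apply/eqP => uc; apply: nu; exists c.
    have [Z [pZ cZ _]] := zero_list (nonconstV nui); exists Z => // v pv.
    rewrite cZ // vgeP ?nonconst_neq0 // (avV pv) ?nonconst_neq0 //; lia.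
  have /choice[C HC] : forall i, exists C : seq (F -> int),
      (forall v, v \in C -> aplace io v) /\
      forall v, aplace io v -> vge v (- (count_mem v C)%:Z) (u i).
    by move=> i; have [C ? ?] := each i; exists C.
  exists (flatten [seq C i | i <- enum I]).
    by move=> v /flattenP[l /mapP[i _ ->]]; have [+ _] := HC i; apply.
  move=> i v pv; have [_ /(_ v pv)] := HC i; apply: vge_trans.
  rewrite lerN2 lez_nat count_flatten -map_comp sumnE big_map big_enum /=.
  by rewrite (bigD1 i) //= leq_addr.
rewrite leqNgt; apply/negP => sB.
pose l := (size C).+1.
pose f (ij : I * 'I_l.+1) := x ^+ ij.2 * u ij.1.
have [|||c [[j cj] cE]] := @bounded_poles_dep (flatten (nseq l B) ++ C) _
    #|{: I * 'I_l.+1}| (fun k => f (enum_val k)).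
- by move=> v; rewrite mem_cat => /orP[/flattenP[L /nseqP[-> _]]|]; [apply: pB|apply: pC].
- move=> k v pv; case: (enum_val k) => i a; rewrite /f /=.
  have cnt : count_mem v (flatten (nseq l B)) = (l * count_mem v B)%N.
    rewrite count_flatten map_nseq sumnE big_nseq iter_addn_0 mulnC //.
  rewrite count_cat cnt PoszD opprD; apply: (vgeM pv); last exact: HC.
  rewrite vgeP ?expf_neq0 // (avX pv) // PoszM cB // -mulr_natl natz.
  have := ltn_ord a; rewrite ltnS; move: (v x) (nat_of_ord a) => e b; nia.
- rewrite card_prod card_ord size_cat size_flatten /shape map_nseq sumnE big_nseq iter_addn_0.
  move: sB; rewrite /l; nia.
have := iu (fun i => \poly_(a < l.+1) (c (enum_rank (i, inord a)))).
have -> : \sum_i kx x (\poly_(a < l.+1) c (enum_rank (i, inord a))) * u i = 0.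
  rewrite -[RHS]cE (reindex (@enum_rank {: I * 'I_l.+1})) /=; last first.
    by exists enum_val => ? _; rewrite ?enum_valK ?enum_rankK.
  transitivity (\sum_i \sum_(a < l.+1) io (c (enum_rank (i, a))) * f (i, a)); last first.
    by rewrite pair_bigA; apply: eq_bigr => -[i a] _; rewrite enum_rankK.
  apply: eq_bigr => i _; rewrite (kx_wide _ (size_poly _ _)) mulr_suml.
  apply: eq_bigr => a _; rewrite coef_poly ltn_ord inord_val /f /=.
  by rewrite mulrA.
move=> /(_ erefl (enum_val j).1) /polyP/(_ (enum_val j).2).
rewrite coef_poly ltn_ord coef0 inord_val -surjective_pairing enum_valK.
by apply/eqP.
Qed.

Lemma place_finite f : f != 0 -> finite_set [set v | aplace io v /\ v f != 0].
Proof.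
move=> f0; have [[c fc]|nf] := pselect (exists c, f = io c).
  apply: (@sub_finite_set _ _ set0) => // v [pv]; rewrite fc (avC pv) ?eqxx //.
  by apply: contra_neq f0 => c0; rewrite fc c0 rmorph0.
have nx : nonconst f by move=> c; apply/eqP => fc; apply: nf; exists c.
apply: (@sub_finite_set _ _ ([set v | aplace io v /\ 0 < v f] `|`
   [set v | aplace io v /\ 0 < v f^-1])).
  move=> v [pv vf]; rewrite /= (avV pv) //.
  by have [h|h|h] := ltgtP (v f) 0; [right; split; rewrite ?oppr_gt0|left|rewrite h in vf].
by rewrite finite_setU; split; apply: finite_zeros => //; apply: nonconstV.
Qed.

(** Zeros and poles, counted with multiplicities, are equinumerous: by
    [zeros_indep] and [poles_ge] there are at least as many poles as zeros, and
    conversely for 1/f. *)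
Lemma sum_places f : f != 0 -> \sum_(v \in aplace io) v f = 0.
Proof.
move=> f0; have [[c fc]|nf] := pselect (exists c, f = io c).
  apply: fsbig1 => v pv; rewrite fc (avC pv) //.
  by apply: contra_neq f0 => c0; rewrite fc c0 rmorph0.
have nx : nonconst f by move=> c; apply/eqP => fc; apply: nf; exists c.
have nV := nonconstV nx.
have [Z [pZ cZ [I [u [iu cI]]]]] := zero_list nx.
have [P [pP cP [J [w [iw cJ]]]]] := zero_list nV.
have cP' v : aplace io v -> (count_mem v P)%:Z = Num.max 0 (- v f).
  by move=> pv; rewrite cP // (avV pv).
have cZ' v : aplace io v -> (count_mem v Z)%:Z = Num.max 0 (- v f^-1).
  by move=> pv; rewrite cZ // (avV pv) // opprK.
have ZP := poles_ge nx iu pP cP'; have PZ := poles_ge nV iw pZ cZ'.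
have E : size Z = size P by apply/eqP; rewrite eqn_leq -{1}cI ZP -cJ PZ.
have szE (s A : seq (F -> int)) : uniq s -> {subset A <= s} ->
    size A = (\sum_(v <- s) count_mem v A)%N.
  move=> us sub; rewrite -sum1_size.
  under [RHS]eq_bigr do rewrite -sum1_count big_mkcond.
  rewrite exchange_big /= !big_seq; apply: eq_bigr => v vA.
  rewrite (bigD1_seq v) ?sub //= eqxx big1 // => w' /negbTE.
  by rewrite eq_sym => ->.
pose X := undup (Z ++ P).
have pX v : v \in X -> aplace io v.
  by rewrite mem_undup mem_cat => /orP[/pZ|/pP].
have vfE v : aplace io v -> v f = (count_mem v Z)%:Z - (count_mem v P)%:Z.
  by move=> pv; rewrite cZ // cP' //; move: (v f) => e; lia.
rewrite (fsbigE X) ?undup_uniq //; first last.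
- move=> v pv vX; rewrite vfE //; move: vX; rewrite mem_undup mem_cat negb_or.
  by move=> /andP[/count_memPn-> /count_memPn->]; rewrite subrr.
rewrite big_seq_cond (eq_bigl (fun v => v \in X)); last first.
  by move=> v; apply: andb_idr => /pX pv; apply: mem_set.
rewrite -big_seq (eq_big_seq _ (fun v vX => vfE v (pX v vX))) sumrB.
have cast (A : seq (F -> int)) : {subset A <= X} ->
    \sum_(v <- X) (count_mem v A)%:Z = (size A)%:Z.
  move=> sub; rewrite (szE X A) ?undup_uniq // -!natz natr_sum.
  by apply: eq_bigr => v _; rewrite natz.
rewrite !cast ?E ?subrr // => v vA; rewrite mem_undup mem_cat vA ?orbT //.
Qed.

End FunctionField.

(** * Multihomogeneous polynomials *)

Section Pev.
Variable K : fieldType.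

(** Evaluation of a multihomogeneous form at a matrix over any K-algebra; generic
    points are matrices over a function field. *)
Definition pev (R : comNzRingType) (io : {rmorphism K -> R}) s N
    (w : 'M[R]_(s, N)) (p : mpolyM K s N) : R :=
  mmap io (fun l => mxvec w 0 l) p.

(** A form in the entries of an s x N matrix, as an element of the iterated
    polynomial ring. *)
Definition tw s N (p : mpolyM K s N) : tower K (s * N) :=
  mmap (towC K (s * N)) (fun l : 'I_(s * N) => towX K (s * N) l) p.

Definition wpt (R : nmodType) s N (w : 'M[R]_(s, N)) (i : nat) : R :=
  oapp (fun l => mxvec w 0 l) 0 (insub i : option 'I_(s * N)).

Lemma wptE (R : nmodType) s N (w : 'M[R]_(s, N)) (l : 'I_(s * N)) :
  wpt w l = mxvec w 0 l.
Proof. by rewrite /wpt valK. Qed.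

Lemma pev_ev (R : comNzRingType) (io : {rmorphism K -> R}) s N
    (w : 'M[R]_(s, N)) (p : mpolyM K s N) :
  pev io w p = ev io (wpt w) (s * N) (tw p).
Proof.
rewrite /pev /tw /mmap rmorph_sum; apply: eq_bigr => m _.
rewrite rmorphM evC; congr (_ * _); rewrite /mmap1 rmorph_prod.
by apply: eq_bigr => l _; rewrite rmorphXn evX // wptE.
Qed.

Lemma mevalM_pev s N (p : mpolyM K s N) z : mevalM p z = pev (idrm K) z p.
Proof. by []. Qed.

Section Morph.
Variables (R : comNzRingType) (io : {rmorphism K -> R}) (s N : nat).
Variable w : 'M[R]_(s, N).

Lemma pevD p q : pev io w (p + q) = pev io w p + pev io w q.
Proof. exact: rmorphD. Qed.
Lemma pevB p q : pev io w (p - q) = pev io w p - pev io w q.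
Proof. exact: rmorphB. Qed.
Lemma pevM p q : pev io w (p * q) = pev io w p * pev io w q.
Proof. exact: rmorphM. Qed.
Lemma pev0 : pev io w 0 = 0.
Proof. exact: rmorph0. Qed.
Lemma pev1 : pev io w 1 = 1.
Proof. exact: rmorph1. Qed.
Lemma pevXn p n : pev io w (p ^+ n) = pev io w p ^+ n.
Proof. exact: rmorphXn. Qed.
Lemma pev_prod (I : Type) (r : seq I) (P : pred I) (f : I -> mpolyM K s N) :
  pev io w (\prod_(i <- r | P i) f i) = \prod_(i <- r | P i) pev io w (f i).
Proof. exact: rmorph_prod. Qed.
Lemma pev_sum (I : Type) (r : seq I) (P : pred I) (f : I -> mpolyM K s N) :
  pev io w (\sum_(i <- r | P i) f i) = \sum_(i <- r | P i) pev io w (f i).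
Proof. exact: rmorph_sum. Qed.
Lemma pevZ c p : pev io w (c *: p) = io c * pev io w p.
Proof. exact: mmapZ. Qed.

Definition pX i j : mpolyM K s N := mpolyX K (mnm1 (mxvec_index i j)).

Lemma pev_pX i j : pev io w (pX i j) = w i j.
Proof. by rewrite /pev mmapX mmap1U mxvecE. Qed.
End Morph.

Lemma pev_comp (R S : comNzRingType) (io : {rmorphism K -> R})
    (f : {rmorphism R -> S}) s N (w : 'M[R]_(s, N)) p :
  f (pev io w p) = pev (GRing.RMorphism.clone _ _ (f \o io) _) (map_mx f w) p.
Proof.
rewrite /pev /mmap rmorph_sum; apply: eq_bigr => m _; rewrite rmorphM; congr (_ * _).
by rewrite /mmap1 rmorph_prod; apply: eq_bigr => l _; rewrite rmorphXn -map_mxvec mxE.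
Qed.

Lemma eq_pev_io (R : comNzRingType) (io io' : {rmorphism K -> R}) s N
    (w : 'M[R]_(s, N)) p : io =1 io' -> pev io w p = pev io' w p.
Proof. by move=> E; apply: eq_bigr => m _; rewrite E. Qed.

Lemma pev_mono s N (m : multinom (s * N)) (R : comNzRingType) (w : 'M[R]_(s, N)) :
  mmap1 (fun l => mxvec w 0 l) m = \prod_i \prod_j w i j ^+ m (mxvec_index i j).
Proof.
rewrite /mmap1 pair_bigA (reindex (uncurry (@mxvec_index s N))) /=; last first.
  exact: curry_mxvec_bij.
by apply: eq_bigr => -[i j] _ /=; rewrite mxvecE.
Qed.

Definition rscale (R : pzRingType) s N (c : 'I_s -> R) (w : 'M[R]_(s, N)) :
  'M[R]_(s, N) := \matrix_(i, j) (c i * w i j).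

Lemma pev_rscale (R : comNzRingType) (io : {rmorphism K -> R}) s N
    (c : 'I_s -> R) (w : 'M[R]_(s, N)) d p : mhomog d p ->
  pev io (rscale c w) p = (\prod_i c i ^+ d i) * pev io w p.
Proof.
move=> hp; rewrite /pev /mmap mulr_sumr [LHS]big_seq [RHS]big_seq; apply: eq_bigr => m mp.
rewrite mulrCA; congr (_ * _); rewrite !pev_mono -big_split; apply: eq_bigr => i _.
rewrite /= -(hp m mp i) expr_sum -big_split; apply: eq_bigr => j _.
by rewrite mxE exprMn.
Qed.

End Pev.

Section Homog.
Variable K : closedFieldType.
Notation idK := (idrm K).

Lemma mpoly_point s N (p : mpolyM K s N) : p != 0 -> exists z, mevalM p z != 0.
Proof.
move=> p0; have tp0 : tw p != 0.
  apply: contra_neq p0 => E.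
  have : ev (GRing.RMorphism.clone _ _ (@mpolyC (s * N) K) _)
     (wpt (vec_mx (\row_l mpolyX K (mnm1 l)) : 'M[mpolyM K s N]_(s, N))) (s * N) (tw p) = p.
    rewrite -pev_ev /pev vec_mxK /mmap [RHS]mpolyE; apply: eq_bigr => m _ /=.
    rewrite mul_mpolyC; congr (_ *: _); rewrite mpolyXE_id.
    by apply: eq_bigr => l _; rewrite mxE.
  by rewrite E rmorph0.
have [c cp] := tower_nonzero tp0; exists (vec_mx (\row_l c l)).
rewrite mevalM_pev pev_ev (@eq_ev _ _ _ _ c) // => i iN.
by rewrite (wptE _ (Ordinal iN)) vec_mxK mxE.
Qed.

Lemma mpoly_ext s N (p q : mpolyM K s N) :
  (forall z, mevalM p z = mevalM q z) -> p = q.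
Proof.
move=> H; apply/eqP; rewrite -subr_eq0; apply/negPn/negP => /mpoly_point[z].
by rewrite mevalM_pev pevB -!mevalM_pev H subrr eqxx.
Qed.

(** Homogeneity can be tested on values, K being infinite: compare the coefficients
    of p when the rows are rescaled. *)
Lemma mhomog_criterion s N (d : 'I_s -> nat) (p : mpolyM K s N) :
  (forall c z, mevalM p (rscale c z) = (\prod_i c i ^+ d i) * mevalM p z) ->
  mhomog d p.
Proof.
move=> H m mp i; apply/eqP/negPn/negP => nd.
set e := (\sum_(j < N) _)%N in nd.
have [t Ht] : exists t : K, t ^+ e - t ^+ d i != 0.
  have : 'X^e - 'X^(d i) != 0 :> {poly K}.
    rewrite subr_eq0; apply: contra_neq nd => /(congr1 (fun p : {poly K} => size p)).
    by rewrite !size_polyXn => -[].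
  by move=> /closed_nonroot[t]; rewrite hornerD hornerN !hornerXn; exists t.
pose c k := if k == i then t else 1.
have scale_m (m' : multinom (s * N)) z : mmap1 (fun l => mxvec (rscale c z) 0 l) m' =
    t ^+ (\sum_(j < N) m' (mxvec_index i j))%N * mmap1 (fun l => mxvec z 0 l) m'.
  rewrite !pev_mono (bigD1 i) //= [in RHS](bigD1 i) //= mulrA; congr (_ * _).
    rewrite expr_sum -big_split; apply: eq_bigr => j _.
    by rewrite mxE /c eqxx exprMn.
  apply: eq_bigr => k ki; apply: eq_bigr => j _.
  by rewrite mxE /c (negbTE ki) mul1r.
pose q : mpolyM K s N := \sum_(m' <- msupp p)
  (mcoeff m' p * t ^+ (\sum_(j < N) m' (mxvec_index i j))%N) *: mpolyX K m'.
have qE : q = t ^+ d i *: p.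
  apply: mpoly_ext => z; have := H c z; rewrite (bigD1 i) //= /c eqxx.
  rewrite big1 ?mulr1; last by move=> k /negbTE ki; rewrite ki expr1n.
  rewrite !mevalM_pev pevZ => <-; rewrite {1}/q pev_sum [RHS]/mmap.
  apply: eq_bigr => m' _; rewrite pevZ /pev mmapX -mulrA; congr (_ * _).
  by rewrite -[RHS]/(mmap1 _ _) scale_m.
have := congr1 (mcoeff m) qE; rewrite mcoeffZ /q raddf_sum /=.
rewrite (bigD1_seq m) ?msupp_uniq //= mcoeffZ mcoeffX eqxx mulr1.
rewrite [X in _ + X = _]big1 ?addr0; last first.
  by move=> m' /negbTE nm; rewrite mcoeffZ mcoeffX nm mulr0.
rewrite mulrC -/e => /eqP; rewrite -subr_eq0 -mulrBl mulf_eq0 (negbTE Ht) /=.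
by rewrite mcoeff_eq0 mp.
Qed.

Lemma mhomogE s N (d : 'I_s -> nat) (p : mpolyM K s N) c z : mhomog d p ->
  mevalM p (rscale c z) = (\prod_i c i ^+ d i) * mevalM p z.
Proof. exact: pev_rscale. Qed.

Lemma mhomogM s N (d e : 'I_s -> nat) (p q : mpolyM K s N) :
  mhomog d p -> mhomog e q -> mhomog (fun i => d i + e i)%N (p * q).
Proof.
move=> hp hq; apply: mhomog_criterion => c z.
rewrite !mevalM_pev !pevM -!mevalM_pev !(mhomogE _ _ hp) !(mhomogE _ _ hq) mulrACA.
by congr (_ * _); rewrite -big_split; apply: eq_bigr => i _; rewrite exprD.
Qed.

Lemma mhomogD s N (d : 'I_s -> nat) (p q : mpolyM K s N) :
  mhomog d p -> mhomog d q -> mhomog d (p + q).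
Proof.
move=> hp hq; apply: mhomog_criterion => c z.
by rewrite !mevalM_pev !pevD -!mevalM_pev !(mhomogE _ _ hp) !(mhomogE _ _ hq) mulrDr.
Qed.

Lemma mhomogZ s N (d : 'I_s -> nat) a (p : mpolyM K s N) :
  mhomog d p -> mhomog d (a *: p).
Proof.
move=> hp; apply: mhomog_criterion => c z.
by rewrite !mevalM_pev !pevZ -!mevalM_pev !(mhomogE _ _ hp) mulrCA.
Qed.

Lemma mhomogC s N (a : K) : mhomog (fun=> 0%N) (a *: 1 : mpolyM K s N).
Proof.
apply: mhomog_criterion => c z; rewrite !mevalM_pev !pevZ !pev1.
by rewrite big1 ?mul1r.
Qed.

Lemma mhomog1 s N : mhomog (fun=> 0%N) (1 : mpolyM K s N).
Proof. by rewrite -[1]scale1r; apply: mhomogC. Qed.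

Lemma mhomogX s N i j : mhomog (fun k => (k == i : nat)) (pX K i j : mpolyM K s N).
Proof.
apply: mhomog_criterion => c z; rewrite !mevalM_pev !pev_pX mxE; congr (_ * _).
rewrite (bigD1 i) //= eqxx expr1 big1 ?mulr1 // => k /negbTE->.
by rewrite expr0.
Qed.

Lemma mhomog_prodX s N (d : 'I_s -> nat) (j : 'I_s -> 'I_N) :
  mhomog d (\prod_i pX K i (j i) ^+ d i : mpolyM K s N).
Proof.
apply: mhomog_criterion => c z; rewrite !mevalM_pev !pev_prod -big_split.
by apply: eq_bigr => i _; rewrite !pevXn !pev_pX mxE exprMn.
Qed.

End Homog.

(** * Zariski closed sets *)

Section Zariski.
Variables (K : closedFieldType) (s N : nat).
Implicit Types (Z : set 'M[K]_(s, N)) (p q : mpolyM K s N).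

Lemma rowP_neq0 (R : nmodType) n (w : 'rV[R]_n) : w != 0 -> exists j, w 0 j != 0.
Proof.
move=> w0; apply: contrapT => H; move/eqP: w0; apply; apply/rowP => j.
by rewrite mxE; apply/eqP/negPn/negP => Hj; apply: H; exists j.
Qed.

Lemma ppoint_entry (z : 'M[K]_(s, N)) i : ppoint z -> exists j, z i j != 0.
Proof. by move=> /(_ i)/rowP_neq0[j]; rewrite mxE => ?; exists j. Qed.

Lemma ppointP (z : 'M[K]_(s, N)) : (forall i, exists j, z i j != 0) -> ppoint z.
Proof.
move=> H i; have [j] := H i; apply: contra_neq => /rowP/(_ j).
by rewrite !mxE.
Qed.

Lemma ppoint_rscale (c : 'I_s -> K) (z : 'M[K]_(s, N)) : (forall i, c i != 0) ->
  ppoint z -> ppoint (rscale c z).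
Proof.
move=> c0 pz; apply: ppointP => i; have [j zj] := ppoint_entry i pz.
by exists j; rewrite mxE mulf_neq0.
Qed.

Lemma rscale_eqmx (c : 'I_s -> K) (z : 'M[K]_(s, N)) i : (forall i, c i != 0) ->
  (row i (rscale c z) == row i z)%MS.
Proof.
move=> c0; suff -> : row i (rscale c z) = c i *: row i z.
  by apply/eqmxP; apply: eqmx_scale.
by apply/rowP => j; rewrite !mxE.
Qed.

Lemma eqmx_rscale (w z : 'M[K]_(s, N)) : ppoint z ->
  (forall i, (row i w == row i z)%MS) ->
  exists2 c, forall i, c i != 0 & w = rscale c z.
Proof.
move=> pz H.
have {}H i : exists c, c != 0 /\ row i w = c *: row i z.
  have /andP[/sub_rVP[c E] zw] := H i; exists c; split => //.
  apply: contraTneq zw => c0; rewrite E c0 scale0r.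
  by apply/negP => /submx0null /eqP; apply/negP; apply: pz.
have [c Hc] := choice H; exists c => [i|]; first by case: (Hc i).
by apply/row_matrixP => i; have [_ ->] := Hc i; apply/rowP => j; rewrite !mxE.
Qed.

Lemma zclosed_ppoint Z z : zclosed Z -> Z z -> ppoint z.
Proof. by case=> S [_ ->] []. Qed.

Lemma mhomog_zero (c : 'I_s -> K) (z : 'M[K]_(s, N)) d p :
  (forall i, c i != 0) -> mhomog d p ->
  (mevalM p (rscale c z) == 0) = (mevalM p z == 0).
Proof.
move=> c0 hp; rewrite (mhomogE _ _ hp) mulf_eq0; case: eqP => //= /eqP.
by rewrite prodf_seq_eq0 => /hasP[i _]; rewrite expf_eq0 (negbTE (c0 i)) andbF.
Qed.

Lemma zclosed_rscale Z (c : 'I_s -> K) z : zclosed Z -> (forall i, c i != 0) ->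
  Z z -> Z (rscale c z).
Proof.
case=> S [hS ->] c0 [pz H]; split; first exact: ppoint_rscale.
move=> p Sp; have [d hp] := hS p Sp.
by apply/eqP; rewrite (mhomog_zero _ c0 hp) H.
Qed.

Lemma zclosed_eqmx Z w z : zclosed Z -> (forall i, (row i w == row i z)%MS) ->
  Z z -> Z w.
Proof.
move=> cZ H Zz; have [c c0 ->] := eqmx_rscale (zclosed_ppoint cZ Zz) H.
exact: zclosed_rscale.
Qed.

Lemma zclosed_zero d p : mhomog d p ->
  zclosed [set z | ppoint z /\ mevalM p z = 0].
Proof.
move=> hp; exists [set p]; split; first by move=> _ ->; exists d.
by apply/seteqP; split => z /= [pz H]; split=> //; [move=> _ ->|apply: H].
Qed.

Lemma zclosedT : zclosed (@ppoint K s N).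
Proof.
exists set0; split=> //; by apply/seteqP; split => [z pz|z []].
Qed.

Lemma zclosed0 : zclosed (set0 : set 'M[K]_(s, N)).
Proof.
exists [set 1]; split; first by move=> _ ->; eexists; apply: mhomog1.
apply/seteqP; split => z //= -[_ /(_ _ erefl)].
by rewrite mevalM_pev pev1 => /eqP; rewrite oner_eq0.
Qed.

Lemma zclosed_bigI (F : set (set 'M[K]_(s, N))) : (forall Z, F Z -> zclosed Z) ->
  zclosed [set z | ppoint z /\ forall Z, F Z -> Z z].
Proof.
move=> cF; exists [set p | (exists d, mhomog d p) /\
  exists2 Z, F Z & forall z, Z z -> mevalM p z = 0]; split; first by move=> p [].
apply/seteqP; split => z /= [pz H]; split=> //.
  by move=> p [_ [Z FZ ->]] //; apply: H.
move=> Z FZ; have [S [hS SE]] := cF _ FZ; rewrite SE; split=> // p Sp.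
apply: H; split; first exact: hS.
by exists Z => // y; rewrite SE => -[_ ->].
Qed.

Lemma zclosedI Z1 Z2 : zclosed Z1 -> zclosed Z2 -> zclosed (Z1 `&` Z2).
Proof.
move=> c1 c2; have := @zclosed_bigI [set Z1; Z2].
have -> : [set z | ppoint z /\ forall Z, [set Z1; Z2] Z -> Z z] = Z1 `&` Z2.
  apply/seteqP; split => z /=.
    by move=> [_ H]; split; apply: H; [left|right].
  move=> [z1 z2]; split; first exact: zclosed_ppoint z1.
  by move=> Z [] ->.
by apply=> Z [] ->.
Qed.

Lemma zclosedU Z1 Z2 : zclosed Z1 -> zclosed Z2 -> zclosed (Z1 `|` Z2).
Proof.
case=> S1 [h1 ->] [S2 [h2 ->]].
exists [set p | exists p1 p2, [/\ S1 p1, S2 p2 & p = p1 * p2]]; split.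
  move=> _ [p1 [p2 [S1p S2p ->]]]; have [d1 H1] := h1 _ S1p; have [d2 H2] := h2 _ S2p.
  by eexists; apply: mhomogM H1 H2.
apply/seteqP; split => z /=.
  move=> H; split; first by case: H => -[].
  move=> _ [p1 [p2 [S1p S2p ->]]]; rewrite mevalM_pev pevM -!mevalM_pev.
  by case: H => -[_ H]; [rewrite (H _ S1p) mul0r|rewrite (H _ S2p) mulr0].
move=> [pz H]; apply: contrapT => /not_orP[H1 H2].
have [p1 S1p n1] : exists2 p, S1 p & mevalM p z <> 0.
  apply: contrapT => /forall2NP F; apply: H1; split=> // p Sp.
  by have [//|/contrapT] := F p.
have [p2 S2p n2] : exists2 p, S2 p & mevalM p z <> 0.
  apply: contrapT => /forall2NP F; apply: H2; split=> // p Sp.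
  by have [//|/contrapT] := F p.
have /eqP := H (p1 * p2) (ex_intro _ p1 (ex_intro _ p2 (And3 S1p S2p erefl))).
by rewrite mevalM_pev pevM mulf_eq0 => /orP[] /eqP.
Qed.

Lemma zclosed_sep Z z : zclosed Z -> ppoint z -> ~ Z z ->
  exists d p, [/\ mhomog d p, forall y, Z y -> mevalM p y = 0 & mevalM p z != 0].
Proof.
case=> S [hS ->] pz /= nz.
have [p Sp np] : exists2 p, S p & mevalM p z <> 0.
  apply: contrapT => /forall2NP F; apply: nz; split=> // p Sp.
  by have [//|/contrapT] := F p.
have [d hp] := hS p Sp; exists d, p; split=> //; last exact/eqP.
by move=> y [_ ->].
Qed.

Lemma zclosureP (A : set 'M[K]_(s, N)) : A `<=` @ppoint K s N -> zclosed (zclosure A).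
Proof.
move=> pA; suff -> : zclosure A =
    [set z | ppoint z /\ forall Z, [set Z | zclosed Z /\ A `<=` Z] Z -> Z z].
  by apply: zclosed_bigI => Z [].
apply/seteqP; split => z /=; last by move=> [_ H] Z cZ AZ; apply: H.
by move=> H; split; [apply: H zclosedT pA|move=> Z [cZ AZ]; apply: H].
Qed.

Lemma sub_zclosure (A : set 'M[K]_(s, N)) : A `<=` zclosure A.
Proof. by move=> z Az Z _; apply. Qed.

Lemma zclosure_min (A : set 'M[K]_(s, N)) Z : zclosed Z -> A `<=` Z -> zclosure A `<=` Z.
Proof. by move=> cZ AZ z; apply. Qed.

Lemma is_point_closed Z : is_point Z -> zclosed Z.
Proof.
case=> z pz ->; pose D (i : 'I_s) (a b : 'I_N) : mpolyM K s N :=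
  z i a *: pX K i b - z i b *: pX K i a.
exists [set p | exists i a b, p = D i a b]; split.
  move=> _ [i [a [b ->]]]; exists (fun k => (k == i : nat)); rewrite /D -scaleNr.
  by apply: mhomogD; apply: mhomogZ; apply: mhomogX.
apply/seteqP; split => w /=.
  move=> /(eqmx_rscale pz)[c c0 ->]; split; first exact: ppoint_rscale.
  move=> _ [i [a [b ->]]]; rewrite mevalM_pev pevB !pevZ !pev_pX !mxE /=.
  by move: (z i a) (z i b) (c i) => x y t; ring.
move=> [pw H] i; have [a za] := ppoint_entry i pz; have [b wb] := ppoint_entry i pw.
have E b' : w i b' = w i a / z i a * z i b'.
  have := H _ (ex_intro _ i (ex_intro _ a (ex_intro _ b' erefl))).
  rewrite mevalM_pev pevB !pevZ !pev_pX /= => /eqP; rewrite subr_eq0 => /eqP E.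
  by apply: (mulfI za); rewrite E; move: (z i b') (w i a) => x y; field.
have -> : row i w = (w i a / z i a) *: row i z.
  by apply/rowP => b'; rewrite !mxE E.
by apply/eqmxP/eqmx_scale; apply: contraNneq wb => c0; rewrite E c0 mul0r.
Qed.

(** ** Noetherianity *)

Lemma nat_monotone_subseq (u : nat -> nat) : exists phi : nat -> nat,
  {homo phi : i j / (i < j)%N} /\ {homo u \o phi : i j / (i <= j)%N}.
Proof.
have argmin a : exists b, (a <= b)%N /\ forall c, (a <= c)%N -> (u b <= u c)%N.

  have ex2 : exists n, `[< exists2 b, (a <= b)%N & u b = n >].
    by exists (u a); apply/asboolP; exists a.
  case: (ex_minnP ex2) => n /asboolP[b ab ubn] H; exists b; split=> // c ac.
  by rewrite ubn; apply: H; apply/asboolP; exists c.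
have [f Hf] := choice argmin.
pose phi := fix phi n := if n is n'.+1 then f (phi n').+1 else f 0%N.
have phiS n : (phi n < phi n.+1)%N by rewrite /=; case: (Hf (phi n).+1).
exists phi; split; first exact: homo_ltn ltn_trans phiS.
apply: (@homo_leq _ (u \o phi) leq) => [n|n m p|n]; [exact: leqnn|exact: leq_trans|].
have up k c : (phi k <= c)%N -> (u (phi k) <= u c)%N.
  move=> le; case: k le => [|k] le /=; first by have [_] := Hf 0%N; apply.
  by have [le1] := Hf (phi k).+1; apply; apply: leq_trans le1 le.
by apply: up; apply: ltnW.
Qed.

Lemma dickson n (u : nat -> multinom n) : exists i j, (i < j)%N /\
  forall l, (u i l <= u j l)%N.
Proof.
have H k : exists phi : nat -> nat, {homo phi : i j / (i < j)%N} /\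
    forall l : 'I_n, (l < k)%N -> {homo (fun i => u (phi i) l) : i j / (i <= j)%N}.
  elim: k => [|k [phi [m1 m2]]]; first by exists id; split=> // l.
  have [kn|nk] := ltnP k n; last first.
    exists phi; split=> // l lk; apply: m2; apply: leq_trans (ltn_ord l) nk.
  have [psi [m3 m4]] := nat_monotone_subseq (fun i => u (phi i) (Ordinal kn)).
  exists (phi \o psi); split; first by move=> i j /m3/m1.
  move=> l; rewrite ltnS leq_eqVlt => /predU1P[lk|lk] i j ij.
    have -> : l = Ordinal kn by apply: val_inj.
    exact: m4.
  by apply: m2 => //; rewrite leq_eqVlt in ij; case/predU1P: ij => [->//|/m3/ltnW].
have [phi [m1 m2]] := H n; exists (phi 0%N), (phi 1%N); split; first exact: m1.
by move=> l; apply: (m2 l).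
Qed.

(** A strictly decreasing sequence of closed sets would give polynomials p_i
    vanishing on the next set but not on the current one. Taken with minimal
    leading monomials, they contradict Dickson's lemma: a later one could be
    reduced by an earlier one. *)
Lemma zclosed_dcc (Z : nat -> set 'M[K]_(s, N)) : (forall i, zclosed (Z i)) ->
  (forall i, Z i.+1 `<=` Z i) -> exists i, Z i `<=` Z i.+1.
Proof.
move=> cZ dec; apply: contrapT => /forallNP nsub.
have decm i j : (i <= j)%N -> Z j `<=` Z i.
  move=> /subnK <-; elim: (j - i)%N => //= d IH; rewrite addSn.
  exact: subset_trans (dec _) IH.
pose good i p := (forall z, Z i.+1 z -> mevalM p z = 0) /\
  exists2 z, Z i z & mevalM p z != 0.
have exg i : exists p, good i p.
  have [z Zz nz] : exists2 z, Z i z & ~ Z i.+1 z.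
    apply: contrapT => /forall2NP F; apply: (nsub i) => z Zz.
    by have [//|/contrapT] := F z.
  have [d [p [hp Hp pz]]] := zclosed_sep (cZ i.+1) (zclosed_ppoint (cZ i) Zz) nz.
  by exists p; split=> //; exists z.
have mini i : exists p, good i p /\ forall q, good i q -> ~ (mlead q < mlead p)%O.
  apply: contrapT => /forallNP H; have [p gp] := exg i.
  have : forall m, Acc (fun m m' : multinom (s * N) => (m < m')%O) m ->
      forall p, mlead p = m -> ~ good i p.
    move=> m; elim=> {}m _ IH {gp}p pm gp; apply: (H p); split=> // q gq lt.
    by apply: (IH (mlead q) _ q) => //; rewrite -pm.
  by move=> /(_ _ (ltom_wf _) p erefl).
have [p Hp] := choice mini.
have [i [j [ij le]]] := dickson (fun i => mlead (p i)).
have [[pi1 [zi Zi pi2]] _] := Hp i; have [[pj1 [zj Zj pj2]] minj] := Hp j.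
have nz (q : mpolyM K s N) z : mevalM q z != 0 -> q != 0.
  by apply: contraNneq => ->; rewrite mevalM_pev pev0.
pose c := mcoeff (mlead (p j)) (p j) / mcoeff (mlead (p i)) (p i).
have pi0 := nz _ _ pi2; have pj0 := nz _ _ pj2.
have lci : mcoeff (mlead (p i)) (p i) != 0 by rewrite mleadc_eq0.
have lcj : mcoeff (mlead (p j)) (p j) != 0 by rewrite mleadc_eq0.
pose t : mpolyM K s N := c *: (mpolyX K (mnm_sub (mlead (p j)) (mlead (p i))) * p i).
have t0 : c != 0 by rewrite mulf_neq0 ?invr_eq0.
have leE : mnm_add (mnm_sub (mlead (p j)) (mlead (p i))) (mlead (p i)) = mlead (p j).
  by rewrite submK //; apply/mnm_lepP.
have tlead : mlead t = mlead (p j).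
  have X0 m : mpolyX K m != 0 :> mpoly (s * N) K.
    apply/eqP => /(congr1 (mcoeff m)) /eqP.
    by rewrite mcoeffX eqxx mcoeff0 oner_eq0.
  by rewrite /t mleadZ // mleadM // mleadXm.
have tc : mcoeff (mlead (p j)) t = mcoeff (mlead (p j)) (p j).
  have := mleadcM (mpolyX K (mnm_sub (mlead (p j)) (mlead (p i)))) (p i).
  by rewrite mleadXm mcoeffX eqxx mul1r leE /t mcoeffZ => ->; rewrite /c divfK.
have tz z : Z j z -> mevalM t z = 0.
  move=> Zjz; rewrite mevalM_pev /t pevZ pevM -!mevalM_pev pi1 ?mulr0 //.
  exact: (decm _ _ ij).
have gt : good j (p j - t).
  split=> [z Zz|].
    by rewrite mevalM_pev pevB -!mevalM_pev pj1 // tz ?subr0 //; apply: dec.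
  by exists zj => //; rewrite mevalM_pev pevB -!mevalM_pev tz // subr0.
apply: (minj _ gt); rewrite lt_neqAle; apply/andP; split; last first.
  apply: le_trans (mleadB_le _ _) _; rewrite tlead joinxx //.
have gt0 : p j - t != 0 by case: gt => _ [z _ /nz].
apply/eqP => E; move: (gt0); rewrite -mleadc_eq0 E mcoeffB tc subrr eqxx //.
Qed.

Lemma zclosed_minimal (P : set (set 'M[K]_(s, N))) Z0 : zclosed Z0 -> P Z0 ->
  exists Z, [/\ zclosed Z, P Z, Z `<=` Z0 &
    forall Z', zclosed Z' -> P Z' -> Z' `<=` Z -> Z' = Z].
Proof.
move=> c0 P0; apply: contrapT => /forallNP H.
pose T := {Z | [/\ zclosed Z, P Z & Z `<=` Z0]}.
have step (Z : T) : exists Z' : T, sval Z' `<=` sval Z /\ ~ (sval Z `<=` sval Z').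
  case: Z => Z [cZ PZ ZZ0] /=; apply: contrapT => /forallNP F; apply: (H Z); split=> //.
  move=> Z' cZ' PZ' Z'Z; have := F (exist _ Z' (And3 cZ' PZ' (subset_trans Z'Z ZZ0))).
  by move=> /= /not_andP[//|/contrapT ZZ']; apply/seteqP.
have [f Hf] := choice step.
pose u := fix u n := if n is n'.+1 then f (u n') else exist _ Z0 (And3 c0 P0 (@subset_refl _ Z0)) : T.
have [i|i|i sub] := @zclosed_dcc (fun i => sval (u i)).
- by case: (u i) => ? [].
- by case: (Hf (u i)).
- by case: (Hf (u i)) => _; apply.
Qed.

End Zariski.

(** * The function field of an irreducible closed set *)

Section RationalFunctions.
Variables (K : closedFieldType) (s N : nat) (C : set 'M[K]_(s, N)).
Hypothesis hC : irred_closed C.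
Implicit Types (p q : mpolyM K s N) (f g : 'M[K]_(s, N) -> K).

(** At all points of a nonempty open subset of C. Two such subsets meet, C being
    irreducible, which is what makes generic equality a congruence. *)
Definition generically (P : 'M[K]_(s, N) -> Prop) : Prop :=
  exists Z, [/\ zclosed Z, ~ C `<=` Z & forall z, C z -> ~ Z z -> P z].

Lemma genT (P : 'M[K]_(s, N) -> Prop) : (forall z, C z -> P z) -> generically P.
Proof.
move=> H; exists set0; split; [exact: zclosed0| |by move=> z /H].
by case: hC => _ [z Cz] _ /(_ z Cz).
Qed.

Lemma gen_and (P Q : 'M[K]_(s, N) -> Prop) : generically P -> generically Q ->
  generically (fun z => P z /\ Q z).
Proof.
case=> Z1 [c1 n1 H1] [Z2 [c2 n2 H2]]; exists (Z1 `|` Z2); split.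
- exact: zclosedU.
- by case: hC => _ _ /(_ _ _ c1 c2) H /H[].
- by move=> z Cz /not_orP[? ?]; split; [apply: H1|apply: H2].
Qed.

Lemma gen_mono (P Q : 'M[K]_(s, N) -> Prop) : (forall z, C z -> P z -> Q z) ->
  generically P -> generically Q.
Proof.
move=> PQ [Z [cZ nZ H]]; exists Z; split=> // z Cz nz.
exact: PQ (H z Cz nz).
Qed.

Lemma gen_and2 (P Q R : 'M[K]_(s, N) -> Prop) :
  (forall z, C z -> P z -> Q z -> R z) ->
  generically P -> generically Q -> generically R.
Proof.
move=> H gP gQ; apply: gen_mono (gen_and gP gQ) => z Cz [? ?]; exact: H.
Qed.

Lemma gen_ex (P : 'M[K]_(s, N) -> Prop) : generically P -> exists2 z, C z & P z.
Proof.
move=> [Z [cZ nZ H]]; apply: contrapT => /forall2NP F; apply: nZ => z Cz.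
by apply: contrapT => nz; have [//|] := F z; apply; apply: H.
Qed.

Lemma gen_forall (I : finType) (P : I -> 'M[K]_(s, N) -> Prop) :
  (forall i, generically (P i)) -> generically (fun z => forall i, P i z).
Proof.
move=> H; suff : forall r : seq I, generically (fun z => forall i, i \in r -> P i z).
  move=> /(_ (enum I)); apply: gen_mono => z _ Hz i; exact: Hz (mem_enum _ _).
elim=> [|i r IH]; first by apply: genT.
by apply: gen_and2 (H i) IH => z _ Pi Pr j; rewrite inE => /predU1P[->|/Pr].
Qed.

Lemma gen_neq0 d p : mhomog d p -> (exists2 z, C z & mevalM p z != 0) ->
  generically (fun z => mevalM p z != 0).
Proof.
move=> hp [z Cz pz]; exists [set z | ppoint z /\ mevalM p z = 0]; split.
- exact: zclosed_zero hp.
- by move=> /(_ z Cz)[_ /eqP]; rewrite (negbTE pz).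
- move=> y Cy; apply: contra_notN => /eqP ?; split=> //.
  by case: hC => cC _ _; apply: zclosed_ppoint Cy.
Qed.

Lemma gen_eq0 d p : mhomog d p -> generically (fun z => mevalM p z = 0) ->
  forall z, C z -> mevalM p z = 0.
Proof.
move=> hp H z Cz; apply/eqP/negPn/negP => pz.
have ex : exists2 z, C z & mevalM p z != 0 by exists z.
by have [y Cy [-> /eqP]] := gen_ex (gen_and H (gen_neq0 hp ex)).
Qed.

Lemma gen_eq_refl f : gen_eq C f f.
Proof. exact: genT. Qed.

Lemma gen_eq_sym f g : gen_eq C f g -> gen_eq C g f.
Proof. by apply: gen_mono. Qed.

Lemma gen_eq_trans f g h : gen_eq C f g -> gen_eq C g h -> gen_eq C f h.
Proof. by apply: gen_and2 => z _ -> ->. Qed.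

Lemma ratfun_ext f g : gen_eq C f g -> ratfun C f -> ratfun C g.
Proof.
move=> fg [d [p [q [hp hq ex H]]]]; exists d, p, q; split=> //.
exact: gen_eq_trans (gen_eq_sym fg) H.
Qed.

Lemma ratfun_frac d p q : mhomog d p -> mhomog d q ->
  (exists2 z, C z & mevalM q z != 0) -> ratfun C (fun z => mevalM p z / mevalM q z).
Proof. by move=> hp hq ex; exists d, p, q; split=> //; apply: gen_eq_refl. Qed.

Lemma ratfun_cst c : ratfun C (fun=> c).
Proof.
have ex1 : exists2 z, C z & mevalM (1 : mpolyM K s N) z != 0.
  by case: hC => _ [z Cz] _; exists z; rewrite // mevalM_pev pev1 oner_eq0.
have H := ratfun_frac (@mhomogC K s N c) (@mhomog1 K s N) ex1.
apply: ratfun_ext H.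
by apply: genT => z _; rewrite !mevalM_pev pevZ pev1 /= mulr1 divr1.
Qed.

Lemma ratfunD f g : ratfun C f -> ratfun C g -> ratfun C (f \+ g).
Proof.
case=> d [p [q [hp hq eq E]]] [d' [p' [q' [hp' hq' eq' E']]]].
have gq := gen_neq0 hq eq; have gq' := gen_neq0 hq' eq'.
have H := gen_and gq gq'.
exists (fun i => d i + d' i)%N, (p * q' + q * p'), (q * q'); split.
- by apply: mhomogD; apply: mhomogM.
- exact: mhomogM.
- have [z Cz [qz qz']] := gen_ex H; exists z => //.
  by rewrite mevalM_pev pevM mulf_neq0.
- apply: gen_and2 (gen_and E E') H => z _ [/= -> ->] [qz qz'].
  rewrite !mevalM_pev pevD !pevM -!mevalM_pev.
  by move: qz qz'; move: (mevalM q z) (mevalM q' z) => a b a0 b0; field; rewrite a0 b0.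
Qed.

Lemma ratfunM f g : ratfun C f -> ratfun C g -> ratfun C (f \* g).
Proof.
case=> d [p [q [hp hq eq E]]] [d' [p' [q' [hp' hq' eq' E']]]].
have gq := gen_neq0 hq eq; have gq' := gen_neq0 hq' eq'.
have H := gen_and gq gq'.
exists (fun i => d i + d' i)%N, (p * p'), (q * q'); split.
- exact: mhomogM.
- exact: mhomogM.
- have [z Cz [qz qz']] := gen_ex H; exists z => //.
  by rewrite mevalM_pev pevM mulf_neq0.
- apply: gen_and2 (gen_and E E') H => z _ [/= -> ->] [qz qz'].
  by rewrite !mevalM_pev !pevM -!mevalM_pev mulf_div.
Qed.

Lemma ratfunV f : ratfun C f -> ratfun C (fun z => (f z)^-1).
Proof.
case=> d [p [q [hp hq eq E]]].
have [ep|np] := pselect (exists2 z, C z & mevalM p z != 0).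
  apply: ratfun_ext (ratfun_frac hq hp ep).
  by apply: gen_mono E => z _ ->; rewrite invf_div.
apply: ratfun_ext (ratfun_cst 0); apply: gen_mono E => z Cz ->.
suff -> : mevalM p z = 0 by rewrite mul0r invr0.
by apply/eqP/negPn/negP => pz; apply: np; exists z.
Qed.

(** The function field of C: its elements are classes of functions modulo generic
    equality. [rep] picks a representative, and an algebraic identity in the field
    holds generically between representatives. The irreducibility of C enters the
    type so that the field structure can be attached to it. *)
Record rfield : Type := RField {
  rclass : set ('M[K]_(s, N) -> K);
  rclassP : let _ := hC in exists2 f, ratfun C f & rclass = gen_eq C f }.

HB.instance Definition _ := gen_eqMixin rfield.
HB.instance Definition _ := gen_choiceMixin rfield.

Lemma rep_subproof (x : rfield) : exists f, ratfun C f /\ rclass x = gen_eq C f.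
Proof. by case: x => c [f rf E] /=; exists f. Qed.

Definition rep (x : rfield) : 'M[K]_(s, N) -> K := sval (cid (rep_subproof x)).

Lemma rep_rat x : ratfun C (rep x).
Proof. by rewrite /rep; case: cid => f []. Qed.

Lemma rep_inj x y : gen_eq C (rep x) (rep y) -> x = y.
Proof.
rewrite /rep; case: cid => f [rf Ef]; case: cid => g [rg Eg] /= E.
have cc' : rclass x = rclass y.
  rewrite Ef Eg; apply/seteqP; split => h; first exact: gen_eq_trans (gen_eq_sym E).
  exact: gen_eq_trans.
case: x y cc' {Ef Eg} => [c Pc] [c' Pc'] /= cc'; move: Pc Pc'; rewrite cc' => Pc Pc'.
by congr RField; apply: Prop_irrelevance.
Qed.

Definition cl f : rfield :=
  match pselect (ratfun C f) with
  | left rf => @RField (gen_eq C f) (ex_intro2 _ _ f rf erefl)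
  | right _ => @RField (gen_eq C (fun=> 0)) (ex_intro2 _ _ _ (ratfun_cst 0) erefl)
  end.

Lemma rep_cl f : ratfun C f -> gen_eq C (rep (cl f)) f.
Proof.
move=> rf; rewrite /cl; case: pselect => // rf'; rewrite /rep; case: cid => g [_ /= E].
by apply: gen_eq_sym; rewrite -/(gen_eq C f g) E; apply: gen_eq_refl.
Qed.

Lemma cl_rep x : cl (rep x) = x.
Proof. by apply: rep_inj; apply: rep_cl; apply: rep_rat. Qed.

Lemma cl_eq f g : ratfun C f -> gen_eq C f g -> cl f = cl g.
Proof.
move=> rf fg; apply: rep_inj.
apply: gen_eq_trans (rep_cl rf) _; apply: (gen_eq_trans fg).
by apply/gen_eq_sym/rep_cl/(ratfun_ext fg).
Qed.

Definition radd (x y : rfield) := cl (rep x \+ rep y).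
Definition rmul (x y : rfield) := cl (rep x \* rep y).
Definition ropp (x : rfield) := cl (fun z => - rep x z).
Definition rinv (x : rfield) := cl (fun z => (rep x z)^-1).
Definition rcst c : rfield := cl (fun=> c).

Lemma rep_add x y : generically (fun z => rep (radd x y) z = rep x z + rep y z).
Proof. by apply: rep_cl; apply: ratfunD; apply: rep_rat. Qed.
Lemma rep_mul x y : generically (fun z => rep (rmul x y) z = rep x z * rep y z).
Proof. by apply: rep_cl; apply: ratfunM; apply: rep_rat. Qed.
Lemma rep_opp x : generically (fun z => rep (ropp x) z = - rep x z).
Proof.
apply: rep_cl; apply: ratfun_ext (ratfunM (ratfun_cst (-1)) (rep_rat x)).
by apply: genT => z _ /=; rewrite mulN1r.
Qed.
Lemma rep_inv x : generically (fun z => rep (rinv x) z = (rep x z)^-1).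
Proof. by apply: rep_cl; apply: ratfunV; apply: rep_rat. Qed.
Lemma rep_cst c : generically (fun z => rep (rcst c) z = c).
Proof. by apply: rep_cl; apply: ratfun_cst. Qed.

Lemma raddA : associative radd.
Proof.
move=> x y z; apply: rep_inj.
apply: gen_and2 (gen_and (rep_add x (radd y z)) (rep_add y z))
                (gen_and (rep_add (radd x y) z) (rep_add x y)).
by move=> t _ [-> ->] [-> ->]; rewrite addrA.
Qed.
Lemma raddC : commutative radd.
Proof.
move=> x y; apply: rep_inj; apply: gen_and2 (rep_add x y) (rep_add y x).
by move=> t _ -> ->; rewrite addrC.
Qed.
Lemma radd0 : left_id (rcst 0) radd.
Proof.
move=> x; apply: rep_inj; apply: gen_and2 (rep_add (rcst 0) x) (rep_cst 0).
by move=> t _ -> ->; rewrite add0r.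
Qed.
Lemma raddN : left_inverse (rcst 0) ropp radd.
Proof.
move=> x; apply: rep_inj.
apply: gen_and2 (gen_and (rep_add (ropp x) x) (rep_opp x)) (rep_cst 0).
by move=> t _ [-> ->] ->; rewrite addNr.
Qed.
HB.instance Definition _ := GRing.isZmodule.Build rfield raddA raddC radd0 raddN.

Lemma rmulA : associative rmul.
Proof.
move=> x y z; apply: rep_inj.
apply: gen_and2 (gen_and (rep_mul x (rmul y z)) (rep_mul y z))
                (gen_and (rep_mul (rmul x y) z) (rep_mul x y)).
by move=> t _ [-> ->] [-> ->]; rewrite mulrA.
Qed.
Lemma rmulC : commutative rmul.
Proof.
move=> x y; apply: rep_inj; apply: gen_and2 (rep_mul x y) (rep_mul y x).
by move=> t _ -> ->; rewrite mulrC.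
Qed.
Lemma rmul1 : left_id (rcst 1) rmul.
Proof.
move=> x; apply: rep_inj; apply: gen_and2 (rep_mul (rcst 1) x) (rep_cst 1).
by move=> t _ -> ->; rewrite mul1r.
Qed.
Lemma rmulDl : left_distributive rmul radd.
Proof.
move=> x y z; apply: rep_inj.
apply: gen_and2 (gen_and (rep_mul (radd x y) z) (rep_add x y))
  (gen_and (rep_add (rmul x z) (rmul y z)) (gen_and (rep_mul x z) (rep_mul y z))).
by move=> t _ [-> ->] [-> [-> ->]]; rewrite mulrDl.
Qed.
Lemma rcst10 : rcst 1 != 0 :> rfield.
Proof.
apply/eqP => E; have := gen_and (rep_cst 1) (rep_cst 0); rewrite E.
by move=> /gen_ex[z _ [-> /eqP]]; rewrite oner_eq0.
Qed.
HB.instance Definition _ := GRing.Zmodule_isComNzRing.Build rfield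
  rmulA rmulC rmul1 rmulDl rcst10.

Lemma gen_dichotomy f : ratfun C f ->
  gen_eq C f (fun=> 0) \/ generically (fun z => f z != 0).
Proof.
case=> d [p [q [hp hq eq E]]].
have [ep|np] := pselect (exists2 z, C z & mevalM p z != 0); [right|left].
  apply: gen_and2 E (gen_and (gen_neq0 hp ep) (gen_neq0 hq eq)) => z _ -> [? ?].
  by rewrite mulf_neq0 ?invr_eq0.
apply: gen_mono E => z Cz ->.
suff -> : mevalM p z = 0 by rewrite mul0r.
by apply/eqP/negPn/negP => pz; apply: np; exists z.
Qed.

Lemma rep_neq0 (x : rfield) : x != 0 -> generically (fun z => rep x z != 0).
Proof.
move=> x0; have [E|//] := gen_dichotomy (rep_rat x); case/eqP: x0.
apply: rep_inj; apply: gen_eq_trans E _; apply: gen_eq_sym; exact: rep_cst.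
Qed.

Lemma rmulV (x : rfield) : x != 0 -> rmul (rinv x) x = 1.
Proof.
move=> /rep_neq0 x0; apply: rep_inj.
apply: gen_and2 (gen_and (rep_mul (rinv x) x) (rep_inv x)) (gen_and x0 (rep_cst 1)).
by move=> t _ [-> ->] [? ->]; rewrite mulVf.
Qed.
Lemma rinv0 : rinv 0 = 0.
Proof.
apply: rep_inj; apply: gen_and2 (rep_inv 0) (rep_cst 0).
by move=> z _ -> E; rewrite E invr0.
Qed.
HB.instance Definition _ := GRing.ComNzRing_isField.Build rfield rmulV rinv0.

Lemma rcst_additive : zmod_morphism rcst.
Proof.
move=> a b; apply: rep_inj.
apply: gen_and2 (gen_and (rep_add (rcst a) (ropp (rcst b))) (rep_opp (rcst b)))
  (gen_and (rep_cst (a - b)) (gen_and (rep_cst a) (rep_cst b))).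
by move=> z _ [-> ->] [-> [-> ->]].
Qed.
Lemma rcst_multiplicative : monoid_morphism rcst.
Proof.
split=> // a b; apply: rep_inj.
apply: gen_and2 (rep_mul (rcst a) (rcst b))
  (gen_and (rep_cst (a * b)) (gen_and (rep_cst a) (rep_cst b))).
by move=> z _ -> [-> [-> ->]].
Qed.
HB.instance Definition _ := GRing.isZmodMorphism.Build K rfield rcst rcst_additive.
HB.instance Definition _ := GRing.isMonoidMorphism.Build K rfield rcst rcst_multiplicative.

End RationalFunctions.

(** * Generic points, places and centers *)

(** A point of C over an extension F of K at which a form vanishes only if it
    vanishes on C. It carries all the algebraic information on C: closed conditions
    on C become equations satisfied by one point. *)
Definition generic_point (K F : fieldType) (io : {rmorphism K -> F}) s N
    (xi : 'M[F]_(s, N)) (C : set 'M[K]_(s, N)) : Prop :=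
  (forall i, row i xi != 0) /\
  forall d p, mhomog d p ->
    (pev io xi p = 0 <-> forall z, C z -> mevalM p z = 0).

Lemma frac_scale (F : fieldType) (a p q : F) : a != 0 -> (a * p) / (a * q) = p / q.
Proof. by move=> a0; rewrite -mulf_div divff // mul1r. Qed.

(* Identities in the function field only involve its field axioms. *)
Opaque radd rmul ropp rinv rcst.

Section GenericPoint.
Variables (K : closedFieldType) (s N : nat) (C : set 'M[K]_(s, N)).
Hypothesis hC : irred_closed C.
Notation F := (rfield hC).

Definition io : {rmorphism K -> F} := GRing.RMorphism.clone _ _ (rcst hC) _.

Lemma repD (x y : F) : generically C (fun z => rep (x + y) z = rep x z + rep y z).
Proof. exact: rep_add. Qed.
Lemma repM (x y : F) : generically C (fun z => rep (x * y) z = rep x z * rep y z).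
Proof. exact: rep_mul. Qed.

Lemma gen_ev n (y : nat -> F) (P : tower K n) :
  generically C (fun z => rep (ev io y n P) z = ev (idrm K) (fun i => rep (y i) z) n P).
Proof.
elim: n P => [|n IH] P; first exact: rep_cst.
elim/poly_ind: P => [|P a IHP].
  by rewrite rmorph0; apply: gen_mono (rep_cst hC 0) => z _ ->; rewrite rmorph0.
rewrite (rmorphD (ev io y n.+1)) (rmorphM (ev io y n.+1)).
apply: (gen_and2 hC _ (gen_and hC (repD (ev io y n.+1 P * ev io y n.+1 'X) (ev io y n.+1 a%:P))
  (repM (ev io y n.+1 P) (ev io y n.+1 'X))) (gen_and hC IHP (IH a))).
move=> z _ [-> ->] [E1 E2].
rewrite (rmorphD (ev (idrm K) _ n.+1)) (rmorphM (ev (idrm K) _ n.+1)) -E1.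
rewrite !ev_polyC -E2; congr (_ * _ + _).
by rewrite !evS !map_polyX !hornerX.
Qed.

Lemma gen_pev s' N' (w : 'M[F]_(s', N')) (p : mpolyM K s' N') :
  generically C (fun z => rep (pev io w p) z = mevalM p (map_mx (fun x : F => rep x z) w)).
Proof.
rewrite pev_ev; apply: gen_mono (gen_ev (wpt w) (tw p)) => z _ ->.
rewrite mevalM_pev pev_ev; apply: eq_ev => i iN.
by rewrite (wptE w (Ordinal iN)) (wptE _ (Ordinal iN)) -map_mxvec mxE.
Qed.

Lemma generic_pivot : exists j : 'I_s -> 'I_N,
  forall i, generically C (fun z => z i (j i) != 0).
Proof.
have [cC [z Cz] _] := hC.
suff : forall i, exists j, generically C (fun z => z i j != 0).
  by move=> /choice[j Hj]; exists j.
move=> i; have [j zj] := ppoint_entry i (zclosed_ppoint cC Cz).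
exists j; have H := gen_neq0 hC (@mhomogX K s N i j).
have [|Z [cZ nZ HZ]] := H; first by exists z; rewrite // mevalM_pev pev_pX.
by exists Z; split=> // y Cy ny; have := HZ y Cy ny; rewrite mevalM_pev pev_pX.
Qed.

(** Coordinates that do not vanish identically on C; they are used to dehomogenize. *)
Definition pivot := sval (cid generic_pivot).
Lemma pivotP : generically C (fun z => forall i, z i (pivot i) != 0).
Proof. by rewrite /pivot; case: cid => j /= H; apply: gen_forall. Qed.

Fact gpt_subproof : exists xi : 'M[F]_(s, N),
  forall i l, xi i l = cl hC (fun z => z i l / z i (pivot i)).
Proof.
by exists (\matrix_(i, l) cl hC (fun z => z i l / z i (pivot i))) => i l; rewrite mxE.
Qed.

(** The tautological generic point, with coordinates in the function field of C
    itself. *)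
Definition gpt : 'M[F]_(s, N) := sval (cid gpt_subproof).
Lemma gptE i l : gpt i l = cl hC (fun z => z i l / z i (pivot i)).
Proof. by rewrite /gpt; case: cid. Qed.

Lemma gen_gpt : generically C (fun z =>
  map_mx (fun x : F => rep x z) gpt = rscale (fun i => (z i (pivot i))^-1) z).
Proof.
have H i l : generically C (fun z => rep (gpt i l) z = z i l / z i (pivot i)).
  rewrite gptE; apply: rep_cl; have ex : exists2 z, C z & mevalM (pX K i (pivot i)) z != 0.
    by have [z Cz Hz] := gen_ex pivotP; exists z; rewrite // mevalM_pev pev_pX.
  have := ratfun_frac hC (@mhomogX K s N i l) (@mhomogX K s N i (pivot i)) ex.
  apply: ratfun_ext => //; apply: genT => // z _.
  by rewrite !mevalM_pev !pev_pX.
have := gen_forall hC (fun i => gen_forall hC (H i)).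
apply: gen_mono => z _ Hz; apply/matrixP => i l.
by rewrite !mxE Hz mulrC.
Qed.

Lemma gpt_eval d p : mhomog d p -> generically C (fun z =>
  rep (pev io gpt p) z = (\prod_i (z i (pivot i))^-1 ^+ d i) * mevalM p z).
Proof.
move=> hp; apply: (gen_and2 hC _ (gen_pev gpt p) gen_gpt) => z _ -> ->.
exact: mhomogE.
Qed.

Lemma gpt_pivot i : gpt i (pivot i) = 1.
Proof.
rewrite gptE; apply: (@rep_inj _ _ _ _ hC).
apply: (gen_eq_trans hC (rep_cl hC _)); last first.
  apply: (gen_and2 hC _ pivotP (rep_cst hC 1)) => z _ Hz ->.
  by rewrite divff.
apply: (ratfun_ext hC _ (ratfun_cst hC 1)).
by apply: gen_mono pivotP => z _ Hz; rewrite divff.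
Qed.

Lemma gpt_generic : generic_point io gpt C.
Proof.
split=> [i|d p hp].
  apply/eqP => /rowP/(_ (pivot i)) /eqP.
  by rewrite [row _ _ _ _]mxE gpt_pivot mxE oner_eq0.
split=> [p0|H].
  apply: (gen_eq0 hC hp); have := gpt_eval hp; rewrite p0 => E.
  apply: (gen_and2 hC _ E (gen_and hC (rep_cst hC 0) pivotP)).
  move=> z _ {}E [E0 Hz]; rewrite E0 in E; apply/eqP; move/esym/eqP: E.
  rewrite mulf_eq0 => /orP[|//]; rewrite prodf_seq_eq0 => /hasP[i _ /=].
  by rewrite expf_eq0 invr_eq0 (negbTE (Hz i)) andbF.
apply: rep_inj; apply: (gen_and2 hC _ (gpt_eval hp) (rep_cst hC 0)) => z Cz -> ->.
by rewrite H // mulr0.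
Qed.

Lemma gpt_eq0 d p : mhomog d p ->
  (pev io gpt p == 0) = `[< forall z, C z -> mevalM p z = 0 >].
Proof.
by move=> hp; have [_ /(_ d p hp) H] := gpt_generic; apply/eqP/asboolP => /H.
Qed.

Lemma gpt_neq0 d p : mhomog d p -> (exists2 z, C z & mevalM p z != 0) ->
  pev io gpt p != 0.
Proof.
move=> hp [z Cz pz]; rewrite (gpt_eq0 hp); apply/asboolP => /(_ z Cz)/eqP.
by rewrite (negbTE pz).
Qed.

Lemma gpt_frac d p q : mhomog d p -> mhomog d q ->
  (exists2 z, C z & mevalM q z != 0) ->
  cl hC (fun z => mevalM p z / mevalM q z) = pev io gpt p / pev io gpt q.
Proof.
move=> hp hq ex; apply: rep_inj.
apply: (gen_eq_trans hC (rep_cl hC (ratfun_frac hC hp hq ex))).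
apply: (gen_and2 hC _ (gen_and hC (repM (pev io gpt p) (pev io gpt q)^-1)
    (rep_inv (pev io gpt q))) (gen_and hC (gen_and hC (gpt_eval hp) (gpt_eval hq)) pivotP)).
move=> z _ [-> ->] [[-> ->] Hz].
have D0 : \prod_i (z i (pivot i))^-1 ^+ d i != 0.
  by apply/prodf_neq0 => i _; rewrite expf_neq0 ?invr_eq0.
by rewrite invfM mulrACA divff // mul1r.
Qed.

Lemma rfield_frac (f : F) : exists d p q, [/\ mhomog d p, mhomog d q,
  pev io gpt q != 0 & f = pev io gpt p / pev io gpt q].
Proof.
have [d [p [q [hp hq ex E]]]] := rep_rat f; exists d, p, q; split=> //.
  exact: gpt_neq0 hq ex.
by rewrite -(gpt_frac hp hq ex) -(cl_eq hC (rep_rat f) E) cl_rep.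
Qed.

Lemma rfield_gen (f : F) : exists P Q : tower K (s * N),
  ev io (wpt gpt) (s * N) Q != 0 /\
  f = ev io (wpt gpt) (s * N) P / ev io (wpt gpt) (s * N) Q.
Proof.
have [d [p [q [_ _ q0 ->]]]] := rfield_frac f; exists (tw p), (tw q).
by rewrite -!pev_ev.
Qed.

(** ** Places *)

(** The places of the function field are those of C; this is the translation from
    functions on the field to functions on representatives. *)
Definition toP (w : F -> int) (f : 'M[K]_(s, N) -> K) : int :=
  if `[< ratfun C f >] then w (cl hC f) else 0.

Lemma toP_rat w f : ratfun C f -> toP w f = w (cl hC f).
Proof. by move=> rf; rewrite /toP asboolT. Qed.

Lemma ratfun_neq0P f : ratfun_neq0 C f <-> ratfun C f /\ cl hC f != 0.
Proof.
split=> -[rf f0]; split=> //.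
  apply/eqP => E; apply: f0; apply: (gen_eq_trans hC (gen_eq_sym (rep_cl hC rf))).
  by rewrite E; apply: rep_cst.
move=> E; move/eqP: f0; apply; apply: rep_inj.
apply: (gen_eq_trans hC (rep_cl hC rf)); apply: (gen_eq_trans hC E).
by apply: gen_eq_sym; apply: rep_cst.
Qed.

Lemma clM f g : ratfun C f -> ratfun C g -> cl hC (f \* g) = cl hC f * cl hC g.
Proof.
move=> rf rg; apply: cl_eq => //; first exact: ratfunM.
by apply: (gen_and2 hC _ (rep_cl hC rf) (rep_cl hC rg)) => z _ /= -> ->.
Qed.
Lemma clD f g : ratfun C f -> ratfun C g -> cl hC (f \+ g) = cl hC f + cl hC g.
Proof.
move=> rf rg; apply: cl_eq => //; first exact: ratfunD.
by apply: (gen_and2 hC _ (rep_cl hC rf) (rep_cl hC rg)) => z _ /= -> ->.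
Qed.

Lemma cl_neq0_rep (x : F) : x != 0 -> ratfun_neq0 C (rep x).
Proof. by move=> x0; apply/ratfun_neq0P; rewrite cl_rep; split=> //; apply: rep_rat. Qed.

Lemma toP_place w : aplace io w -> place C (toP w).
Proof.
move=> pw; split.
- move=> f nf; rewrite /toP; case: asboolP => // rf.
  have [->|f0] := eqVneq (cl hC f) 0; first exact: av0 pw.
  by case: nf; apply/ratfun_neq0P.
- move=> f g /ratfun_neq0P[rf _] fg; rewrite !toP_rat //; last exact: ratfun_ext fg rf.
  by rewrite (cl_eq hC rf fg).
- move=> f g /ratfun_neq0P[rf f0] /ratfun_neq0P[rg g0].
  by rewrite !toP_rat ?clM ?(avM pw) //; apply: ratfunM.
- move=> f g /ratfun_neq0P[rf f0] /ratfun_neq0P[rg g0] /ratfun_neq0P[rfg fg0].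
  by rewrite !toP_rat ?clD ?(avD pw) // -clD.
- move=> c c0; rewrite toP_rat; last exact: ratfun_cst.
  exact: avC pw c c0.
- have [x x0 wx] := avN pw; exists (rep x); first exact: cl_neq0_rep.
  by rewrite toP_rat ?cl_rep //; apply: rep_rat.
Qed.

Lemma place_aplace v : place C v -> aplace io (fun x => v (rep x)).
Proof.
move=> pv.
have H f (x : F) : x != 0 -> generically C (fun z => rep x z = f z) -> v (rep x) = v f.
  by move=> x0 E; apply: (place_ext pv) => //; apply: cl_neq0_rep.
split.
- apply: (place_out pv) => /ratfun_neq0P[_]; by rewrite cl_rep eqxx.
- move=> x y x0 y0; rewrite (H _ _ (mulf_neq0 x0 y0) (repM x y)).
  by rewrite (place_mul pv) //; apply: cl_neq0_rep.
- move=> x y x0 y0 xy0; rewrite (H _ _ xy0 (repD x y)).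
  apply: (place_add pv); try exact: cl_neq0_rep.
  apply/ratfun_neq0P; split; first by apply: ratfunD => //; apply: rep_rat.
  by rewrite clD ?cl_rep //; apply: rep_rat.
- move=> c c0; rewrite (H _ _ _ (rep_cst hC c)) ?fmorph_eq0 //.
  exact: (place_cst pv).
- have [f f0 vf] := place_norm pv; exists (cl hC f); first by case/ratfun_neq0P: f0.
  rewrite -vf; apply/esym/(place_ext pv) => //; apply: gen_eq_sym; apply: rep_cl.
  by case: f0.
Qed.

Lemma toPK v : place C v -> toP (fun x => v (rep x)) = v.
Proof.
move=> pv; apply/funext => f; rewrite /toP; case: asboolP => rf; last first.
  by rewrite (place_out pv) // => -[].
have [rn0|n0] := pselect (ratfun_neq0 C f).
  by apply/esym/(place_ext pv) => //; apply: gen_eq_sym; apply: rep_cl.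
rewrite (place_out pv n0) (place_out pv) // => H; apply: n0; apply/ratfun_neq0P.
by split=> //; move/ratfun_neq0P: H => []; rewrite cl_rep.
Qed.

Lemma toP_rep w x : toP w (rep x) = w x.
Proof. by rewrite toP_rat ?cl_rep //; apply: rep_rat. Qed.

Lemma toP_inj : injective toP.
Proof. by move=> w w' E; apply/funext => x; rewrite -!toP_rep E. Qed.

Lemma sum_place (G : (('M[K]_(s, N) -> K) -> int) -> int) :
  \sum_(v \in place C) G v = \sum_(w \in aplace io) G (toP w).
Proof.
have -> : place C = toP @` aplace io.
  apply/seteqP; split => v /=; last by move=> [w pw <-]; apply: toP_place.
  by move=> pv; exists (fun x => v (rep x)); [apply: place_aplace|apply: toPK].
rewrite fsbig_image //; move=> w w' _ _; exact: toP_inj.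
Qed.

(** ** Centers *)

(** The center of a place is read off the generic point: rescale its rows to be
    integral, and reduce. *)
Definition rcenter (w : F -> int) (z : 'M[K]_(s, N)) : Prop :=
  C z /\ exists2 c : 'I_s -> F, (forall i, c i != 0) &
    forall i j, vge w 1 (c i * gpt i j - io (z i j)).

Lemma red_pev w (pw : aplace io w) s' N' (y : 'M[F]_(s', N')) (z : 'M[K]_(s', N')) p :
  (forall i j, vge w 1 (y i j - io (z i j))) ->
  vge w 1 (pev io y p - io (mevalM p z)).
Proof.
move=> H; rewrite mevalM_pev !pev_ev; apply: red_ev => // i iN.
rewrite (wptE _ (Ordinal iN)) (wptE _ (Ordinal iN)).
by case/mxvec_indexP: (Ordinal iN) => a b; rewrite !mxvecE.
Qed.

Lemma rcenterP w z : aplace io w -> rcenter w z -> center C (toP w) z.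
Proof.
move=> pw [Cz [c c0 H]]; split=> // d p q hp hq exp qz /=.
have exq : exists2 z, C z & mevalM q z != 0 by exists z.
rewrite toP_rat; last exact: ratfun_frac hq exq.
rewrite (gpt_frac hp hq exq).
have p0 := gpt_neq0 hp exp; have q0 := gpt_neq0 hq exq.
have E r : mhomog d r -> pev io gpt r = (\prod_i c i ^+ d i)^-1 * pev io (rscale c gpt) r.
  move=> hr; rewrite (pev_rscale _ _ _ hr) mulKf //.
  by apply/prodf_neq0 => i _; rewrite expf_neq0.
have -> : pev io gpt p / pev io gpt q = pev io (rscale c gpt) p / pev io (rscale c gpt) q.
  rewrite (E p hp) (E q hq); apply: frac_scale; rewrite invr_eq0.
  by apply/prodf_neq0 => i _; rewrite expf_neq0.
have p0' : pev io (rscale c gpt) p != 0.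
  by apply: contraNneq p0 => E0; rewrite (E p hp) E0 mulr0.
have R r : vge w 1 (pev io (rscale c gpt) r - io (mevalM r z)).
  by apply: red_pev => // i j; rewrite mxE.
have [q0' vq] := red_unit pw qz (R q).
rewrite (avM pw) ?invr_eq0 // (avV pw) // vq oppr0 addr0.
rewrite -(vgeP w 0) // (red_vge0 pw (R p)); split=> // pz.
by have := R p; rewrite pz rmorph0 subr0 vgeP // gtz0_ge1.
Qed.

Hypothesis Fdep : forall x y : F, algdep io x y.

Lemma int_min_seq (T : eqType) (r : seq T) (f : T -> int) x : x \in r ->
  exists2 y, y \in r & forall t, t \in r -> f y <= f t.
Proof.
elim: r x => // a [|b r] IH x _; first by exists a; rewrite ?inE // => t; rewrite inE => /eqP->.
have [y yr Hy] := IH b (mem_head _ _); have [le|lt] := leP (f a) (f y).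
  exists a; rewrite ?mem_head // => t; rewrite inE => /predU1P[->//|/Hy]; exact: le_trans.
exists y; first by rewrite inE yr orbT.
by move=> t; rewrite inE => /predU1P[->|/Hy//]; apply: ltW.
Qed.

Lemma row_pivot (w : F -> int) n (y : 'I_n -> F) : aplace io w -> (exists i, y i != 0) ->
  exists2 i, y i != 0 & forall j, vge w 0 (y j / y i).
Proof.
move=> pw [i0 y0]; pose r := [seq i <- enum 'I_n | y i != 0].
have [i] : exists2 i, i \in r & forall t, t \in r -> w (y i) <= w (y t).
  by apply: (@int_min_seq _ _ _ i0); rewrite mem_filter y0 mem_enum.
rewrite mem_filter => /andP[yi _] H; exists i => // j.
have [->|yj] := eqVneq (y j) 0; first by rewrite mul0r vge0.
rewrite vgeP ?mulf_neq0 ?invr_eq0 // (avM pw) ?invr_eq0 // (avV pw) // subr_ge0.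
by apply: H; rewrite mem_filter yj mem_enum.
Qed.

(** Divide each row by an entry of minimal valuation and reduce; the result is a
    point of C because the equations of C reduce too. This is the valuative
    criterion of properness. *)
Lemma rcenter_ex w : aplace io w -> exists z, rcenter w z.
Proof.
move=> pw; have H i : exists j, gpt i j != 0 /\ forall l, vge w 0 (gpt i l / gpt i j).
  have [|j ? ?] := @row_pivot w N (gpt i) pw; last by exists j.
  by exists (pivot i); rewrite gpt_pivot oner_eq0.
have [j Hj] := choice H.
have R i l : exists a, vge w 1 (gpt i l / gpt i (j i) - io a).
  by apply: (place_residue Fdep pw); case: (Hj i).
have {R} : forall i, exists a : 'I_N -> K, forall l, vge w 1 (gpt i l / gpt i (j i) - io (a l)).
  by move=> i; have [a Ha] := choice (R i); exists a.
move=> /choice[a Ha].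
pose z : 'M[K]_(s, N) := \matrix_(i, l) a i l.
have Hz i l : vge w 1 ((gpt i (j i))^-1 * gpt i l - io (z i l)).
  by rewrite mxE mulrC; apply: Ha.
exists z; split; last by exists (fun i => (gpt i (j i))^-1) => // i; rewrite invr_eq0; case: (Hj i).
have [[S [hS CE]] _ _] := hC; rewrite CE; split.
  apply: ppointP => i; exists (j i); apply/eqP => E; have := Hz i (j i).
  rewrite mulVf ?E ?rmorph0 ?subr0; last by case: (Hj i).
  by rewrite vgeP ?oner_eq0 // (av1 pw).
move=> p Sp; have [d hp] := hS p Sp.
pose c i := (gpt i (j i))^-1.
have := @red_pev w pw _ _ (rscale c gpt) z p; rewrite (pev_rscale _ _ _ hp).
have /eqP -> : pev io gpt p == 0.
  by rewrite (gpt_eq0 hp); apply/asboolP => y; rewrite CE => -[_ ->].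
rewrite mulr0 => /(_ (fun i l => _)) R.
apply: (red_uniq pw (x := 0)); first by apply: R => i l; rewrite mxE; apply: Hz.
by rewrite rmorph0 subr0 vge0.
Qed.

(** The point z is compared with z' by evaluating the forms z_ij X_il - z_il X_ij,
    which vanish at z. *)
Lemma center_uniq w z z' : aplace io w -> rcenter w z' -> center C (toP w) z ->
  forall i, (row i z == row i z')%MS.
Proof.
move=> pw [Cz' [c c0 Hc]] [Cz H] i; have [cC _ _] := hC.
have [j zj] := ppoint_entry i (zclosed_ppoint cC Cz).
have [j' zj'] := ppoint_entry i (zclosed_ppoint cC Cz').
pose q := pX K i j; have hq := @mhomogX K s N i j.
have qz : mevalM q z != 0 by rewrite mevalM_pev pev_pX.
have exq : exists2 z, C z & mevalM q z != 0 by exists z.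
have gj : gpt i j != 0 by have := gpt_neq0 hq exq; rewrite pev_pX.
have V l : vge w 0 (gpt i l / gpt i j).
  have [->|gl] := eqVneq (gpt i l) 0; first by rewrite mul0r vge0.
  have hp := @mhomogX K s N i l.
  have exp : exists2 z, C z & mevalM (pX K i l) z != 0.
    apply: contrapT => /forall2NP F0; case/eqP: gl; rewrite -(pev_pX io gpt).
    have [_ /(_ _ _ hp) [_ ->]] := gpt_generic => // y Cy.
    by apply/eqP/negPn/negP; have [|] := F0 y.
  have := H _ _ _ hp hq exp qz; rewrite /= toP_rat; last exact: ratfun_frac hq exq.
  rewrite (gpt_frac hp hq exq) !pev_pX => -[? _].
  by rewrite vgeP // mulf_neq0 ?invr_eq0.
have [v0 w0] := red_unit pw zj' (Hc i j').
have z'j : z' i j != 0.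
  apply/eqP => E; have := Hc i j; rewrite E rmorph0 subr0 => H1.
  have := vgeM pw (V j') H1; rewrite add0r.
  have -> : gpt i j' / gpt i j * (c i * gpt i j) = c i * gpt i j'.
    by field.
  by rewrite vgeP // w0.
have [u0 wu0] := red_unit pw z'j (Hc i j).
have key l : z' i j * z i l = z' i l * z i j.
  pose P : mpolyM K s N := z i j *: pX K i l - z i l *: pX K i j.
  have hP : mhomog (fun k => (k == i : nat)) P.
    by rewrite /P -scaleNr; apply: mhomogD; apply: mhomogZ; apply: mhomogX.
  have PE : pev io gpt P = io (z i j) * gpt i l - io (z i l) * gpt i j.
    by rewrite /P pevB !pevZ !pev_pX.
  have V1 : vge w 1 (io (z i j) * (gpt i l / gpt i j) - io (z i l)).
    have -> : io (z i j) * (gpt i l / gpt i j) - io (z i l) = pev io gpt P / gpt i j.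
      by rewrite PE; field.
    have [->|P0] := eqVneq (pev io gpt P) 0; first by rewrite mul0r vge0.
    have exP : exists2 z, C z & mevalM P z != 0.
      apply: contrapT => /forall2NP F0; case/eqP: P0.
      have [_ /(_ _ _ hP) [_ ->]] := gpt_generic => // y Cy.
      by apply/eqP/negPn/negP; have [|] := F0 y.
    have := H _ _ _ hP hq exP qz; rewrite /= toP_rat; last exact: ratfun_frac hq exq.
    rewrite (gpt_frac hP hq exq) !pev_pX => -[_ H1].
    rewrite vgeP ?mulf_neq0 ?invr_eq0 // -gtz0_ge1; apply: H1.
    by rewrite mevalM_pev /P pevB !pevZ !pev_pX /=; ring.
  have := redM pw (redC io w (z i j)) (Hc i l) => A1.
  have := redM pw (redM pw (redC io w (z i j)) _) (Hc i j).
  move=> /(_ (gpt i l / gpt i j) (z i l / z i j)).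
  have Hr : vge w 1 (gpt i l / gpt i j - io (z i l / z i j)).
    have := redM pw (redC io w (z i j)^-1) (a := (z i j)^-1) _.
    move=> /(_ (io (z i j) * (gpt i l / gpt i j)) (z i l) V1).
    by rewrite mulrA -rmorphM mulVf // rmorph1 mul1r [in z i l / _]mulrC.
  move=> /(_ Hr).
  have -> : io (z i j) * (gpt i l / gpt i j) * (c i * gpt i j) = io (z i j) * (c i * gpt i l).
    by field.
  move=> /(red_uniq pw A1) E; apply: (mulfI zj).
  rewrite [z' i l * _]mulrC E; move: zj; move: (z i l) (z i j) (z' i j) => a b e b0.
  by field.
have -> : row i z = (z i j / z' i j) *: row i z'.
  apply/rowP => l; rewrite !mxE; apply: (mulfI z'j); rewrite key.
  by move: z'j; move: (z i j) (z' i j) (z' i l) => a b e b0; field.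
by apply/eqmxP/eqmx_scale; rewrite mulf_neq0 ?invr_eq0.
Qed.

End GenericPoint.

(** * Curves and algebraic dependence *)

Section CurveDep.
Variables (K : closedFieldType) (s N : nat).
Notation idK := (idrm K).

(** A form in the entries of a matrix, as a polynomial in which m additional
    variables come first. *)
Definition stw m (p : mpolyM K s N) : tower K (m + s * N) :=
  mmap (towC K (m + s * N)) (fun l : 'I_(s * N) => towX K (m + s * N) (m + l)) p.

Lemma ev_stw (R : comNzRingType) (io : {rmorphism K -> R}) m (y : nat -> R)
    (w : 'M[R]_(s, N)) (p : mpolyM K s N) :
  (forall l : 'I_(s * N), y (m + l)%N = mxvec w 0 l) ->
  ev io y (m + s * N) (stw m p) = pev io w p.
Proof.
move=> H; rewrite /pev /stw /mmap rmorph_sum; apply: eq_bigr => t _.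
rewrite rmorphM evC; congr (_ * _); rewrite /mmap1 rmorph_prod.
by apply: eq_bigr => l _; rewrite rmorphXn evX ?H // ltn_add2l.
Qed.

Section Dominant.
Variables (C : set 'M[K]_(s, N)) (F : fieldType) (iota : {rmorphism K -> F}).
Variable xi : 'M[F]_(s, N).
Hypotheses (cC : zclosed C) (gxi : generic_point iota xi C).

(** If x and y were algebraically independent, every general pair of values (a, b)
    would be taken by (x, y) at a point of C: the point (x, y, xi) over F
    specializes to K above any such pair. *)
Lemma independent_dominant (d1 d2 : 'I_s -> nat) (p1 q1 p2 q2 : mpolyM K s N) :
  mhomog d1 p1 -> mhomog d1 q1 -> mhomog d2 p2 -> mhomog d2 q2 ->
  pev iota xi q1 != 0 -> pev iota xi q2 != 0 ->
  ~ algdep iota (pev iota xi p1 / pev iota xi q1)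
                   (pev iota xi p2 / pev iota xi q2) ->
  exists2 v : tower K 2, v != 0 & forall c, ev idK c 2 v != 0 ->
    exists z, [/\ C z, mevalM q1 z != 0, mevalM q2 z != 0,
      mevalM p1 z = c 0%N * mevalM q1 z & mevalM p2 z = c 1%N * mevalM q2 z].
Proof.
move=> hp1 hq1 hp2 hq2 q10 q20; set x := _ / _; set x2 := _ / _ => ndep.
have [j Hj] : exists j : 'I_s -> 'I_N, forall i, xi i (j i) != 0.
  have H i : exists l, xi i l != 0.
    by have [/(_ i)/rowP_neq0[l]] := gxi; rewrite mxE => ? _; exists l.
  by have [j Hj] := choice H; exists j.
pose y i := if (i < 2)%N then pair_pt x x2 i else wpt (xi) (i - 2).
have yl (l : 'I_(s * N)) : y (2 + l)%N = mxvec (xi) 0 l.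
  by rewrite /y addKn wptE.
pose u := stw 2 (q1 * q2 * \prod_i pX K i (j i)).
have u0 : ev iota y (2 + s * N) u != 0.
  rewrite (ev_stw _ _ yl) !pevM; apply: mulf_neq0; first exact: mulf_neq0.
  by rewrite pev_prod; apply/prodf_neq0 => i _; rewrite pev_pX.
have [v v0 H] := specialize_extend_many u0.
exists v; first by apply: contra_neq v0 => ->; rewrite rmorph0.
move=> c cv; have [||c' [c'E sp c'u]] := H c.
- move=> P Py; have -> : P = 0; last by rewrite rmorph0.
  by apply/eqP/negPn/negP => P0; apply: ndep; exists P.
- exact: cv.
pose z : 'M[K]_(s, N) := vec_mx (\row_l c' (2 + l)%N).
have zl (l : 'I_(s * N)) : c' (2 + l)%N = mxvec z 0 l by rewrite vec_mxK mxE.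
move: c'u; rewrite (ev_stw _ _ zl) !pevM !mulf_eq0 !negb_or => /andP[/andP[q1z q2z] pz].
have Cz : C z.
  have [S [hS CE]] := cC; rewrite CE; split.
    apply: ppointP => i; exists (j i); move: pz; rewrite pev_prod.
    rewrite prodf_seq_eq0 -all_predC => /allP/(_ i (mem_index_enum _)) /=.
    by rewrite pev_pX.
  move=> p Sp; have [d hp] := hS p Sp; rewrite mevalM_pev -(ev_stw _ _ zl).
  apply: sp; rewrite (ev_stw _ _ yl).
  by have [_ /(_ d p hp)[_ ->]] := gxi; rewrite // CE => w [_ ->].
have rel (p q : mpolyM K s N) i : (i < 2)%N -> pev iota xi q != 0 ->
    pair_pt x x2 i = pev iota xi p / pev iota xi q ->
    mevalM p z = c i * mevalM q z.
  move=> i2 q0 E; pose r : tower K (2 + s * N) :=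
    stw 2 p - towX K (2 + s * N) i * stw 2 q.
  have i2' : (i < 2 + s * N)%N by apply: leq_trans i2 (leq_addr _ _).
  have : ev idK c' (2 + s * N) r = 0.
    apply: sp; rewrite /r rmorphB rmorphM !(ev_stw _ _ yl) evX // {1}/y i2 E.
    by rewrite divfK // subrr.
  rewrite /r rmorphB rmorphM !(ev_stw _ _ zl) evX // (c'E i i2) => /eqP.
  by rewrite subr_eq0 => /eqP.
by exists z; split=> //; [apply: rel|apply: (rel p2 q2 1%N)].
Qed.

End Dominant.

Section Curve.
Variable C : set 'M[K]_(s, N).
Hypothesis hC : irred_closed C.
Notation F := (rfield hC).

(** If x and y were independent, consider the closed sets contained in the locus x
    = a on which y takes infinitely many values. A minimal one is irreducible. It
    is not a point, since y is not constant on it, and not C, since x takes other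
    values on C: this contradicts the dimension of C. *)
Lemma curve_algdep : is_curve C -> forall x y : F, algdep (io hC) x y.
Proof.
case=> _ _ minC x y; apply: contrapT => ndep.
have [d1 [p1 [q1 [hp1 hq1 q10 xE]]]] := rfield_frac x.
have [d2 [p2 [q2 [hp2 hq2 q20 yE]]]] := rfield_frac y.
rewrite xE yE in ndep.
have [cC _ _] := hC.
have [v v0 H] := independent_dominant cC (gpt_generic hC) hp1 hq1 hp2 hq2 q10 q20 ndep.
have lv0 : lead_coef (v : {poly {poly K}}) != 0 by rewrite lead_coef_eq0.
have [a la] := closed_nonroot lv0.
have la' : lead_coef (v : {poly {poly K}}) * ('X - a%:P) != 0.
  by rewrite mulf_neq0 // polyXsubC_eq0.
have [a'] := closed_nonroot la'; rewrite hornerM !hornerE mulf_eq0 negb_or => /andP[la2 aa'].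
pose vv b : {poly K} := map_poly (ev idK (fun=> b) 1) v.
have vvE b t : ev idK (pair_pt b t) 2 v = (vv b).[t].
  by rewrite evS /vv; congr horner; apply: eq_map_poly => Q.
have vv0 b : (lead_coef (v : {poly {poly K}})).[b] != 0 -> vv b != 0.
  apply: contraNneq => /polyP/(_ (size (v : {poly {poly K}})).-1).
  rewrite coef_map coef0 => E; apply/eqP; rewrite -[RHS]E /lead_coef.
  by rewrite /= map_poly_id.
pose Z0 := C `&` [set z | ppoint z /\ mevalM (p1 - a *: q1) z = 0].
have cZ0 : zclosed Z0.
  apply: zclosedI => //.
  by apply: (@zclosed_zero _ _ _ d1); rewrite -scaleNr; apply: mhomogD => //; apply: mhomogZ.
have Z0E z : C z -> mevalM p1 z = a * mevalM q1 z -> Z0 z.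
  move=> Cz E; split=> //; split; first exact: zclosed_ppoint Cz.
  by rewrite mevalM_pev pevB pevZ -!mevalM_pev E subrr.
have EZ0 z : Z0 z -> mevalM p1 z = a * mevalM q1 z.
  by move=> [_ [_ /eqP]]; rewrite mevalM_pev pevB pevZ subr_eq0 => /eqP.
pose big Z := forall p : {poly K}, p != 0 -> exists b z, [/\ p.[b] != 0, Z z,
  mevalM q2 z != 0 & mevalM p2 z = b * mevalM q2 z].
have bigZ0 : big Z0.
  move=> p p0; have [|b] := @closed_nonroot _ (p * vv a).
    by rewrite mulf_neq0 ?vv0.
  rewrite hornerM mulf_eq0 negb_or => /andP[pb vb].
  have [|z [Cz q1z q2z E1 E2]] := H (pair_pt a b); first by rewrite vvE.
  by exists b, z; split=> //; apply: Z0E.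
have [Z [cZ bZ ZZ0 minZ]] := zclosed_minimal cZ0 bigZ0.
have irrZ : irred_closed Z.
  split=> //; first by have [|b [z [_ Zz _ _]]] := bZ 1; [exact: oner_neq0|exists z].
  move=> Z1 Z2 c1 c2 ZU.
  have sub Zi : zclosed Zi -> big (Z `&` Zi) -> Z `<=` Zi.
    move=> ci bi; have := minZ _ (zclosedI cZ ci) bi (@subIsetl _ _ _).
    by move=> <-; apply: subIsetr.
  have [b1|n1] := pselect (big (Z `&` Z1)); first by left; apply: sub.
  have [b2|n2] := pselect (big (Z `&` Z2)); first by right; apply: sub.
  move: n1 => /existsNP[r1 /not_implyP[r10 H1]].
  move: n2 => /existsNP[r2 /not_implyP[r20 H2]].
  have [|b [z [rb Zz q2z E]]] := bZ (r1 * r2); first exact: mulf_neq0.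
  move: rb; rewrite hornerM mulf_eq0 negb_or => /andP[rb1 rb2].
  by case: (ZU z Zz) => Ziz; [case: H1|case: H2]; exists b, z.
have ZC : Z `<=` C by move=> z /ZZ0[].
case: (minC Z irrZ ZC) => [ZE|[w pw ZE]].
  have [|b vb] := @closed_nonroot _ (vv a'); first exact: vv0.
  have [|z [Cz q1z q2z E1 E2]] := H (pair_pt a' b); first by rewrite vvE.
  rewrite -ZE in Cz; have := EZ0 z (ZZ0 z Cz); rewrite E1 => /(mulIf q1z) /eqP.
  by rewrite -subr_eq0 (negbTE aa').
have [|b [z [_ Zz q2z E]]] := bZ 1; first exact: oner_neq0.
have [|b' [z' [rb Zz' q2z' E']]] := bZ ('X - b%:P); first by rewrite polyXsubC_eq0.
move: rb; rewrite !hornerE subr_eq0 => /negP; apply; apply/eqP.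
have [c c0 zE] : exists2 c, forall i, c i != 0 & z' = rscale c z.
  apply: eqmx_rscale; first by apply: zclosed_ppoint Zz.
  move: Zz Zz'; rewrite ZE => Zz Zz' i; apply/eqmxP.
  by apply: eqmx_trans (eqmxP (Zz' i)) (eqmx_sym (eqmxP (Zz i))).
move: q2z' E'; rewrite zE !(mhomogE _ _ hp2) !(mhomogE _ _ hq2) E mulrCA => n0 /eqP.
by rewrite (inj_eq (mulIf n0)) => /eqP.
Qed.

End Curve.

(** ** A criterion for curves *)

Section Criterion.
Variables (D : set 'M[K]_(s, N)) (F : fieldType) (iota : {rmorphism K -> F}).
Variable xi : 'M[F]_(s, N).
Hypothesis gxi : generic_point iota xi D.

(** Values of rational functions at a point where they are regular can be read off
    the generic point. *)
Definition local_value (z : 'M[K]_(s, N)) (f : F) (c : K) : Prop :=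
  exists d p q, [/\ mhomog d p, mhomog d q, mevalM q z != 0,
    pev iota xi q * f = pev iota xi p & mevalM q z * c = mevalM p z].

Lemma local_valueD z f c g e : local_value z f c -> local_value z g e ->
  local_value z (f + g) (c + e).
Proof.
move=> [d [p [q [hp hq qz E1 E2]]]] [d' [p' [q' [hp' hq' qz' E1' E2']]]].
exists (fun i => d i + d' i)%N, (p * q' + q * p'), (q * q'); split.
- by apply: mhomogD; apply: mhomogM.
- exact: mhomogM.
- by rewrite mevalM_pev pevM mulf_neq0.
- by rewrite pevD !pevM -E1 -E1'; ring.
- by rewrite !mevalM_pev pevD !pevM -!mevalM_pev -E2 -E2'; ring.
Qed.

Lemma local_valueM z f c g e : local_value z f c -> local_value z g e ->
  local_value z (f * g) (c * e).
Proof.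
move=> [d [p [q [hp hq qz E1 E2]]]] [d' [p' [q' [hp' hq' qz' E1' E2']]]].
exists (fun i => d i + d' i)%N, (p * p'), (q * q'); split; try exact: mhomogM.
- by rewrite mevalM_pev pevM mulf_neq0.
- by rewrite !pevM -E1 -E1'; ring.
- by rewrite !mevalM_pev !pevM -!mevalM_pev -E2 -E2'; ring.
Qed.

Lemma local_valueC z c : local_value z (iota c) c.
Proof.
exists (fun=> 0%N), (c *: 1), 1; split; [exact: mhomogC|exact: mhomog1|..].
- by rewrite mevalM_pev pev1 oner_eq0.
- by rewrite pevZ !pev1 mul1r mulr1.
- by rewrite !mevalM_pev pevZ pev1 mul1r mulr1.
Qed.

Lemma local_value_ev z n (y : nat -> F) (c : nat -> K) (P : tower K n) :
  (forall i, (i < n)%N -> local_value z (y i) (c i)) ->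
  local_value z (ev iota y n P) (ev idK c n P).
Proof.
elim: n P => [|n IH] P H; first exact: local_valueC.
elim/poly_ind: P => [|P a IHP].
  by rewrite !rmorph0 -(rmorph0 iota); apply: local_valueC.
rewrite (rmorphD (ev iota y n.+1)) (rmorphM (ev iota y n.+1)).
rewrite (rmorphD (ev idK c n.+1)) (rmorphM (ev idK c n.+1)).
apply: local_valueD.
  apply: local_valueM => //.
  by rewrite !evS !map_polyX !hornerX; apply: H.
by rewrite !ev_polyC; apply: IH => j jm; apply: H; rewrite ltnS ltnW.
Qed.

Lemma local_value0 z c : D z -> local_value z 0 c -> c = 0.
Proof.
move=> Dz [d [p [q [hp hq qz]]]]; rewrite mulr0 => /esym p0 E.
have [_ /(_ d p hp) [/(_ p0) H _]] := gxi.
by move/eqP: E; rewrite H // mulf_eq0 (negbTE qz) => /eqP.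
Qed.

End Criterion.

Lemma algebraic_const (F : fieldType) (iota : {rmorphism K -> F}) (e : F) (R : {poly K}) :
  R != 0 -> (map_poly iota R).[e] = 0 -> exists b, e = iota b.
Proof.
move=> R0 Re; have [r RE] := closed_field_poly_normal R.
have [b br eb] : exists2 b, b \in r & e = iota b.
  apply: contrapT => /forall2NP H; move/eqP: Re; apply/negP; rewrite RE map_polyZ hornerZ.
  rewrite mulf_neq0 ?fmorph_eq0 ?lead_coef_eq0 // rmorph_prod horner_prod.
  rewrite prodf_seq_neq0; apply/allP => b br /=.
  rewrite rmorphB /= map_polyX map_polyC !hornerE subr_eq0; apply/eqP => E.
  by have [] := H b.
by exists b.
Qed.

(** If the generic point has constant coordinates, it is a point of Z over K, and
    the forms W_il X_il' - W_il' X_il vanish on Z. *)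
Lemma const_gpt_point (Z : set 'M[K]_(s, N)) (hZ : irred_closed Z) :
  (forall i l, exists b, gpt hZ i l = io hZ b) -> is_point Z.
Proof.
move=> H; have {H} : forall i, exists w : 'I_N -> K, forall l, gpt hZ i l = io hZ (w l).
  by move=> i; have [w Hw] := choice (H i); exists w.
move=> /choice[w Hw]; pose W : 'M[K]_(s, N) := \matrix_(i, l) w i l.
have WE p : pev (io hZ) (gpt hZ) p = io hZ (mevalM p W).
  rewrite mevalM_pev pev_comp.
  have <- : gpt hZ = map_mx (io hZ) W by apply/matrixP => i l; rewrite !mxE Hw.
  exact: eq_pev_io.
have pW : ppoint W.
  apply: ppointP => i; exists (pivot hZ i); rewrite -(fmorph_eq0 (io hZ)) mxE -Hw.
  by rewrite gpt_pivot oner_eq0.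
exists W => //; have [cZ _ _] := hZ; apply/seteqP; split=> z Zz; last first.
  apply: (zclosed_eqmx cZ Zz); case: (cZ) => S [hS ZE]; rewrite ZE; split=> // p Sp.
  have [d hp] := hS p Sp; apply: (fmorph_inj (io hZ)); rewrite rmorph0 -WE.
  by have [_ /(_ d p hp) [_ ->]] := gpt_generic hZ; rewrite // ZE => y [_ ->].
move=> i; have [j zj] := ppoint_entry i (zclosed_ppoint cZ Zz).
have [j' wj'] := ppoint_entry i pW.
have E l l' : W i l * z i l' = W i l' * z i l.
  pose P : mpolyM K s N := W i l *: pX K i l' - W i l' *: pX K i l.
  have hP : mhomog (fun k => (k == i : nat)) P.
    by rewrite /P -scaleNr; apply: mhomogD; apply: mhomogZ; apply: mhomogX.
  have [_ /(_ _ P hP) [H _]] := gpt_generic hZ.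
  have P0 : pev (io hZ) (gpt hZ) P = 0.
    rewrite WE mevalM_pev pevB !pevZ !pev_pX /=.
    by rewrite [W i l' * _]mulrC subrr rmorph0.
  have /eqP := H P0 z Zz; rewrite mevalM_pev pevB !pevZ !pev_pX /= subr_eq0.
  by move=> /eqP.
have -> : row i z = (z i j' / W i j') *: row i W.
  apply/rowP => l; rewrite !mxE; apply: (mulfI wj'); rewrite E.
  by move: wj'; rewrite /W !mxE; move: (w i j') (w i l) (z i j') => a b c a0; field.
apply/eqmxP/eqmx_scale; rewrite mulf_neq0 ?invr_eq0 //; apply: contraNneq zj => z0.
by have /eqP := E j' j; rewrite z0 mulr0 mulf_eq0 (negbTE wj').
Qed.

(** Let Z be a proper irreducible closed subset, and h a form vanishing on Z but
    not on D. Made into a rational function, h is related to each coordinate g on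
    D: in an algebraic relation between h and g, not divisible by h, put h = 0.
    This leaves a nontrivial equation for g on Z, so that g is constant on Z. *)
Lemma curve_criterion (D : set 'M[K]_(s, N)) (F : fieldType) (iota : {rmorphism K -> F})
    (xi : 'M[F]_(s, N)) :
  irred_closed D -> ~ is_point D -> generic_point iota xi D ->
  (forall x y : F, algdep iota x y) -> is_curve D.
Proof.
move=> hD nD gxi dep; split=> // Z hZ ZD.
have [DZ|nDZ] := pselect (D `<=` Z); first by left; apply/seteqP.
right; apply: (@const_gpt_point Z hZ) => i l.
have [y Dy nZy] : exists2 y, D y & ~ Z y.
  apply: contrapT => /forall2NP F0; apply: nDZ => y Dy.
  by have [//|/contrapT] := F0 y.
have [cZ _ _] := hZ; have [cD _ _] := hD.
have [d [h [hh hZ0 hy]]] := zclosed_sep cZ (zclosed_ppoint cD Dy) nZy.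
have xiN0 d' p : mhomog d' p -> (exists2 z, D z & mevalM p z != 0) -> pev iota xi p != 0.
  move=> hp [z Dz pz]; apply/eqP => p0; have [_ /(_ d' p hp) [/(_ p0) H _]] := gxi.
  by move: pz; rewrite H ?eqxx.
pose q := \prod_k pX K k (pivot hZ k) ^+ d k : mpolyM K s N.
have hq : mhomog d q by apply: mhomog_prodX.
have qz (z : 'M[K]_(s, N)) : (forall k, z k (pivot hZ k) != 0) -> mevalM q z != 0.
  move=> H; rewrite mevalM_pev pev_prod; apply/prodf_neq0 => k _.
  by rewrite pevXn pev_pX expf_neq0.
have [z0 Zz0 Hz0] := gen_ex (pivotP hZ).
have h0 : pev iota xi h != 0 by apply: xiN0 hh _; exists y.
have q0 : pev iota xi q != 0.
  by apply: xiN0 hq _; exists z0; [apply: ZD|apply: qz].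
have r0 : xi i (pivot hZ i) != 0.
  rewrite -(pev_pX iota xi); apply: xiN0 (@mhomogX K s N i _) _.
  by exists z0; [apply: ZD|rewrite mevalM_pev pev_pX].
pose x := pev iota xi h / pev iota xi q; pose g := xi i l / xi i (pivot hZ i).
have [P [P0 Pxg]] := dep x g.
have [k [R [PE [j Rj]]]] := polyX_content P0.
have x0 : x != 0 by rewrite mulf_neq0 ?invr_eq0.
have Rxg : ev iota (pair_pt x g) 2 (R : tower K 2) = 0.
  have E : ev iota (pair_pt x g) 2 (('X^k)%:P : {poly {poly K}}) = x ^+ k.
    rewrite (@ev_polyC K F iota (pair_pt x g) 1) (rmorphXn (ev iota _ 1)); congr (_ ^+ _).
    exact: (@evX K F iota (pair_pt x g) 1 0).
  have := Pxg; rewrite PE (rmorphM (ev iota (pair_pt x g) 2)) E => /eqP.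
  by rewrite mulf_eq0 expf_eq0 (negbTE x0) andbF orbF => /eqP.
pose R0 : {poly K} := map_poly (horner_eval 0) R.
have R00 : R0 != 0.
  by apply: contraNneq Rj => /polyP/(_ j); rewrite coef_map coef0 /= /horner_eval horner_coef0 => ->.
apply: (@algebraic_const _ (io hZ) _ R0 R00).
have evR c : ev idK (pair_pt 0 c) 2 (R : tower K 2) = R0.[c].
  rewrite evS /R0; congr horner; apply: eq_map_poly => Q.
  by rewrite evS; congr horner; rewrite map_poly_id.
have -> : (map_poly (io hZ) R0).[gpt hZ i l] =
    ev (io hZ) (fun=> gpt hZ i l) 1 (R0 : tower K 1) by [].
apply: rep_inj; apply: (gen_and2 hZ _ (gen_ev (fun=> gpt hZ i l) (R0 : tower K 1))
  (gen_and hZ (gen_gpt hZ) (gen_and hZ (pivotP hZ) (rep_cst hZ 0)))).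
move=> z Zz -> [/matrixP/(_ i l)]; rewrite !mxE => gz [Hz ->].
have -> : ev idK (fun=> rep (gpt hZ i l) z) 1 (R0 : tower K 1) = R0.[rep (gpt hZ i l) z].
  by rewrite evS map_poly_id.
rewrite gz mulrC -evR; apply: (local_value0 gxi (ZD z Zz)).
rewrite -Rxg; apply: local_value_ev => -[|[|//]] _ /=.
- exists d, h, q; split=> //; first exact: qz.
    by rewrite /x mulrC divfK.
  by rewrite mulr0 hZ0.
- exists (fun k => (k == i : nat)), (pX K i l), (pX K i (pivot hZ i)); split.
  + exact: mhomogX.
  + exact: mhomogX.
  + by rewrite mevalM_pev pev_pX.
  + by rewrite !pev_pX /g mulrC divfK.
  + by rewrite !mevalM_pev !pev_pX mulrC divfK.
Qed.

End CurveDep.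

(** * Line bundles on an affine chart *)

Lemma ltn_sum_at (I : finType) (i : I) (a b : I -> nat) :
  (forall j, a j <= b j)%N -> (a i < b i)%N -> (\sum_j a j < \sum_j b j)%N.
Proof.
move=> le lt; rewrite (bigD1 i) //= [ltnRHS](bigD1 i) //= -addSn.
by apply: leq_add => //; apply: leq_sum.
Qed.

Section Trivialize.
Variables (K : closedFieldType) (m n : nat) (W : 'I_n -> set (nat -> K)).
Notation T := (tower K m).
Notation evc c := (ev (idrm K) c m).
Hypothesis Wopen : forall i c, W i c ->
  exists2 h : T, evc c h != 0 & forall c', evc c' h != 0 -> W i c'.

(** The functions p_i / q_i form a rational section of the bundle given by the
    g_ij: near every point of W_i and W_j the quotient of p_i / q_i by p_j / q_j is
    g_ij, up to units. The g_ij are only known through local fractions a / b. *)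
Definition transition (g : 'I_n -> 'I_n -> (nat -> K) -> K) (p q : 'I_n -> T) : Prop :=
  (forall i, p i != 0 /\ q i != 0) /\
  forall i j c, W i c -> W j c -> exists a b : T,
    [/\ evc c a != 0, evc c b != 0, evc c a = evc c b * g i j c &
      p i * q j * b = a * p j * q i].

Lemma transition_swap g p q : transition g p q ->
  transition (fun i j c => (g i j c)^-1) q p.
Proof.
case=> n0 H; split=> [i|i j c ci cj]; first by case: (n0 i).
have [a [b [a0 b0 E1 E2]]] := H i j c ci cj.
exists b, a; split=> //; last first.
  have -> : q i * p j * a = a * p j * q i by ring.
  by rewrite -E2; ring.
rewrite E1 mulfK //; apply: contraNneq a0 => g0; by rewrite E1 g0 mulr0.
Qed.

Lemma transition_correct g p q p' q' (t : T) : transition g p q -> t != 0 ->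
  (forall i, p' i != 0 /\ q' i != 0) ->
  (forall i, p' i * q i * t = p i * q' i) -> transition g p' q'.
Proof.
case=> n0 H t0 n0' E; split=> // i j c ci cj.
have [a [b [a0 b0 E1 E2]]] := H i j c ci cj.
exists a, b; split=> //.
have [[_ qi] [_ qj]] := (n0 i, n0 j).
apply: (mulIf t0); apply: (mulIf qi); apply: (mulIf qj).
have -> : p' i * q' j * b * t * q i * q j = (p' i * q i * t) * q' j * b * q j by ring.
have -> : a * p' j * q' i * t * q i * q j = a * q' i * q i * (p' j * q j * t) by ring.
rewrite !E; have -> : p i * q' i * q' j * b * q j = (p i * q j * b) * q' i * q' j by ring.
by rewrite E2; ring.
Qed.

Definition unit_on i (w : T) : Prop := forall c, W i c -> evc c w != 0.

(** Here k bounds the number of prime factors of p that have zeros in W_i; the sum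
    of these bounds is what decreases in [trivialize_step]. *)
Definition fac i (p : T) k : Prop := exists w (s : seq T),
  [/\ unit_on i w, forall x, x \in s -> prime_elt x, size s = k & p = w * \prod_(x <- s) x].

Lemma unit_onM i w w' : unit_on i w -> unit_on i w' -> unit_on i (w * w').
Proof. by move=> H H' c ci; rewrite rmorphM mulf_neq0 ?H ?H'. Qed.

Lemma unit_on_unit i (u : T) : u \is a GRing.unit -> unit_on i u.
Proof. by move=> uu c _; have := rmorph_unit (ev (idrm K) c m) uu; rewrite unitfE. Qed.

Lemma fac_ex i (p : T) : p != 0 -> exists k, fac i p k.
Proof.
move=> /ufd_tower[u [s [uu ps ->]]]; exists (size s), u, s; split=> //.
exact: unit_on_unit.
Qed.

Lemma fac0 i p : fac i p 0 -> unit_on i p.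
Proof. by move=> [w [s [H _ /size0nil-> ->]]]; rewrite big_nil mulr1. Qed.

Lemma fac_head i p k : fac i p k.+1 -> fac i p k \/
  exists x, [/\ prime_elt x, divides x p & exists2 c, W i c & evc c x = 0].
Proof.
move=> [w [s0 [H ps sk E]]]; case: s0 ps sk E => // x s ps [sk] E.
have [ex|nex] := pselect (exists2 c, W i c & evc c x = 0); [right|left].
  exists x; split=> //; first by apply: ps; rewrite mem_head.
  by exists (w * \prod_(y <- s) y); rewrite E big_cons; ring.
exists (w * x), s; split=> //.
- apply: unit_onM => // c ci; apply/eqP => xc; apply: nex; by exists c.
- by move=> y ys; apply: ps; rewrite inE ys orbT.
- by rewrite E big_cons mulrA.
Qed.

Lemma fac_div i b x k : fac i (b * x) k -> prime_elt x ->
  (exists2 c, W i c & evc c x = 0) -> exists2 k', fac i b k' & k'.+1 = k.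
Proof.
move=> [w [s [H ps sk E]]] px [c ci xc].
have nxw : ~ divides x w.
  by move=> [y wE]; have := H c ci; rewrite wE rmorphM xc mulr0 eqxx.
have [u [s' [uu ss' sz bE]]] := factors_cancel ps px nxw (esym E).
exists (size s'); last by rewrite sz.
exists (w * u), s'; split=> //; first by apply: unit_onM => //; apply: unit_on_unit.
by move=> y /ss'/ps.
Qed.

Lemma fac_mul i p k x : fac i p k -> unit_on i x -> fac i (p * x) k.
Proof.
move=> [w [s [H ps sk ->]]] ux; exists (w * x), s; split=> //.
  exact: unit_onM.
by ring.
Qed.

(** Let x be a prime factor of p_i with a zero in W_i. If x divides the numerator
    and the denominator at some j, it can be cancelled there. Otherwise x divides
    p_j for every j where x has a zero, because its zero set is irreducible and the
    transition functions are units ([prime_point]). So x can be divided out of all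
    these p_j; where x has no zero, it is a unit, and is moved to q_j. *)
Lemma trivialize_step g p q np nq i : transition g p q ->
  (forall j, fac j (p j) (np j)) -> (forall j, fac j (q j) (nq j)) -> (0 < np i)%N ->
  exists p' q' np' nq', [/\ transition g p' q',
    forall j, fac j (p' j) (np' j), forall j, fac j (q' j) (nq' j) &
    (\sum_j (np' j + nq' j) < \sum_j (np j + nq j))%N].
Proof.
move=> tr fp fq; case npi: (np i) => [//|k] _.
have := fp i; rewrite npi => /fac_head[fk|[x [px [pi' piE] xi]]].
  exists p, q, (fun j => if j == i then k else np j), nq; split=> // [j|].
    by case: eqP => // ->.
  apply: (@ltn_sum_at _ i) => [j|]; last by rewrite eqxx npi.
  by case: eqP => // ->; rewrite npi leq_add2r.
have [n0 tr2] := tr; have x0 := prime_elt_neq0 px.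
have [[j [xj [a aE] [b bE]]]|nboth] := pselect (exists j,
    [/\ exists2 c, W j c & evc c x = 0, divides x (p j) & divides x (q j)]).
  have := fp j; rewrite aE => /fac_div/(_ px xj)[ka fa kaE].
  have := fq j; rewrite bE => /fac_div/(_ px xj)[kb fb kbE].
  exists (fun l => if l == j then a else p l), (fun l => if l == j then b else q l).
  exists (fun l => if l == j then ka else np l), (fun l => if l == j then kb else nq l).
  split.
  - apply: (transition_correct tr (oner_neq0 _)) => l; case: (eqVneq l j) => [lj|_] //=.
    + have [] := n0 j; rewrite aE bE !mulf_eq0 !negb_or.
      by move=> /andP[? _] /andP[].
    + by rewrite lj aE bE; ring.
    + by rewrite mulr1.
  - by move=> l; case: eqP => // ->.
  - by move=> l; case: eqP => // ->.
  - apply: (@ltn_sum_at _ j) => [l|]; last by rewrite eqxx -kaE -kbE addSn addnS.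
    by case: eqP => // ->; rewrite -kaE -kbE; apply: leq_add.
have meet j : (exists2 c, W j c & evc c x = 0) -> divides x (p j).
  move=> xj; have [ci Wci xci] := xi; have [cj Wcj xcj] := xj.
  have [hi hi0 Hi] := Wopen Wci; have [hj hj0 Hj] := Wopen Wcj.
  have ndiv h c : evc c x = 0 -> evc c h != 0 -> ~ divides x h.
    by move=> xc + [y hE]; rewrite hE rmorphM xc mulr0 eqxx.
  have [|c [xc hc]] := @prime_point K m x (hi * hj) px.
    by move=> /(prime_eltM px)[]; [apply: ndiv xci hi0|apply: ndiv xcj hj0].
  move: hc; rewrite rmorphM mulf_eq0 negb_or => /andP[/Hi Wic /Hj Wjc].
  have [a [b [a0 b0 _ E]]] := tr2 i j c Wic Wjc.
  have : divides x (a * p j * q i).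
    by rewrite -E piE; exists (pi' * q j * b); ring.
  move=> /(prime_eltM px)[/(prime_eltM px)[|//]|].
    by move=> /(ndiv _ _ xc a0).
  move=> xq; case: nboth; exists i; split=> //; by exists pi'.
have H j : exists t : T * T * nat * nat, let: (p', q', k1, k2) := t in
    [/\ p' * q j * x = p j * q', p' != 0 /\ q' != 0, fac j p' k1, fac j q' k2 &
      (k1 + k2 <= np j + nq j)%N /\ (j = i -> k1 + k2 < np j + nq j)%N].
  have [p0 q0] := n0 j.
  have [xj|nxj] := pselect (exists2 c, W j c & evc c x = 0).
    have [b bE] := meet j xj; have := fp j; rewrite bE => /fac_div/(_ px xj)[kb fb kbE].
    exists (b, q j, kb, nq j); split=> //; first by ring.
      by split=> //; move: p0; rewrite bE mulf_eq0 negb_or => /andP[].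
    by rewrite -kbE addSn; split.
  exists (p j, q j * x, np j, nq j); split=> //; first by ring.
    by split=> //; apply: mulf_neq0.
    by apply: fac_mul => // c cj; apply/eqP => xc; apply: nxj; exists c.
  by split=> // ji; case: nxj; rewrite ji.
have [t Ht] := choice H.
exists (fun j => (t j).1.1.1), (fun j => (t j).1.1.2), (fun j => (t j).1.2), (fun j => (t j).2).
have {}Ht j : [/\ (t j).1.1.1 * q j * x = p j * (t j).1.1.2,
    (t j).1.1.1 != 0 /\ (t j).1.1.2 != 0, fac j (t j).1.1.1 (t j).1.2,
    fac j (t j).1.1.2 (t j).2 & ((t j).1.2 + (t j).2 <= np j + nq j)%N /\
      (j = i -> (t j).1.2 + (t j).2 < np j + nq j)%N].
  by have := Ht j; case: (t j) => [[[]]].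
split.
- by apply: (transition_correct tr x0) => j; case: (Ht j).
- by move=> j; case: (Ht j).
- by move=> j; case: (Ht j).
- apply: (@ltn_sum_at _ i) => [j|]; first by case: (Ht j) => _ _ _ _ [].
  by case: (Ht i) => _ _ _ _ [_]; apply.
Qed.

(** Transition data on a polynomial ring are trivial: a rational section can be
    corrected by a common rational function, prime by prime, until it has neither
    zeros nor poles. *)
Lemma trivialize g p q : transition g p q -> exists p' q', transition g p' q' /\
  forall i, unit_on i (p' i) /\ unit_on i (q' i).
Proof.
move=> tr; have [n0 _] := tr.
have [np fp] := choice (fun i => fac_ex i (n0 i).1).
have [nq fq] := choice (fun i => fac_ex i (n0 i).2).
have [N sN] := ubnP (\sum_j (np j + nq j))%N.
elim: N p q np nq sN tr fp fq {n0} => // N IH p q np nq sN tr fp fq.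
have [[i npi]|/forallNP zp] := pselect (exists i, (0 < np i)%N).
  have [p' [q' [np' [nq' [tr' fp' fq' lt]]]]] := trivialize_step tr fp fq npi.
  by apply: IH tr' fp' fq'; apply: leq_trans lt _; rewrite -ltnS.
have [[i nqi]|/forallNP zq] := pselect (exists i, (0 < nq i)%N).
  have [q' [p' [nq' [np' [tr' fq' fp' lt]]]]] := trivialize_step (transition_swap tr) fq fp nqi.
  apply: (IH p' q' np' nq') => //.
    under eq_bigr do rewrite addnC.
    apply: leq_trans lt _; under eq_bigr do rewrite addnC.
    by rewrite -ltnS.
  have := transition_swap tr'; congr transition.
  by apply/funext => a; apply/funext => b; apply/funext => c; rewrite invrK.
exists p, q; split=> // i; split; apply: fac0.
  by have := fp i; case: (np i) (zp i) => // k /(_ isT).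
by have := fq i; case: (nq i) (zq i) => // k /(_ isT).
Qed.

End Trivialize.

Section Chart.
Variables (K : closedFieldType) (s N m : nat) (X : set 'M[K]_(s, N)).
Variables (LB : line_bundle X) (Psi : 'M[tower K m]_(s, N)).
Notation T := (tower K m).
Notation evc c := (ev (idrm K) c m).
Notation opn := (@lb_open K s N X LB).
Notation trn := (@lb_trans K s N X LB).

Definition chart_at (c : nat -> K) : 'M[K]_(s, N) := map_mx (evc c) Psi.

Hypothesis chartX : forall c, ppoint (chart_at c) -> X (chart_at c).

Definition chart_open i : set (nat -> K) :=
  [set c | ppoint (chart_at c) /\ opn i (chart_at c)].

Lemma meval_chart c (p : mpolyM K s N) :
  mevalM p (chart_at c) = evc c (pev (towC K m) Psi p).
Proof.
rewrite mevalM_pev pev_comp; apply: eq_pev_io => a; rewrite /= evC //.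
Qed.

Lemma ppoint_open c : ppoint (chart_at c) ->
  exists2 h : T, evc c h != 0 & forall c', evc c' h != 0 -> ppoint (chart_at c').
Proof.
move=> pc; have H i : exists l, evc c (Psi i l) != 0.
  by have [l] := ppoint_entry i pc; rewrite mxE; exists l.
have [l Hl] := choice H; exists (\prod_i Psi i (l i)).
  by rewrite rmorph_prod; apply/prodf_neq0 => i _.
move=> c'; rewrite rmorph_prod => /prodf_neq0 H'; apply: ppointP => i.
by exists (l i); rewrite mxE; apply: H'.
Qed.

(** Separate the point from Z by a form, and pull this form back. *)
Lemma avoid_open Z c : zclosed Z -> ppoint (chart_at c) -> ~ Z (chart_at c) ->
  exists2 h : T, evc c h != 0 &
    forall c', evc c' h != 0 -> ppoint (chart_at c') /\ ~ Z (chart_at c').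
Proof.
move=> cZ pc nZ; have [d [p [hp pZ pc0]]] := zclosed_sep cZ pc nZ.
have [h hc Hh] := ppoint_open pc; exists (h * pev (towC K m) Psi p).
  by rewrite rmorphM mulf_neq0 // -meval_chart.
move=> c'; rewrite rmorphM mulf_eq0 negb_or => /andP[/Hh pc' pc'0]; split=> // Zc'.
by move: pc'0; rewrite -meval_chart pZ ?eqxx.
Qed.

Lemma chart_open_open i c : chart_open i c ->
  exists2 h : T, evc c h != 0 & forall c', evc c' h != 0 -> chart_open i c'.
Proof.
move=> [pc Uc]; have [_ cU] := @lb_openP _ _ _ _ LB i.
have nZ : ~ (X `\` opn i) (chart_at c) by move=> [_].
have [h hc H] := avoid_open cU pc nZ; exists h => // c' /H[pc' nc']; split=> //.
by apply: contrapT => nU; apply: nc'; split=> //; apply: chartX.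
Qed.

Lemma local_transition i j c : chart_open i c -> chart_open j c ->
  exists p q h : T, [/\ evc c p != 0, evc c q != 0, evc c h != 0,
    evc c p = evc c q * trn i j (chart_at c) &
    forall c', chart_open i c' -> chart_open j c' -> evc c' h != 0 ->
      evc c' q != 0 /\ evc c' p = evc c' q * trn i j (chart_at c')].
Proof.
move=> [pc Ui] [_ Uj].
have [d [p [q [Z [hp hq cZ nZ H]]]]] := @lb_regular _ _ _ _ LB _ _ _ (conj Ui Uj).
have [h hc Hh] := avoid_open cZ pc nZ.
exists (pev (towC K m) Psi p), (pev (towC K m) Psi q), h; rewrite -!meval_chart.
have [q0 gE] := H _ (conj Ui Uj) nZ.
have E c' : mevalM q (chart_at c') != 0 -> trn i j (chart_at c') =
    mevalM p (chart_at c') / mevalM q (chart_at c') ->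
    mevalM p (chart_at c') = mevalM q (chart_at c') * trn i j (chart_at c').
  by move=> q0' ->; rewrite mulrC divfK.
split=> //; last first.
  move=> c' [_ Ui'] [_ Uj'] /Hh[_ nZ']; rewrite -!meval_chart.
  by have [q0' gE'] := H _ (conj Ui' Uj') nZ'; split=> //; apply: E.
  exact: E.
rewrite E // mulf_neq0 //; exact: (@lb_unit _ _ _ _ LB).
Qed.

(** A line bundle on an open subset of affine space is trivial. Start from the
    rational section given by the transition functions to one fixed open set, and
    apply [trivialize]. *)
Lemma chart_trivial : (exists c, ppoint (chart_at c)) ->
  exists P Q : 'I_(lb_size LB) -> T,
    (forall i c, chart_open i c -> evc c (P i) != 0 /\ evc c (Q i) != 0) /\
    forall i j c, chart_open i c -> chart_open j c ->
      evc c (P i) * evc c (Q j) =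
      trn i j (chart_at c) * evc c (P j) * evc c (Q i).
Proof.
move=> [c0 pc0]; have [i0 Ui0] := @lb_cover _ _ _ _ LB _ (chartX pc0).
have W0 : chart_open i0 c0 by split.
have common i : (exists c, chart_open i c) -> exists c, chart_open i c /\ chart_open i0 c.
  move=> [c Wc]; have [h hc Hh] := chart_open_open Wc.
  have [h0 hc0 Hh0] := chart_open_open W0.
  have /tower_nonzero[c1] : h * h0 != 0.
    rewrite mulf_neq0 //; first by apply: contraNneq hc => ->; rewrite rmorph0.
    by apply: contraNneq hc0 => ->; rewrite rmorph0.
  rewrite rmorphM mulf_eq0 negb_or => /andP[/Hh ? /Hh0 ?]; by exists c1.
have H i : exists t : T * T * T, let: (p, q, h) := t in
    [/\ p != 0, q != 0, h != 0 & forall c, chart_open i c -> chart_open i0 c ->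
      evc c h != 0 -> evc c q != 0 /\
        evc c p = evc c q * trn i i0 (chart_at c)].
  have [/common[c [Wi Wi0]]|ne] := pselect (exists c, chart_open i c); last first.
    exists (1, 1, 1); split; rewrite ?oner_neq0 // => c Wc; case: ne; by exists c.
  have [p [q [h [p0 q0 h0 _ Hpq]]]] := local_transition Wi Wi0.
  exists (p, q, h); split=> //; [move: p0|move: q0|move: h0];
    by apply: contraNneq => ->; rewrite rmorph0.
have [t Ht] := choice H.
have {}Ht i : [/\ (t i).1.1 != 0, (t i).1.2 != 0, (t i).2 != 0 &
    forall c, chart_open i c -> chart_open i0 c ->
      evc c (t i).2 != 0 -> evc c (t i).1.2 != 0 /\
        evc c (t i).1.1 = evc c (t i).1.2 * trn i i0 (chart_at c)].
  by have := Ht i; case: (t i) => [[]].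
pose g i j c := trn i j (chart_at c).
have [|P [Q [[n0 trPQ] unitPQ]]] := @trivialize K m _ chart_open (@chart_open_open) g
    (fun i => (t i).1.1) (fun i => (t i).1.2).
  split=> [i|i j c Wi Wj]; first by case: (Ht i).
  have [a [b [h [a0 b0 h0 gE Hab]]]] := local_transition Wi Wj.
  exists a, b; split=> //.
  have [hi hic Hi] := chart_open_open Wi; have [hj hjc Hj] := chart_open_open Wj.
  have [h2 h2c H2] := chart_open_open W0.
  have [_ _ ti0 Hti] := Ht i; have [_ _ tj0 Htj] := Ht j.
  have nz (f : T) c1 : evc c1 f != 0 -> f != 0.
    by apply: contraNneq => ->; rewrite rmorph0.
  pose f := h * hi * hj * h2 * (t i).2 * (t j).2.
  have f0 : f != 0 by rewrite /f !mulf_neq0 ?(nz _ _ h0) ?(nz _ _ hic) ?(nz _ _ hjc) ?(nz _ _ h2c).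
  apply: (mulIf f0); apply: tower_eq => c'; rewrite rmorphM [RHS]rmorphM.
  have [->|fc] := eqVneq (evc c' f) 0; first by rewrite !mulr0.
  congr (_ * _); move: fc; rewrite /f !rmorphM !mulf_eq0 !negb_or.
  move=> /andP[/andP[/andP[/andP[/andP[hc' /Hi Wi'] /Hj Wj'] /H2 W0'] tic'] tjc'].
  have [qi -> ] := Hti c' Wi' W0' tic'; have [qj ->] := Htj c' Wj' W0' tjc'.
  have [_ ->] := Hab c' Wi' Wj' hc'.
  have [_ Ui] := Wi'; have [_ Uj] := Wj'; have [_ Uo] := W0'.
  rewrite -(lb_cocycle Ui Uj Uo).
  by move: (lb_trans _ _ _) (lb_trans _ _ _) => x y; ring.
exists P, Q; split=> [i c Wc|i j c Wi Wj].
  by have [H1 H2] := unitPQ i; split; [apply: H1|apply: H2].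
have [a [b [a0 b0 gE E]]] := trPQ i j c Wi Wj; apply: (mulIf b0).
have := congr1 (ev (idrm K) c m) E; rewrite !rmorphM gE => ->.
by rewrite /g; ring.
Qed.

End Chart.

(** * Pluecker coordinates *)

Section Pluecker.
Variables k n : nat.
Notation N := #|increasing k n|.
Implicit Types R : comNzRingType.

Definition plk R (A : 'M[R]_(k, n)) : 'rV[R]_N :=
  \row_i \det (colsub (enum_val i : {ffun 'I_k -> 'I_n}) A).

Lemma plueckerE (K : fieldType) (A : 'M[K]_(k, n)) : pluecker A = plk A.
Proof. by []. Qed.

Lemma plk_map (R S : comNzRingType) (f : {rmorphism R -> S}) (A : 'M[R]_(k, n)) :
  plk (map_mx f A) = map_mx f (plk A).
Proof.
apply/rowP => i; rewrite !mxE -det_map_mx; congr (\det _).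
by apply/matrixP => a b; rewrite !mxE.
Qed.

Lemma plk_mul R (B : 'M[R]_k) (A : 'M[R]_(k, n)) : plk (B *m A) = \det B *: plk A.
Proof. by apply/rowP => i; rewrite !mxE -mulmx_colsub det_mulmx. Qed.

Lemma plkZ R c (A : 'M[R]_(k, n)) : plk (c *: A) = c ^+ k *: plk A.
Proof. by rewrite -mul_scalar_mx plk_mul det_scalar. Qed.

Lemma plk_neq0_free (K : fieldType) (A : 'M[K]_(k, n)) : plk A != 0 -> row_free A.
Proof.
move=> /rowP_neq0[i]; rewrite mxE => d0; rewrite -kermx_eq0.
apply/eqP/row_matrixP => a; rewrite row0; apply/rowP => b; rewrite mxE.
set f : 'I_k -> 'I_n := fun_of_fin _ in d0.
have u : colsub f A \in unitmx by rewrite unitmxE unitfE.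
have : row a (kermx A) *m colsub f A = 0.
  rewrite mulmx_colsub -row_mul mulmx_ker row0.
  by apply/matrixP => c d; rewrite !mxE.
by move=> /(congr1 (mulmx^~ (invmx (colsub f A)))); rewrite mulmxK // mul0mx => /rowP/(_ b); rewrite mxE.
Qed.

(** Sort the columns: the minor is a Pluecker coordinate up to sign, or zero if a
    column is repeated. The coefficients are integers, so that they are the same
    over all rings. *)
Lemma minor_linear (f : {ffun 'I_k -> 'I_n}) : exists v : 'cV[int]_N,
  forall R (A : 'M[R]_(k, n)), \det (colsub f A) = (plk A *m map_mx intr v) 0 0.
Proof.
have [/injectiveP inj|ninj] := boolP (injectiveb f); last first.
  exists 0 => R A; rewrite map_mx0 mulmx0 mxE -det_tr.
  have /injectivePn[a [b ab fab]] := ninj.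
  by apply: (determinant_alternate ab) => c; rewrite !mxE fab.
pose t : k.-tuple 'I_n := [tuple f i | i < k].
pose r : rel 'I_n := fun a b => (a <= b)%N.
have rtr : transitive r by move=> a b c; apply: leq_trans.
have rrefl : reflexive r by move=> a; apply: leqnn.
have rtot : total r by move=> a b; apply: leq_total.
have : perm_eq (sort r t) t by rewrite perm_sort.
move=> /tuple_permP[s sE].
have JE (i : 'I_k) : nth (f i) (sort r t) i = f (s i).
  rewrite sE (nth_map i) ?size_enum_ord // !tnth_mktuple.
  by rewrite nth_ord_enum.
pose J := [ffun i => f (s i)].
have Jinc : J \in increasing k n.
  rewrite inE; apply/forallP => a; apply/forallP => b; apply/implyP => ab.
  rewrite !ffunE ltn_neqAle; apply/andP; split.
    by rewrite (inj_eq val_inj) (inj_eq inj) (inj_eq perm_inj) -val_eqE /= (ltn_eqF ab).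
  have sz : size (sort r t) = k by rewrite size_sort size_tuple.
  have := sorted_leq_nth rtr rrefl (f a) (sort_sorted rtot t).
  move=> /(_ a b); rewrite !inE sz !ltn_ord => /(_ isT isT (ltnW ab)).
  by rewrite JE (set_nth_default (f b)) ?sz // JE.
exists ((-1) ^+ s *: delta_mx (enum_rank_in Jinc J) 0) => R A.
rewrite map_mxZ map_delta_mx -scalemxAr -colE !mxE enum_rankK_in //.
have -> : colsub J A = col_perm s (colsub f A).
  by apply/matrixP => a b; rewrite !mxE ffunE.
rewrite col_permE det_mulmx det_perm rmorph_sign odd_permV mulrCA -expr2 sqrr_sign.
by rewrite mulr1.
Qed.

Definition minor_vec : {ffun 'I_k -> 'I_n} -> 'cV[int]_N := projT1 (choice minor_linear).

(** The minor on arbitrary, possibly repeated or unsorted, columns, as a linear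
    form in the Pluecker coordinates. *)
Definition lam R (f : {ffun 'I_k -> 'I_n}) (x : 'rV[R]_N) : R :=
  (x *m map_mx intr (minor_vec f)) 0 0.

Lemma lam_plk R f (A : 'M[R]_(k, n)) : lam f (plk A) = \det (colsub f A).
Proof. by rewrite /lam /minor_vec; case: choice => v /= ->. Qed.

Lemma lamZ R f c (x : 'rV[R]_N) : lam f (c *: x) = c * lam f x.
Proof. by rewrite /lam -scalemxAl mxE. Qed.

Lemma lamB R f (x y : 'rV[R]_N) : lam f (x - y) = lam f x - lam f y.
Proof. by rewrite /lam mulmxBl !mxE. Qed.

Lemma lam_map (R S : comNzRingType) (g : {rmorphism R -> S}) f (x : 'rV[R]_N) :
  lam f (map_mx g x) = g (lam f x).
Proof.
rewrite /lam !mxE rmorph_sum; apply: eq_bigr => i _.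
by rewrite !mxE rmorphM rmorph_int.
Qed.

Definition subst (f : {ffun 'I_k -> 'I_n}) i l : {ffun 'I_k -> 'I_n} :=
  [ffun a => if a == i then l else f a].

(** For the coordinates x of a k-space W whose I-coordinate is nonzero, this is the
    basis of W with an identity block in the columns I, times that coordinate. It
    is linear in x. *)
Definition Lmat R (f : {ffun 'I_k -> 'I_n}) (x : 'rV[R]_N) : 'M[R]_(k, n) :=
  \matrix_(i, l) lam (subst f i l) x.

Lemma LmatZ R f c (x : 'rV[R]_N) : Lmat f (c *: x) = c *: Lmat f x.
Proof. by apply/matrixP => i l; rewrite !mxE lamZ. Qed.

Lemma LmatB R f (x y : 'rV[R]_N) : Lmat f (x - y) = Lmat f x - Lmat f y.
Proof. by apply/matrixP => i l; rewrite !mxE lamB. Qed.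

Lemma Lmat_map (R S : comNzRingType) (g : {rmorphism R -> S}) f (x : 'rV[R]_N) :
  Lmat f (map_mx g x) = map_mx g (Lmat f x).
Proof. by apply/matrixP => i l; rewrite !mxE lam_map. Qed.

(** Cramer's rule. *)
Lemma Lmat_plk R f (A : 'M[R]_(k, n)) : Lmat f (plk A) = \adj (colsub f A) *m A.
Proof.
apply/matrixP => i l; rewrite !mxE lam_plk (expand_det_col _ i).
apply: eq_bigr => a _; rewrite !mxE ffunE eqxx mulrC; congr (_ * _).
rewrite /cofactor; congr (_ * \det _); apply/matrixP => b c.
by rewrite !mxE ffunE eq_sym (negbTE (neq_lift _ _)).
Qed.

Lemma Lmat_plk1 R (f : {ffun _ -> _}) (A : 'M[R]_(k, n)) : colsub f A = 1%:M -> Lmat f (plk A) = A.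
Proof. by move=> E; rewrite Lmat_plk E adj1 mul1mx. Qed.

(** The Pluecker relations, in the form that recovers the space from its
    coordinates. *)
Lemma plk_Lmat R (i : 'I_N) c (A : 'M[R]_(k, n)) (x := c *: plk A) :
  x 0 i *: plk (Lmat (enum_val i) x) = x 0 i ^+ k *: x.
Proof.
rewrite /x LmatZ plkZ Lmat_plk plk_mul !scalerA; congr (_ *: _).
rewrite !mxE; set f : 'I_k -> 'I_n := fun_of_fin _; set B := colsub f A.
have E : \det B * \det (\adj B) = \det B ^+ k by rewrite -det_mulmx mul_mx_adj det_scalar.
rewrite exprMn -E; move: (\det B) (\det _) (c ^+ k) => a b d; ring.
Qed.

(** ** Differences of Pluecker coordinates *)

Definition mixrow R (A Y A' : 'M[R]_(k, n)) (j : nat) : 'M[R]_(k, n) :=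
  \matrix_(i, l) (if (i < j)%N then A' i l else if i == j :> nat then Y i l else A i l).

(** For A' = A + t Y: the difference plk A' - plk A, divided by t in a way that makes sense at
    t = 0: the determinants are multilinear in the rows, and the difference is
    telescoped row by row. For t = 0 this is the derivative of plk at A in the
    direction Y. *)
Definition Tel R (A Y A' : 'M[R]_(k, n)) : 'rV[R]_N := \sum_(j < k) plk (mixrow A Y A' j).

Lemma plk_row_linear R (A B C : 'M[R]_(k, n)) (j : 'I_k) b c :
  row j A = b *: row j B + c *: row j C ->
  (forall i, i != j -> row i B = row i A) -> (forall i, i != j -> row i C = row i A) ->
  plk A = b *: plk B + c *: plk C.
Proof.
move=> E EB EC; apply/rowP => i; rewrite !mxE.
have H (D : 'M[R]_(k, n)) f : (forall i, i != j -> row i D = row i A) ->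
    row' j (colsub f D) = row' j (colsub f A).
  move=> ED; apply/matrixP => a b'; rewrite !mxE.
  have ja : lift j a != j by rewrite eq_sym neq_lift.
  by have /rowP/(_ (f b')) := ED _ ja; rewrite !mxE.
apply: (determinant_multilinear (i0 := j)); [|exact: H|exact: H].
by apply/rowP => a; have /rowP/(_ ((enum_val i : {ffun 'I_k -> 'I_n}) a)) := E; rewrite !mxE.
Qed.

Lemma Tel_diff R (A A' : 'M[R]_(k, n)) : Tel A (A' - A) A' = plk A' - plk A.
Proof.
pose M j : 'M[R]_(k, n) := \matrix_(i, l) (if (i < j)%N then A' i l else A i l).
suff H j : (j <= k)%N -> plk (M j) - plk (M 0%N) =
    \sum_(i < j) plk (mixrow A (A' - A) A' i).
  have := H k (leqnn k).
  have -> : M k = A' by apply/matrixP => i l; rewrite mxE ltn_ord.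
  by have -> : M 0%N = A by apply/matrixP => i l; rewrite mxE.
elim: j => [|j IH] jk; first by rewrite subrr big_ord0.
rewrite big_ord_recr /= -IH ?(ltnW jk) // addrAC; congr (_ - _).
have -> : plk (M j.+1) = 1 *: plk (M j) + 1 *: plk (mixrow A (A' - A) A' j).
  apply: (@plk_row_linear _ _ _ _ (Ordinal jk)).
  - by apply/rowP => l; rewrite !mxE /= ltnn ltnSn eqxx; ring.
  - move=> i; rewrite -val_eqE /= => ij; apply/rowP => l.
    by rewrite !mxE [(i < j.+1)%N]ltnS [(i <= j)%N]leq_eqVlt (negbTE ij).
  - move=> i; rewrite -val_eqE /= => ij; apply/rowP => l.
    by rewrite !mxE [(i < j.+1)%N]ltnS [(i <= j)%N]leq_eqVlt (negbTE ij).
by rewrite !scale1r.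
Qed.

Lemma Tel_map (R S : comNzRingType) (f : {rmorphism R -> S}) (A Y A' : 'M[R]_(k, n)) :
  Tel (map_mx f A) (map_mx f Y) (map_mx f A') = map_mx f (Tel A Y A').
Proof.
rewrite /Tel raddf_sum; apply: eq_bigr => j _; rewrite /= -plk_map; congr plk.
by apply/matrixP => i l; rewrite !mxE; case: ltnP => // _; case: eqP.
Qed.

Lemma Tel_lin R (A Y Y' A' : 'M[R]_(k, n)) b c :
  Tel A (b *: Y + c *: Y') A' = b *: Tel A Y A' + c *: Tel A Y' A'.
Proof.
rewrite /Tel !scaler_sumr -big_split; apply: eq_bigr => j _ /=.
apply: (@plk_row_linear _ _ _ _ j); first by apply/rowP => l; rewrite !mxE ltnn eqxx.
  by move=> i ij; apply/rowP => l; rewrite !mxE; case: ltnP => // _; rewrite val_eqE (negbTE ij).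
by move=> i ij; apply/rowP => l; rewrite !mxE; case: ltnP => // _; rewrite val_eqE (negbTE ij).
Qed.

Lemma TelZ R (A Y A' : 'M[R]_(k, n)) c : Tel A (c *: Y) A' = c *: Tel A Y A'.
Proof. by have := Tel_lin A Y Y A' c 0; rewrite !scale0r !addr0. Qed.

Lemma Tel_scale R s (A Y A' : 'M[R]_(k, n)) :
  Tel (s *: A) Y (s *: A') = s ^+ k.-1 *: Tel A Y A'.
Proof.
rewrite /Tel scaler_sumr; apply: eq_bigr => j _.
pose D : 'M[R]_k := diag_mx (\row_i (if i == j then 1 else s)).
have -> : mixrow (s *: A) Y (s *: A') j = D *m mixrow A Y A' j.
  apply/matrixP => i l; rewrite mul_diag_mx !mxE; case: (ltngtP i j) => ij.
  - by rewrite ifN // -val_eqE /= (ltn_eqF ij).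
  - by rewrite ifN // -val_eqE /= (gtn_eqF ij).
  - by rewrite ifT ?mul1r // -val_eqE /= ij.
rewrite plk_mul det_diag; congr (_ *: _); rewrite (bigD1 j) //= mxE eqxx mul1r.
rewrite (eq_bigr (fun=> s)); last by move=> i ij; rewrite mxE (negbTE ij).
by rewrite prodr_const cardC1 card_ord.
Qed.

(** Increments transverse to the columns of an identity block can be read off the
    Pluecker coordinates. For t invertible this is [Tel_diff]; in general, t is
    replaced by a variable, which can be cancelled. *)
Lemma Lmat_Tel (R : idomainType) (f : {ffun _ -> _}) (A Y : 'M[R]_(k, n)) t :
  colsub f A = 1%:M -> colsub f Y = 0 -> Lmat f (Tel A Y (A + t *: Y)) = Y.
Proof.
move=> A1 Y0; pose pA := map_mx (@polyC R) A; pose pY := map_mx (@polyC R) Y.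
have col1 : colsub f (pA + 'X *: pY) = 1%:M.
  apply/matrixP => i l; have /matrixP/(_ i l) := A1; have /matrixP/(_ i l) := Y0.
  by rewrite !mxE => -> ->; rewrite rmorph0 mulr0 addr0 rmorph_nat.
have col2 : colsub f pA = 1%:M.
  apply/matrixP => i l; have /matrixP/(_ i l) := A1.
  by rewrite !mxE => ->; rewrite rmorph_nat.
have E : Lmat f (Tel pA pY (pA + 'X *: pY)) = pY.
  have H : Lmat f ('X *: Tel pA pY (pA + 'X *: pY)) = 'X *: pY.
    rewrite -TelZ; have := Tel_diff pA (pA + 'X *: pY); rewrite addrC addKr => ->.
    by rewrite LmatB !Lmat_plk1 // [pA + _]addrC addrK.
  have X0 : 'X != 0 :> {poly R} by rewrite polyX_eq0.
  apply/matrixP => i l; apply: (mulfI X0).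
  by move: H; rewrite LmatZ => /matrixP/(_ i l); rewrite !mxE.
have ev (M : 'M[R]_(k, n)) : map_mx (horner_eval t) (map_mx (@polyC R) M) = M.
  by apply/matrixP => i l; rewrite !mxE /= /horner_eval hornerC.
have := congr1 (map_mx (horner_eval t)) E; rewrite -Lmat_map -Tel_map.
have -> : map_mx (horner_eval t) (pA + 'X *: pY) = A + t *: Y.
  by apply/matrixP => i l; rewrite !mxE /= /horner_eval !hornerE.
move=> H; apply: etrans (etrans H (ev Y)).
by congr (Lmat f (Tel _ _ _)); apply: esym (ev _).
Qed.

End Pluecker.

(** * The blow-up: equations and charts *)

Lemma free_plk_neq0 (K : fieldType) k n (A : 'M[K]_(k, n)) : row_free A -> plk A != 0.
Proof.
move=> fA; have fT : row_full A^T by rewrite /row_full mxrank_tr.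
pose f : {ffun 'I_k -> 'I_n} := fullrankfun fT.
have : lam f (plk A) != 0.
  rewrite lam_plk -det_tr; have := fullrowsub_unit fT.
  rewrite unitmxE unitfE; congr (\det _ != 0).
  by apply/matrixP => i j; rewrite !mxE.
by apply: contraNneq => ->; rewrite /lam mul0mx mxE.
Qed.

Lemma grassmannian_normal (K : fieldType) k n (x : 'rV[K]_#|increasing k n|) :
  grassmannian K k n x -> exists (i : 'I_#|increasing k n|) A c,
    [/\ colsub (enum_val i : {ffun 'I_k -> 'I_n}) A = 1%:M, c != 0 & x = c *: plk A].
Proof.
move=> [A [c [fA c0 ->]]]; have [i] := rowP_neq0 (free_plk_neq0 fA).
rewrite mxE; set f : 'I_k -> 'I_n := fun_of_fin _ => d0.
have u : colsub f A \in unitmx by rewrite unitmxE unitfE.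
exists i, (invmx (colsub f A) *m A), (c * \det (colsub f A)).
rewrite mulf_neq0 // -mulmx_colsub mulVmx //; split=> //.
by rewrite plueckerE plk_mul scalerA det_inv mulfK.
Qed.

Lemma mxZE (R : pzRingType) a b d (M : 'M[R]_(a, b)) i j : (d *: M) i j = d * M i j.
Proof. by rewrite mxE. Qed.

Lemma mxBE (R : pzRingType) a b (M M' : 'M[R]_(a, b)) i j : (M - M') i j = M i j - M' i j.
Proof. by rewrite !mxE. Qed.

Lemma usubmx_rscale (R : comNzRingType) r N (c : 'I_(1 + r) -> R) (w : 'M[R]_(1 + r, N)) :
  usubmx (rscale c w) = c (lshift r 0) *: usubmx w.
Proof. by apply/matrixP => i j; rewrite !ord1 !mxE. Qed.

Lemma row_rscale (R : comNzRingType) m N (c : 'I_m -> R) (w : 'M[R]_(m, N)) i :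
  row i (rscale c w) = c i *: row i w.
Proof. by apply/rowP => j; rewrite !mxE. Qed.

Lemma map_idrm (K : fieldType) a b (M : 'M[K]_(a, b)) : map_mx (idrm K) M = M.
Proof. by apply/matrixP => i j; rewrite mxE. Qed.

Section Universal.
Variables (K : fieldType) (s N : nat).

Definition pevm (R : comNzRingType) (io : {rmorphism K -> R}) (w : 'M[R]_(s, N)) :
  {rmorphism mpolyM K s N -> R} :=
  GRing.RMorphism.clone _ _ (mmap io (fun l => mxvec w 0 l)) _.

Lemma pevmE (R : comNzRingType) (io : {rmorphism K -> R}) w p : pevm io w p = pev io w p.
Proof. by []. Qed.

Definition mpolyCm : {rmorphism K -> mpolyM K s N} :=
  GRing.RMorphism.clone _ _ (@mpolyC (s * N) K) _.

Lemma pevm_C (R : comNzRingType) (io : {rmorphism K -> R}) w c :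
  pevm io w (mpolyCm c) = io c.
Proof. exact: mmapC. Qed.

(** The point whose coordinates are the variables. Expressions that make sense at
    every point, such as [incr], become polynomials by evaluation at it. *)
Definition univ : 'M[mpolyM K s N]_(s, N) := \matrix_(i, j) pX K i j.

Lemma pevm_univ (R : comNzRingType) (io : {rmorphism K -> R}) w :
  map_mx (pevm io w) univ = w.
Proof. by apply/matrixP => i j; rewrite !mxE pevmE pev_pX. Qed.

Lemma map_pevm_C (R : comNzRingType) (io : {rmorphism K -> R}) w a b (M : 'M[K]_(a, b)) :
  map_mx (pevm io w) (map_mx mpolyCm M) = map_mx io M.
Proof. by apply/matrixP => i j; rewrite !mxE pevm_C. Qed.

End Universal.

Section Blowup.
Variables (K : closedFieldType) (k n r : nat).
Notation N := #|increasing k n|.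
Variables (idx : 'I_r -> 'I_N) (Aa : 'I_r -> 'M[K]_(k, n)) (Gam : 'I_r -> 'rV[K]_N).
Notation I a := (enum_val (idx a) : {ffun 'I_k -> 'I_n}).
Hypothesis k_gt0 : (0 < k)%N.
Hypothesis Aa1 : forall a, colsub (I a) (Aa a) = 1%:M.
Hypothesis GamE : forall a, exists2 c, c != 0 & Gam a = c *: plk (Aa a).
Hypothesis Gam_inj : forall a b, a != b -> ~~ (Gam a == Gam b)%MS.
Notation G := (grassmannian K k n).
Notation X := (blowup G Gam).

(** The projection from the a-th center. *)
Definition cok a : 'M[K]_N := locked (cokermx (Gam a)).

Lemma plk_idx (R : comNzRingType) i (A : 'M[R]_(k, n)) :
  colsub (enum_val i : {ffun 'I_k -> 'I_n}) A = 1%:M -> plk A 0 i = 1.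
Proof. by move=> E; rewrite mxE E det1. Qed.

Lemma cok_eq0 a (x : 'rV[K]_N) : (x *m cok a == 0) = (x <= Gam a)%MS.
Proof. by rewrite submxE /cok -lock. Qed.

Lemma plk_cok a : plk (Aa a) *m cok a = 0.
Proof.
have [c c0 E] := GamE a; apply: (scalerI c0); rewrite scaler0 scalemxAl -E.
by apply/eqP; rewrite cok_eq0.
Qed.

Lemma Gam_ncok a b : a != b -> plk (Aa a) *m cok b != 0.
Proof.
move=> ab; rewrite cok_eq0; apply/negP => sub; have [c c0 E] := GamE a.
have sab : (Gam a <= Gam b)%MS by rewrite E scalemx_sub.
have := Gam_inj ab; rewrite sab /=; apply/negP; rewrite negbK.
have /sub_rVP[d E2] := sab; have d0 : d != 0.
  apply: contraNneq c0 => d0; move: E; rewrite E2 d0 scale0r => /rowP/(_ (idx a)).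
  by rewrite mxE [RHS]mxE plk_idx // mulr1 => <-.
by rewrite E2 (eqmx_scale _ d0).
Qed.

(** The hyperplane where the coordinate idx a vanishes is a complement of the line
    of Gam a, so the projection from Gam a is injective on it. *)
Lemma split_exists a : exists mu : 'M[K]_N, forall v : 'rV[K]_N,
  v 0 (idx a) = 0 -> v *m cok a *m mu = v.
Proof.
pose P : 'M[K]_N := 1%:M - delta_mx (idx a) (0 : 'I_1) *m plk (Aa a).
have GP : Gam a *m P = 0.
  have [c c0 ->] := GamE a; rewrite -scalemxAl mulmxBr mulmx1 mulmxA -colE.
  have -> : col (idx a) (plk (Aa a)) = 1%:M.
    by apply/matrixP => i j; rewrite !ord1 mxE plk_idx // mxE eqxx.
  by rewrite mul1mx subrr scaler0.
have : (P^T <= (cok a)^T)%MS.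
  have sub : ((cok a)^T <= kermx (Gam a)^T)%MS.
    apply/sub_kermxP; rewrite -trmx_mul; apply/eqP; rewrite -trmx0 (inj_eq trmx_inj).
    by rewrite cok_eq0.
  have : ((cok a)^T == kermx (Gam a)^T)%MS.
    rewrite -(geq_leqif (mxrank_leqif_eq sub)) mxrank_ker !mxrank_tr /cok -lock.
    by rewrite mxrank_coker.
  move=> /andP[_]; apply: submx_trans; apply/sub_kermxP.
  by rewrite -trmx_mul GP trmx0.
move=> /submxP[D /(congr1 trmx)]; rewrite trmx_mul !trmxK => PE; exists D^T => v v0.
rewrite -mulmxA -PE mulmxBr mulmx1 mulmxA -colE.
have -> : col (idx a) v = 0 by apply/matrixP => i j; rewrite !ord1 !mxE.
by rewrite mul0mx subr0.
Qed.

(** Inverts the projection from the center, on the hyperplane where the coordinate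
    idx a vanishes. *)
Definition mu a : 'M[K]_N := projT1 (choice split_exists) a.
Lemma muP a (v : 'rV[K]_N) : v 0 (idx a) = 0 -> v *m cok a *m mu a = v.
Proof. by rewrite /mu; case: choice => m /= H; apply: H. Qed.

(** ** Equations *)

Section Equations.
Variables (R : comNzRingType) (io : {rmorphism K -> R}) (w : 'M[R]_(1 + r, N)).
Let x := usubmx w.
Let y a := row (rshift 1 a) w.

(** The four families of equations satisfied on the graph, as functions of a point
    w over any K-algebra: the Pluecker relations; the proportionality of the a-th
    component with the projection from Gam a; the expression of the a-th component
    by the increment; the vanishing of the block of the increment in the columns I
    a. *)
Definition eqn1 i j : R := x 0 i * plk (Lmat (enum_val i) x) 0 j - x 0 i ^+ k * x 0 j.
Definition eqn2 a l l' : R := y a 0 l * (x *m map_mx io (cok a)) 0 l' -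
  y a 0 l' * (x *m map_mx io (cok a)) 0 l.

(** The tangent direction at the center, as a matrix Y with zero block in the
    columns I a, computed from the a-th component of a point of the blow-up. On the
    graph it is proportional to the difference between the normalized matrix of the
    point and [Aa a], see [graph_incr]. *)
Definition incr a : 'M[R]_(k, n) := Lmat (I a) (y a *m map_mx io (mu a)).

(** Written so that it stays nontrivial over the center, where the projection of
    the first component vanishes: there it says that the a-th component is the
    projection of a derivative of the Pluecker embedding. *)
Definition eqn3 a l : R := x 0 (idx a) ^+ k * y a 0 l - x 0 (idx a) *
  (Tel (x 0 (idx a) *: map_mx io (Aa a)) (incr a) (Lmat (I a) x) *m map_mx io (cok a)) 0 l.
Definition eqn4 a i i' : R := incr a i (I a i').
End Equations.

Section Natural.
Variables (R S : comNzRingType) (io : {rmorphism K -> R}) (io' : {rmorphism K -> S}).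
Variables (f : {rmorphism R -> S}) (w : 'M[R]_(1 + r, N)).
Hypothesis fio : forall c, f (io c) = io' c.

Lemma map_io a b (M : 'M[K]_(a, b)) : map_mx f (map_mx io M) = map_mx io' M.
Proof. by apply/matrixP => i j; rewrite !mxE fio. Qed.

Lemma eqn1_map i j : f (eqn1 w i j) = eqn1 (map_mx f w) i j.
Proof.
rewrite /eqn1 -map_usubmx -/(Lmat _ _) Lmat_map plk_map !mxE.
by rewrite rmorphB !rmorphM rmorphXn.
Qed.

Lemma eqn2_map a l l' : f (eqn2 io w a l l') = eqn2 io' (map_mx f w) a l l'.
Proof.
rewrite /eqn2 -map_usubmx -(map_io (cok a)) -map_mxM -map_row.
by rewrite ![map_mx f _ _ _]mxE rmorphB !rmorphM.
Qed.

Lemma incr_map a : map_mx f (incr io w a) = incr io' (map_mx f w) a.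
Proof. by rewrite /incr -(map_io (mu a)) -map_row -map_mxM Lmat_map. Qed.

Lemma eqn3_map a l : f (eqn3 io w a l) = eqn3 io' (map_mx f w) a l.
Proof.
rewrite /eqn3 -map_usubmx -(map_io (cok a)) -(map_io (Aa a)) -incr_map Lmat_map.
rewrite ![map_mx f (usubmx w) 0 _]mxE -map_mxZ Tel_map -map_mxM -map_row.
by rewrite ![map_mx f _ _ _]mxE rmorphB !rmorphM rmorphXn.
Qed.

Lemma eqn4_map a i i' : f (eqn4 io w a i i') = eqn4 io' (map_mx f w) a i i'.
Proof. by rewrite /eqn4 -incr_map [RHS]mxE. Qed.
End Natural.

Lemma prod_deg (c : 'I_(1 + r) -> K) (i j : 'I_(1 + r)) al be :
  \prod_l c l ^+ (al * (l == i) + be * (l == j))%N = c i ^+ al * c j ^+ be.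
Proof.
under eq_bigr do rewrite exprD; rewrite big_split /=.
have H a i0 : \prod_l c l ^+ (a * (l == i0)) = c i0 ^+ a.
  rewrite (bigD1 i0) //= eqxx muln1 big1 ?mulr1 // => l /negbTE->.
  by rewrite muln0 expr0.
by rewrite !H.
Qed.

(** The blow-up is the closure of the graph. *)
Lemma blowup_equation (p : mpolyM K (1 + r) N) d : mhomog d p ->
  (forall x, G x -> (forall a, ~~ (x <= Gam a)%MS) -> mevalM p (graph_pt Gam x) = 0) ->
  forall z, X z -> mevalM p z = 0.
Proof.
move=> hp H z Xz; have cZ := zclosed_zero hp.
suff [] : [set z | ppoint z /\ mevalM p z = 0] z by [].
apply: (zclosure_min cZ _ Xz) => w [x [Gx nx] <-]; split; last exact: H.
  apply: ppointP => i; case: (splitP i) => [j ij|j ij].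
    have -> : i = lshift r j by apply: val_inj.
    have [A [c [fA c0 xE]]] := Gx.
    have : x != 0 by rewrite xE scaler_eq0 negb_or c0 free_plk_neq0.
    by move=> /rowP_neq0[l xl]; exists l; rewrite col_mxEu ord1.
  have -> : i = rshift 1 j by apply: val_inj.
  have /rowP_neq0[l xl] : x *m cok j != 0 by rewrite cok_eq0 nx.
  by exists l; rewrite col_mxEd mxE; move: xl; rewrite /cok -lock.
Qed.

(** Naturality in the base ring: what makes an expression a polynomial in the
    coordinates. *)
Definition transfer (p : forall (R : comNzRingType) (io : {rmorphism K -> R}), 'M[R]_(1 + r, N) -> R) :=
  forall (R S : comNzRingType) (io : {rmorphism K -> R}) (io' : {rmorphism K -> S})
    (f : {rmorphism R -> S}) (w : 'M[R]_(1 + r, N)),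
    (forall c, f (io c) = io' c) -> f (p R io w) = p S io' (map_mx f w).

Section GenericEquation.
Variables (C : set 'M[K]_(1 + r, N)) (F : fieldType) (io : {rmorphism K -> F}).
Variable xi : 'M[F]_(1 + r, N).
Hypotheses (gxi : generic_point io xi C) (CX : C `<=` X).

(** A natural and bihomogeneous expression is a form, obtained by evaluating it at
    [univ]. If it vanishes on the graph, it vanishes on the blow-up, so at the
    generic points of its subvarieties. *)
Lemma generic_equation (p : forall (R : comNzRingType) (io : {rmorphism K -> R}),
    'M[R]_(1 + r, N) -> R) (i j : 'I_(1 + r)) al be :
  transfer p ->
  (forall c z, p K (idrm K) (rscale c z) = c i ^+ al * c j ^+ be * p K (idrm K) z) ->
  (forall x, G x -> (forall a, ~~ (x <= Gam a)%MS) -> p K (idrm K) (graph_pt Gam x) = 0) ->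
  p F io xi = 0.
Proof.
move=> tp hp H; pose P := p _ (mpolyCm K (1 + r) N) (univ K (1 + r) N).
have PE (R : comNzRingType) (ir : {rmorphism K -> R}) w : pev ir w P = p R ir w.
  by rewrite -pevmE (tp _ _ _ ir) ?pevm_univ // => c; apply: pevm_C.
have hP : mhomog (fun l => al * (l == i) + be * (l == j))%N P.
  by apply: mhomog_criterion => c z; rewrite prod_deg !mevalM_pev !PE hp.
have [_ /(_ _ _ hP) [_ H2]] := gxi; rewrite -PE; apply: H2 => z /CX.
by apply: (blowup_equation hP) => x Gx nx; rewrite mevalM_pev PE H.
Qed.

Let x := usubmx xi.
Let y a := row (rshift 1 a) xi.

Lemma graph_usubmx (v : 'rV[K]_N) : usubmx (graph_pt Gam v) = v.
Proof. exact: col_mxKu. Qed.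
Lemma graph_row (v : 'rV[K]_N) a : row (rshift 1 a) (graph_pt Gam v) = v *m cok a.
Proof. by rewrite /cok -lock; apply/rowP => l; rewrite mxE col_mxEd mxE. Qed.

Lemma xi_plk i : x 0 i *: plk (Lmat (enum_val i) x) = x 0 i ^+ k *: x.
Proof.
apply/rowP => j; rewrite [LHS]mxE [RHS]mxE; apply/eqP; rewrite -subr_eq0; apply/eqP.
pose o : 'I_(1 + r) := lshift r 0.
apply: (@generic_equation (fun R _ w => eqn1 w i j) o o k.+1 0).
- by move=> R S io1 io2 f w E; apply: eqn1_map.
- move=> c z; rewrite /eqn1 usubmx_rscale LmatZ plkZ expr0 mulr1 [plk]lock !mxE -lock.
  move: (c o) => t; rewrite exprMn exprS mulrBr; congr (_ - _).
    by move: (t ^+ k) => u; ring.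
  by move: (t ^+ k) => u; ring.
move=> v [A [c [fA c0 ->]]] _; rewrite /eqn1 graph_usubmx.
have /rowP/(_ j) := plk_Lmat i c A; rewrite [LHS]mxE [RHS]mxE => ->; exact: subrr.
Qed.

Lemma xi_row a l l' : y a 0 l * (x *m map_mx io (cok a)) 0 l' =
  y a 0 l' * (x *m map_mx io (cok a)) 0 l.
Proof.
apply/eqP; rewrite -subr_eq0; apply/eqP.
pose o : 'I_(1 + r) := lshift r 0.
apply: (@generic_equation (fun R io w => eqn2 io w a l l') o (rshift 1 a) 1 1).
- by move=> R S io1 io2 f w E; apply: eqn2_map.
- move=> c z; rewrite /eqn2 usubmx_rscale row_rscale -!scalemxAl !expr1.
  rewrite !mxZE; move: (row _ z) (usubmx z *m _) (c _) (c _) => M M' t t'.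
  by move: (M 0 l) (M 0 l') (M' 0 l) (M' 0 l') => *; ring.
move=> v _ _; rewrite /eqn2 graph_usubmx graph_row map_idrm; ring.
Qed.

Lemma incr_rscale c (z : 'M[K]_(1 + r, N)) a :
  incr (idrm K) (rscale c z) a = c (rshift 1 a) *: incr (idrm K) z a.
Proof. by rewrite /incr row_rscale -scalemxAl LmatZ. Qed.

(** On the graph, away from the points where the coordinate idx a vanishes, the
    increment is the deviation from the normalized matrix of the center. *)
Lemma graph_incr v a : G v -> v 0 (idx a) != 0 ->
  let A := (v 0 (idx a))^-1 *: Lmat (I a) v in
  [/\ colsub (I a) A = 1%:M, v = v 0 (idx a) *: plk A &
    incr (idrm K) (graph_pt Gam v) a = v 0 (idx a) *: (A - Aa a)].
Proof.
move=> Gv v0 A; have vE : v = v 0 (idx a) *: plk A.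
  have [A' [c [_ c0 vA]]] := Gv; have := plk_Lmat (idx a) c A'; rewrite -vA plkZ => E.
  have ek : v 0 (idx a) ^+ k != 0 by rewrite expf_neq0.
  rewrite scalerA; apply: (scalerI ek); rewrite -E !scalerA; congr (_ *: _).
  by rewrite exprVn mulrCA mulfV ?mulr1.
have A1 : colsub (I a) A = 1%:M.
  have [A' [c [_ c0 vA]]] := Gv.
  have d0 : \det (colsub (I a) A') != 0.
    by apply: contraNneq v0 => E; rewrite vA !mxE E mulr0.
  rewrite /A vA LmatZ Lmat_plk !mxE !scalerA invfM mulrC mulrA mulfV // mul1r.
  apply/matrixP => i j; rewrite !mxE; have /matrixP/(_ i j) := mul_adj_mx (colsub (I a) A').
  rewrite !mxE => E.
  have -> : \sum_j0 (\adj (colsub (I a) A')) i j0 * A' j0 (I a j) = \det (colsub (I a) A') *+ (i == j).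
    by rewrite -E; apply: eq_bigr => b _; rewrite !mxE.
  by rewrite -mulr_natr mulrA mulVf // mul1r.
split=> //; rewrite /incr graph_row map_idrm {1}vE.
have -> : v 0 (idx a) *: plk A *m cok a = (v 0 (idx a) *: (plk A - plk (Aa a))) *m cok a.
  by rewrite -!scalemxAl mulmxBl plk_cok subr0.
rewrite muP; last by rewrite mxZE mxBE !plk_idx // subrr mulr0.
by rewrite LmatZ LmatB !Lmat_plk1.
Qed.

Lemma xi_incr a l : x 0 (idx a) ^+ k * y a 0 l = x 0 (idx a) *
  (Tel (x 0 (idx a) *: map_mx io (Aa a)) (incr io xi a) (Lmat (I a) x) *m map_mx io (cok a)) 0 l.
Proof.
apply/eqP; rewrite -subr_eq0; apply/eqP.
pose o : 'I_(1 + r) := lshift r 0.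
apply: (@generic_equation (fun R io w => eqn3 io w a l) o (rshift 1 a) k 1).
- by move=> R S io1 io2 f w E; apply: eqn3_map.
- move=> c z; rewrite /eqn3 usubmx_rscale row_rscale incr_rscale LmatZ TelZ.
  rewrite !map_idrm [(_ *: usubmx z) 0 _]mxE -scalerA Tel_scale -!scalemxAl.
  have kS (t : K) : t ^+ k = t * t ^+ k.-1 by rewrite -exprS prednK.
  rewrite !mxZE exprMn -/o expr1 [c o ^+ k]kS.
  by move: ((_ *m cok a) 0 l) (row (rshift 1 a) z 0 l) (c (rshift 1 a)) => u u' e; ring.
move=> v Gv nv; rewrite /eqn3 graph_usubmx !map_idrm.
have [->|v0] := eqVneq (v 0 (idx a)) 0; first by rewrite expr0n eqn0Ngt k_gt0 /= !mul0r subrr.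
have [A1 vE ->] := graph_incr Gv v0; set A := _ *: Lmat _ _ in A1 vE *.
have -> : Lmat (I a) v = v 0 (idx a) *: A by rewrite /A scalerA mulfV // scale1r.
rewrite TelZ Tel_scale Tel_diff graph_row {2}vE -!scalemxAl mulmxBl plk_cok subr0.
have kS (t : K) : t ^+ k = t * t ^+ k.-1 by rewrite -exprS prednK.
by rewrite !mxZE kS; move: ((plk A *m cok a) 0 l) => t; ring.
Qed.

Lemma xi_incr_block a : colsub (I a) (incr io xi a) = 0.
Proof.
apply/matrixP => i i'; rewrite [LHS]mxE [RHS]mxE.
apply: (@generic_equation (fun R io w => eqn4 io w a i i') (rshift 1 a) (rshift 1 a) 1 0).
- by move=> R S io1 io2 f w E; apply: eqn4_map.
- by move=> c z; rewrite /eqn4 incr_rscale mxE expr1 expr0 mulr1.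

move=> v Gv nv; rewrite /eqn4; have [v0|v0] := eqVneq (v 0 (idx a)) 0; last first.
  have [A1 vE ->] := graph_incr Gv v0; have /matrixP/(_ i i') := A1.
  have /matrixP/(_ i i') := Aa1 a; rewrite !mxE => -> ->.
  by rewrite subrr mulr0.
rewrite /incr graph_row !map_idrm muP //.
have [A [c [fA c0 vE]]] := Gv; rewrite vE LmatZ Lmat_plk mxE.
have /eqP := v0; rewrite vE !mxE mulf_eq0 (negbTE c0) /= => /eqP d0.
have /matrixP/(_ i i') := mul_adj_mx (colsub (I a) A); rewrite d0 !mxE mul0rn => E.
suff -> : \sum_j (\adj (colsub (I a) A)) i j * A j (I a i') = 0 by rewrite mulr0.
by rewrite -[RHS]E; apply: eq_bigr => b _; rewrite !mxE.
Qed.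

End GenericEquation.
End Blowup.

(** ** Independence of the homogeneous coordinates *)

Section Saturation.
Variables (K : closedFieldType) (s N : nat) (X : set 'M[K]_(s, N)) (LB : line_bundle X).
Notation opn := (@lb_open K s N X LB).
Notation trn := (@lb_trans K s N X LB).
Hypothesis cX : zclosed X.

Lemma rscaleK (R : fieldType) (c : 'I_s -> R) (z : 'M[R]_(s, N)) : (forall i, c i != 0) ->
  rscale (fun i => (c i)^-1) (rscale c z) = z.
Proof. by move=> c0; apply/matrixP => i j; rewrite !mxE mulKf. Qed.

Lemma closed_rscale_iff (Z : set 'M[K]_(s, N)) (c : 'I_s -> K) z : zclosed Z -> (forall i, c i != 0) ->
  Z (rscale c z) <-> Z z.
Proof.
move=> cZ c0; split=> [H|]; last exact: zclosed_rscale.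
rewrite -(rscaleK z c0); apply: (zclosed_rscale cZ _ H) => i; by rewrite invr_eq0.
Qed.

(** Closed sets, hence the open sets and transition functions of a bundle, do not
    depend on the homogeneous coordinates chosen. *)
Lemma opn_rscale i (c : 'I_s -> K) z : (forall i, c i != 0) -> opn i (rscale c z) <-> opn i z.
Proof.
move=> c0; have [UX cU] := @lb_openP _ _ _ _ LB i.
have H w : opn i w <-> X w /\ ~ (X `\` opn i) w.
  split=> [Uw|[Xw nw]]; first by split; [apply: UX|case].
  by apply: contrapT => nU; apply: nw.
by rewrite !H !closed_rscale_iff.
Qed.

Lemma trn_rscale i j (c : 'I_s -> K) z : (forall i, c i != 0) -> opn i z -> opn j z ->
  trn i j (rscale c z) = trn i j z.
Proof.
move=> c0 Ui Uj.
have [d [p [q [Z [hp hq cZ nZ H]]]]] := @lb_regular _ _ _ _ LB i j z (conj Ui Uj).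
have [_ ->] := H z (conj Ui Uj) nZ.
have Uc : (opn i `&` opn j) (rscale c z) by split; apply/opn_rscale.
have [|_ ->] := H _ Uc; first by rewrite closed_rscale_iff.
rewrite !(mhomogE _ _ hp) !(mhomogE _ _ hq); apply: frac_scale.
by apply/prodf_neq0 => l _; rewrite expf_neq0.
Qed.

End Saturation.

(** ** Polynomials as functions of matrices *)

Section MatrixEval.
Variables (K : closedFieldType) (k n : nat).

(** A polynomial in k n variables, as a function of a matrix. *)
Definition evA (R : comNzRingType) (io : {rmorphism K -> R}) (A : 'M[R]_(k, n)) :
  {rmorphism tower K (k * n) -> R} := ev io (wpt A) (k * n).

(** A polynomial in one more variable t, which is the outermost one, as a function
    of t and of a matrix. *)
Definition evB (R : comNzRingType) (io : {rmorphism K -> R}) (t : R) (Y : 'M[R]_(k, n)) :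
  {rmorphism tower K (k * n).+1 -> R} := ev io (upd (wpt Y) (k * n) t) (k * n).+1.

Lemma wpt_map (R S : comNzRingType) (f : {rmorphism R -> S}) a b (A : 'M[R]_(a, b)) i :
  (i < a * b)%N -> wpt (map_mx f A) i = f (wpt A i).
Proof. by move=> im; rewrite (wptE _ (Ordinal im)) (wptE A (Ordinal im)) -map_mxvec mxE. Qed.

Section Map.
Variables (R S : comNzRingType) (io : {rmorphism K -> R}) (io' : {rmorphism K -> S}).
Variables (f : {rmorphism R -> S}).
Hypothesis fio : forall c, f (io c) = io' c.

Lemma evA_map A P : f (evA io A P) = evA io' (map_mx f A) P.
Proof.
rewrite /evA ev_comp; apply: eq_ev_io => [c|i im]; first exact: fio.
by rewrite wpt_map.
Qed.

Lemma evB_map t Y P : f (evB io t Y P) = evB io' (f t) (map_mx f Y) P.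
Proof.
rewrite /evB ev_comp; apply: eq_ev_io => [c|i im]; first exact: fio.
rewrite /= /upd; case: eqP im => // /eqP ne; rewrite ltnS leq_eqVlt (negbTE ne) /= => im.
by rewrite wpt_map.
Qed.
End Map.

Definition varA m : 'M[tower K m]_(k, n) := \matrix_(i, l) towX K m (mxvec_index i l).

Lemma evA_var (R : comNzRingType) (io : {rmorphism K -> R}) A :
  map_mx (evA io A) (varA (k * n)) = A.
Proof. by apply/matrixP => i l; rewrite !mxE /evA evX ?ltn_ord // wptE mxvecE. Qed.

Lemma evB_var (R : comNzRingType) (io : {rmorphism K -> R}) t Y :
  map_mx (evB io t Y) (varA (k * n).+1) = Y.
Proof.
apply/matrixP => i l; rewrite !mxE /evB evX; last by rewrite ltnS ltnW.
by rewrite /upd ltn_eqF ?ltn_ord // wptE mxvecE.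
Qed.

Lemma evB_t (R : comNzRingType) (io : {rmorphism K -> R}) t Y :
  evB io t Y (towX K (k * n).+1 (k * n)) = t.
Proof. by rewrite /evB evX // /upd eqxx. Qed.

Lemma evB_poly (R : comNzRingType) (io : {rmorphism K -> R}) t Y (P : tower K (k * n).+1) :
  evB io t Y P = (map_poly (evA io Y) P).[t].
Proof. exact: ev_upd. Qed.

Definition matm (R : Type) (c : nat -> R) : 'M[R]_(k, n) := \matrix_(i, l) c (mxvec_index i l).

Lemma wpt_matm (R : comNzRingType) (c : nat -> R) i : (i < k * n)%N -> wpt (matm c) i = c i.
Proof.
move=> im; rewrite (wptE _ (Ordinal im)).
suff H : forall o : 'I_(k * n), mxvec (matm c) 0 o = c o by rewrite H.
by case/mxvec_indexP => a b; rewrite mxvecE mxE.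
Qed.

Lemma ev_matm (R : comNzRingType) (io : {rmorphism K -> R}) c P :
  ev io c (k * n) P = evA io (matm c) P.
Proof. by apply: eq_ev => i im; rewrite wpt_matm. Qed.

Lemma ev_matmB (R : comNzRingType) (io : {rmorphism K -> R}) c P :
  ev io c (k * n).+1 P = evB io (c (k * n)%N) (matm c) P.
Proof.
apply: eq_ev => i; rewrite ltnS leq_eqVlt /upd; case: eqP => [->//|_] /= im.
by rewrite wpt_matm.
Qed.

Lemma evA_eq (P Q : tower K (k * n)) :
  (forall A, evA (idrm K) A P = evA (idrm K) A Q) -> P = Q.
Proof. by move=> H; apply: tower_eq => c; rewrite (ev_matm _ c P) (ev_matm _ c Q). Qed.

Lemma evB_eq (P Q : tower K (k * n).+1) :
  (forall t Y, evB (idrm K) t Y P = evB (idrm K) t Y Q) -> P = Q.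
Proof. by move=> H; apply: tower_eq => c; rewrite (ev_matmB _ c P) (ev_matmB _ c Q). Qed.

Lemma evA_nonzero (P : tower K (k * n)) : P != 0 -> exists A, evA (idrm K) A P != 0.
Proof. by move=> /tower_nonzero[c]; rewrite ev_matm; exists (matm c). Qed.

Lemma evB_nonzero (P : tower K (k * n).+1) : P != 0 -> exists t Y, evB (idrm K) t Y P != 0.
Proof. by move=> /tower_nonzero[c]; rewrite ev_matmB => ?; exists (c (k * n)%N), (matm c). Qed.

End MatrixEval.

Section RowForm.
Variables (r N : nat) (R : Type).
Implicit Type v : 'I_r -> 'rV[R]_N.

Definition stack (u : 'rV[R]_N) v : 'M[R]_(1 + r, N) := col_mx u (\matrix_(a < r) v a).

Lemma stack_u u v : usubmx (stack u v) = u.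
Proof. exact: col_mxKu. Qed.

Lemma stack_row u v a : row (rshift 1 a) (stack u v) = v a.
Proof. by apply/rowP => l; rewrite mxE col_mxEd mxE. Qed.

Lemma stack_ext (w w' : 'M[R]_(1 + r, N)) : usubmx w = usubmx w' ->
  (forall a, row (rshift 1 a) w = row (rshift 1 a) w') -> w = w'.
Proof.
move=> E H; apply/matrixP => i l; case: (splitP i) => [j ij|a ia].
  have -> : i = lshift r 0 by apply: val_inj; rewrite /= ij [j]ord1.
  by have /rowP/(_ l) := E; rewrite !mxE.
have -> : i = rshift 1 a by apply: val_inj.
by have /rowP/(_ l) := H a; rewrite !mxE.
Qed.
End RowForm.

Lemma row_u (R : Type) r N (M : 'M[R]_(1 + r, N)) : row (lshift r (0 : 'I_1)) M = usubmx M.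
Proof. by apply/rowP => l; rewrite !mxE. Qed.

Lemma row_cases r (i : 'I_(1 + r)) : i = lshift r (0 : 'I_1) \/ exists a, i = rshift 1 a.
Proof.
case: (splitP i) => [j ij|a ia]; [left|right; exists a]; apply: val_inj => //=.
by rewrite ij [j]ord1.
Qed.

Lemma ppoint_stack (K : closedFieldType) r N (z : 'M[K]_(1 + r, N)) : usubmx z != 0 ->
  (forall a, row (rshift 1 a) z != 0) -> ppoint z.
Proof.
move=> u0 v0 i; case: (splitP i) => [j ij|a ia].
  have -> : i = lshift r 0 by apply: val_inj; rewrite /= ij [j]ord1.
  by apply: contraNneq u0 => /rowP E; apply/eqP/rowP => l; have := E l; rewrite !mxE.
by have -> : i = rshift 1 a by apply: val_inj.
Qed.

Lemma ppoint_u (K : closedFieldType) r N (z : 'M[K]_(1 + r, N)) : ppoint z -> usubmx z != 0.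
Proof.
move=> /(_ (lshift r 0)); apply: contraNneq => /rowP E; apply/eqP/rowP => l.
by have := E l; rewrite !mxE.
Qed.

(** ** The charts *)

Section Charts.
Variables (K : closedFieldType) (k n r : nat).
Notation N := #|increasing k n|.
Variables (idx : 'I_r -> 'I_N) (Aa : 'I_r -> 'M[K]_(k, n)) (Gam : 'I_r -> 'rV[K]_N).
Notation I a := (enum_val (idx a) : {ffun 'I_k -> 'I_n}).
Hypothesis k_gt0 : (0 < k)%N.
Hypothesis Aa1 : forall a, colsub (I a) (Aa a) = 1%:M.
Hypothesis GamE : forall a, exists2 c, c != 0 & Gam a = c *: plk (Aa a).
Hypothesis Gam_inj : forall a b, a != b -> ~~ (Gam a == Gam b)%MS.
Notation G := (grassmannian K k n).
Notation X := (blowup G Gam).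
Notation cok := (cok Gam).
Notation idK := (idrm K).

(** The first chart: a matrix is sent to its row space, as a point of the graph. *)
Definition gr (R : comNzRingType) (io : {rmorphism K -> R}) (A : 'M[R]_(k, n)) :
    'M[R]_(1 + r, N) :=
  stack (plk A) (fun a => plk A *m map_mx io (cok a)).

(** The chart around the exceptional divisor over the b-th center: (t, Y) is sent
    to the row space of A_b + t Y, with the b-th component divided by t. For t = 0
    it parametrizes the divisor by the tangent direction Y. *)
Definition ch b (R : comNzRingType) (io : {rmorphism K -> R}) (t : R) (Y : 'M[R]_(k, n)) :
    'M[R]_(1 + r, N) :=
  let A := map_mx io (Aa b) + t *: Y in
  stack (plk A) (fun a =>
    (if a == b then Tel (map_mx io (Aa b)) Y A else plk A) *m map_mx io (cok a)).

Section Map.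
Variables (R S : comNzRingType) (io : {rmorphism K -> R}) (io' : {rmorphism K -> S}).
Variables (f : {rmorphism R -> S}).
Hypothesis fio : forall c, f (io c) = io' c.

Lemma gr_map A : map_mx f (gr io A) = gr io' (map_mx f A).
Proof.
apply: stack_ext => [|a]; first by rewrite -map_usubmx !stack_u plk_map.
by rewrite -map_row !stack_row map_mxM plk_map (map_io fio).
Qed.

Lemma ch_map b t Y : map_mx f (ch b io t Y) = ch b io' (f t) (map_mx f Y).
Proof.
apply: stack_ext => [|a].
  by rewrite -map_usubmx !stack_u -plk_map map_mxD map_mxZ (map_io fio).
rewrite -map_row !stack_row map_mxM (map_io fio); congr (_ *m _).
by case: ifP => _; rewrite -?Tel_map -?plk_map map_mxD map_mxZ !(map_io fio).
Qed.
End Map.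

(** The scaling by t of the component in which [ch] and [gr] differ. *)
Definition rowsc (R : comNzRingType) (b : 'I_r) (t : R) (i : 'I_(1 + r)) : R :=
  if i == rshift 1 b then t else 1.

Lemma map_plk_cok (R : comNzRingType) (io : {rmorphism K -> R}) b :
  plk (map_mx io (Aa b)) *m map_mx io (cok b) = 0.
Proof. by rewrite plk_map -map_mxM plk_cok // map_mx0. Qed.

Lemma ch_gr b (R : comNzRingType) (io : {rmorphism K -> R}) t Y :
  rscale (rowsc b t) (ch b io t Y) = gr io (map_mx io (Aa b) + t *: Y).
Proof.
apply: stack_ext => [|a].
  by rewrite usubmx_rscale !stack_u /rowsc eq_lrshift scale1r.
rewrite row_rscale !stack_row /rowsc eq_rshift; case: eqP => [->|_]; last by rewrite scale1r.
have := Tel_diff (map_mx io (Aa b)) (map_mx io (Aa b) + t *: Y).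
have -> : map_mx io (Aa b) + t *: Y - map_mx io (Aa b) = t *: Y by rewrite addrC addKr.
by rewrite TelZ => E; rewrite scalemxAl E mulmxBl map_plk_cok subr0.
Qed.

Lemma gr_graph (A : 'M[K]_(k, n)) : gr idK A = graph_pt Gam (plk A).
Proof.
apply: stack_ext => [|a]; first by rewrite stack_u graph_usubmx.
by rewrite stack_row graph_row map_idrm.
Qed.

Lemma graph_ppoint x : G x -> (forall a, ~~ (x <= Gam a)%MS) -> ppoint (graph_pt Gam x).
Proof.
move=> [A [c [fA c0 xE]]] nx; apply: ppoint_stack => [|a].
  by rewrite graph_usubmx xE scaler_eq0 negb_or c0 free_plk_neq0.
by rewrite graph_row cok_eq0.
Qed.

Lemma zclosed_blowup : zclosed X.
Proof. by apply: zclosureP => w [x [Gx nx] <-]; apply: graph_ppoint. Qed.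

Lemma gr_X (A : 'M[K]_(k, n)) : ppoint (gr idK A) -> X (gr idK A).
Proof.
move=> pA; have u0 := ppoint_u pA; rewrite stack_u in u0.
rewrite gr_graph; apply: sub_zclosure; exists (plk A) => //; split=> [|a].
  exists A, 1; rewrite oner_eq0 plueckerE scale1r; split=> //.
  exact: plk_neq0_free.
by have := pA (rshift 1 a); rewrite stack_row map_idrm cok_eq0.
Qed.

(** ** The charts as matrices of polynomials *)

Definition Psi0 : 'M[tower K (k * n)]_(1 + r, N) := gr (towC K (k * n)) (varA K k n (k * n)).

Definition PsiB b : 'M[tower K (k * n).+1]_(1 + r, N) :=
  ch b (towC K (k * n).+1) (towX K (k * n).+1 (k * n)) (varA K k n (k * n).+1).

Lemma evA_Psi0 (R : comNzRingType) (io : {rmorphism K -> R}) A :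
  map_mx (evA io A) Psi0 = gr io A.
Proof. by rewrite (@gr_map _ _ _ io) ?evA_var // => c; apply: evC. Qed.

Lemma evB_PsiB b (R : comNzRingType) (io : {rmorphism K -> R}) t Y :
  map_mx (evB io t Y) (PsiB b) = ch b io t Y.
Proof. by rewrite (@ch_map _ _ _ io) ?evB_var ?evB_t // => c; apply: evC. Qed.

Lemma chart_at_gr c : chart_at Psi0 c = gr idK (matm k n c).
Proof.
rewrite -evA_Psi0; apply/matrixP => i l; rewrite !mxE; exact: ev_matm.
Qed.

Lemma chart_at_ch b c : chart_at (PsiB b) c = ch b idK (c (k * n)%N) (matm k n c).
Proof.
rewrite -evB_PsiB; apply/matrixP => i l; rewrite !mxE; exact: ev_matmB.
Qed.

Lemma rowsc_neq0 b (t : K) i : t != 0 -> rowsc b t i != 0.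
Proof. by move=> t0; rewrite /rowsc; case: ifP => // _; apply: oner_neq0. Qed.

Lemma ppoint_rscale_iff (c : 'I_(1 + r) -> K) (z : 'M[K]_(1 + r, N)) :
  (forall i, c i != 0) -> ppoint (rscale c z) <-> ppoint z.
Proof. by move=> c0; apply: closed_rscale_iff c0; apply: zclosedT. Qed.

Lemma matm_upd (Y : 'M[K]_(k, n)) t : matm k n (upd (wpt Y) (k * n) t) = Y.
Proof.
apply/matrixP => i l; rewrite mxE /upd ltn_eqF ?ltn_ord //.
by rewrite wptE mxvecE.
Qed.

(** The points with t = 0 are limits of points with t nonzero, where the chart
    agrees with [gr]: an open set around the former contains some of the latter. *)
Lemma ch_X b t (Y : 'M[K]_(k, n)) : ppoint (ch b idK t Y) -> X (ch b idK t Y).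
Proof.
have nz t' Y' : t' != 0 -> ppoint (ch b idK t' Y') -> X (ch b idK t' Y').
  move=> t0 pc; have c0 i : rowsc b t' i != 0 by apply: rowsc_neq0.
  apply/(closed_rscale_iff _ zclosed_blowup c0); rewrite ch_gr; apply: gr_X.
  by rewrite -ch_gr; apply/ppoint_rscale_iff.
have [->|t0] := eqVneq t 0; last exact: nz.
move=> pc; apply: contrapT => nX; pose c0 := upd (wpt Y) (k * n) 0.
have cE : chart_at (PsiB b) c0 = ch b idK 0 Y.
  by rewrite chart_at_ch matm_upd /c0 /upd eqxx.
have [||h hc H] := @avoid_open _ _ _ _ (PsiB b) X c0 zclosed_blowup.
- by rewrite cE.
- by rewrite cE.
move: hc; rewrite ev_matmB matm_upd evB_poly; set p := map_poly _ _ => p0.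
have q0 : p * 'X != 0.
  rewrite mulf_neq0 ?polyX_eq0 //; apply: contraNneq p0 => ->; by rewrite horner0.
have [s] := closed_nonroot q0; rewrite hornerM hornerX mulf_eq0 negb_or => /andP[ps s0].
have [|pc' nX'] := H (upd (wpt Y) (k * n) s).
  by rewrite ev_matmB matm_upd evB_poly {1}/upd eqxx.
move: pc' nX'; rewrite chart_at_ch matm_upd {1 2}/upd eqxx => pc' []; exact: nz.
Qed.

End Charts.

(** * Nowhere vanishing functions *)

Section NoRoots.
Variable K : closedFieldType.
Implicit Types (p n d : {poly K}).

Lemma noroot_const p : (forall s, p.[s] != 0) -> exists2 c, c != 0 & p = c%:P.
Proof.
move=> H; have sp : (size p <= 1)%N.
  by rewrite leqNgt; apply/negP => /closed_root[c pc]; have := H c; rewrite pc eqxx.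
exists p`_0; last exact: size1_polyC.
by have := H 0; rewrite horner_coef0.
Qed.

Lemma factor_X p a : p != 0 -> exists m q, q.[a] != 0 /\ p = q * ('X - a%:P) ^+ m.
Proof. by move=> p0; have [m [q]] := multiplicity_XsubC p a; rewrite p0 /= => qa E; exists m, q. Qed.

Lemma noroot_monomial p : (forall t, t != 0 -> p.[t] != 0) ->
  exists e c, c != 0 /\ p = c *: 'X^e.
Proof.
move=> H; have p0 : p != 0.
  by apply: contraNneq (H 1 (oner_neq0 _)) => ->; rewrite horner0.
have [m [q [q0 E]]] := factor_X 0 p0; have [s|c c0 qE] := @noroot_const q.
  have [->//|s0] := eqVneq s 0; have := H s s0; rewrite E hornerM mulf_eq0 negb_or.
  by move=> /andP[].
by exists m, c; rewrite E qE subr0 mul_polyC.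
Qed.

(** The rational function n / d has neither zero nor pole at s. *)
Definition unit_ratio_at n d s := exists a b, [/\ a.[s] != 0, b.[s] != 0 & n * a = b * d].

(** Common roots can be divided out, and there are no others. *)
Lemma unit_ratio_const n d : (forall s, unit_ratio_at n d s) -> n != 0 ->
  exists2 c, c != 0 & n = c *: d.
Proof.
have [m sm] := ubnP (size n); elim: m => // m IH in n d sm *; move=> H n0.
have [[s ns]|/forallNP nr] := pselect (exists s, n.[s] = 0); last first.
  have [|c c0 nE] := @noroot_const n; first by move=> s; apply/eqP.
  have [|c' c'0 dE] := @noroot_const d.
    move=> s; have [a [b [a0 b0 /(congr1 (horner^~ s))]]] := H s.
    rewrite !hornerM => E; apply: contraNneq a0 => ds; move/eqP: E.
    by rewrite ds mulr0 mulf_eq0 => /orP[/eqP/nr|].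
  exists (c / c'); first by rewrite mulf_neq0 ?invr_eq0.
  by rewrite nE dE -mul_polyC -polyCM divfK.
have [q nE] : exists q, n = q * ('X - s%:P).
  by have /factor_theorem := introT rootP ns.
have ds : d.[s] = 0.
  have [a [b [a0 b0 /(congr1 (horner^~ s))]]] := H s.
  by rewrite !hornerM ns mul0r => /esym/eqP; rewrite mulf_eq0 (negbTE b0) => /eqP.
have [q' dE] : exists q', d = q' * ('X - s%:P).
  by have /factor_theorem := introT rootP ds.
have X0 : 'X - s%:P != 0 by rewrite polyXsubC_eq0.
have q0 : q != 0 by apply: contraNneq n0 => E; rewrite nE E mul0r.
have [|s'|//|c c0 qE] := IH q q'.
- by move: sm; rewrite nE size_Mmonic ?monicXsubC // size_XsubC addn2.
- have [a [b [a0 b0 E]]] := H s'; exists a, b; split=> //.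
  by apply: (mulIf X0); rewrite -mulrA [a * _]mulrC mulrA -nE E dE mulrA.
by exists c => //; rewrite nE dE qE scalerAl.
Qed.

Lemma unit_ratio_eq n d : (forall s, unit_ratio_at n d s) ->
  forall s s', n.[s] * d.[s'] = n.[s'] * d.[s].
Proof.
move=> H s s'; have [n0|n0] := eqVneq n 0.
  by rewrite n0 !horner0 !mul0r.
have [c c0 ->] := unit_ratio_const H n0; rewrite !hornerZ; ring.
Qed.

Lemma unit_ratio_monomial n d : n != 0 -> d != 0 ->
  (forall s, s != 0 -> unit_ratio_at n d s) ->
  exists e e' c, c != 0 /\ 'X^e' * n = c *: ('X^e * d).
Proof.
move=> n0 d0 H; have [e [n1 [n10 nE]]] := factor_X 0 n0.
have [e' [d1 [d10 dE]]] := factor_X 0 d0.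
rewrite subr0 in nE dE.
have n1n0 : n1 != 0 by apply: contraNneq n0 => E; rewrite nE E mul0r.
have [s|//|c c0 E] := @unit_ratio_const n1 d1; last first.
  by exists e, e', c; rewrite nE dE E -!scalerAl; split=> //; rewrite -scalerAr; congr (_ *: _); ring.
have [->|s0] := eqVneq s 0; first by exists d1, n1.
have [a [b [a0 b0 Eab]]] := H s s0; exists (a * 'X^e), (b * 'X^e').
rewrite !hornerM !hornerXn !mulf_neq0 ?expf_neq0 //; split=> //.
by move: Eab; rewrite nE dE => Eab; rewrite -[RHS]mulrA [_ * d1]mulrC -Eab; ring.
Qed.

(** A polynomial in t with coefficients depending on parameters, and without zeros
    t <> 0 for general values of the parameters, is a monomial in t: two nonzero
    coefficients would both be nonzero for general parameters. *)
Lemma monomial_coef m (Phi : {poly tower K m}) (h : tower K m) : h != 0 ->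
  (forall c t, ev (idrm K) c m h != 0 -> t != 0 ->
     (map_poly (ev (idrm K) c m) Phi).[t] != 0) ->
  exists e C, Phi = C *: 'X^e.
Proof.
move=> h0 H; exists (size Phi).-1, (lead_coef Phi); apply/polyP => i.
rewrite coefZ coefXn; have [->|ne] := eqVneq; first by rewrite mulr1.
rewrite mulr0; apply/eqP/negPn/negP => Pi.
have P0 : lead_coef Phi != 0.
  by rewrite lead_coef_eq0; apply: contraNneq Pi => ->; rewrite coef0.
have [c] := tower_nonzero (mulf_neq0 h0 (mulf_neq0 Pi P0)).
rewrite !rmorphM !mulf_eq0 !negb_or => /andP[hc /andP[Pic lc]].
have [|e [a [a0 E]]] := @noroot_monomial (map_poly (ev (idrm K) c m) Phi).
  by move=> t; apply: H.
have := congr1 (fun p : {poly K} => p`_i) E.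
have := congr1 (fun p : {poly K} => p`_(size Phi).-1) E.
rewrite !coef_map !coefZ !coefXn /= => E1 E2.
move: Pic lc; rewrite /lead_coef E1 E2; have [ie|] := eqVneq i e; last by rewrite mulr0 eqxx.
by move: ne; rewrite ie eq_sym => /negbTE->; rewrite mulr0 eqxx.
Qed.

End NoRoots.

(** ** Functions of invertible matrices depending on the determinant only *)

Section DetOnly.
Variables (K : fieldType) (V : Type).

(** A matrix that is joined to the identity by an affine line of matrices of
    determinant 1. Functions without zeros are constant on such a line. *)
Definition unip k (E : 'M[K]_k) : Prop := forall s, \det (1%:M + s *: (E - 1%:M)) = 1.

Definition unip_invariant k (h : 'M[K]_k -> V) : Prop := forall B1 B2 E,
  \det B1 != 0 -> \det B2 != 0 -> unip E -> h (B1 *m E *m B2) = h (B1 *m B2).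

Lemma unip_u k (u : 'rV[K]_k) : @unip (1 + k) (block_mx 1%:M u 0 1%:M).
Proof.
move=> s; have -> : 1%:M + s *: (block_mx 1%:M u 0 1%:M - 1%:M) =
    block_mx (1%:M : 'M[K]_1) (s *: u) 0 1%:M.
  rewrite (scalar_mx_block 1 k 1) opp_block_mx add_block_mx scale_block_mx add_block_mx.
  by rewrite !subrr !subr0 !scaler0 !addr0 ?add0r.
by rewrite det_ublock !det1 mulr1.
Qed.

Lemma unip_l k (v : 'cV[K]_k) : @unip (1 + k) (block_mx 1%:M 0 v 1%:M).
Proof.
move=> s; have -> : 1%:M + s *: (block_mx 1%:M 0 v 1%:M - 1%:M) =
    block_mx (1%:M : 'M[K]_1) 0 (s *: v) 1%:M.
  rewrite (scalar_mx_block 1 k 1) opp_block_mx add_block_mx scale_block_mx add_block_mx.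
  by rewrite !subrr !subr0 !scaler0 !addr0 ?add0r.
by rewrite det_lblock !det1 mulr1.
Qed.

Lemma unip_left k (h : 'M[K]_k -> V) E B : unip_invariant h -> \det B != 0 -> unip E ->
  h (E *m B) = h B.
Proof. by move=> hi B0 uE; have := hi 1%:M B E; rewrite det1 oner_neq0 !mul1mx => ->. Qed.

Lemma unip_right k (h : 'M[K]_k -> V) E B : unip_invariant h -> \det B != 0 -> unip E ->
  h (B *m E) = h B.
Proof. by move=> hi B0 uE; have := hi B 1%:M E; rewrite det1 oner_neq0 !mulmx1 => ->. Qed.

Lemma unip_det k (E : 'M[K]_k) : unip E -> \det E = 1.
Proof. by move=> /(_ 1); rewrite scale1r addrC subrK. Qed.

(** Unipotent row and column operations clear the first row and the first column. *)
Lemma unip_reduce k (h : 'M[K]_(1 + k.+1) -> V) B : unip_invariant h -> \det B != 0 ->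
  exists B1, \det B1 = \det B /\ h B = h (block_mx 1%:M 0 0 B1).
Proof.
move=> hi; rewrite -(submxK B); move: (ulsubmx B) (ursubmx B) (dlsubmx B) (drsubmx B).
move=> b u v D.
(* the lower left block can be made nonzero, then the upper left one equal to 1 *)
have s3 b' u' v' D' : b' = 1%:M -> \det (block_mx b' u' v' D') != 0 ->
    exists B1, \det B1 = \det (block_mx b' u' v' D') /\
      h (block_mx b' u' v' D') = h (block_mx 1%:M 0 0 B1).
  move=> -> d0; pose L := block_mx (1%:M : 'M[K]_1) 0 (- v') (1%:M : 'M[K]_k.+1).
  pose R := block_mx (1%:M : 'M[K]_1) (- u') 0 (1%:M : 'M[K]_k.+1).
  have E : L *m block_mx 1%:M u' v' D' *m R = block_mx 1%:M 0 0 (D' - v' *m u').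
    have -> : L *m block_mx 1%:M u' v' D' = block_mx 1%:M u' 0 (D' - v' *m u').
      rewrite /L mulmx_block !mul1mx !mul0mx !addr0 mulmx1 addNr mulNmx.
      by rewrite [- _ + D']addrC.
    by rewrite /R mulmx_block !mul1mx !mulmx1 !mul0mx !mulmx0 !addr0 addNr add0r.
  have dE : \det (L *m block_mx 1%:M u' v' D') = \det (block_mx 1%:M u' v' D').
    by rewrite det_mulmx (unip_det (unip_l _)) mul1r.
  exists (D' - v' *m u'); rewrite -E unip_right ?dE //; last exact: unip_u.
  rewrite unip_left //; last exact: unip_l.
  split=> //; have := congr1 determinant E.
  by rewrite det_mulmx dE (unip_det (unip_u _)) mulr1 det_ublock det1 mul1r => ->.
have s2 b' u' v' D' : v' != 0 -> \det (block_mx b' u' v' D') != 0 ->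
    exists B1, \det B1 = \det (block_mx b' u' v' D') /\
      h (block_mx b' u' v' D') = h (block_mx 1%:M 0 0 B1).
  move=> v0 d0; have [i vi] : exists i, v' i 0 != 0.
    have : v'^T != 0 by rewrite -trmx0 (inj_eq trmx_inj).
    by move=> /rowP_neq0[i]; rewrite mxE; exists i.
  pose rho : 'rV[K]_k.+1 := ((1 - b' 0 0) / v' i 0) *: delta_mx 0 i.
  have E : block_mx 1%:M rho 0 1%:M *m block_mx b' u' v' D' =
      block_mx (b' + rho *m v') (u' + rho *m D') v' D'.
    by rewrite mulmx_block !mul1mx !mul0mx !add0r.
  have dE : \det (block_mx (b' + rho *m v') (u' + rho *m D') v' D') =
      \det (block_mx b' u' v' D').
    by rewrite -E det_mulmx (unip_det (unip_u _)) mul1r.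
  have [||B1 [dB1 hB1]] := s3 (b' + rho *m v') (u' + rho *m D') v' D'.
  - rewrite [b']mx11_scalar [rho *m v']mx11_scalar -scalemxAl -rowE !mxE -raddfD /=.
    by congr (_%:M); rewrite mulfVK // subrKC.
  - by rewrite dE.
  exists B1; rewrite dB1 dE -hB1 -E unip_left //; exact: unip_u.
move=> d0; have [v0|v0] := eqVneq v 0; last exact: s2.
have b0 : b 0 0 != 0.
  apply: contraNneq d0 => b0; rewrite v0 det_ublock; apply/eqP.
  by rewrite [b]mx11_scalar b0 det_scalar expr1 mul0r.
pose w : 'cV[K]_k.+1 := delta_mx 0 0.
have E : block_mx 1%:M 0 w 1%:M *m block_mx b u v D = block_mx b u (w *m b + v) (w *m u + D).
  by rewrite mulmx_block !mul1mx !mul0mx !addr0.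
have dE : \det (block_mx b u (w *m b + v) (w *m u + D)) = \det (block_mx b u v D).
  by rewrite -E det_mulmx (unip_det (unip_l _)) mul1r.
have [||B1 [dB1 hB1]] := s2 b u (w *m b + v) (w *m u + D).
- rewrite v0 addr0; apply: contraNneq b0 => /matrixP/(_ 0 0).
  by rewrite mxE big_ord1 !mxE eqxx mul1r => ->.
- by rewrite dE.
exists B1; rewrite dB1 dE -hB1 -E unip_left //; exact: unip_l.
Qed.

(** Row and column operations are unipotent, and reduce an invertible matrix to one
    that depends only on its determinant. *)
Lemma det_only k (h : 'M[K]_k -> V) : unip_invariant h ->
  forall B B', \det B != 0 -> \det B = \det B' -> h B = h B'.
Proof.
elim: k h => [|[|k] IH] h hi B B' d0 dE.
- by congr h; apply/matrixP => -[].
- congr h; move: dE; rewrite [B]mx11_scalar [B']mx11_scalar !det_scalar !expr1.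
  by move=> ->.
have [B1 [dB1 ->]] := @unip_reduce k h B hi d0.
have [|B1' [dB1' ->]] := @unip_reduce k h B' hi; first by rewrite -dE.
pose blk (M : 'M[K]_k.+1) : 'M[K]_(1 + k.+1) := block_mx 1%:M 0 0 M.
have blkM M M' : blk (M *m M') = blk M *m blk M'.
  by rewrite /blk mulmx_block !mul1mx !mul0mx !mulmx0 !addr0 !add0r.
have dblk M : \det (blk M) = \det M by rewrite det_ublock det1 mul1r.
apply: (IH (fun M => h (blk M))); last 2 first.
- by rewrite dB1.
- by rewrite dB1 dB1'.
move=> M1 M2 E d1 d2 uE; rewrite !blkM; apply: hi; rewrite ?dblk // => s.
have -> : 1%:M + s *: (blk E - 1%:M) = blk (1%:M + s *: (E - 1%:M)).
  rewrite /blk (scalar_mx_block 1 k.+1 1) opp_block_mx add_block_mx scale_block_mx.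
  by rewrite !subrr !scaler0 add_block_mx !addr0.
by rewrite dblk.
Qed.

End DetOnly.

(** * Line bundles on the blow-up *)

Section Bundle.
Variables (K : closedFieldType) (k n r : nat).
Notation N := #|increasing k n|.
Variables (idx : 'I_r -> 'I_N) (Aa : 'I_r -> 'M[K]_(k, n)) (Gam : 'I_r -> 'rV[K]_N).
Notation I a := (enum_val (idx a) : {ffun 'I_k -> 'I_n}).
Hypothesis k_gt0 : (0 < k)%N.
Hypothesis kn : (k.+1 < n)%N.
Hypothesis Aa1 : forall a, colsub (I a) (Aa a) = 1%:M.
Hypothesis GamE : forall a, exists2 c, c != 0 & Gam a = c *: plk (Aa a).
Hypothesis Gam_inj : forall a b, a != b -> ~~ (Gam a == Gam b)%MS.
Notation G := (grassmannian K k n).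
Notation X := (blowup G Gam).
Notation idK := (idrm K).
Notation T := (tower K (k * n)).
Notation Tb := (tower K (k * n).+1).
Notation gr := (gr Gam).
Notation ch := (ch Aa Gam).

(** ** Matrices avoiding the centers while one column varies *)

(** The row space of A has maximal dimension and is none of the centers, so that A
    gives a point of the graph. *)
Definition good (A : 'M[K]_(k, n)) : Prop := ppoint (gr idK A).

(** A condition under which A stays good when its l-th column varies arbitrarily.
    For general A it holds for all l at once, because k < n - 1: with one column
    removed, A still has rank k, and a row space different from those of the
    centers. In geometric terms, the locus to be avoided has codimension at least
    two. *)
Definition goodcol l (A : 'M[K]_(k, n)) : Prop :=
  row_free (col' l A) /\ forall a, ~~ (col' l A <= col' l (Aa a))%MS.

Lemma goodcol_good l A A' : goodcol l A -> col' l A' = col' l A -> good A'.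
Proof.
move=> [fA nA] E; rewrite -E in fA nA.
have f0 : row_free A'.
  rewrite -kermx_eq0; apply/eqP; have : kermx A' *m col' l A' = 0.
    rewrite -[col' l A']/(colsub (lift l) A') mulmx_colsub mulmx_ker.
    by apply/matrixP => i j; rewrite !mxE.
  by rewrite -[RHS](mul0mx _ (col' l A')) => /(row_free_inj fA).
apply: ppoint_stack => [|a]; first by rewrite stack_u free_plk_neq0.
rewrite stack_row map_idrm cok_eq0; apply: contraNN (nA a) => /sub_rVP[d].
have [c c0 ->] := GamE a; rewrite scalerA => E2.
have d0 : d * c != 0.
  by apply: contraNneq (free_plk_neq0 f0) => d0; rewrite E2 d0 scale0r.
have := Lmat_plk (I a) A'; rewrite E2 LmatZ Lmat_plk1 // => /(congr1 (mulmx (colsub (I a) A'))).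
rewrite mulmxA mul_mx_adj mul_scalar_mx -scalemxAr.
have -> : \det (colsub (I a) A') = d * c.
  by have /rowP/(_ (idx a)) := E2; rewrite mxE [RHS]mxE plk_idx // mulr1.
move=> /(scalerI d0) <-; rewrite -[col' l (_ *m _)]/(colsub (lift l) _).
by rewrite -mulmx_colsub submxMl.
Qed.

Definition avoid (l : 'I_n) (kn1 : (k <= n.-1)%N) (i : 'I_k) : 'I_n := lift l (widen_ord kn1 i).

(** Nonvanishing of a maximal minor without the l-th column, and of a product of a
    row of A with a vector orthogonal to the truncated rows of each center; such a
    vector exists because k < n - 1. *)
Lemma goodcol_open l : exists2 h : T, h != 0 & forall A, evA idK A h != 0 -> goodcol l A.
Proof.
have kn1 : (k <= n.-1)%N by move: kn; clear; lia.
have Hu a : exists u : 'cV[K]_n.-1, u != 0 /\ col' l (Aa a) *m u = 0.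
  have : kermx (col' l (Aa a))^T != 0.
    rewrite -mxrank_eq0 mxrank_ker mxrank_tr -lt0n subn_gt0.
    apply: leq_ltn_trans (rank_leq_row _) _; by move: kn; clear; lia.
  move=> /matrix0Pn[i [j uij]]; exists (row i (kermx (col' l (Aa a))^T))^T; split.
    apply: contraNneq uij => /matrixP/(_ j 0); by rewrite !mxE => ->.
  apply: trmx_inj; rewrite trmx_mul trmxK -row_mul mulmx_ker row0 trmx0 //.
have [u Hu'] := choice Hu; pose i0 : 'I_k := Ordinal k_gt0.
pose V := varA K k n (k * n).
pose m0 : T := \det (colsub (avoid l kn1) V).
pose ma a : T := (row i0 (col' l V) *m map_mx (towC K (k * n)) (u a)) 0 0.
have Em A : evA idK A m0 = \det (colsub (avoid l kn1) A).
  rewrite -det_map_mx; congr (\det _); rewrite -[in RHS](evA_var idK A).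
  by apply/matrixP => i j; rewrite !mxE.
have Ema A a : evA idK A (ma a) = (row i0 (col' l A) *m u a) 0 0.
  rewrite /ma mxE rmorph_sum mxE; apply: eq_bigr => j _.
  rewrite rmorphM !mxE; congr (_ * _); last by rewrite /evA evC.
  by rewrite /evA evX ?ltn_ord // wptE mxvecE.
exists (m0 * \prod_a ma a).
  rewrite mulf_neq0 //.
    have : evA idK (\matrix_(i, j) (j == avoid l kn1 i)%:R) m0 != 0.
      rewrite Em (_ : colsub _ _ = 1%:M) ?det1 ?oner_neq0 //.
      apply/matrixP => i j; rewrite !mxE (inj_eq (@lift_inj _ l)) -val_eqE /=.
      by rewrite eq_sym.
    by apply: contraNneq => ->; rewrite rmorph0.
  apply/prodf_neq0 => a _; have [/matrix0Pn[j [i1 uj]] _] := Hu' a.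
  rewrite !ord1 in uj.
  have : evA idK (\matrix_(i, b) (b == lift l j)%:R) (ma a) != 0.
    rewrite Ema mxE (bigD1 j) //= !mxE eqxx mul1r big1 ?addr0 //.
    by move=> b bj; rewrite !mxE (inj_eq (@lift_inj _ l)) (negbTE bj) mul0r.
  by apply: contraNneq => ->; rewrite rmorph0.
move=> A; rewrite rmorphM mulf_eq0 negb_or Em rmorph_prod => /andP[d0 /prodf_neq0 Ha].
split=> [|a].
  rewrite -kermx_eq0; apply/eqP; have u1 : colsub (avoid l kn1) A \in unitmx.
    by rewrite unitmxE unitfE.
  have : kermx (col' l A) *m colsub (avoid l kn1) A = 0.
    rewrite -[colsub _ _]/(colsub (lift l \o widen_ord kn1) A).
    rewrite (colsub_comp (lift l) (widen_ord kn1)) -/(col' l A) mulmx_colsub mulmx_ker.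
    by apply/matrixP => i j; rewrite !mxE.
  by move=> /(congr1 (mulmx^~ (invmx (colsub (avoid l kn1) A)))); rewrite mulmxK // mul0mx.
have [_ Eu] := Hu' a; have := Ha a isT; rewrite Ema; apply: contraNN => /submxP[D ->].
by rewrite row_mul -mulmxA Eu mulmx0 mxE.
Qed.

Lemma good_ex : exists A, good A.
Proof.
have n0 : (0 < n)%N by apply: leq_ltn_trans kn.
have [h h0 H] := goodcol_open (Ordinal n0); have [A hA] := evA_nonzero h0.
by exists A; apply: (goodcol_good (H A hA)).
Qed.

(** ** The two kinds of charts *)

Variable LB : line_bundle X.
Notation opn := (@lb_open K (1 + r) N X LB).
Notation trn := (@lb_trans K (1 + r) N X LB).
Let cX : zclosed X := zclosed_blowup Gam.

Definition W0 j A : Prop := ppoint (gr idK A) /\ opn j (gr idK A).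
Definition Wb b j t Y : Prop := ppoint (ch b idK t Y) /\ opn j (ch b idK t Y).

Lemma chart_open0 j c : chart_open (LB:=LB) (Psi0 Gam) j c <-> W0 j (matm k n c).
Proof. by rewrite /chart_open /= chart_at_gr. Qed.

Lemma chart_openb b j c :
  chart_open (LB:=LB) (PsiB Aa Gam b) j c <-> Wb b j (c (k * n)%N) (matm k n c).
Proof. by rewrite /chart_open /= chart_at_ch. Qed.

Lemma matm_wpt (A : 'M[K]_(k, n)) : matm k n (wpt A) = A.
Proof. by apply/matrixP => i l; rewrite mxE wptE mxvecE. Qed.

Lemma chartX0 c : ppoint (chart_at (Psi0 Gam) c) -> X (chart_at (Psi0 Gam) c).
Proof. by rewrite chart_at_gr; apply: gr_X. Qed.

Lemma chartXb b c : ppoint (chart_at (PsiB Aa Gam b) c) -> X (chart_at (PsiB Aa Gam b) c).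
Proof. by rewrite chart_at_ch; apply: (ch_X GamE). Qed.

Lemma W0_open j A : W0 j A -> exists2 h : T, evA idK A h != 0 &
  forall A', evA idK A' h != 0 -> W0 j A'.
Proof.
move=> WA; have : chart_open (LB:=LB) (Psi0 Gam) j (wpt A).
  by apply/chart_open0; rewrite matm_wpt.
move=> /(chart_open_open chartX0)[h h0 H]; exists h => // A' hA'.
by have /chart_open0 := H (wpt A') hA'; rewrite matm_wpt.
Qed.

Lemma W0_common i j A A' : W0 i A -> W0 j A' -> exists A1, W0 i A1 /\ W0 j A1.
Proof.
move=> /W0_open[h h0 H] /W0_open[h' h0' H'].
have /evA_nonzero[A1] : h * h' != 0.
  by rewrite mulf_neq0 //; [apply: contraNneq h0 => ->|apply: contraNneq h0' => ->];
    rewrite rmorph0.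
by rewrite rmorphM mulf_eq0 negb_or => /andP[/H ? /H' ?]; exists A1.
Qed.

Lemma gr_mul (R : comNzRingType) (io : {rmorphism K -> R}) (B : 'M[R]_k) A :
  gr io (B *m A) = rscale (fun=> \det B) (gr io A).
Proof.
apply: stack_ext => [|a]; first by rewrite usubmx_rscale !stack_u plk_mul.
by rewrite row_rscale !stack_row plk_mul scalemxAl.
Qed.

Lemma W0_mul j (B : 'M[K]_k) A : \det B != 0 -> W0 j (B *m A) <-> W0 j A.
Proof.
move=> d0; rewrite /W0 gr_mul ppoint_rscale_iff // (opn_rscale cX) //.
Qed.

Lemma Wb_W0 b j t Y : t != 0 -> Wb b j t Y <-> W0 j (Aa b + t *: Y).
Proof.
move=> t0; have c0 i : rowsc b t i != 0 by apply: rowsc_neq0.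
rewrite /Wb /W0 -{1 2}[Aa b](map_idrm (Aa b)) -(ch_gr GamE).
by rewrite ppoint_rscale_iff // (opn_rscale cX).
Qed.

(** ** Invariance under change of basis *)

Section Weight.
Variables (j : 'I_(lb_size LB)) (P : T).
Hypothesis HP : forall A, W0 j A -> evA idK A P != 0.
Variable A0 : 'M[K]_(k, n).
Hypothesis WA0 : W0 j A0.

(** Along the line from the identity to E, the function B |-> P (B A) has no zeros. *)
Lemma eval_unip A : W0 j A -> unip_invariant (fun B : 'M[K]_k => evA idK (B *m A) P).
Proof.
move=> WA B1 B2 E d1 d2 uE.
pose iop : {rmorphism K -> {poly K}} := GRing.RMorphism.clone _ _ (@polyC K) _.
pose M : 'M[{poly K}]_(k, n) := map_mx iop B1 *m (1%:M + 'X *: map_mx iop (E - 1%:M)) *m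
  map_mx iop B2 *m map_mx iop A.
pose p : {poly K} := evA iop M P.
have pE s : p.[s] = evA idK (B1 *m (1%:M + s *: (E - 1%:M)) *m B2 *m A) P.
  rewrite -[p.[s]]/(horner_eval s p) /p (@evA_map _ _ _ _ _ iop idK); last first.
    by move=> c; rewrite /= /horner_eval hornerC.
  have C a b (M' : 'M[K]_(a, b)) : map_mx (horner_eval s) (map_mx iop M') = M'.
    by apply/matrixP => x y; rewrite !mxE /= /horner_eval hornerC.
  congr (evA _ _ _); rewrite /M !map_mxM !C; congr (_ *m _ *m _ *m _).
  by rewrite map_mxD map_mx1 map_mxZ C /= /horner_eval hornerX.
have [s|c c0 pc] := @noroot_const _ p.
  by rewrite pE; apply: HP; apply/W0_mul => //; rewrite !det_mulmx uE mulr1 mulf_neq0.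
have := pE 0; have := pE 1; rewrite !pc !hornerC scale1r scale0r addr0 addrC subrK mulmx1.
by move=> <- <-.
Qed.

Definition diag1 (R : pzRingType) (t : R) : 'M[R]_k :=
  diag_mx (\row_i (if i == Ordinal k_gt0 then t else 1)).

Lemma det_diag1 (R : comPzRingType) (t : R) : \det (diag1 t) = t.
Proof.
rewrite det_diag (bigD1 (Ordinal k_gt0)) //= mxE eqxx big1 ?mulr1 // => i /negbTE ni.
by rewrite mxE ni.
Qed.

Lemma map_diag1 (R S : comNzRingType) (f : {rmorphism R -> S}) t :
  map_mx f (diag1 t) = diag1 (f t).
Proof.
rewrite /diag1 map_diag_mx; congr diag_mx; apply/rowP => i; rewrite !mxE.
by case: ifP => //; rewrite rmorph1.
Qed.

Lemma weight_diag : exists e, forall t A, evA idK (diag1 t *m A) P = t ^+ e * evA idK A P.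
Proof.
pose ioT := towC K (k * n).+1.
pose Phi : Tb := evA ioT (diag1 (towX K (k * n).+1 (k * n)) *m varA K k n (k * n).+1) P.
have PhiE t A : evB idK t A Phi = evA idK (diag1 t *m A) P.
  rewrite /Phi (@evA_map _ _ _ _ _ ioT idK); last by move=> c; apply: evC.
  by rewrite map_mxM map_diag1 evB_var evB_t.
have [h h0 H] := W0_open WA0.
have hn0 : h != 0 by apply: contraNneq h0 => ->; rewrite rmorph0.
have [|e [C PhiC]] := @monomial_coef K (k * n) Phi h hn0.
  move=> c t; rewrite (ev_matm _ c h) => /H Wc t0.
  have -> : map_poly (ev idK c (k * n)) (Phi : {poly T}) =
      map_poly (evA idK (matm k n c)) (Phi : {poly T}).
    by apply: eq_map_poly => Q; apply: ev_matm.
  rewrite -evB_poly PhiE; apply: HP; apply/W0_mul => //.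
  by rewrite det_diag1.
exists e => t A; rewrite -PhiE evB_poly PhiC map_polyZ map_polyXn hornerZ hornerXn mulrC.
have := PhiE 1 A; rewrite evB_poly PhiC map_polyZ map_polyXn hornerZ hornerXn expr1n mulr1 => ->.
congr (_ * evA _ _ _); rewrite -[RHS]mul1mx; congr (_ *m _).
by apply/matrixP => a b; rewrite !mxE; case: ifP.
Qed.

(** The trivializing section on the space of matrices is not invariant under change
    of basis, but since it has no zeros on an orbit of GL_k, it is multiplied by a
    power of the determinant. This exponent is, up to sign, the coefficient of the
    bundle along the hyperplane class. *)
Lemma weight_ex : exists e, forall (F : comNzRingType) (io : {rmorphism K -> F})
    (B : 'M[F]_k) A, evA io (B *m A) P = \det B ^+ e * evA io A P.
Proof.
have [e He] := weight_diag; exists e.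
have HK A B : W0 j A -> \det B != 0 -> evA idK (B *m A) P = \det B ^+ e * evA idK A P.
  move=> WA d0; rewrite -He; apply: (det_only (eval_unip WA)) => //.
  by rewrite det_diag1.
(* extend to all matrices by density, B and A being the blocks of a universal matrix *)
move=> F io B A; pose V := varA K k (k + n) (k * (k + n)).
pose ioV := towC K (k * (k + n)).
have PE (R : comNzRingType) (ir : {rmorphism K -> R}) (M : 'M[R]_(k, k + n)) Q :
    evA ir M (evA ioV (rsubmx V) Q) = evA ir (rsubmx M) Q.
  rewrite (@evA_map _ _ _ _ _ ioV ir) ?map_rsubmx ?evA_var // => c; exact: evC.
have PE2 (R : comNzRingType) (ir : {rmorphism K -> R}) (M : 'M[R]_(k, k + n)) Q :
    evA ir M (evA ioV (lsubmx V *m rsubmx V) Q) = evA ir (lsubmx M *m rsubmx M) Q.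
  rewrite (@evA_map _ _ _ _ _ ioV ir) ?map_mxM ?map_rsubmx ?map_lsubmx ?evA_var // => c.
  exact: evC.
have DE (R : comNzRingType) (ir : {rmorphism K -> R}) (M : 'M[R]_(k, k + n)) :
    evA ir M (\det (lsubmx V)) = \det (lsubmx M).
  by rewrite -det_map_mx map_lsubmx evA_var.
suff U : evA ioV (lsubmx V *m rsubmx V) P = \det (lsubmx V) ^+ e * evA ioV (rsubmx V) P.
  have := congr1 (evA io (row_mx B A)) U.
  by rewrite rmorphM rmorphXn PE PE2 DE row_mxKl row_mxKr.
have [h h0 H] := W0_open WA0.
have D0 : \det (lsubmx V) * evA ioV (rsubmx V) h != 0.
  have : evA idK (row_mx 1%:M A0) (\det (lsubmx V) * evA ioV (rsubmx V) h) != 0.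
    by rewrite rmorphM DE PE row_mxKl row_mxKr det1 mul1r.
  by apply: contraNneq => ->; rewrite rmorph0.
apply: (mulIf D0); apply: evA_eq => M; rewrite rmorphM [RHS]rmorphM.
have [->|] := eqVneq (evA idK M (\det (lsubmx V) * evA ioV (rsubmx V) h)) 0.
  by rewrite !mulr0.
rewrite rmorphM DE PE mulf_eq0 negb_or => /andP[d0 /H WM]; congr (_ * _).
by rewrite rmorphM rmorphXn PE PE2 DE HK.
Qed.

End Weight.

End Bundle.

(** ** Trivializations on the charts *)

Section BundleData.
Variables (K : closedFieldType) (k n r : nat).
Notation N := #|increasing k n|.
Variables (idx : 'I_r -> 'I_N) (Aa : 'I_r -> 'M[K]_(k, n)) (Gam : 'I_r -> 'rV[K]_N).
Notation I a := (enum_val (idx a) : {ffun 'I_k -> 'I_n}).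
Hypothesis k_gt0 : (0 < k)%N.
Hypothesis kn : (k.+1 < n)%N.
Hypothesis Aa1 : forall a, colsub (I a) (Aa a) = 1%:M.
Hypothesis GamE : forall a, exists2 c, c != 0 & Gam a = c *: plk (Aa a).
Notation G := (grassmannian K k n).
Notation X := (blowup G Gam).
Notation idK := (idrm K).
Notation T := (tower K (k * n)).
Notation Tb := (tower K (k * n).+1).
Notation gr := (gr Gam).
Notation ch := (ch Aa Gam).
Variable LB : line_bundle X.
Notation opn := (@lb_open K (1 + r) N X LB).
Notation trn := (@lb_trans K (1 + r) N X LB).
Notation J := 'I_(lb_size LB).
Notation W0 := (@W0 K k n r Gam LB).
Notation Wb := (@Wb K k n r Aa Gam LB).
Let cX : zclosed X := zclosed_blowup Gam.

Lemma trivial0 : exists P Q : J -> T,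
  (forall j A, W0 j A -> evA idK A (P j) != 0 /\ evA idK A (Q j) != 0) /\
  forall i j A, W0 i A -> W0 j A -> evA idK A (P i) * evA idK A (Q j) =
    trn i j (gr idK A) * evA idK A (P j) * evA idK A (Q i).
Proof.
have [|P [Q [H1 H2]]] := chart_trivial LB (@chartX0 K k n r Gam).
  have [A gA] := good_ex k_gt0 kn Aa1 GamE; exists (wpt A).
  by rewrite chart_at_gr matm_wpt.
exists P, Q; split=> [j A WA|i j A WA WA'].
  by apply: H1; apply/chart_open0; rewrite matm_wpt.
have := H2 i j (wpt A); rewrite chart_at_gr matm_wpt; apply.
  by apply/chart_open0; rewrite matm_wpt.
by apply/chart_open0; rewrite matm_wpt.
Qed.

Lemma trivialb b : exists P Q : J -> Tb,
  (forall j t Y, Wb b j t Y -> evB idK t Y (P j) != 0 /\ evB idK t Y (Q j) != 0) /\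
  forall i j t Y, Wb b i t Y -> Wb b j t Y -> evB idK t Y (P i) * evB idK t Y (Q j) =
    trn i j (ch b idK t Y) * evB idK t Y (P j) * evB idK t Y (Q i).
Proof.
have E t (Y : 'M[K]_(k, n)) : upd (wpt Y) (k * n) t (k * n)%N = t by rewrite /upd eqxx.
have [|P [Q [H1 H2]]] := chart_trivial LB (@chartXb K k n r Aa Gam GamE b).
  have [A gA] := good_ex k_gt0 kn Aa1 GamE; exists (upd (wpt (A - Aa b)) (k * n) 1).
  rewrite chart_at_ch matm_upd E.
  have c0 i : rowsc b (1 : K) i != 0 by apply: rowsc_neq0; apply: oner_neq0.
  by rewrite -(ppoint_rscale_iff _ c0) (ch_gr GamE) map_idrm scale1r addrC subrK.
exists P, Q; split=> [j t Y WA|i j t Y WA WA'].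
  by apply: H1; apply/chart_openb; rewrite matm_upd E.
have := H2 i j (upd (wpt Y) (k * n) t); rewrite chart_at_ch matm_upd E; apply.
  by apply/chart_openb; rewrite matm_upd E.
by apply/chart_openb; rewrite matm_upd E.
Qed.

Variables (P0 Q0 : J -> T).
Hypothesis PQ0 : forall j A, W0 j A -> evA idK A (P0 j) != 0 /\ evA idK A (Q0 j) != 0.
Hypothesis PQ0g : forall i j A, W0 i A -> W0 j A ->
  evA idK A (P0 i) * evA idK A (Q0 j) =
    trn i j (gr idK A) * evA idK A (P0 j) * evA idK A (Q0 i).

Definition active j : Prop := exists A, W0 j A.

(** The differences e j - e' j do not depend on j, the transition functions being
    invariant under change of basis. *)
Lemma weights : exists e e' : J -> nat,
  (forall j, active j -> forall (F : comNzRingType) (io : {rmorphism K -> F}) (B : 'M[F]_k) A,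
     evA io (B *m A) (P0 j) = \det B ^+ e j * evA io A (P0 j) /\
     evA io (B *m A) (Q0 j) = \det B ^+ e' j * evA io A (Q0 j)) /\
  (forall i j, active i -> active j -> (e i + e' j = e j + e' i)%N).
Proof.
have H j : exists ee : nat * nat, active j ->
    forall (F : comNzRingType) (io : {rmorphism K -> F}) (B : 'M[F]_k) A,
     evA io (B *m A) (P0 j) = \det B ^+ ee.1 * evA io A (P0 j) /\
     evA io (B *m A) (Q0 j) = \det B ^+ ee.2 * evA io A (Q0 j).
  have [[A0 WA0]|na] := pselect (active j); last by exists (0%N, 0%N).
  have [|e He] := weight_ex k_gt0 (P := P0 j) _ WA0; first by move=> A /PQ0[].
  have [|e' He'] := weight_ex k_gt0 (P := Q0 j) _ WA0; first by move=> A /PQ0[].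
  by exists (e, e') => _ F io B A; split; [apply: He|apply: He'].
have [ee Hee] := choice H.
exists (fun j => (ee j).1), (fun j => (ee j).2); split=> [j aj|i j ai aj]; first exact: Hee.
have [[Ai WAi] [Aj WAj]] := (ai, aj).
have [A [Wi Wj]] := W0_common WAi WAj.
have [[Pi Qi] [Pj Qj]] := (PQ0 Wi, PQ0 Wj).
have E (t : K) : t != 0 -> t ^+ ((ee i).1 + (ee j).2) = t ^+ ((ee j).1 + (ee i).2).
  move=> t0; have d0 : \det (diag1 k_gt0 t) != 0 by rewrite det_diag1.
  have [Wi' Wj'] : W0 i (diag1 k_gt0 t *m A) /\ W0 j (diag1 k_gt0 t *m A).
    by split; apply/W0_mul.
  have := PQ0g Wi' Wj'; have [_ opi] := Wi; have [_ opj] := Wj.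
  rewrite gr_mul (trn_rscale cX _ opi opj) //.
  have [-> ->] := Hee i ai K idK (diag1 k_gt0 t) A.
  have [-> ->] := Hee j aj K idK (diag1 k_gt0 t) A.
  rewrite det_diag1 !exprD => E; have g0 := PQ0g Wi Wj.
  have z0 : evA idK A (P0 i) * evA idK A (Q0 j) != 0 by rewrite mulf_neq0.
  apply: (mulIf z0); rewrite mulrACA E {}g0; ring.
apply/eqP/negPn/negP => ne.
have : 'X * ('X^((ee i).1 + (ee j).2) - 'X^((ee j).1 + (ee i).2)) != 0 :> {poly K}.
  rewrite mulf_neq0 ?polyX_eq0 // subr_eq0; apply: contra_neq ne.
  by move=> /(congr1 (fun p : {poly K} => size p)); rewrite !size_polyXn => -[].
move=> /closed_nonroot[t]; rewrite !hornerE mulf_eq0 negb_or subr_eq0.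
by move=> /andP[/E-> /eqP].
Qed.

(** ** Comparison of the charts *)

Section Compare.
Variables (b : 'I_r) (P Q : J -> Tb).
Hypothesis PQb : forall j t Y, Wb b j t Y -> evB idK t Y (P j) != 0 /\ evB idK t Y (Q j) != 0.
Hypothesis PQbg : forall i j t Y, Wb b i t Y -> Wb b j t Y ->
  evB idK t Y (P i) * evB idK t Y (Q j) =
    trn i j (ch b idK t Y) * evB idK t Y (P j) * evB idK t Y (Q i).

Notation ioT := (towC K (k * n).+1).
Notation tvar := (towX K (k * n).+1 (k * n)).

Definition Lb : 'M[Tb]_(k, n) := map_mx ioT (Aa b) + tvar *: varA K k n (k * n).+1.

(** The ratio Nb / Db compares the trivialization (P0, Q0) on the first chart with
    (P, Q) on the chart around the b-th exceptional divisor. It does not depend on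
    j, by [ND_rel], and is a unit where t <> 0 and the matrix is good, by
    [ND_neq0]. *)
Definition Nb j : Tb := evA ioT Lb (P0 j) * Q j.
Definition Db j : Tb := evA ioT Lb (Q0 j) * P j.

Lemma evB_L (R : comNzRingType) (io : {rmorphism K -> R}) t Y U :
  evB io t Y (evA ioT Lb U) = evA io (map_mx io (Aa b) + t *: Y) U.
Proof.
have fio c : evB io t Y (ioT c) = io c by apply: evC.
by rewrite (evA_map fio) map_mxD map_mxZ evB_var evB_t (map_io fio).
Qed.

Lemma evB_N (R : comNzRingType) (io : {rmorphism K -> R}) t Y j : evB io t Y (Nb j) =
  evA io (map_mx io (Aa b) + t *: Y) (P0 j) * evB io t Y (Q j).
Proof. by rewrite rmorphM evB_L. Qed.

Lemma evB_D (R : comNzRingType) (io : {rmorphism K -> R}) t Y j : evB io t Y (Db j) =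
  evA io (map_mx io (Aa b) + t *: Y) (Q0 j) * evB io t Y (P j).
Proof. by rewrite rmorphM evB_L. Qed.

Lemma ND_neq0 j t Y : t != 0 -> W0 j (Aa b + t *: Y) ->
  evB idK t Y (Nb j) != 0 /\ evB idK t Y (Db j) != 0.
Proof.
move=> t0 WA; have [p0 q0] := PQ0 WA; have [p1 q1] := PQb ((Wb_W0 GamE _ _ _ t0).2 WA).
by rewrite evB_N evB_D !map_idrm !mulf_neq0.
Qed.

Lemma ND_rel i j : active i -> active j -> Nb i * Db j = Db i * Nb j.
Proof.
move=> [Ai /W0_open[hi hi0 Hi]] [Aj /W0_open[hj hj0 Hj]].
have nz A h : evA idK A h != 0 -> evA ioT Lb h != 0.
  move=> h0; have : evB idK 1 (A - Aa b) (evA ioT Lb h) != 0.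
    by rewrite evB_L map_idrm scale1r addrC subrK.
  by apply: contraNneq => ->; rewrite rmorph0.
have f0 : tvar * evA ioT Lb hi * evA ioT Lb hj != 0.
  rewrite !mulf_neq0 //; [|exact: nz hi0|exact: nz hj0].
  have : evB idK 1 (0 : 'M[K]_(k, n)) tvar != 0 by rewrite evB_t oner_eq0.
  by apply: contraNneq => ->; rewrite rmorph0.
apply: (mulIf f0); apply: evB_eq => t Y; rewrite rmorphM [RHS]rmorphM.
have [->|] := eqVneq (evB idK t Y (tvar * evA ioT Lb hi * evA ioT Lb hj)) 0.
  by rewrite !mulr0.
rewrite !rmorphM !evB_L evB_t map_idrm !mulf_eq0 !negb_or.
move=> /andP[/andP[t0 /Hi Wi] /Hj Wj]; congr (_ * _).
have [Wi' Wj'] : Wb b i t Y /\ Wb b j t Y by split; apply/(Wb_W0 GamE).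
have g0 := PQ0g Wi Wj; have gb := PQbg Wi' Wj'.
have [_ opi] := Wi'; have [_ opj] := Wj'.
have c0 a : rowsc b t a != 0 by apply: rowsc_neq0.
have gE : gr idK (Aa b + t *: Y) = rscale (rowsc b t) (ch b idK t Y).
  by rewrite (ch_gr GamE) map_idrm.
move: g0; rewrite gE (trn_rscale cX c0 opi opj).
move: gb; move: (evB idK t Y (P i)) (evB idK t Y (P j)) (evB idK t Y (Q i)) (evB idK t Y (Q j)).
move: (evA _ _ (P0 i)) (evA _ _ (P0 j)) (evA _ _ (Q0 i)) (evA _ _ (Q0 j)) (trn _ _ _).
move=> p0i p0j q0i q0j g pi pj qi qj E1 E2.
have -> : p0i * qi * (q0j * pj) = (p0i * q0j) * (qi * pj) by ring.
have -> : q0i * pi * (p0j * qj) = (pi * qj) * (q0i * p0j) by ring.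
by rewrite E1 E2; ring.
Qed.

Variables (j0 : J) (A0 : 'M[K]_(k, n)).
Hypothesis WA0 : W0 j0 A0.

(** The ratio Nb / Db has neither zero nor pole on a line along which only the l-th
    column varies, if the matrices on it are good; so it is constant there. *)
Lemma ND_column l t Y Y' : t != 0 -> goodcol Aa l (Aa b + t *: Y) -> col' l Y = col' l Y' ->
  evB idK t Y (Nb j0) * evB idK t Y' (Db j0) = evB idK t Y' (Nb j0) * evB idK t Y (Db j0).
Proof.
move=> t0 gY E; pose iop : {rmorphism K -> {poly K}} := GRing.RMorphism.clone _ _ (@polyC K) _.
pose M : 'M[{poly K}]_(k, n) := map_mx iop Y + 'X *: map_mx iop (Y' - Y).
have pE s U : (evB iop t%:P M U).[s] = evB idK t (Y + s *: (Y' - Y)) U.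
  have fio c : horner_eval s (iop c) = idK c by rewrite /= /horner_eval hornerC.
  rewrite -[_.[s]]/(horner_eval s (evB iop t%:P M U)) (evB_map fio).
  rewrite map_mxD map_mxZ !(map_io fio) !map_idrm /= /horner_eval hornerX hornerC //.
have H s : unit_ratio_at (evB iop t%:P M (Nb j0)) (evB iop t%:P M (Db j0)) s.
  have gs : good Gam (Aa b + t *: (Y + s *: (Y' - Y))).
    apply: (goodcol_good Aa1 GamE gY); apply/matrixP => i c; rewrite !mxE.
    have /matrixP/(_ i c) := E; rewrite !mxE => ->.
    by rewrite subrr mulr0 addr0.
  have [j opj] := @lb_cover _ _ _ _ LB _ (gr_X gs).
  have Wj : W0 j (Aa b + t *: (Y + s *: (Y' - Y))) by split.
  have [n0 d0] := ND_neq0 t0 Wj.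
  exists (evB iop t%:P M (Db j)), (evB iop t%:P M (Nb j)); rewrite !pE; split=> //.
  rewrite -!rmorphM ND_rel ?[Db j0 * _]mulrC //; first by exists A0.
  by exists (Aa b + t *: (Y + s *: (Y' - Y))).
have := unit_ratio_eq H 0 1; rewrite !pE scale0r addr0 scale1r addrC.
by rewrite subrK => ->.
Qed.

Definition mixcol (R : Type) (Y Y' : 'M[R]_(k, n)) (l : nat) : 'M[R]_(k, n) :=
  \matrix_(i, c) (if (c < l)%N then Y' i c else Y i c).

Lemma ND_chain t Y Y' : t != 0 ->
  (forall l : 'I_n, goodcol Aa l (Aa b + t *: mixcol Y Y' l)) ->
  (forall l : 'I_n, evB idK t (mixcol Y Y' l) (Db j0) != 0) ->
  evB idK t Y (Nb j0) * evB idK t Y' (Db j0) = evB idK t Y' (Nb j0) * evB idK t Y (Db j0).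
Proof.
move=> t0 gl dl; suff H l : (l <= n)%N -> evB idK t Y (Nb j0) * evB idK t (mixcol Y Y' l) (Db j0) =
    evB idK t (mixcol Y Y' l) (Nb j0) * evB idK t Y (Db j0).
  have := H n (leqnn n); have -> // : mixcol Y Y' n = Y'.
  by apply/matrixP => i c; rewrite mxE ltn_ord.
elim: l => [|l IH] ln.
  have -> : mixcol Y Y' 0 = Y by apply/matrixP => i c; rewrite mxE.
  by [].
have := @ND_column (Ordinal ln) t (mixcol Y Y' l) (mixcol Y Y' l.+1) t0 (gl (Ordinal ln)).
have E : col' (Ordinal ln) (mixcol Y Y' l) = col' (Ordinal ln) (mixcol Y Y' l.+1).
  apply/matrixP => i c; rewrite !mxE.
  have ne := neq_lift (Ordinal ln) c; rewrite -val_eqE /= in ne.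
  by rewrite ltnS [(lift _ _ <= l)%N]leq_eqVlt eq_sym (negbTE ne).
move=> /(_ E) E2; have E1 := IH (ltnW ln).
apply: (mulIf (dl (Ordinal ln))); rewrite /= mulrAC E1 mulrAC E2; ring.
Qed.

Lemma map_mixcol (R S : Type) (f : R -> S) Y Y' l :
  map_mx f (mixcol Y Y' l) = mixcol (map_mx f Y) (map_mx f Y') l.
Proof. by apply/matrixP => i c; rewrite !mxE; case: ifP. Qed.

(** Changing Y column by column into a fixed Y' does not change the ratio, as long
    as the intermediate matrices are good, which holds for general (t, Y). Hence
    the ratio depends only on t. *)
Lemma ND_base : exists2 Y', (evB idK 1 Y' (Nb j0) != 0 /\ evB idK 1 Y' (Db j0) != 0) &
  exists2 H : Tb, H != 0 & forall t Y, evB idK t Y H != 0 ->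
    evB idK t Y (Nb j0) * evB idK t Y' (Db j0) = evB idK t Y' (Nb j0) * evB idK t Y (Db j0).
Proof.
have [h Hh] : exists h : 'I_n -> T, forall l, h l != 0 /\
    forall A, evA idK A (h l) != 0 -> goodcol Aa l A.
  have H l : exists h : T, h != 0 /\ forall A, evA idK A h != 0 -> goodcol Aa l A.
    by have [h h0 Hh] := goodcol_open Aa k_gt0 kn l; exists h.
  by have [h Hh] := choice H; exists h.
have [h0 h00 H0] := W0_open WA0.
have h0n : h0 != 0 by apply: contraNneq h00 => ->; rewrite rmorph0.
have /evA_nonzero[A] : h0 * \prod_l h l != 0.
  by rewrite mulf_neq0 //; apply/prodf_neq0 => l _; case: (Hh l).
rewrite rmorphM rmorph_prod mulf_eq0 negb_or => /andP[/H0 WA /prodf_neq0 hA].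
have A1 : Aa b + 1 *: (A - Aa b) = A by rewrite scale1r addrC subrK.
have ND1 := @ND_neq0 j0 1 (A - Aa b) (oner_neq0 _); rewrite A1 in ND1.
have {ND1}[n1 d1] := ND1 WA.
exists (A - Aa b) => //.
pose V := varA K k n (k * n).+1; pose Vs := map_mx ioT (A - Aa b).
pose Ml l := mixcol V Vs l.
pose Hl (l : 'I_n) : Tb := evA ioT (map_mx ioT (Aa b) + tvar *: Ml l) (h l) * evB ioT tvar (Ml l) (Db j0).
have HlE t Y l : evB idK t Y (Hl l) =
    evA idK (Aa b + t *: mixcol Y (A - Aa b) l) (h l) * evB idK t (mixcol Y (A - Aa b) l) (Db j0).
  have fio c : evB idK t Y (ioT c) = idK c by apply: evC.
  have EM : map_mx (evB idK t Y) (Ml l) = mixcol Y (A - Aa b) l.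
    by rewrite map_mixcol evB_var (map_io fio) map_idrm.
  by rewrite rmorphM (evA_map fio) (evB_map fio) map_mxD map_mxZ EM (map_io fio) map_idrm evB_t.
exists (tvar * \prod_l Hl l).
  have : evB idK 1 (A - Aa b) (tvar * \prod_l Hl l) != 0.
    rewrite rmorphM rmorph_prod evB_t mul1r; apply/prodf_neq0 => l _; rewrite HlE.
    have -> : mixcol (A - Aa b) (A - Aa b) l = A - Aa b.
      by apply/matrixP => i c; rewrite mxE if_same.
    by rewrite A1 mulf_neq0 // hA.
  by apply: contraNneq => ->; rewrite rmorph0.
move=> t Y; rewrite rmorphM rmorph_prod evB_t mulf_eq0 negb_or => /andP[t0 /prodf_neq0 HY].
apply: ND_chain => // l; have := HY l isT; rewrite HlE mulf_eq0 negb_or => /andP[hl dl //].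
by have [_ Hl'] := Hh l; apply: Hl' hl.
Qed.

(** The ratio of the two trivializations depends only on t and is a unit for t <>
    0, so it is c t^(e - e'). The exponent is the coefficient of the bundle along
    the exceptional divisor. *)
Lemma compare_charts : exists e e' c, c != 0 /\
  forall j, active j -> Nb j * tvar ^+ e' = ioT c * (tvar ^+ e * Db j).
Proof.
have [Y' [n1 d1] [H H0 HH]] := ND_base.
pose iop : {rmorphism K -> {poly K}} := GRing.RMorphism.clone _ _ (@polyC K) _.
pose nu : {poly K} := evB iop 'X (map_mx iop Y') (Nb j0).
pose de : {poly K} := evB iop 'X (map_mx iop Y') (Db j0).
have fio s c : horner_eval s (iop c) = idK c by rewrite /= /horner_eval hornerC.
have nuE s : nu.[s] = evB idK s Y' (Nb j0).
  rewrite -[nu.[s]]/(horner_eval s nu) (evB_map (fio s)) (map_io (fio s)) map_idrm.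
  by rewrite /= /horner_eval hornerX.
have deE s : de.[s] = evB idK s Y' (Db j0).
  rewrite -[de.[s]]/(horner_eval s de) (evB_map (fio s)) (map_io (fio s)) map_idrm.
  by rewrite /= /horner_eval hornerX.
have nu0 : nu != 0 by apply: contraNneq n1 => E; rewrite -nuE E horner0.
have de0 : de != 0 by apply: contraNneq d1 => E; rewrite -deE E horner0.
pose nuT : Tb := evB ioT tvar (map_mx ioT Y') (Nb j0).
pose deT : Tb := evB ioT tvar (map_mx ioT Y') (Db j0).
have fiT t Y c : evB idK t Y (ioT c) = idK c by apply: evC.
have nuTE t Y : evB idK t Y nuT = nu.[t].
  by rewrite nuE (evB_map (fiT t Y)) (map_io (fiT t Y)) map_idrm evB_t.
have deTE t Y : evB idK t Y deT = de.[t].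
  by rewrite deE (evB_map (fiT t Y)) (map_io (fiT t Y)) map_idrm evB_t.
have deT0 : deT != 0.
  by apply: contraNneq d1 => E; rewrite -deE -(deTE 1 0) E rmorph0.
have D0 : Db j0 != 0 by apply: contraNneq d1 => ->; rewrite rmorph0.
have a0 : active j0 by exists A0.
have base : Nb j0 * deT = nuT * Db j0.
  apply: (mulIf H0); apply: evB_eq => t Y; rewrite rmorphM [RHS]rmorphM.
  have [->|Ht] := eqVneq (evB idK t Y H) 0; first by rewrite !mulr0.
  by rewrite rmorphM [evB _ _ _ (nuT * _)]rmorphM nuTE deTE nuE deE HH.
have all j : active j -> Nb j * deT = nuT * Db j.
  move=> aj; apply: (mulfI D0); rewrite mulrA -ND_rel // mulrAC base; ring.
have [s s0|e [e' [c [c0 E]]]] := unit_ratio_monomial nu0 de0.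
  have [A gA] := good_ex k_gt0 kn Aa1 GamE.
  have [j opj] := @lb_cover _ _ _ _ LB _ (gr_X gA).
  have Wj : W0 j A by split.
  pose Y1 := s^-1 *: (A - Aa b).
  have YE : Aa b + s *: Y1 = A by rewrite scalerA divff // scale1r addrC subrK.
  have [|nj dj] := @ND_neq0 j s Y1 s0; first by rewrite YE.
  have ej U : (evB iop 'X (map_mx iop Y1) U).[s] = evB idK s Y1 U.
    rewrite -[_.[s]]/(horner_eval s (evB iop 'X (map_mx iop Y1) U)).
    rewrite (evB_map (fio s)) (map_io (fio s)) map_idrm.
    by rewrite /= /horner_eval hornerX.
  exists (evB iop 'X (map_mx iop Y1) (Db j)), (evB iop 'X (map_mx iop Y1) (Nb j)).
  rewrite !ej; split=> //.
  have fiTp c : evB iop 'X (map_mx iop Y1) (ioT c) = iop c by apply: evC.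
  have nuTp : evB iop 'X (map_mx iop Y1) nuT = nu.
    by rewrite (evB_map fiTp) (map_io fiTp) evB_t.
  have deTp : evB iop 'X (map_mx iop Y1) deT = de.
    by rewrite (evB_map fiTp) (map_io fiTp) evB_t.
  have := congr1 (evB iop 'X (map_mx iop Y1)) (all j (ex_intro _ A Wj)).
  by rewrite rmorphM [evB _ _ _ (nuT * _)]rmorphM nuTp deTp => ->.
exists e, e', c; split=> // j aj; apply: (mulIf deT0).
have -> : Nb j * tvar ^+ e' * deT = tvar ^+ e' * (Nb j * deT) by ring.
rewrite all // mulrA; have -> : tvar ^+ e' * nuT = ioT c * (tvar ^+ e * deT).
  apply: evB_eq => t Y; rewrite !rmorphM !rmorphXn evB_t nuTE deTE fiT.
  have := congr1 (horner^~ t) E; rewrite hornerZ !hornerM !hornerXn => ->.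
  by [].
ring.
Qed.

(** Evaluate [compare_charts] at (t, la Y) and at (t la, Y), which give the same
    matrix, and put t = 0. The factors coming from the first chart cancel because
    they do not vanish for generic t. *)
Lemma exceptional_weight e e' c : c != 0 ->
  (forall j, active j -> Nb j * tvar ^+ e' = ioT c * (tvar ^+ e * Db j)) ->
  forall j, active j -> forall (F : comNzRingType) (io : {rmorphism K -> F}) (la : F) Y,
    la ^+ e * (evB io 0 (la *: Y) (Q j) * evB io 0 Y (P j)) =
    la ^+ e' * (evB io 0 Y (Q j) * evB io 0 (la *: Y) (P j)).
Proof.
move=> c0 HC j aj F io la Y.
pose V := varA K k n (k * n).+1.
pose ioR : {rmorphism K -> {poly Tb}} := GRing.RMorphism.clone _ _ (polyC \o ioT) _.
pose lam : {poly Tb} := tvar%:P; pose U : 'M[{poly Tb}]_(k, n) := map_mx (@polyC Tb) V.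
have fio t Z : forall c, evB ioR t Z (ioT c) = ioR c by move=> d; apply: evC.
have E1 := congr1 (evB ioR 'X (lam *: U)) (HC j aj).
have E2 := congr1 (evB ioR ('X * lam) U) (HC j aj).
have EL s Z : evB ioR s Z (Nb j * tvar ^+ e') = evB ioR s Z (Nb j) * s ^+ e'.
  by rewrite rmorphM [in RHS]/Nb rmorphXn evB_t.
have ER s Z : evB ioR s Z (ioT c * (tvar ^+ e * Db j)) = ioR c * (s ^+ e * evB ioR s Z (Db j)).
  by rewrite rmorphM fio [evB _ _ _ (_ ^+ _ * _)]rmorphM rmorphXn evB_t.
move: E1 E2; rewrite !EL !ER !evB_N !evB_D scalerA.
set p := evA _ _ (P0 j); set q := evA _ _ (Q0 j); set cc := ioR c.
set Q1 := evB _ 'X _ (Q j); set P1 := evB _ 'X _ (P j).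
set Q2 := evB _ ('X * lam) _ (Q j); set P2 := evB _ ('X * lam) _ (P j) => E1 E2.
have [A WA] := aj; have [pA qA] := PQ0 WA.
have nz (S : T) : evA idK A S != 0 ->
    evA ioR (map_mx ioR (Aa b) + ('X * lam) *: U) S != 0.
  move=> S0.
  pose f : {rmorphism {poly Tb} -> K} :=
    GRing.RMorphism.clone _ _ (evB idK 1 (A - Aa b) \o horner_eval 1) _.
  have ff d : f (ioR d) = idK d.
    transitivity (evB idK 1 (A - Aa b) (ioT d)); last exact: evC.
    by rewrite -[LHS]/(evB idK 1 (A - Aa b) ((ioT d)%:P.[1])) hornerC.
  have : f (evA ioR (map_mx ioR (Aa b) + ('X * lam) *: U) S) != 0.
    rewrite (evA_map ff) map_mxD map_mxZ (map_io ff) map_idrm.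
    have -> : map_mx f U = A - Aa b.
      rewrite -[RHS](evB_var idK 1); apply/matrixP => i l.
      by rewrite !mxE /= /horner_eval hornerC.
    have -> : f ('X * lam) = 1.
      rewrite -[LHS]/(evB idK 1 (A - Aa b) (('X * lam).[1])) hornerM hornerX hornerC mul1r.
      by rewrite evB_t.
    by rewrite scale1r addrC subrK.
  by apply: contraNneq => ->; rewrite rmorph0.
have p0 : p != 0 by apply: nz.
have q0 : q != 0 by apply: nz.
have cc0 : cc != 0 by rewrite /cc fmorph_eq0.
have X0 m : 'X^m != 0 :> {poly Tb} by rewrite expf_neq0 // polyX_eq0.
have key : lam ^+ e * (Q1 * P2) = lam ^+ e' * (Q2 * P1).
  have z0 : p * q * cc * 'X^e' * 'X^e != 0 by rewrite !mulf_neq0.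
  apply: (mulfI z0).
  have -> : p * q * cc * 'X^e' * 'X^e * (lam ^+ e * (Q1 * P2)) =
      (p * Q1 * 'X^e') * (cc * (('X * lam) ^+ e * (q * P2))) by rewrite exprMn; ring.
  by rewrite E1 -E2 exprMn; ring.
pose g : {rmorphism {poly Tb} -> F} :=
  GRing.RMorphism.clone _ _ (evB io la Y \o horner_eval 0) _.
have gf d : g (ioR d) = io d.
  transitivity (evB io la Y (ioT d)); last exact: evC.
  by rewrite -[LHS]/(evB io la Y ((ioT d)%:P.[0])) hornerC.
have gU : map_mx g U = Y.
  rewrite -[RHS](evB_var io la); apply/matrixP => i l.
  by rewrite !mxE /= /horner_eval hornerC.
have gl : g lam = la.
  by rewrite -[LHS]/(evB io la Y (lam.[0])) hornerC evB_t.
have gX : g 'X = 0.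
  by rewrite -[LHS]/(evB io la Y ('X.[0])) hornerX rmorph0.
have := congr1 g key; rewrite !rmorphM !rmorphXn /Q1 /Q2 /P1 /P2 !(evB_map gf).
by rewrite map_mxZ gU rmorphM gX gl mul0r.
Qed.

End Compare.
End BundleData.

(** * Degrees on a curve *)

(** ** Sums over places and minimal valuations *)

Lemma ratio_neq0 (F : fieldType) (a b : F) : a != 0 -> b != 0 -> a / b != 0.
Proof. by move=> a0 b0; rewrite mulf_neq0 ?invr_eq0. Qed.

Section PlaceSums.
Variables (K : closedFieldType) (F : fieldType) (io : {rmorphism K -> F}).

(** Sums over all places. They are finite for functions with finite support; for
    others the value is a default one, which is why finiteness is carried along. *)
Definition psum (g : (F -> int) -> int) : int := \sum_(w \in aplace io) g w.
Definition fsupp (g : (F -> int) -> int) := finite_set [set w | aplace io w /\ g w != 0].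

Lemma psum_widen g B : finite_set B -> B `<=` aplace io ->
  (forall w, aplace io w -> g w != 0 -> B w) -> psum g = \sum_(w \in B) g w.
Proof.
move=> fB BA H; apply/esym/fsbig_widen => // w [pw nB] /=.
by apply/eqP/negPn/negP => /(H w pw).
Qed.

Lemma psumD g h : fsupp g -> fsupp h ->
  psum (fun w => g w + h w) = psum g + psum h /\ fsupp (fun w => g w + h w).
Proof.
move=> fg fh; pose B := [set w | aplace io w /\ g w != 0] `|` [set w | aplace io w /\ h w != 0].
have fB : finite_set B by rewrite finite_setU.
have BA : B `<=` aplace io by move=> w [[]|[]].
have H w : aplace io w -> g w + h w != 0 -> B w.
  move=> pw; have [g0|g0] := eqVneq (g w) 0; last by left.
  by rewrite g0 add0r; right.
split; last by apply: sub_finite_set fB => w [pw]; apply: H.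
rewrite (psum_widen fB BA H) (@psum_widen g _ fB BA) => [|w pw gw]; last by left.
rewrite (@psum_widen h _ fB BA) => [|w pw hw]; last by right.
exact: fsbig_split.
Qed.

Lemma psumZ c g : fsupp g -> psum (fun w => c * g w) = c * psum g /\ fsupp (fun w => c * g w).
Proof.
move=> fg; have H w : aplace io w -> c * g w != 0 -> aplace io w /\ g w != 0.
  by move=> pw; rewrite mulf_eq0 negb_or => /andP[].
have BA : [set w | aplace io w /\ g w != 0] `<=` aplace io by move=> w [].
split; last by apply: sub_finite_set fg => w [pw]; apply: H.
rewrite (psum_widen fg BA H) (@psum_widen g _ fg BA) //.
by rewrite !fsbig_finite // mulr_sumr.
Qed.

Lemma psum0 : psum (fun=> 0) = 0 /\ fsupp (fun=> 0).
Proof.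
split; first by rewrite /psum fsbig1.
by apply: (@sub_finite_set _ _ set0) => // w [_]; rewrite eqxx.
Qed.

Lemma psum_sum (I : finType) (g : I -> (F -> int) -> int) : (forall i, fsupp (g i)) ->
  psum (fun w => \sum_i g i w) = \sum_i psum (g i) /\ fsupp (fun w => \sum_i g i w).
Proof.
move=> fg; elim: (index_enum I) => [|i s [E fs]].
  by rewrite big_nil; under eq_fun do rewrite big_nil; apply: psum0.
by rewrite big_cons -E; under eq_fun do rewrite big_cons; apply: psumD.
Qed.

Lemma eq_psum g h : (forall w, aplace io w -> g w = h w) -> psum g = psum h.
Proof. by move=> E; apply: eq_fsbigr => w /set_mem; apply: E. Qed.

Lemma eq_fsupp g h : (forall w, aplace io w -> g w = h w) -> fsupp g -> fsupp h.
Proof. by move=> E; apply: sub_finite_set => w /= [pw]; rewrite -E. Qed.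

Lemma psum_ge0 g : fsupp g -> (forall w, aplace io w -> 0 <= g w) -> 0 <= psum g.
Proof.
move=> fg H; have BA : [set w | aplace io w /\ g w != 0] `<=` aplace io by move=> w [].
rewrite (psum_widen fg BA); last by [].
rewrite fsbig_finite // big_seq; apply: sumr_ge0 => w.
by rewrite in_fset_set // => /set_mem[pw _]; apply: H.
Qed.

Lemma psum_gt0 g w : fsupp g -> (forall w, aplace io w -> 0 <= g w) ->
  aplace io w -> 0 < g w -> 0 < psum g.
Proof.
move=> fg H pw gw; pose B := [set w | aplace io w /\ g w != 0].
have BA : B `<=` aplace io by move=> ? [].
rewrite (psum_widen fg BA); last by [].
have wB : w \in fset_set B by rewrite in_fset_set //; apply/mem_set; split; rewrite // gt_eqF.
rewrite fsbig_finite // (big_rem w) //= ltr_wpDr //.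
rewrite big_seq; apply: sumr_ge0 => v /mem_rem.
by rewrite in_fset_set // => /set_mem[pv _]; apply: H.
Qed.

(** The minimal valuation of the coordinates of a vector. *)
Definition mv (w : F -> int) n (x : 'rV[F]_n) : int :=
  xget 0 [set v | (exists2 l, x 0 l != 0 & w (x 0 l) = v) /\ forall l, vge w v (x 0 l)].

Section AtPlace.
Variables (w : F -> int) (pw : aplace io w).

Lemma mv_uniq n (x : 'rV[F]_n) v : (exists2 l, x 0 l != 0 & w (x 0 l) = v) ->
  (forall l, vge w v (x 0 l)) -> mv w x = v.
Proof.
move=> [l xl <-] H; rewrite /mv; case: xgetP => [u _ [[l' xl' E] H']|/(_ (w (x 0 l)))]; last first.
  by case; split=> //; exists l.
apply/eqP; rewrite eq_le -{2}E; have := H' l; have := H l'.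
by rewrite !vgeP // => -> ->.
Qed.

Lemma mvP n (x : 'rV[F]_n) : x != 0 ->
  (exists2 l, x 0 l != 0 & mv w x = w (x 0 l)) /\ forall l, vge w (mv w x) (x 0 l).
Proof.
move=> /rowP_neq0[l0 xl0]; pose r := [seq l <- enum 'I_n | x 0 l != 0].
have [l] : exists2 l, l \in r & forall t, t \in r -> w (x 0 l) <= w (x 0 t).
  by apply: (@int_min_seq _ _ (fun t => w (x 0 t)) l0); rewrite mem_filter xl0 mem_enum.
rewrite mem_filter => /andP[xl _] H.
have V j : vge w (w (x 0 l)) (x 0 j).
  have [->|xj] := eqVneq (x 0 j) 0; first exact: vge0.
  by rewrite vgeP // H // mem_filter xj mem_enum.
have E : mv w x = w (x 0 l) by apply: mv_uniq => //; exists l.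
by split=> [|j]; [exists l|rewrite E].
Qed.

Lemma mvZ n c (x : 'rV[F]_n) : c != 0 -> x != 0 -> mv w (c *: x) = w c + mv w x.
Proof.
move=> c0 /mvP[[l xl E] H]; apply: mv_uniq => [|j].
  by exists l; rewrite mxE ?mulf_neq0 // (avM pw) // E.
rewrite mxE; apply: (vgeM pw _ (H j)); by rewrite vgeP.
Qed.

Lemma mv_red n (x : 'rV[F]_n) (z : 'rV[K]_n) : z != 0 ->
  (forall l, vge w 1 (x 0 l - io (z 0 l))) -> mv w x = 0.
Proof.
move=> /rowP_neq0[l zl] H; apply: mv_uniq => [|j]; last exact: (red_vge0 pw (H j)).
by exists l; have [? ?] := red_unit pw zl (H l).
Qed.

End AtPlace.

Hypothesis Fgen : forall f : F, f != 0 -> finite_set [set v | aplace io v /\ v f != 0].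

Lemma mv_fsupp n (x : 'rV[F]_n) : x != 0 -> fsupp (fun w => mv w x).
Proof.
move=> x0; pose B := \bigcup_(l in [set l | x 0 l != 0]) [set v | aplace io v /\ v (x 0 l) != 0].
have fB : finite_set B by apply: bigcup_finite => [|l xl]; [exact: finite_finset|exact: Fgen].
apply: sub_finite_set fB => w [pw mw]; have [[l xl E] _] := mvP w x0.
by exists l => //; split=> //; rewrite -E.
Qed.

End PlaceSums.

Section CurveDegree.
Variables (K : closedFieldType) (s N : nat) (X C : set 'M[K]_(s, N)).
Hypothesis cX : zclosed X.
Hypothesis hC : irred_closed C.
Hypothesis CX : C `<=` X.
Notation F := (rfield hC).
Notation io := (io hC).
Notation gpt := (gpt hC).
Hypothesis Fdep : forall x y : F, algdep io x y.

Lemma rfield_finite (f : F) : f != 0 -> finite_set [set v | aplace io v /\ v f != 0].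
Proof. by move=> f0; apply: (place_finite Fdep (@rfield_gen _ _ _ _ hC)). Qed.

Lemma rfield_sum (f : F) : f != 0 -> psum io (fun w => w f) = 0.
Proof. by move=> f0; apply: (sum_places Fdep (@rfield_gen _ _ _ _ hC)). Qed.

Lemma gpt_row_neq0 i : row i gpt != 0.
Proof. by have [H _] := gpt_generic hC. Qed.

(** The degree of the pullback to C of O(1) from the i-th factor; see [degree_O1].
    As the generic point has some coordinate equal to 1, the summands are
    nonpositive. *)
Definition fdeg i : int := - psum io (fun w => mv w (row i gpt)).

Lemma fdeg_fsupp i : fsupp io (fun w => mv w (row i gpt)).
Proof. exact: (mv_fsupp rfield_finite (gpt_row_neq0 i)). Qed.

Lemma mv_gpt_le0 i w : aplace io w -> mv w (row i gpt) <= 0.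
Proof.
move=> pw; have [_ /(_ (pivot hC i))] := mvP w (gpt_row_neq0 i).
by rewrite mxE gpt_pivot vgeP ?oner_eq0 // (av1 pw).
Qed.

Lemma fdegE i : fdeg i = psum io (fun w => - mv w (row i gpt)) /\
  fsupp io (fun w => - mv w (row i gpt)).
Proof.
have [E H] := psumZ (-1) (fdeg_fsupp i); rewrite /fdeg -mulN1r -E.
by split; [apply: eq_psum|apply: eq_fsupp H] => w _; rewrite mulN1r.
Qed.

Lemma fdeg_ge0 i : 0 <= fdeg i.
Proof.
have [-> fs] := fdegE i; apply: (psum_ge0 fs) => w pw.
by rewrite oppr_ge0 mv_gpt_le0.
Qed.

Lemma fdeg_gt0 i l : nonconst io (gpt i l) -> 0 < fdeg i.
Proof.
move=> nc; have [w pw wl] := exists_pole Fdep (@rfield_gen _ _ _ _ hC) nc.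
have [-> fs] := fdegE i; apply: (psum_gt0 fs _ pw) => [v pv|]; rewrite ?oppr_gt0 ?oppr_ge0.
  exact: mv_gpt_le0.
have [_ /(_ l)] := mvP w (gpt_row_neq0 i).
have g0 : gpt i l != 0 by apply: contraTneq wl => ->; rewrite (av0 pw) ltxx.
by rewrite mxE vgeP // => h; apply: le_lt_trans h wl.
Qed.

Lemma fdeg_eq0 i : (forall l, exists c, gpt i l = io c) -> fdeg i = 0.
Proof.
move=> H; have [c Hc] := choice H; rewrite /fdeg (_ : psum _ _ = 0) ?oppr0 //.
rewrite /psum fsbig1 // => w pw; apply: (mv_red pw (z := \row_l c l)).
  have := gpt_row_neq0 i; apply: contraNneq => E; apply/eqP/rowP => l.
  by have /rowP/(_ l) := E; rewrite !mxE Hc => ->; rewrite rmorph0.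
by move=> l; rewrite !mxE Hc subrr vge0.
Qed.

Lemma red_rcenter w (pw : aplace io w) (c : 'I_s -> F) (z : 'M[K]_(s, N)) : (forall i, c i != 0) ->
  (forall i l, vge w 1 (c i * gpt i l - io (z i l))) -> ppoint z -> rcenter w z.
Proof.
move=> c0 H pz; split; last by exists c.
have [[S [hS CE]] _ _] := hC; rewrite CE; split=> // p Sp; have [d hp] := hS p Sp.
have := @red_pev _ _ _ _ hC w pw _ _ (rscale c gpt) z p; rewrite (pev_rscale _ _ _ hp).
have /eqP -> : pev io gpt p == 0.
  by rewrite (gpt_eq0 hC hp); apply/asboolP => y; rewrite CE => -[_ ->].
rewrite mulr0 => R.
apply: (red_uniq pw (x := 0)); first by apply: R => i l; rewrite mxE; apply: H.
by rewrite rmorph0 subr0 vge0.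
Qed.

(** ** Orders of rational sections *)

Variable LB : line_bundle X.
Notation opn := (@lb_open K s N X LB).
Notation trn := (@lb_trans K s N X LB).
Notation J := 'I_(lb_size LB).

Lemma gen_open j : C `&` opn j !=set0 -> generically C (opn j).
Proof.
move=> [y [Cy Uy]]; have [_ cU] := @lb_openP _ _ _ _ LB j.
exists (X `\` opn j); split=> // [H|z Cz nz]; first by have [_] := H y Cy.
by apply: contrapT => nU; apply: nz; split=> //; apply: CX.
Qed.

Section Section1.
Variable sigma : J -> 'M[K]_(s, N) -> K.
Hypothesis rs : ratsection LB C sigma.
Notation x j := (cl hC (sigma j)).

Lemma section_rat j : C `&` opn j !=set0 -> ratfun C (sigma j) /\ x j != 0.
Proof. by move=> /(proj1 rs)/ratfun_neq0P. Qed.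

(** Transition functions are units at the center of the place, by regularity. *)
Lemma section_change w i j z : aplace io w -> center C (toP w) z -> opn i z -> opn j z ->
  w (x i) = w (x j).
Proof.
move=> pw cz Ui Uj; have [Cz Hz] := cz.
have [d [p [q [Z [hp hq cZ nZ H]]]]] := @lb_regular _ _ _ _ LB i j z (conj Ui Uj).
have [q0 E] := H z (conj Ui Uj) nZ; have := lb_unit Ui Uj.
rewrite E mulf_eq0 invr_eq0 negb_or => /andP[p0 _].
have ni : C `&` opn i !=set0 by exists z.
have nj : C `&` opn j !=set0 by exists z.
have [[ri xi0] [rj xj0]] := (section_rat ni, section_rat nj).
have exq : exists2 y, C y & mevalM q y != 0 by exists z.
have exp : exists2 y, C y & mevalM p y != 0 by exists z.
have pq := gpt_neq0 hC hp exp; have qp := gpt_neq0 hC hq exq.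
have xE : x i = pev io gpt p / pev io gpt q * x j.
  apply: rep_inj; have gZ : generically C (fun y => ~ Z y).
    by exists Z; split=> // H1; apply: nZ; apply: H1.
  rewrite -(gpt_frac hC hp hq exq).
  apply: (gen_and2 hC _ (gen_and hC (gen_and hC (gen_open ni) (gen_open nj)) gZ)
    (gen_and hC (gen_and hC (rep_cl hC ri) (rep_cl hC rj))
      (gen_and hC (gen_and hC (repM (cl hC (fun y => mevalM p y / mevalM q y)) (x j))
         (rep_cl hC (ratfun_frac hC hp hq exq))) ((proj2 rs) i j ni nj)))).
  move=> y _ [[Uiy Ujy] nZy] [[-> Ej] [[-> ->] ->]] /=; rewrite Ej.
  by have [_ ->] := H y (conj Uiy Ujy) nZy.
have := Hz _ _ _ hp hq exp q0; have := Hz _ _ _ hq hp exq p0.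
rewrite /= !toP_rat; try exact: (ratfun_frac hC hp hq exq); try exact: (ratfun_frac hC hq hp exp).
rewrite (gpt_frac hC hp hq exq) (gpt_frac hC hq hp exp) => -[H1 _] [H2 _].
have c0 : pev io gpt p / pev io gpt q != 0.
  exact: (ratio_neq0 pq qp).
have : w (pev io gpt p / pev io gpt q) = 0.
  apply/eqP; rewrite eq_le H2 andbT; move: H1.
  rewrite -[pev io gpt q / _]invrK invfM invrK mulrC.
  by rewrite (avV pw c0) oppr_ge0.
by move=> E0; rewrite xE (avM pw) // E0 add0r.
Qed.

Lemma ord_sectionE w j z : aplace io w -> rcenter w z -> opn j z ->
  ord_section LB C sigma (toP w) = w (x j).
Proof.
move=> pw rz Uj; have cz := rcenterP pw rz.
have nj : C `&` opn j !=set0 by exists z; split=> //; case: rz.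
have tE i : C `&` opn i !=set0 -> toP w (sigma i) = w (x i).
  by move=> /section_rat[ri _]; rewrite toP_rat.
rewrite /ord_section; case: xgetP => [e _ [i [z' [cz' Ui ->]]]|/(_ (toP w (sigma j)))]; last first.
  by case; exists j, z.
have Cz' : C z' by case: cz'.
rewrite tE; last by exists z'.
apply: (section_change pw cz _ Uj).
have U := center_uniq pw rz cz'; have [cC _ _] := hC; have [d d0 dE] := eqmx_rscale (zclosed_ppoint cC (proj1 rz)) U.
by move: Ui; rewrite dE; move/(opn_rscale cX _ _ d0).
Qed.

End Section1.

(** The degree can be computed from any rational section, since two of them differ
    by a rational function, and [rfield_sum] applies. It is the sum of the local
    orders g. *)
Lemma degreeP sigma (g : (F -> int) -> int) : ratsection LB C sigma -> fsupp io g ->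
  (forall w, aplace io w -> exists z j,
     [/\ rcenter w z, opn j z & w (cl hC (sigma j)) = g w]) ->
  degree LB C = psum io g.
Proof.
move=> rs fg Hg; have E0 : \sum_(v \in place C) ord_section LB C sigma v = psum io g.
  rewrite sum_place; apply: eq_psum => w pw; have [z [j [rz Uj <-]]] := Hg w pw.
  exact: ord_sectionE rz Uj.
rewrite /degree; case: xgetP => [e _ [sg rg ->]|/(_ (psum io g))]; last first.
  by case; exists sigma.
rewrite sum_place; have [z0 Cz0] : C !=set0 by case: hC.
have [j0 U0] := @lb_cover _ _ _ _ LB _ (CX Cz0).
have n0 : C `&` opn j0 !=set0 by exists z0.
have [[r0 x0] [r0' x0']] := (section_rat rs n0, section_rat rg n0).
pose f := cl hC (sg j0) / cl hC (sigma j0).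
have f0 : f != 0 by rewrite mulf_neq0 ?invr_eq0.
have fE j : C `&` opn j !=set0 -> cl hC (sg j) = f * cl hC (sigma j).
  move=> nj; have [[rj xj] [rj' xj']] := (section_rat rs nj, section_rat rg nj).
  have key : cl hC (sg j) * cl hC (sigma j0) = cl hC (sg j0) * cl hC (sigma j).
    apply: rep_inj.
    apply: (gen_and2 hC _ (gen_and hC (repM (cl hC (sg j)) (cl hC (sigma j0)))
        (repM (cl hC (sg j0)) (cl hC (sigma j))))
      (gen_and hC (gen_and hC (gen_and hC (rep_cl hC rj) (rep_cl hC rj'))
          (gen_and hC (rep_cl hC r0) (rep_cl hC r0')))
        (gen_and hC ((proj2 rs) j j0 nj n0) ((proj2 rg) j j0 nj n0)))).
    move=> y _ [-> ->] [[[-> ->] [-> ->]] [-> ->]] /=; by rewrite mulrAC mulrC mulrA.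
  by rewrite /f mulrAC -key mulfK.
have E w : aplace io w -> ord_section LB C sg (toP w) = g w + w f.
  move=> pw; have [z [j [rz Uj <-]]] := Hg w pw; rewrite (ord_sectionE rg pw rz Uj).
  have nj : C `&` opn j !=set0 by exists z; split=> //; case: rz.
  have [_ xj] := section_rat rs nj.
  by rewrite fE // (avM pw) // addrC.
have ff : fsupp io (fun w => w f) by apply: rfield_finite.
rewrite -[LHS]/(psum io (fun w => ord_section LB C sg (toP w))) (eq_psum E).
by have [-> _] := psumD fg ff; rewrite (rfield_sum f0) addr0.
Qed.

(** ** Sections read off a chart *)

Section ChartSection.
Variables (m : nat) (Psi : 'M[tower K m]_(s, N)).
Variables (P Q : J -> tower K m).
Hypothesis PQ1 : forall j c, chart_open (LB:=LB) Psi j c ->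
  ev (idrm K) c m (P j) != 0 /\ ev (idrm K) c m (Q j) != 0.
Hypothesis PQ2 : forall i j c, chart_open (LB:=LB) Psi i c -> chart_open (LB:=LB) Psi j c ->
  ev (idrm K) c m (P i) * ev (idrm K) c m (Q j) =
  trn i j (chart_at Psi c) * ev (idrm K) c m (P j) * ev (idrm K) c m (Q i).
Variables (y : nat -> F) (c : 'I_s -> F).
Hypothesis c0 : forall i, c i != 0.
Hypothesis yE : map_mx (ev io y m) Psi = rscale c gpt.

(** The rational section on C obtained by evaluating the trivialization (P, Q) on a
    chart at the parameters y of the generic point. *)
Definition chart_section j : F := ev io y m (P j) / ev io y m (Q j).

Let yat z := fun i => rep (y i) z.

Lemma gen_chart : generically C (fun z => exists d : 'I_s -> K,
  (forall i, d i != 0) /\ chart_at Psi (yat z) = rscale d z).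
Proof.
have H i l : generically C (fun z => ev (idrm K) (yat z) m (Psi i l) =
    rep (c i) z * rep (gpt i l) z).
  have E : ev io y m (Psi i l) = c i * gpt i l by have /matrixP/(_ i l) := yE; rewrite !mxE.
  apply: (gen_mono _ (gen_and hC (gen_ev y (Psi i l)) (repM (c i) (gpt i l)))) => z _ [E1 E2].
  by rewrite -E1 E E2.
have cn i : generically C (fun z => rep (c i) z != 0).
  apply: (gen_and2 hC _ (repM (c i) (c i)^-1) (rep_cst hC 1)) => z _.
  rewrite divff // => E1 E2; move: E1; rewrite E2; apply: contra_eq_neq => ->.
  by rewrite mul0r oner_eq0.
apply: (gen_and2 hC _ (gen_and hC (gen_forall hC (fun i => gen_forall hC (H i)))
  (gen_forall hC cn)) (gen_and hC (gen_gpt hC) (pivotP hC))).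
move=> z _ [E nc] [Eg pz]; exists (fun i => rep (c i) z * (z i (pivot hC i))^-1).
split=> [i|]; first by rewrite mulf_neq0 ?invr_eq0.
apply/matrixP => i l; rewrite !mxE E -mulrA; congr (_ * _).
by have /matrixP/(_ i l) := Eg; rewrite !mxE.
Qed.

Lemma gen_chart_open j : C `&` opn j !=set0 ->
  generically C (fun z => chart_open (LB:=LB) Psi j (yat z)).
Proof.
move=> nj; apply: (gen_and2 hC _ gen_chart (gen_open nj)) => z Cz [d [d0 E]] Uz.
have [cC _ _] := hC.
split; rewrite E; last by apply/(opn_rscale cX _ _ d0).
by apply: (zclosed_rscale (@zclosedT K s N) d0); apply: zclosed_ppoint Cz.
Qed.

Lemma chart_section_neq0 j : C `&` opn j !=set0 ->
  ev io y m (P j) != 0 /\ ev io y m (Q j) != 0.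
Proof.
move=> nj; split.
  have [z Cz [[A B] D]] := gen_ex (gen_and hC (gen_and hC (gen_ev y (P j)) (rep_cst hC 0))
    (gen_chart_open nj)).
  have [+ _] := PQ1 D; rewrite -A; apply: contraNneq => ->.
  by rewrite B.
have [z Cz [[A B] D]] := gen_ex (gen_and hC (gen_and hC (gen_ev y (Q j)) (rep_cst hC 0))
  (gen_chart_open nj)).
have [_ +] := PQ1 D; rewrite -A; apply: contraNneq => ->.
by rewrite B.
Qed.

Lemma chart_ratsection : ratsection LB C (fun j => rep (chart_section j)).
Proof.
split=> [j nj|i j ni nj].
  by apply: cl_neq0_rep; have [p q] := chart_section_neq0 nj; rewrite mulf_neq0 ?invr_eq0.
have gE l : generically C (fun z => rep (chart_section l) z =
    ev (idrm K) (yat z) m (P l) / ev (idrm K) (yat z) m (Q l)).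
  apply: (gen_and2 hC _ (gen_and hC (repM (ev io y m (P l)) (ev io y m (Q l))^-1)
    (rep_inv (ev io y m (Q l)))) (gen_and hC (gen_ev y (P l)) (gen_ev y (Q l)))).
  by move=> z _ [E1 E2] [<- <-]; rewrite E1 E2.
apply: (gen_and2 hC _ (gen_and hC (gE i) (gE j)) (gen_and hC
   (gen_and hC (gen_chart_open ni) (gen_chart_open nj)) (gen_and hC gen_chart
     (gen_and hC (gen_open ni) (gen_open nj))))).
move=> z _ [Ei Ej] [[Wi Wj] [[d [d0 E]] [Ui Uj]]]; rewrite Ei /= Ej.
have [[pi qi] [pj qj]] := (PQ1 Wi, PQ1 Wj).
have := PQ2 Wi Wj; rewrite E (trn_rscale cX d0 Ui Uj) => H.
by apply/eqP; rewrite mulrA eqr_div // H.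
Qed.

End ChartSection.
End CurveDegree.

(** * The degree formula on the blow-up *)

(** ** Reduction of matrices at a place *)

Section Reduction.
Variables (K : closedFieldType) (F : fieldType) (io : {rmorphism K -> F}).
Variables (w : F -> int) (pw : aplace io w).

(** The matrix y over F is integral at the place w, and reduces to z. *)
Definition redm m n (y : 'M[F]_(m, n)) (z : 'M[K]_(m, n)) : Prop :=
  forall i j, vge w 1 (y i j - io (z i j)).

Lemma redm_uniq m n (y : 'M[F]_(m, n)) z z' : redm y z -> redm y z' -> z = z'.
Proof. by move=> H H'; apply/matrixP => i j; apply: (red_uniq pw (H i j) (H' i j)). Qed.

Lemma redm_mulC m n p (y : 'M[F]_(m, n)) z (M : 'M[K]_(n, p)) : redm y z ->
  redm (y *m map_mx io M) (z *m M).
Proof.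
move=> H i j; rewrite !mxE rmorph_sum -sumrB; apply: (vge_sum pw) => l _.
rewrite mxE rmorphM -mulrBl; have := vgeM pw (H i l) (vgeC pw (M l j)).
by rewrite addr0.
Qed.

Lemma redm_row m n (y : 'M[F]_(m, n)) z i : redm y z -> redm (row i y) (row i z).
Proof. by move=> H i' j; rewrite ![row _ _ _ _]mxE. Qed.

Lemma redm_map m n (z : 'M[K]_(m, n)) : redm (map_mx io z) z.
Proof. by move=> i j; rewrite mxE subrr vge0. Qed.

Lemma redmB m n (y y' : 'M[F]_(m, n)) z z' : redm y z -> redm y' z' -> redm (y - y') (z - z').
Proof.
move=> H H' i j; rewrite !mxBE rmorphB.
have -> : y i j - y' i j - (io (z i j) - io (z' i j)) = (y i j - io (z i j)) - (y' i j - io (z' i j)).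
  by rewrite !opprD !opprK addrACA.
exact: (vgeB pw).
Qed.

Lemma redm_neq0 m n (y : 'M[F]_(m, n)) z : z != 0 -> redm y z -> y != 0.
Proof.
move=> z0 H; apply: contra_neq z0 => y0; apply/esym; apply: (redm_uniq _ H).
by move=> i j; rewrite y0 !mxE rmorph0 subr0 vge0.
Qed.

Lemma redm_ex (Fdep : forall x y : F, algdep io x y) m n (y : 'M[F]_(m, n)) :
  (forall i j, vge w 0 (y i j)) -> exists z, redm y z.
Proof.
move=> H; have R i : exists a : 'I_n -> K, forall j, vge w 1 (y i j - io (a j)).
  have R' j : exists a, vge w 1 (y i j - io a) by apply: (place_residue Fdep pw).
  by have [a Ha] := choice R'; exists a.
have [a Ha] := choice R; exists (\matrix_(i, j) a i j) => i j; rewrite mxE; exact: Ha.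
Qed.

Lemma mv_redm n (x : 'rV[F]_n) z : z != 0 -> redm x z -> mv w x = 0.
Proof. by move=> z0 H; apply: (mv_red pw z0) => l; apply: H. Qed.

Lemma redV x a : a != 0 -> vge w 1 (x - io a) -> vge w 1 (x^-1 - io a^-1).
Proof.
move=> an H; have [x0 wx] := red_unit pw an H; have ia : io a != 0 by rewrite fmorph_eq0.
have -> : x^-1 - io a^-1 = (x - io a) * (- (x^-1 * (io a)^-1)).
  by rewrite fmorphV; field; rewrite x0 ia.
have := vgeM pw H (_ : vge w 0 (- (x^-1 * (io a)^-1))); rewrite addr0; apply.
rewrite (vgeN pw) vgeP ?mulf_neq0 ?invr_eq0 // (avM pw) ?invr_eq0 // !(avV pw) // wx.
by rewrite (avC pw an).
Qed.

Lemma redm_rescale n (y : 'rV[F]_n) (z : 'rV[K]_n) l : z 0 l != 0 -> redm y z ->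
  redm ((y 0 l)^-1 *: y) ((z 0 l)^-1 *: z).
Proof.
move=> zl H i j; rewrite !ord1 !mxE; apply: (redM pw); last exact: H.
exact: redV.
Qed.

(** Divide by an entry of minimal valuation. *)
Lemma primitive_matrix (Fdep : forall x y : F, algdep io x y) m n (D : 'M[F]_(m, n)) : D != 0 ->
  exists i l Yb, [/\ D i l != 0, redm ((D i l)^-1 *: D) Yb & Yb != 0].
Proof.
move=> D0; have mD0 : mxvec D != 0 by rewrite mxvec_eq0.
have [[q Dq E] H] := mvP w mD0.
have {}H i l : vge w (w (mxvec D 0 q)) (D i l).
  by have := H (mxvec_index i l); rewrite mxvecE E.
case/mxvec_indexP: q Dq H {E} => i l; rewrite mxvecE => Dn H; exists i, l.
have [Yb rY] : exists Yb, redm ((D i l)^-1 *: D) Yb.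
  apply: (redm_ex Fdep) => i' l'; rewrite mxE.
  have := vgeM pw (_ : vge w (- w (D i l)) (D i l)^-1) (H i' l'); rewrite addrC subrr; apply.
  by rewrite vgeP ?invr_eq0 // (avV pw).
exists Yb; split=> //.
apply: contra_neq (oner_neq0 K) => Y0; have := rY i l.
rewrite Y0 [(_ *: D) _ _]mxE mulVf // mxE => H1; apply: (red_uniq pw _ H1).
by rewrite rmorph1 subrr vge0.
Qed.

Lemma redm_colsub0 m n p (g : 'I_p -> 'I_n) (D : 'M[F]_(m, n)) t Yb : colsub g D = 0 ->
  redm (t *: D) Yb -> colsub g Yb = 0.
Proof.
move=> D0 rY; apply: (@redm_uniq _ _ (colsub g (t *: D))) => i j.
  by rewrite ![colsub _ _ _ _]mxE; apply: rY.
have := congr1 (fun M : 'M[F]_(m, p) => M i j) D0; rewrite !mxE => ->.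
by rewrite mulr0 rmorph0 subrr vge0.
Qed.

Lemma av_ratio x y : x != 0 -> y != 0 -> w (x / y) = w x - w y.
Proof. by move=> x0 y0; rewrite (avM pw) ?invr_eq0 // (avV pw). Qed.

Lemma av_exp x m : x != 0 -> w (x ^+ m) = m%:Z * w x.
Proof. by move=> x0; rewrite (avX pw) // -mulr_natl natz. Qed.

Lemma av_exp_ratio x m m' : x != 0 -> w (x ^+ m / x ^+ m') = (m%:Z - m'%:Z) * w x.
Proof. by move=> x0; rewrite av_ratio ?expf_neq0 // !av_exp // mulrBl. Qed.

Lemma av_compare p q P Q t c m m' : p != 0 -> q != 0 -> P != 0 -> Q != 0 -> t != 0 -> c != 0 ->
  w P = 0 -> w Q = 0 -> p * Q * t ^+ m' = io c * (t ^+ m * (q * P)) ->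
  w (p / q) = (m%:Z - m'%:Z) * w t.
Proof.
move=> p0 q0 P0 Q0 t0 c0 wP wQ E; have ic0 : io c != 0 by rewrite fmorph_eq0.
have tn i : t ^+ i != 0 by rewrite expf_neq0.
have := congr1 w E; rewrite (avM pw (mulf_neq0 p0 Q0) (tn _)) (avM pw p0 Q0).
rewrite (avM pw ic0 (mulf_neq0 (tn _) (mulf_neq0 q0 P0))) (avM pw (tn _) (mulf_neq0 q0 P0)).
rewrite (avM pw q0 P0) wP wQ (avC pw) // !av_exp // av_ratio // mulrBl; lia.
Qed.

Section Charts.
Variables (k n r : nat).
Notation N := #|increasing k n|.
Variables (Aa : 'I_r -> 'M[K]_(k, n)) (Gam : 'I_r -> 'rV[K]_N).

Lemma redm_Lmat f (x : 'rV[F]_N) z : redm x z -> redm (Lmat f x) (Lmat f z).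
Proof.
move=> H i l; have E (R : comNzRingType) (u : 'rV[R]_N) : Lmat f u i l = lam (subst f i l) u.
  by rewrite mxE.
rewrite !E /lam; have -> : map_mx intr (minor_vec (subst f i l)) =
    map_mx io (map_mx intr (minor_vec (subst f i l))) :> 'cV[F]_N.
  by apply/matrixP => a b; rewrite !mxE rmorph_int.
exact: redm_mulC.
Qed.

Lemma redm_wpt m p (A : 'M[F]_(m, p)) Ab i : redm A Ab -> (i < m * p)%N ->
  vge w 1 (wpt A i - io (wpt Ab i)).
Proof.
move=> H im; rewrite (wptE A (Ordinal im)) (wptE Ab (Ordinal im)).
by case/mxvec_indexP: (Ordinal im) => a b; rewrite !mxvecE.
Qed.

Lemma redm_gr A Ab : redm A Ab -> redm (gr Gam io A) (gr Gam (idrm K) Ab).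
Proof.
move=> H i l; rewrite -!evA_Psi0 ![map_mx _ (Psi0 _) i l]mxE; apply: (red_ev pw) => m mk.
exact: redm_wpt.
Qed.

Lemma red_upd t tb (Y : 'M[F]_(k, n)) Yb i : vge w 1 (t - io tb) -> redm Y Yb ->
  (i < (k * n).+1)%N ->
  vge w 1 (upd (wpt Y) (k * n) t i - io (upd (wpt Yb) (k * n) tb i)).
Proof.
move=> Ht HY; rewrite ltnS leq_eqVlt /upd; case: eqP => //= _ im.
exact: redm_wpt.
Qed.

Lemma redm_ch b t tb Y Yb : vge w 1 (t - io tb) -> redm Y Yb ->
  redm (ch Aa Gam b io t Y) (ch Aa Gam b (idrm K) tb Yb).
Proof.
move=> Ht HY i l; rewrite -!evB_PsiB ![map_mx _ (PsiB _ _ _) i l]mxE.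
by apply: (red_ev pw) => m mk; apply: red_upd.
Qed.

End Charts.
End Reduction.

Section DegreeFormula.
Variables (K : closedFieldType) (k n r : nat).
Notation N := #|increasing k n|.
Variables (idx : 'I_r -> 'I_N) (Aa : 'I_r -> 'M[K]_(k, n)) (Gam : 'I_r -> 'rV[K]_N).
Notation I a := (enum_val (idx a) : {ffun 'I_k -> 'I_n}).
Hypothesis k_gt0 : (0 < k)%N.
Hypothesis kn : (k.+1 < n)%N.
Hypothesis Aa1 : forall a, colsub (I a) (Aa a) = 1%:M.
Hypothesis GamE : forall a, exists2 c, c != 0 & Gam a = c *: plk (Aa a).
Hypothesis Gam_inj : forall a b, a != b -> ~~ (Gam a == Gam b)%MS.
Notation G := (grassmannian K k n).
Notation X := (blowup G Gam).
Notation idK := (idrm K).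
Notation T := (tower K (k * n)).
Notation Tb := (tower K (k * n).+1).
Notation gr := (gr Gam).
Notation ch := (ch Aa Gam).
Notation e0 := (lshift r (0 : 'I_1)).
Let cX : zclosed X := zclosed_blowup Gam.

(** The tangent direction Y is not in the kernel of the projection from the center:
    it can be recovered from its image by [Lmat_Tel]. *)
Lemma ch_fibre b (Y : 'M[K]_(k, n)) : colsub (I b) Y = 0 -> Y != 0 ->
  ppoint (ch b idK 0 Y).
Proof.
move=> Y0 Yn; have E : map_mx idK (Aa b) + 0 *: Y = Aa b by rewrite map_idrm scale0r addr0.
have pn : plk (Aa b) != 0.
  by apply/eqP => /rowP/(_ (idx b)) /eqP; rewrite plk_idx // mxE oner_eq0.
apply: ppoint_stack => [|a]; rewrite ?stack_u ?stack_row E // !map_idrm.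
have [->|ab] := eqVneq a b; last by rewrite (Gam_ncok Aa1 GamE Gam_inj) // eq_sym.
rewrite cok_eq0; apply/negP => sub; have [c c0 GE] := GamE b.
have LT := Lmat_Tel 0 (Aa1 b) Y0; rewrite scale0r addr0 in LT.
have /sub_rVP[d dE] : (Tel (Aa b) Y (Aa b) <= plk (Aa b))%MS.
  by apply: submx_trans sub _; rewrite GE scalemx_sub.
move: LT; rewrite dE LmatZ Lmat_plk1 // => YE.
have /matrixP/(_ (Ordinal k_gt0) (Ordinal k_gt0)) := Y0.
rewrite -YE [LHS]mxE mxZE; have /matrixP/(_ (Ordinal k_gt0) (Ordinal k_gt0)) := Aa1 b.
rewrite [LHS]mxE => -> ; rewrite !mxE eqxx mulr1 => d0.
by move: Yn; rewrite -YE d0 scale0r eqxx.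
Qed.

(** Left multiplication with the inverse of the block in the columns l, whose
    determinant is a Pluecker coordinate. *)
Lemma normalize (F : fieldType) (A : 'M[F]_(k, n)) (l : 'I_N) : plk A 0 l != 0 ->
  exists B : 'M[F]_k, [/\ \det B = (plk A 0 l)^-1,
    colsub (enum_val l : {ffun 'I_k -> 'I_n}) (B *m A) = 1%:M &
    B *m A = Lmat (enum_val l) ((plk A 0 l)^-1 *: plk A)].
Proof.
set x := plk A 0 l => x0.
have xE : x = \det (colsub (enum_val l : {ffun 'I_k -> 'I_n}) A) by rewrite /x mxE.
have u : colsub (enum_val l : {ffun 'I_k -> 'I_n}) A \in unitmx by rewrite unitmxE unitfE -xE.
exists (invmx (colsub (enum_val l : {ffun 'I_k -> 'I_n}) A)); split.
- by rewrite det_inv xE.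
- by rewrite -mulmx_colsub mulVmx.
- by rewrite LmatZ Lmat_plk /invmx u scalemxAl xE.
Qed.

(** ** The generic point in coordinates *)

Section Coordinates.
Variables (F : fieldType) (io : {rmorphism K -> F}) (C : set 'M[K]_(1 + r, N)).
Variable xi : 'M[F]_(1 + r, N).
Hypothesis gxi : generic_point io xi C.
Hypothesis CX : C `<=` X.

Lemma rscale_ex (M M' : 'M[F]_(1 + r, N)) :
  (exists2 d, d != 0 & usubmx M = d *: usubmx M') ->
  (forall a, exists2 d, d != 0 & row (rshift 1 a) M = d *: row (rshift 1 a) M') ->
  exists2 c, forall i, c i != 0 & M = rscale c M'.
Proof.
move=> H0 Ha; have H i : exists d : F, d != 0 /\ row i M = d *: row i M'.
  have [->|[a ->]] := row_cases i; last by have [d ? ?] := Ha a; exists d.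
  by have [d ? ?] := H0; exists d; rewrite !row_u.
have [c Hc] := choice H; exists c => [i|]; first by case: (Hc i).
by apply/row_matrixP => i; rewrite row_rscale; case: (Hc i).
Qed.

Let x := usubmx xi.
Let y a := row (rshift 1 a) xi.

Lemma point_row_cok a : x *m map_mx io (cok Gam a) != 0 ->
  exists2 d, d != 0 & x *m map_mx io (cok Gam a) = d *: y a.
Proof.
set v := x *m _ => v0; have [H _] := gxi; have [p yp] := rowP_neq0 (H (rshift 1 a)).
have E : v = (v 0 p / y a 0 p) *: y a.
  apply/rowP => l; have := xi_row gxi CX a p l; rewrite -/v -/x -/(y a) => E.
  by apply: (mulfI yp); rewrite E mxZE; move: yp; rewrite -/(y a) => yp; field.
exists (v 0 p / y a 0 p) => //; apply: contraNneq v0 => v0; by rewrite E v0 scale0r.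
Qed.

(** If no projection from a center kills the first component of xi, the Pluecker
    relations put xi in the first chart. Otherwise C lies over a center, and the
    equations for the increment show that xi is in the chart around it, at t = 0.
    In this way the generic point of every curve lies in some chart, so that no covering of the blow-up by charts is needed. *)
Lemma point_cases : (exists A, exists2 c, forall i, c i != 0 & gr io A = rscale c xi) \/
  exists b Y, colsub (I b) Y = 0 /\ exists2 c, forall i, c i != 0 & ch b io 0 Y = rscale c xi.
Proof.
have [xn _] := gxi; have x0 : x != 0 by rewrite /x -row_u.
have [[b xb]|nb] := pselect (exists b, x *m map_mx io (cok Gam b) = 0); [right|left]; last first.
  have [l xl] := rowP_neq0 x0; pose A := Lmat (enum_val l : {ffun 'I_k -> 'I_n}) x.
  have plkA : plk A = x 0 l ^+ k.-1 *: x.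
    apply: (scalerI xl); rewrite (xi_plk gxi CX l) scalerA -exprS prednK //.
  have xk : x 0 l ^+ k.-1 != 0 by rewrite expf_neq0.
  exists A; apply: rscale_ex => [|a]; first by exists (x 0 l ^+ k.-1); rewrite // stack_u.
  rewrite stack_row plkA -scalemxAl; have [|d d0 ->] := @point_row_cok a.
    by apply/eqP => xa; apply: nb; exists a.
  by exists (x 0 l ^+ k.-1 * d); rewrite ?mulf_neq0 // scalerA.
have [d d0 GE] := GamE b.
have [t tE] : exists t, x = t *: plk (map_mx io (Aa b)).
  have : (x <= map_mx io (Gam b))%MS.
    by rewrite submxE -map_cokermx; move/eqP: xb; rewrite /cok -lock.
  rewrite GE map_mxZ -plk_map => /sub_rVP[t ->]; exists (t * io d); by rewrite scalerA.
have tn : t != 0 by apply: contraNneq x0 => t0; rewrite tE t0 scale0r.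
have A1 : colsub (I b) (map_mx io (Aa b)) = 1%:M.
  apply/matrixP => i j; have /matrixP/(_ i j) := Aa1 b; rewrite !mxE => ->.
  exact: rmorph_nat.
have xt : x 0 (idx b) = t by rewrite tE mxE plk_idx // mulr1.
pose Y := incr Aa1 GamE io xi b.
have yb : y b = Tel (map_mx io (Aa b)) Y (map_mx io (Aa b)) *m map_mx io (cok Gam b).
  apply/rowP => l; have := xi_incr k_gt0 Aa1 GamE gxi CX b l.
  rewrite -/x -/(y b) -/Y xt tE LmatZ Lmat_plk1 // Tel_scale -scalemxAl mxZE.
  rewrite mulrA -exprS prednK // => /(mulfI _) -> //.
  by rewrite expf_neq0.
have E0 : map_mx io (Aa b) + 0 *: Y = map_mx io (Aa b) by rewrite scale0r addr0.
exists b, Y; split; first exact: (xi_incr_block Aa1 GamE gxi CX).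
apply: rscale_ex.
  by exists t^-1; rewrite ?invr_eq0 // stack_u E0 -/x tE scalerA mulVf // scale1r.
move=> a; rewrite stack_row E0; have [->|ab] := eqVneq a b.
  by exists 1; rewrite ?oner_neq0 // scale1r.
have [|s s0 sE] := @point_row_cok a.
  rewrite tE -scalemxAl scaler_eq0 negb_or tn plk_map -map_mxM map_mx_eq0.
  by apply: (Gam_ncok Aa1 GamE Gam_inj); rewrite eq_sym.
exists (t^-1 * s); rewrite ?mulf_neq0 ?invr_eq0 // -scalerA -sE tE -scalemxAl scalerA.
by rewrite mulVf // scale1r.
Qed.
End Coordinates.

Variable LB : line_bundle X.
Notation opn := (@lb_open K (1 + r) N X LB).
Notation trn := (@lb_trans K (1 + r) N X LB).
Notation J := 'I_(lb_size LB).
Notation W0 := (@W0 K k n r Gam LB).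
Notation Wb := (@Wb K k n r Aa Gam LB).

Variables (P0 Q0 : J -> T).
Hypothesis PQ0 : forall j A, W0 j A -> evA idK A (P0 j) != 0 /\ evA idK A (Q0 j) != 0.
Hypothesis PQ0g : forall i j A, W0 i A -> W0 j A ->
  evA idK A (P0 i) * evA idK A (Q0 j) =
    trn i j (gr idK A) * evA idK A (P0 j) * evA idK A (Q0 i).
Notation active := (@active K k n r Gam LB).
Variables (e e' : J -> nat).
Hypothesis He : forall j, active j -> forall (F : comNzRingType) (io : {rmorphism K -> F})
  (B : 'M[F]_k) A, evA io (B *m A) (P0 j) = \det B ^+ e j * evA io A (P0 j) /\
  evA io (B *m A) (Q0 j) = \det B ^+ e' j * evA io A (Q0 j).
Variable a0 : int.
Hypothesis a0E : forall j, active j -> (e j)%:Z - (e' j)%:Z = a0.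
Variables (P Q : 'I_r -> J -> Tb).
Hypothesis PQb : forall b j t Y, Wb b j t Y -> evB idK t Y (P b j) != 0 /\ evB idK t Y (Q b j) != 0.
Hypothesis PQbg : forall b i j t Y, Wb b i t Y -> Wb b j t Y ->
  evB idK t Y (P b i) * evB idK t Y (Q b j) =
    trn i j (ch b idK t Y) * evB idK t Y (P b j) * evB idK t Y (Q b i).
Variables (f f' : 'I_r -> nat) (cc : 'I_r -> K).
Hypothesis cc0 : forall b, cc b != 0.
Hypothesis HC : forall b j, active j -> Nb Aa P0 b (Q b) j * towX K (k * n).+1 (k * n) ^+ f' b =
  towC K (k * n).+1 (cc b) * (towX K (k * n).+1 (k * n) ^+ f b * Db Aa Q0 b (P b) j).

(** The coefficients of the bundle along the exceptional divisors, as [a0] is, up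
    to sign, the one along the hyperplane class. *)
Definition cb b : int := (f b)%:Z - (f' b)%:Z.

Lemma Wb_active b j t Y : Wb b j t Y -> active j.
Proof.
move=> WB; have : chart_open (LB:=LB) (PsiB Aa Gam b) j (upd (wpt Y) (k * n) t).
  by apply/chart_openb; rewrite matm_upd /upd eqxx.
move=> /(chart_open_open (chartXb GamE (b:=b)))[h h0 H].
have : h * towX K (k * n).+1 (k * n) != 0.
  rewrite mulf_neq0 //; first by apply: contraNneq h0 => ->; rewrite rmorph0.
  have : evB idK 1 Y (towX K (k * n).+1 (k * n)) != 0 by rewrite evB_t oner_eq0.
  by apply: contraNneq => ->; rewrite rmorph0.
move=> /evB_nonzero[t' [Y']]; rewrite rmorphM evB_t mulf_eq0 negb_or => /andP[h' t0].
have /chart_openb := H (upd (wpt Y') (k * n) t') h'.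
rewrite matm_upd /upd eqxx => /(Wb_W0 GamE _ _ _ t0) W'.
by exists (Aa b + t' *: Y').
Qed.

Lemma PQ0_chart j y : chart_open (LB:=LB) (Psi0 Gam) j y ->
  ev idK y (k * n) (P0 j) != 0 /\ ev idK y (k * n) (Q0 j) != 0.
Proof. by move=> /chart_open0/PQ0; rewrite -(ev_matm idK y (P0 j)) -(ev_matm idK y (Q0 j)). Qed.

Lemma PQ0g_chart i j y : chart_open (LB:=LB) (Psi0 Gam) i y -> chart_open (LB:=LB) (Psi0 Gam) j y ->
  ev idK y (k * n) (P0 i) * ev idK y (k * n) (Q0 j) =
  trn i j (chart_at (Psi0 Gam) y) * ev idK y (k * n) (P0 j) * ev idK y (k * n) (Q0 i).
Proof.
move=> /chart_open0 Wi /chart_open0 Wj; have := PQ0g Wi Wj.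
rewrite -(ev_matm idK y (P0 j)) -(ev_matm idK y (Q0 j)).
by rewrite -(ev_matm idK y (P0 i)) -(ev_matm idK y (Q0 i)) chart_at_gr.
Qed.

Lemma PQb_chart b j y : chart_open (LB:=LB) (PsiB Aa Gam b) j y ->
  ev idK y (k * n).+1 (P b j) != 0 /\ ev idK y (k * n).+1 (Q b j) != 0.
Proof.
by move=> /chart_openb/PQb; rewrite -(ev_matmB idK y (P b j)) -(ev_matmB idK y (Q b j)).
Qed.

Lemma PQbg_chart b i j y : chart_open (LB:=LB) (PsiB Aa Gam b) i y ->
  chart_open (LB:=LB) (PsiB Aa Gam b) j y ->
  ev idK y (k * n).+1 (P b i) * ev idK y (k * n).+1 (Q b j) =
  trn i j (chart_at (PsiB Aa Gam b) y) * ev idK y (k * n).+1 (P b j) * ev idK y (k * n).+1 (Q b i).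
Proof.
move=> /chart_openb Wi /chart_openb Wj; have := PQbg Wi Wj.
rewrite -(ev_matmB idK y (P b j)) -(ev_matmB idK y (Q b j)).
by rewrite -(ev_matmB idK y (P b i)) -(ev_matmB idK y (Q b i)) chart_at_ch.
Qed.

Lemma fibre_scale b (R : comNzRingType) (io : {rmorphism K -> R}) (Y : 'M[R]_(k, n)) la :
  ch b io 0 (la *: Y) = rscale (rowsc b la) (ch b io 0 Y).
Proof.
have E : map_mx io (Aa b) + 0 *: (la *: Y) = map_mx io (Aa b) + 0 *: Y by rewrite !scale0r.
apply: stack_ext => [|a]; first by rewrite usubmx_rscale !stack_u E /rowsc eq_lrshift scale1r.
rewrite row_rscale !stack_row E /rowsc (inj_eq (@rshift_inj _ _)).
by case: eqP => _; rewrite ?scale1r // TelZ scalemxAl.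
Qed.

Lemma rowscF_neq0 (F : fieldType) b (t : F) i : t != 0 -> rowsc (r:=r) b t i != 0.
Proof. by move=> t0; rewrite /rowsc; case: ifP => // _; apply: oner_neq0. Qed.

Lemma scaleKV (F : fieldType) p q (t : F) (D : 'M[F]_(p, q)) : t != 0 -> t *: (t^-1 *: D) = D.
Proof. by move=> t0; rewrite scalerA divff // scale1r. Qed.

Lemma scaleVK (F : fieldType) p q (t : F) (D : 'M[F]_(p, q)) : t != 0 -> t^-1 *: (t *: D) = D.
Proof. by move=> t0; rewrite scalerA mulVf // scale1r. Qed.

Lemma scale_ratio (F : fieldType) q (t : F) (v : 'rV[F]_q) l : t != 0 ->
  ((t *: v) 0 l)^-1 *: (t *: v) = (v 0 l)^-1 *: v.
Proof. by move=> t0; rewrite mxE scalerA invfM mulrAC mulVf // mul1r. Qed.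

Lemma rscale_mul (F : fieldType) p q (c d : 'I_p -> F) (M : 'M[F]_(p, q)) :
  rscale c (rscale d M) = rscale (fun i => c i * d i) M.
Proof. by apply/matrixP => i j; rewrite !mxE mulrA. Qed.

Lemma rscale_div (F : fieldType) p q (c d : 'I_p -> F) (M M' : 'M[F]_(p, q)) :
  (forall i, c i != 0) -> rscale c M = rscale d M' ->
  M = rscale (fun i => (c i)^-1 * d i) M'.
Proof. by move=> c0 E; rewrite -rscale_mul -E rscale_mul; apply/matrixP => i j; rewrite mxE mulVf // mul1r. Qed.

Lemma rscale_div_ex (F : fieldType) p q (c d e1 : 'I_p -> F) (M M' M1 : 'M[F]_(p, q)) :
  (forall i, c i != 0) -> (forall i, d i != 0) -> (forall i, e1 i != 0) ->
  rscale c M = rscale d M' -> M' = rscale e1 M1 ->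
  exists2 g, forall i, g i != 0 & M = rscale g M1.
Proof.
move=> c0 d0 e10 /(rscale_div c0) -> ->; rewrite rscale_mul.
by exists (fun i => (c i)^-1 * d i * e1 i) => // i; rewrite !mulf_neq0 ?invr_eq0.
Qed.

(** The order at w of the rational section given by the first chart, in terms of
    the minimal valuations of the rows of a representative V of the generic point.
    With H the hyperplane class and E_b the exceptional divisors, the minimal
    valuation of the row 0 corresponds to - H, and that of the b-th row to E_b - H. *)
Definition order_form (F : fieldType) (V : 'M[F]_(1 + r, N)) (w : F -> int) : int :=
  a0 * mv w (row e0 V) + \sum_b cb b * (mv w (row (rshift 1 b) V) - mv w (row e0 V)).

Lemma order_form_rowsc (F : fieldType) (ioF : {rmorphism K -> F}) (V : 'M[F]_(1 + r, N)) w b tau v :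
  aplace ioF w -> (forall i, mv w (row i V) = w (rowsc b tau i) - v) ->
  order_form V w = a0 * - v + cb b * w tau.
Proof.
move=> pw mvE; have E0 : mv w (row e0 V) = - v by rewrite mvE /rowsc eq_lrshift (av1 pw) add0r.
rewrite /order_form E0 (bigD1 b) //= big1 => [|b' bb'].
  by rewrite mvE /rowsc eqxx opprK addr0 subrK.
by rewrite mvE /rowsc (inj_eq (@rshift_inj _ _)) (negbTE bb') (av1 pw) add0r subrr mulr0.
Qed.

Section Curve.
Variable C : set 'M[K]_(1 + r, N).
Hypothesis hC : irred_closed C.
Hypothesis CX : C `<=` X.
Notation F := (rfield hC).
Notation io := (io hC).
Notation gpt := (gpt hC).
Hypothesis Fdep : forall x y : F, algdep io x y.

Lemma redm_rcenter w (pw : aplace io w) (c : 'I_(1 + r) -> F) (M : 'M[F]_(1 + r, N)) z :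
  (forall i, c i != 0) -> M = rscale c gpt -> redm io w M z -> ppoint z -> rcenter w z.
Proof.
move=> c0 ME H pz; apply: (red_rcenter pw c0 _ pz) => i l.
by have := H i l; rewrite ME mxE.
Qed.

Lemma psum_mv c i : c != 0 -> psum io (fun w => mv w (c *: row i gpt)) = - fdeg hC i /\
  fsupp io (fun w => mv w (c *: row i gpt)).
Proof.
move=> c0; have fc : fsupp io (fun w => w c) by apply: (rfield_finite Fdep c0).
have fm := fdeg_fsupp Fdep i.
have [E H] := psumD fc fm; rewrite (rfield_sum Fdep c0) add0r in E.
have EE w : aplace io w -> w c + mv w (row i gpt) = mv w (c *: row i gpt).
  by move=> pw; rewrite (mvZ pw c0 (gpt_row_neq0 hC i)).
split; last exact: eq_fsupp EE H.
by rewrite -(eq_psum EE) E opprK.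
Qed.

Lemma psum_order_form (c : 'I_(1 + r) -> F) : (forall i, c i != 0) ->
  psum io (order_form (rscale c gpt)) = - a0 * fdeg hC e0 +
    \sum_b cb b * (fdeg hC e0 - fdeg hC (rshift 1 b)) /\
  fsupp io (order_form (rscale c gpt)).
Proof.
move=> c0; have R i : psum io (fun w => mv w (row i (rscale c gpt))) = - fdeg hC i /\
    fsupp io (fun w => mv w (row i (rscale c gpt))).
  by rewrite row_rscale; apply: psum_mv.
have S b : psum io (fun w => cb b * (mv w (row (rshift 1 b) (rscale c gpt)) -
      mv w (row e0 (rscale c gpt)))) = cb b * (fdeg hC e0 - fdeg hC (rshift 1 b)) /\
    fsupp io (fun w => cb b * (mv w (row (rshift 1 b) (rscale c gpt)) - mv w (row e0 (rscale c gpt)))).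
  have [E1 H1] := R (rshift 1 b); have [E0 H0] := R e0.
  have [E2 H2] := psumZ (-1) H0; have [E3 H3] := psumD H1 H2.
  have [E4 H4] := psumZ (cb b) H3.
  have EE w : aplace io w -> cb b * (mv w (row (rshift 1 b) (rscale c gpt)) +
      -1 * mv w (row e0 (rscale c gpt))) = cb b * (mv w (row (rshift 1 b) (rscale c gpt)) -
      mv w (row e0 (rscale c gpt))) by rewrite mulN1r.
  split; last exact: eq_fsupp EE H4.
  rewrite -(eq_psum EE) E4 E3 E2 E1 E0; ring.
have [E0 H0] := R e0; have [E1 H1] := psumZ a0 H0.
have [E2 H2] := psum_sum (fun b => (S b).2); have [E3 H3] := psumD H1 H2.
split=> //; rewrite E3 E1 E0 E2; congr (_ + _); first by rewrite mulrN mulNr.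
by apply: eq_bigr => b _; case: (S b).
Qed.

(** ** Curves not contained in the exceptional divisors *)

Section Generic.
Variables (A : 'M[F]_(k, n)) (c : 'I_(1 + r) -> F).
Hypothesis c0 : forall i, c i != 0.
Hypothesis AE : gr io A = rscale c gpt.

Let x := plk A.

Definition sig0 j : F := evA io A (P0 j) / evA io A (Q0 j).

Lemma gr_row_neq0 i : row i (gr io A) != 0.
Proof. by rewrite AE row_rscale scaler_eq0 negb_or c0 gpt_row_neq0. Qed.

Lemma x_neq0 : x != 0.
Proof. by have := gr_row_neq0 e0; rewrite row_u stack_u. Qed.

Let yE : map_mx (ev io (wpt A) (k * n)) (Psi0 Gam) = rscale c gpt.
Proof. by rewrite -AE -evA_Psi0. Qed.

Lemma sig0_ratsection : ratsection LB C (fun j => rep (sig0 j)).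
Proof. exact: (chart_ratsection cX CX PQ0_chart PQ0g_chart c0 yE). Qed.

Lemma sig0_neq0 j : C `&` opn j !=set0 -> evA io A (P0 j) != 0 /\ evA io A (Q0 j) != 0.
Proof. exact: (chart_section_neq0 cX CX PQ0_chart c0 yE). Qed.

Section Place.
Variables (w : F -> int) (pw : aplace io w).

(** A change of basis changes the section by a power of the determinant; this is
    [weights]. *)
Lemma sig0_change (B : 'M[F]_k) j : \det B != 0 -> active j -> C `&` opn j !=set0 ->
  [/\ evA io (B *m A) (P0 j) != 0, evA io (B *m A) (Q0 j) != 0 &
  w (evA io (B *m A) (P0 j) / evA io (B *m A) (Q0 j)) = a0 * w (\det B) + w (sig0 j)].
Proof.
move=> d0 aj /sig0_neq0[p0 q0]; have [-> ->] := He aj io B A.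
have s0 := ratio_neq0 p0 q0.
have d1 : \det B ^+ e j != 0 by rewrite expf_neq0.
have d2 : \det B ^+ e' j != 0 by rewrite expf_neq0.
split; try exact: mulf_neq0.
rewrite -mulf_div (avM pw (ratio_neq0 d1 d2) s0) -(a0E aj); congr (_ + _).
exact: (av_exp_ratio pw).
Qed.

(** At a place whose center lies over no center of the blow-up: after a change of
    basis, the matrix of the generic point reduces to the matrix of the center of
    the place. There the trivialization is a unit, so only the change of basis
    contributes. *)
Lemma generic_away l (u : 'rV[K]_N) : x 0 l != 0 -> redm io w ((x 0 l)^-1 *: x) u ->
  (forall b, u *m cok Gam b != 0) -> u != 0 ->
  exists z j, [/\ rcenter w z, opn j z & w (sig0 j) = order_form (gr io A) w].
Proof.
move=> xl ru ub u0; have [B [dB B1 BE]] := normalize xl.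
have dB0 : \det B != 0 by rewrite dB invr_eq0.
pose Ab := Lmat (enum_val l : {ffun 'I_k -> 'I_n}) u.
have rA : redm io w (B *m A) Ab by rewrite BE; apply: (redm_Lmat pw).
have rG := redm_gr pw Gam rA; set z := gr idK Ab in rG.
have grE : gr io (B *m A) = rscale (fun i => \det B * c i) gpt.
  by rewrite gr_mul AE; apply/matrixP => i j; rewrite !mxE mulrA.
have uE : plk Ab = u.
  have := redm_row e0 rG; rewrite row_u stack_u row_u stack_u plk_mul dB => H.
  exact: (redm_uniq pw H ru).
have pz : ppoint z.
  apply: ppoint_stack => [|b]; first by rewrite stack_u uE.
  by rewrite stack_row uE map_idrm ub.
have rz : rcenter w z := redm_rcenter pw (fun i => mulf_neq0 dB0 (c0 i)) grE rG pz.
have [j Uj] := @lb_cover _ _ _ _ LB _ (CX (proj1 rz)).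
have WA : W0 j Ab by split.
have nj : C `&` opn j !=set0 := ex_intro _ z (conj (proj1 rz) Uj).
have [p q] := PQ0 WA.
have [p0 vp] := red_unit pw p (red_ev pw (P0 j) (fun i im => redm_wpt rA im)).
have [q0 vq] := red_unit pw q (red_ev pw (Q0 j) (fun i im => redm_wpt rA im)).
have [_ _ E] := sig0_change dB0 (ex_intro _ Ab WA) nj.
exists z, j; split; [exact: rz|exact: Uj|].
move: E; rewrite (av_ratio pw p0 q0) -/(evA io _) vp vq subr0 => E.
have mvE i : mv w (row i (gr io A)) = - w (\det B).
  have -> : row i (gr io A) = (\det B)^-1 *: row i (gr io (B *m A)).
    by rewrite gr_mul row_rscale scalerA mulVf // scale1r.
  rewrite (mvZ pw) ?invr_eq0 ?(avV pw) //; last first.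
    by apply: (redm_neq0 pw (pz i)); apply: redm_row.
  by rewrite (mv_redm pw (pz i)) ?addr0 //; apply: redm_row.
rewrite /order_form !mvE big1 ?addr0 => [|b _]; last by rewrite mvE subrr mulr0.
by apply/eqP; rewrite mulrN -addr_eq0 addrC -E.
Qed.

(** At a place whose center lies on the exceptional divisor over b: normalize the
    matrix and write it as A_b + tau Y with Y primitive, so that (tau, Y) reduces
    to (0, Yb) with Yb nonzero. The trivialization on the chart around the divisor
    is a unit there, and [compare_charts] gives the additional contribution w tau. *)
Lemma generic_over b : x 0 (idx b) != 0 ->
  redm io w ((x 0 (idx b))^-1 *: x) (plk (Aa b)) ->
  exists z j, [/\ rcenter w z, opn j z & w (sig0 j) = order_form (gr io A) w].
Proof.
move=> xl ru; have [B [dB B1 BE]] := normalize xl.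
have dB0 : \det B != 0 by rewrite dB invr_eq0.
have rA : redm io w (B *m A) (Aa b).
  by have := redm_Lmat pw (I b) ru; rewrite -BE Lmat_plk1.
pose D := B *m A - map_mx io (Aa b).
have rD : redm io w D 0 by have := redmB pw rA (redm_map io w (Aa b)); rewrite subrr.
have DI : colsub (I b) D = 0.
  apply/matrixP => i j; have /matrixP/(_ i j) := B1; have /matrixP/(_ i j) := Aa1 b.
  rewrite !mxE => -> ->; rewrite rmorph_nat subrr //.
have D0 : D != 0.
  apply/eqP => /subr0_eq DE; have := gr_row_neq0 (rshift 1 b).
  have : row (rshift 1 b) (gr io (B *m A)) = 0 by rewrite DE stack_row map_plk_cok.
  rewrite gr_mul row_rscale => /eqP; rewrite scaler_eq0 (negbTE dB0) /=.
  by move=> /eqP ->; rewrite eqxx.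
have [i0 [l0 [Yb [Dn rY Yb0]]]] := primitive_matrix pw Fdep D0.
set tau := D i0 l0 in Dn rY; pose Y := tau^-1 *: D.
have YE : D = tau *: Y by rewrite scaleKV.
have YbI := redm_colsub0 pw DI rY.
have rt : vge w 1 (tau - io 0).
  have E0 : (0 : 'M[K]_(k, n)) i0 l0 = 0 by rewrite mxE.
  by rewrite -E0; apply: rD.
have rG := redm_ch pw Aa Gam b rt rY; set z := ch b idK 0 Yb in rG.
have pz : ppoint z by apply: ch_fibre.
have c1 i : rowsc b tau i != 0 by apply: rowscF_neq0.
have BAE : map_mx io (Aa b) + tau *: Y = B *m A by rewrite -YE addrC subrK.
have chE : rscale (rowsc b tau) (ch b io tau Y) = rscale (fun=> \det B) (gr io A).
  by rewrite (ch_gr GamE) BAE gr_mul.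
have [g gn grE] := rscale_div_ex c1 (fun=> dB0) c0 chE AE.
have rz : rcenter w z := redm_rcenter pw gn grE rG pz.
have [j Uj] := @lb_cover _ _ _ _ LB _ (CX (proj1 rz)).
have WB : Wb b j 0 Yb by split.
have aj := Wb_active WB; have [p q] := PQb WB.
have [p0 vp] := red_unit pw p (red_ev pw (P b j) (fun i im => red_upd rt rY im)).
have [q0 vq] := red_unit pw q (red_ev pw (Q b j) (fun i im => red_upd rt rY im)).
rewrite -/(evB io tau Y) in p0 vp q0 vq.
have key : evA io (B *m A) (P0 j) * evB io tau Y (Q b j) * tau ^+ f' b =
    io (cc b) * (tau ^+ f b * (evA io (B *m A) (Q0 j) * evB io tau Y (P b j))).
  have := congr1 (evB io tau Y) (HC b aj).
  rewrite rmorphM rmorphXn evB_t evB_N BAE => ->.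
  have fio d : evB io tau Y (towC K (k * n).+1 d) = io d by apply: evC.
  rewrite rmorphM fio [evB _ _ _ (_ ^+ _ * _)]rmorphM rmorphXn evB_t evB_D BAE //.
have nj : C `&` opn j !=set0 := ex_intro _ z (conj (proj1 rz) Uj).
have [PA QA E] := sig0_change dB0 aj nj.
have E2 := av_compare pw PA QA p0 q0 Dn (cc0 b) vp vq key.
have {}E : w (sig0 j) = cb b * w tau - a0 * w (\det B).
  by rewrite /cb -E2 E addrC addKr.
have grA := rscale_div (fun=> dB0) (esym chE).
have mvE i : mv w (row i (gr io A)) = w (rowsc b tau i) - w (\det B).
  have cn : row i (ch b io tau Y) != 0 by apply: (redm_neq0 pw (pz i)); apply: redm_row.
  have dn : (\det B)^-1 != 0 by rewrite invr_eq0.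
  have ln : (\det B)^-1 * rowsc b tau i != 0 by apply: mulf_neq0.
  rewrite grA row_rscale (mvZ pw ln cn) (mv_redm pw (pz i)) ?addr0; last exact: redm_row.
  by rewrite (avM pw dn (c1 i)) (avV pw dB0) addrC.
exists z, j; split; [exact: rz|exact: Uj|].
by rewrite E (order_form_rowsc pw mvE) mulrN addrC.
Qed.

(** The reduction of the first component of the generic point tells which of the
    two cases holds. *)
Lemma generic_place : exists z j, [/\ rcenter w z, opn j z & w (sig0 j) = order_form (gr io A) w].
Proof.
have [[l xl E] H] := mvP w x_neq0.
have [u ru] : exists u, redm io w ((x 0 l)^-1 *: x) u.
  apply: (redm_ex pw Fdep) => i j; rewrite ord1 mxE.
  have := vgeM pw (_ : vge w (- w (x 0 l)) (x 0 l)^-1) (H j); rewrite E addrC subrr; apply.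
  by rewrite vgeP ?invr_eq0 // (avV pw).
have u0 : u != 0.
  apply: contra_neq (oner_neq0 K) => u0; have := ru 0 l.
  rewrite u0 [X in vge w 1 (X - _)]mxE mulVf // mxE => H1; apply: (red_uniq pw _ H1).
  by rewrite rmorph1 subrr vge0.
have [[b ub]|nb] := pselect (exists b, u *m cok Gam b = 0); last first.
  apply: (generic_away xl ru) => // b; apply/eqP => ub; by apply: nb; exists b.
have [d d0 GE] := GamE b; move/eqP: ub; rewrite cok_eq0 GE => sub.
have /sub_rVP[t tE] : (u <= plk (Aa b))%MS by apply: submx_trans sub _; rewrite scalemx_sub.
have ut : u 0 (idx b) = t by rewrite tE mxE plk_idx // mulr1.
have tn : t != 0 by apply: contraNneq u0 => t0; rewrite tE t0 scale0r.
have ul : u 0 (idx b) != 0 by rewrite ut.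
have [yl wl] := red_unit pw ul (ru 0 (idx b)).
have xb : x 0 (idx b) != 0.
  by move: yl; rewrite mxE mulf_eq0 negb_or => /andP[].
apply: (generic_over xb); have := redm_rescale pw ul ru.
have xl' : (x 0 l)^-1 != 0 by rewrite invr_eq0.
by rewrite (scale_ratio _ _ xl') ut tE scaleVK.
Qed.
End Place.

Lemma generic_degree : degree LB C = - a0 * fdeg hC e0 +
  \sum_b cb b * (fdeg hC e0 - fdeg hC (rshift 1 b)).
Proof.
have [<- fs] := psum_order_form c0; rewrite -AE.
apply: (degreeP cX CX Fdep sig0_ratsection); first by rewrite AE.
by move=> w pw; have [z [j [rz Uj E]]] := generic_place pw; exists z, j; rewrite cl_rep.
Qed.
End Generic.

(** ** Curves contained in an exceptional divisor *)

Section Fibre.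
Variables (b : 'I_r) (Y : 'M[F]_(k, n)) (c : 'I_(1 + r) -> F).
Hypothesis c0 : forall i, c i != 0.
Hypothesis YI : colsub (I b) Y = 0.
Hypothesis YE : ch b io 0 Y = rscale c gpt.

(** For a curve contained in the exceptional divisor over b, the generic point has
    t = 0. *)
Definition sigb j : F := evB io 0 Y (P b j) / evB io 0 Y (Q b j).

Let yE : map_mx (ev io (upd (wpt Y) (k * n) 0) (k * n).+1) (PsiB Aa Gam b) = rscale c gpt.
Proof. by rewrite -YE -evB_PsiB. Qed.

Lemma sigb_ratsection : ratsection LB C (fun j => rep (sigb j)).
Proof. exact: (chart_ratsection cX CX (PQb_chart (b:=b)) (PQbg_chart (b:=b)) c0 yE). Qed.

Lemma sigb_neq0 j : C `&` opn j !=set0 ->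
  evB io 0 Y (P b j) != 0 /\ evB io 0 Y (Q b j) != 0.
Proof. exact: (chart_section_neq0 cX CX (PQb_chart (b:=b)) c0 yE). Qed.

(** Divide Y by an entry of minimal valuation, to bring the point to the domain
    where the trivialization is a unit; by [exceptional_weight] this changes the
    section by a power of that entry. *)
Lemma fibre_place w : aplace io w ->
  exists z j, [/\ rcenter w z, opn j z & w (sigb j) = order_form (ch b io 0 Y) w].
Proof.
move=> pw; have Yn : Y != 0.
  apply/eqP => Y0; have := gpt_row_neq0 hC (rshift 1 b); apply/negP; rewrite negbK.
  have := fibre_scale b io Y 0; have -> : 0 *: Y = Y by rewrite Y0 scaler0.
  rewrite YE => /(congr1 (row (rshift 1 b))).
  rewrite row_rscale row_rscale row_rscale /rowsc eqxx scale0r => /eqP.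
  by rewrite scaler_eq0 (negbTE (c0 _)).
have [i0 [l0 [Yb [Dn rY Yb0]]]] := primitive_matrix pw Fdep Yn.
set tau := Y i0 l0 in Dn rY; pose la := tau^-1; pose Y' := la *: Y.
have la0 : la != 0 by rewrite invr_eq0.
have wla : w la = - w tau by rewrite (avV pw).
have YbI := redm_colsub0 pw YI rY.
have rt : vge w 1 (0 - io 0) by rewrite rmorph0 subrr vge0.
have rG := redm_ch pw Aa Gam b rt rY; set z := ch b idK 0 Yb in rG.
have pz : ppoint z by apply: ch_fibre.
have c1 i : rowsc b la i != 0 by apply: rowscF_neq0.
have grE : ch b io 0 Y' = rscale (fun i => rowsc b la i * c i) gpt.
  by rewrite fibre_scale YE rscale_mul.
have rz : rcenter w z := redm_rcenter pw (fun i => mulf_neq0 (c1 i) (c0 i)) grE rG pz.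
have [j Uj] := @lb_cover _ _ _ _ LB _ (CX (proj1 rz)).
have nj : C `&` opn j !=set0 := ex_intro _ z (conj (proj1 rz) Uj).
have WB : Wb b j 0 Yb by split.
have aj := Wb_active WB; have [p q] := PQb WB.
have [p0 vp] := red_unit pw p (red_ev pw (P b j) (fun i im => red_upd rt rY im)).
have [q0 vq] := red_unit pw q (red_ev pw (Q b j) (fun i im => red_upd rt rY im)).
rewrite -/(evB io 0 Y') in p0 vp q0 vq.
have [PA QA] := sigb_neq0 nj.
have key := exceptional_weight PQ0 (cc0 b) (HC b) aj io la Y.
have E : w (sigb j) = cb b * w tau.
  have H : evB io 0 Y (P b j) * evB io 0 Y' (Q b j) * la ^+ f b =
      io 1 * (la ^+ f' b * (evB io 0 Y (Q b j) * evB io 0 Y' (P b j))).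
    by rewrite rmorph1 mul1r -key [RHS]mulrC [X in X * _]mulrC.
  rewrite /sigb (av_compare pw PA QA p0 q0 la0 (oner_neq0 _) vp vq H) wla /cb.
  by rewrite mulrN -mulNr opprB.
have YY : Y = tau *: Y' by rewrite scaleKV.
have mvE i : mv w (row i (ch b io 0 Y)) = w (rowsc b tau i) - 0.
  have cn : row i (ch b io 0 Y') != 0 by apply: (redm_neq0 pw (pz i)); apply: redm_row.
  have tn : rowsc b tau i != 0 by apply: rowscF_neq0.
  rewrite YY fibre_scale row_rscale (mvZ pw tn cn) (mv_redm pw (pz i)) ?subr0 ?addr0 //.
  exact: redm_row.
exists z, j; split; [exact: rz|exact: Uj|].
by rewrite E (order_form_rowsc pw mvE) oppr0 mulr0 add0r.
Qed.

Lemma fibre_degree : degree LB C = - a0 * fdeg hC e0 +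
  \sum_b cb b * (fdeg hC e0 - fdeg hC (rshift 1 b)).
Proof.
have [<- fs] := psum_order_form c0; rewrite -YE.
apply: (degreeP cX CX Fdep sigb_ratsection); first by rewrite YE.
by move=> w pw; have [z [j [rz Uj E]]] := fibre_place pw; exists z, j; rewrite cl_rep.
Qed.
End Fibre.

Lemma curve_degree : degree LB C = - a0 * fdeg hC e0 +
  \sum_b cb b * (fdeg hC e0 - fdeg hC (rshift 1 b)).
Proof.
have [[A [c c0 AE]]|[b [Y [YI [c c0 YE]]]]] := point_cases (gpt_generic hC) CX.
  exact: (generic_degree c0 AE).
exact: (fibre_degree c0 YI YE).
Qed.
End Curve.
End DegreeFormula.

(** Sum the local orders found at all places. The coefficients come from the charts
    only, so they are the same for all curves. *)
Theorem degree_formula (K : closedFieldType) (k n r : nat)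
    (idx : 'I_r -> 'I_#|increasing k n|) (Aa : 'I_r -> 'M[K]_(k, n))
    (Gam : 'I_r -> 'rV[K]_#|increasing k n|) :
  (0 < k)%N -> (k.+1 < n)%N ->
  (forall a, colsub (enum_val (idx a) : {ffun 'I_k -> 'I_n}) (Aa a) = 1%:M) ->
  (forall a, exists2 c, c != 0 & Gam a = c *: plk (Aa a)) ->
  (forall a b, a != b -> ~~ (Gam a == Gam b)%MS) ->
  forall LB : line_bundle (blowup (grassmannian K k n) Gam),
  exists a : 'I_(1 + r) -> int,
  forall C (hC : irred_closed C), is_curve C -> C `<=` blowup (grassmannian K k n) Gam ->
  degree LB C = \sum_i a i * fdeg hC i.
Proof.
move=> k0 kn Aa1 GamE Gi LB; have [P0 [Q0 [PQ0 PQ0g]]] := trivial0 k0 kn Aa1 GamE LB.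
have H b : exists PQ : ('I_(lb_size LB) -> tower K (k * n).+1) * ('I_(lb_size LB) -> tower K (k * n).+1),
   (forall j t Y, Wb Aa (LB:=LB) b j t Y -> evB (idrm K) t Y (PQ.1 j) != 0 /\ evB (idrm K) t Y (PQ.2 j) != 0) /\
  forall i j t Y, Wb Aa (LB:=LB) b i t Y -> Wb Aa (LB:=LB) b j t Y ->
  evB (idrm K) t Y (PQ.1 i) * evB (idrm K) t Y (PQ.2 j) =
    lb_trans i j (ch Aa Gam b (idrm K) t Y) * evB (idrm K) t Y (PQ.1 j) * evB (idrm K) t Y (PQ.2 i).
  by have [P [Q ?]] := trivialb k0 kn Aa1 GamE LB b; exists (P, Q).
have [PQ HPQ] := choice H.
have [e [e' [He ee]]] := weights k0 PQ0 PQ0g.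
have [A gA] := good_ex k0 kn Aa1 GamE; have [j0 U0] := @lb_cover _ _ _ _ LB _ (gr_X gA).
have W0' : W0 (LB:=LB) j0 A by split.
have aj0 : active (LB:=LB) j0 by exists A.
pose a0 := (e j0)%:Z - (e' j0)%:Z.
have a0E j : active (LB:=LB) j -> (e j)%:Z - (e' j)%:Z = a0.
  by move=> aj; have := ee _ _ aj aj0; rewrite /a0; lia.
have C1 b : exists d : nat * nat * K, d.2 != 0 /\ forall j, active (LB:=LB) j ->
    Nb Aa P0 b (PQ b).2 j * towX K (k * n).+1 (k * n) ^+ d.1.2 =
    towC K (k * n).+1 d.2 * (towX K (k * n).+1 (k * n) ^+ d.1.1 * Db Aa Q0 b (PQ b).1 j).
  have [H1 H2] := HPQ b.
  have [f [f' [c [c0 Hc]]]] := compare_charts k0 kn Aa1 GamE PQ0 PQ0g H1 H2 W0'.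
  by exists (f, f', c).
have [d Hd] := choice C1.
pose cc b := (d b).1.1%:Z - (d b).1.2%:Z.
exists (fun i => match fintype.split i with inl _ => - a0 + \sum_b cc b | inr b => - cc b end).
move=> C hC curveC CX.

rewrite (curve_degree k0 Aa1 GamE Gi PQ0 PQ0g He a0E (fun b => (HPQ b).1) (fun b => (HPQ b).2)
  (f := fun b => (d b).1.1) (f' := fun b => (d b).1.2) (cc := fun b => (d b).2)
  (fun b => (Hd b).1) (fun b => (Hd b).2) CX (curve_algdep curveC)).
rewrite big_split_ord /= big_ord1.
have -> : fintype.split (lshift r (0 : 'I_1)) = inl 0 by exact: (unsplitK (inl _ 0)).
rewrite mulrDl -addrA; congr (_ + _).
under [X in _ = _ + X]eq_bigr => b _ do rewrite (unsplitK (inr _ b) : fintype.split (rshift 1 b) = _).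
rewrite mulr_suml -big_split; apply: eq_bigr => b _ /=.
by rewrite /cb /cc mulrBr mulNr.
Qed.

(** * The line bundles O(1) of the factors *)

Section O1.
Variables (K : closedFieldType) (s N : nat) (X : set 'M[K]_(s, N)).
Hypothesis cX : zclosed X.
Variable i : 'I_s.

Definition O1_open (l : 'I_N) : set 'M[K]_(s, N) := [set z | X z /\ z i l != 0].
Definition O1_trans (l l' : 'I_N) (z : 'M[K]_(s, N)) : K := z i l' / z i l.

Lemma O1_openP l : O1_open l `<=` X /\ zclosed (X `\` O1_open l).
Proof.
split=> [z []//|]; suff -> : X `\` O1_open l = X `&` [set z | ppoint z /\ mevalM (pX K i l) z = 0].
  by apply: zclosedI => //; apply: zclosed_zero; apply: mhomogX.
apply/seteqP; split => z /=; rewrite mevalM_pev pev_pX => -[Xz H]; split=> //.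
  split; first exact: zclosed_ppoint Xz.
  by apply/eqP/negPn/negP => zl; apply: H.
by case: H => _ zl [_]; rewrite zl eqxx.
Qed.

Lemma O1_cover z : X z -> exists l, O1_open l z.
Proof. by move=> Xz; have [l zl] := ppoint_entry i (zclosed_ppoint cX Xz); exists l. Qed.

Lemma O1_regular l l' : regular_on (O1_open l `&` O1_open l') (O1_trans l l').
Proof.
move=> z _; exists (fun k => (k == i : nat)), (pX K i l'), (pX K i l), set0; split.
- exact: mhomogX.
- exact: mhomogX.
- exact: zclosed0.
- by [].
- by move=> y [[_ yl] _] _; rewrite !mevalM_pev !pev_pX.
Qed.

Lemma O1_unit l l' z : O1_open l z -> O1_open l' z -> O1_trans l l' z != 0.
Proof. by move=> [_ zl] [_ zl']; apply: ratio_neq0. Qed.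

Lemma O1_cocycle l l' l'' z : O1_open l z -> O1_open l' z -> O1_open l'' z ->
  O1_trans l l' z * O1_trans l' l'' z = O1_trans l l'' z.
Proof. by move=> [_ zl] [_ zl'] _; rewrite /O1_trans mulrC mulrA divfK. Qed.

Definition O1 : line_bundle X :=
  @LineBundle K s N X N O1_open O1_trans O1_openP O1_cover O1_regular O1_unit O1_cocycle.

(** A nonzero coordinate of the i-th component is a rational section, whose order
    at a place is minus the minimal valuation of the component, up to a principal
    divisor. *)
Lemma degree_O1 C (hC : irred_closed C) : is_curve C -> C `<=` X -> degree O1 C = fdeg hC i.
Proof.
move=> curveC CX; have Fdep := curve_algdep (hC := hC) curveC.
have gE l : C `&` O1_open l !=set0 -> gpt hC i l != 0.
  move=> [z [Cz [_ zl]]]; have := gpt_neq0 hC (@mhomogX K s N i l).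
  by rewrite pev_pX; apply; exists z; rewrite // mevalM_pev pev_pX.
have rs : ratsection O1 C (fun l => rep ((gpt hC i l)^-1)).
  split=> [l nl|l l' nl nl'] /=.
    by apply: cl_neq0_rep; rewrite invr_eq0 gE.
  apply: (gen_and2 hC _ (gen_and hC (rep_inv (gpt hC i l)) (rep_inv (gpt hC i l')))
    (gen_and hC (gen_and hC (gen_gpt hC) (pivotP hC))
       (gen_and hC (gen_open (LB:=O1) CX nl) (gen_open (LB:=O1) CX nl')))).
  move=> z _ [El El'] [[Eg pz] [[_ zl] [_ zl']]].
  have E m : rep (gpt hC i m) z = (z i (pivot hC i))^-1 * z i m.
    by have /matrixP/(_ i m) := Eg; rewrite !mxE.
  have -> : rep ((gpt hC i l)^-1) z = ((z i (pivot hC i))^-1 * z i l)^-1 by rewrite El E.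
  rewrite /= El' E /O1_trans; move: (pz i) zl zl'.
  by move: (z i (pivot hC i)) (z i l) (z i l') => x y y' *; field; apply/and3P.
have [-> fs] := fdegE Fdep i.
apply: (degreeP cX CX Fdep rs fs) => w pw.
have [z rz] := rcenter_ex Fdep pw; have [Cz [c c0 Hc]] := rz.
have [l Ul] := O1_cover (CX _ Cz); exists z, l; split=> //; rewrite cl_rep.
have [_ zl] := Ul; have gl : gpt hC i l != 0 by apply: gE; exists z.
have [cg wcg] := red_unit pw zl (Hc i l).
have wc : w (c i) = - w (gpt hC i l).
  by apply/eqP; rewrite -addr_eq0 -(avM pw (c0 i) gl) wcg.
have rr : row i z != 0 by have [cC _ _] := hC; apply: (zclosed_ppoint cC Cz).
have : mv w (c i *: row i (gpt hC)) = 0.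
  by apply: (mv_red pw rr) => m; rewrite mxE mxE [row i z _ _]mxE.
rewrite (mvZ pw (c0 i) (gpt_row_neq0 hC i)) wc (avV pw gl) => /eqP.
by rewrite addrC subr_eq0 => /eqP ->.
Qed.
End O1.

(** * Curves with constant components *)

Section Constant.
Variables (K : closedFieldType) (s N : nat).

Definition linear_form (M : 'cV[K]_N) (i : 'I_s) : mpolyM K s N := \sum_j M j 0 *: pX K i j.

Lemma pev_linear_form (R : comNzRingType) (ir : {rmorphism K -> R}) w M i :
  pev ir w (linear_form M i) = (row i w *m map_mx ir M) 0 0.
Proof.
rewrite /linear_form pev_sum mxE; apply: eq_bigr => j _.
by rewrite pevZ pev_pX !mxE mulrC.
Qed.

Lemma mhomog_linear_form M i : mhomog (fun k => (k == i : nat)) (linear_form M i).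
Proof.
apply: mhomog_criterion => c z; rewrite !mevalM_pev !pev_linear_form.
rewrite (bigD1 i) //= eqxx expr1 big1 ?mulr1 => [|k /negbTE->]; last by rewrite expr0.
by rewrite -[row i (rscale c z)](_ : c i *: row i z = _) -?scalemxAl ?mxE //; apply/rowP => l; rewrite !mxE.
Qed.

(** The 2 x 2 minors of the i-th component with the vector q: their vanishing says
    that the component is proportional to q. *)
Definition minor2 (q : 'rV[K]_N) (i : 'I_s) l l' : mpolyM K s N :=
  q 0 l *: pX K i l' - q 0 l' *: pX K i l.

Lemma pev_minor2 (R : comNzRingType) (ir : {rmorphism K -> R}) w q i l l' :
  pev ir w (minor2 q i l l') = ir (q 0 l) * w i l' - ir (q 0 l') * w i l.
Proof. by rewrite /minor2 pevB !pevZ !pev_pX. Qed.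

Lemma mhomog_minor2 q i l l' : mhomog (fun k => (k == i : nat)) (minor2 q i l l').
Proof. by rewrite /minor2 -scaleNr; apply: mhomogD; apply: mhomogZ; apply: mhomogX. Qed.

Arguments mhomog_minor2 q i l l' : clear implicits.
Arguments mhomog_linear_form M i : clear implicits.

Variables (C : set 'M[K]_(s, N)) (hC : irred_closed C).

Lemma const_row i (q : 'rV[K]_N) : q != 0 ->
  (generically C (fun z => forall l l', q 0 l * z i l' = q 0 l' * z i l)) ->
  forall l, exists c, gpt hC i l = io hC c.
Proof.
move=> q0 H l; have E l1 l2 : io hC (q 0 l1) * gpt hC i l2 = io hC (q 0 l2) * gpt hC i l1.
  apply/eqP; rewrite -subr_eq0 -pev_minor2 (gpt_eq0 hC (mhomog_minor2 q i l1 l2)); apply/asboolP.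
  apply: (gen_eq0 hC (mhomog_minor2 q i l1 l2)); apply: gen_mono H => z _ Hz.
  by rewrite mevalM_pev pev_minor2 /= Hz subrr.
have [j qj] := rowP_neq0 q0; have Ep := E j (pivot hC i); rewrite gpt_pivot mulr1 in Ep.
have qp : q 0 (pivot hC i) != 0.
  apply: contraTneq qj => qp; rewrite qp rmorph0 mul0r in Ep.
  by rewrite negbK -(fmorph_eq0 (io hC)) Ep.
exists (q 0 l / q 0 (pivot hC i)); have := E (pivot hC i) l; rewrite gpt_pivot mulr1 => El.
have ip : io hC (q 0 (pivot hC i)) != 0 by rewrite fmorph_eq0.
by apply: (mulfI ip); rewrite El -rmorphM mulrC divfK.
Qed.

(** The generic point of C has constant components except the one of index i0. That
    one cannot be constant, since otherwise C would be a point, and a nonconstant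
    coordinate has a pole. *)
Lemma one_component_degree i0 (q : 'M[K]_(s, N)) : is_curve C ->
  (forall i, i != i0 -> row i q != 0) ->
  (forall z, C z -> forall i, i != i0 -> forall l l', q i l * z i l' = q i l' * z i l) ->
  (forall i, i != i0 -> fdeg hC i = 0) /\ 0 < fdeg hC i0.
Proof.
move=> curveC q0 H; have Fdep := curve_algdep (hC := hC) curveC.
have cst i : i != i0 -> forall l, exists c, gpt hC i l = io hC c.
  move=> ii; apply: (@const_row i (row i q) (q0 i ii)); apply: (genT hC) => z Cz l l'.
  by rewrite ![row i q _ _]mxE H.
split=> [i ii|]; first by apply: fdeg_eq0; apply: cst.
have [l nc] : exists l, nonconst (io hC) (gpt hC i0 l).
  apply: contrapT => nn; have [_ np _] := curveC; apply: np; apply: (const_gpt_point (hZ := hC)).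
  move=> i; have [->|ii] := eqVneq i i0; last exact: cst.
  move=> l; apply: contrapT => nl; apply: nn; exists l => c; apply/eqP => E.
  by apply: nl; exists c.
exact: (fdeg_gt0 Fdep nc).
Qed.

End Constant.

(** ** Irreducibility *)

(** A form vanishes on D when it vanishes at the generic point, and a product of
    values in a field vanishes only if one of the factors does. *)
Lemma generic_irred (K : closedFieldType) (s N : nat) (D : set 'M[K]_(s, N)) (F : fieldType)
    (iota : {rmorphism K -> F}) (xi : 'M[F]_(s, N)) :
  zclosed D -> D !=set0 -> generic_point iota xi D -> irred_closed D.
Proof.
move=> cD nD [_ gD]; split=> // Z1 Z2 c1 c2 DZ; apply: contrapT => /not_orP[n1 n2].
have sep Z : zclosed Z -> ~ D `<=` Z -> exists d p, [/\ mhomog d p,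
    forall y, Z y -> mevalM p y = 0 & pev iota xi p != 0].
  move=> cZ nZ; have [z Dz nz] : exists2 z, D z & ~ Z z.
    apply: contrapT => H; apply: nZ => z Dz; apply: contrapT => nz; by apply: H; exists z.
  have [d [p [hp Zp pz]]] := zclosed_sep cZ (zclosed_ppoint cD Dz) nz.
  exists d, p; split=> //; apply/eqP => p0; have [/(_ p0) H _] := gD d p hp.
  by move: pz; rewrite H // eqxx.
have [d1 [p1 [h1 z1 n1']]] := sep _ c1 n1; have [d2 [p2 [h2 z2 n2']]] := sep _ c2 n2.
have [_ H] := gD _ _ (mhomogM h1 h2).
have : pev iota xi p1 * pev iota xi p2 != 0 by rewrite mulf_neq0.
rewrite -pevM H ?eqxx // => z /DZ[/z1|/z2] E; rewrite mevalM_pev pevM -!mevalM_pev E.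
  by rewrite mul0r.
by rewrite mulr0.
Qed.

(** By induction on the number of points: each of them is closed. *)
Lemma irred_finite (K : closedFieldType) (s N : nat) (Z : set 'M[K]_(s, N)) (r : seq 'M[K]_(s, N)) :
  irred_closed Z -> (forall z, z \in r -> ppoint z) ->
  (forall w, Z w -> exists2 z, z \in r & forall i, (row i w == row i z)%MS) -> is_point Z.
Proof.
move=> hZ; have [cZ nZ iZ] := hZ.
pose pt (z : 'M[K]_(s, N)) := [set w : 'M[K]_(s, N) | forall i, (row i w == row i z)%MS].
pose U (r : seq 'M[K]_(s, N)) := [set w | exists2 z, z \in r & pt z w].
have cpt z : ppoint z -> zclosed (pt z) by move=> pz; apply: is_point_closed; exists z.
have cU r' : (forall z, z \in r' -> ppoint z) -> zclosed (U r').
  elim: r' => [|z r' IH] H.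
    have -> : U [::] = set0 by apply/seteqP; split => w // -[].
    exact: zclosed0.
  have -> : U (z :: r') = pt z `|` U r'.
    apply/seteqP; split => w.
      by move=> [y]; rewrite inE => /predU1P[->|yr] yw; [left|right; exists y].
    by move=> [wz|[y yr yw]]; [exists z; rewrite ?mem_head|exists y; rewrite // inE yr orbT].
  apply: zclosedU; first by apply: cpt; apply: H; rewrite mem_head.
  by apply: IH => y yr; apply: H; rewrite inE yr orbT.
elim: r => [|z r IH] pr H; first by have [w /H[]] := nZ.
have [|||ZH|ZH] := iZ (pt z) (U r).
- by apply: cpt; apply: pr; rewrite mem_head.
- by apply: cU => y yr; apply: pr; rewrite inE yr orbT.
- move=> w /H[y]; rewrite inE => /predU1P[->|yr] yw; by [left|right; exists y].
- exists z; first by apply: pr; rewrite mem_head.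
  apply/seteqP; split => // w wz; have [y Zy] := nZ.
  apply: (zclosed_eqmx cZ _ Zy) => i; have := ZH y Zy i; have := wz i.
  move=> /eqmxP E1 /eqmxP E2; apply/eqmxP; exact: (eqmx_trans E1 (eqmx_sym E2)).
- by apply: IH => [y yr|w /ZH[y yr]]; [apply: pr; rewrite inE yr orbT|exists y].
Qed.

(** * Lines in one factor *)

Section LineCurve.
Variables (K : closedFieldType) (s N : nat) (i0 : 'I_s) (q : 'M[K]_(s, N)) (u v : 'rV[K]_N).
Hypothesis q0 : forall i, i != i0 -> row i q != 0.
Hypothesis ind : forall a b, a *: u + b *: v = 0 -> a = 0 /\ b = 0.

(** The point on a line in the i0-th factor, with the other components fixed to
    those of q. *)
Definition lpt (R : comNzRingType) (ir : {rmorphism K -> R}) (a b : R) : 'M[R]_(s, N) :=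
  \matrix_(i, l) if i == i0 then a * ir (u 0 l) + b * ir (v 0 l) else ir (q i l).

Notation lK := (lpt (idrm K)).

Definition lcurve : set 'M[K]_(s, N) :=
  [set w | exists a b c, [/\ (a != 0) || (b != 0), forall i, c i != 0 & w = rscale c (lK a b)]].

Lemma lpt_row a b : row i0 (lK a b) = a *: u + b *: v.
Proof. by apply/rowP => l; rewrite !mxE eqxx. Qed.

Lemma lpt_row' a b i : i != i0 -> row i (lK a b) = row i q.
Proof. by move=> /negbTE ii; apply/rowP => l; rewrite !mxE ii. Qed.

Lemma lpt_ppoint a b : (a != 0) || (b != 0) -> ppoint (lK a b).
Proof.
move=> ab i; have [->|ii] := eqVneq i i0; last by rewrite lpt_row' // q0.
rewrite lpt_row; apply/eqP => /ind[a0 b0]; by move: ab; rewrite a0 b0 eqxx.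
Qed.

Definition at_i0 (t : K) (i : 'I_s) : K := if i == i0 then t else 1.

Lemma lpt_scale t a b : lK (t * a) (t * b) = rscale (at_i0 t) (lK a b).
Proof.
apply/matrixP => i l; rewrite !mxE /at_i0; case: eqP => _; last by rewrite mul1r.
by rewrite mulrDr !mulrA.
Qed.

Lemma at_i0_neq0 t i : t != 0 -> at_i0 t i != 0.
Proof. by move=> t0; rewrite /at_i0; have [_|_] := eqVneq i i0; rewrite ?oner_neq0. Qed.

Lemma zclosed_lcurve : zclosed lcurve.
Proof.
pose U := col_mx u v.
exists [set p | (exists l, p = linear_form (col l (cokermx U)) i0) \/
  exists i l l', i != i0 /\ p = minor2 (row i q) i l l'].
split=> [p [[l ->]|[i [l [l' [_ ->]]]]]|].
- by eexists; apply: mhomog_linear_form.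
- by eexists; apply: mhomog_minor2.
apply/seteqP; split => z /=.
  move=> [a [b [c [ab c0 ->]]]]; split; first by apply: ppoint_rscale c0 _; apply: lpt_ppoint.
  move=> p [[l ->]|[i [l [l' [ii ->]]]]]; rewrite mevalM_pev; last first.
    by rewrite pev_minor2 ![rscale _ _ _ _]mxE !mxE (negbTE ii) /=; ring.
  rewrite pev_linear_form map_idrm.
  have -> : row i0 (rscale c (lK a b)) = c i0 *: (a *: u + b *: v).
    by rewrite row_rscale lpt_row.
  have uU : (u <= U)%MS by rewrite /U -addsmxE addsmxSl.
  have vU : (v <= U)%MS by rewrite /U -addsmxE addsmxSr.
  have : (c i0 *: (a *: u + b *: v) <= U)%MS by rewrite scalemx_sub // addmx_sub // scalemx_sub.
  rewrite submxE => /eqP E; rewrite colE mulmxA E mul0mx mxE //.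
move=> [pz H]; have [a [b Eab]] : exists a b, row i0 z = a *: u + b *: v.
  have : (row i0 z <= U)%MS.
    rewrite submxE; apply/eqP/rowP => l; rewrite [RHS]mxE.
    have := H _ (or_introl (ex_intro _ l erefl)); rewrite mevalM_pev pev_linear_form map_idrm.
    by rewrite colE mulmxA -colE mxE.
  move=> /submxP[D ->]; exists (D 0 (lshift 1 0)), (D 0 (rshift 1 0)).
  by apply/rowP => l; rewrite !mxE big_split_ord /= !big_ord1 col_mxEu col_mxEd.
have Hc i : exists d : K, d != 0 /\ row i z = d *: row i (lK a b).
  have [->|ii] := eqVneq i i0; first by exists 1; rewrite oner_neq0 scale1r lpt_row.
  rewrite lpt_row' //; have [l ql] := rowP_neq0 (q0 ii); rewrite mxE in ql.
  have [l1 zl1] := ppoint_entry i pz.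
  have E l' : q i l * z i l' = q i l' * z i l.
    have := H _ (or_intror (ex_intro _ i (ex_intro _ l (ex_intro _ l' (conj ii erefl))))).
    by rewrite mevalM_pev pev_minor2 ![row i q _ _]mxE => /eqP; rewrite subr_eq0 => /eqP.
  exists (z i l / q i l); split; last first.
    apply/rowP => l'; rewrite mxZE ![row i _ _ _]mxE; apply: (mulfI ql); rewrite E.
    by field.
  apply: ratio_neq0 => //; apply: contraNneq zl1 => zl.
  by have /eqP := E l1; rewrite zl mulr0 mulf_eq0 (negbTE ql).
have [c Hcc] := choice Hc; exists a, b, c; split=> [|i|]; last first.
- by apply/row_matrixP => i; rewrite row_rscale; case: (Hcc i).
- by case: (Hcc i).
apply/negPn/negP => /norP[/negPn/eqP a0 /negPn/eqP b0]; have := pz i0.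
by rewrite Eab a0 b0 !scale0r addr0 eqxx.
Qed.

Let iop : {rmorphism K -> {poly K}} := GRing.RMorphism.clone _ _ (@polyC K) _.

Lemma lpt_poly d (p : mpolyM K s N) : mhomog d p -> (exists2 z, lcurve z & mevalM p z != 0) ->
  exists2 P : {poly K}, P != 0 & forall t, P.[t] = mevalM p (lK 1 t).
Proof.
move=> hp [_ [a [b [c [ab c0 ->]]]]]; rewrite (mhomog_zero _ c0 hp) => pz.
have E x y t : (pev iop (lpt iop x y) p).[t] = mevalM p (lK x.[t] y.[t]).
  rewrite -[_.[t]]/(horner_eval t (pev iop (lpt iop x y) p)) pev_comp mevalM_pev.
  rewrite (@eq_pev_io _ _ _ (idrm K)) => [|e]; last by rewrite /= /horner_eval hornerC.
  congr (pev _ _ _); apply/matrixP => i l; rewrite !mxE /horner_eval; case: eqP => _.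
    by rewrite -[LHS]/((x * (u 0 l)%:P + y * (v 0 l)%:P).[t]) hornerD !hornerM !hornerC.
  by rewrite -[LHS]/((q i l)%:P.[t]) hornerC.
exists (pev iop (lpt iop 1 'X) p); last by move=> t; rewrite E hornerC hornerX.
have key x : mevalM p (lK 1 x) != 0 -> pev iop (lpt iop 1 'X) p != 0.
  move=> h; apply: contraNneq h => P0; have := E 1 'X x; rewrite P0 horner0 hornerC hornerX => <- //.
have [a0|a0] := eqVneq a 0; last first.
  apply: (key (b / a)); rewrite -(mhomog_zero _ (fun i => at_i0_neq0 i a0) hp) -lpt_scale.
  by rewrite mulr1 mulrC divfK.
have b0 : b != 0 by move: ab; rewrite a0 eqxx.
have R0 : pev iop (lpt iop 'X b%:P) p != 0.
  apply: contraNneq pz => R0; have := E 'X b%:P 0.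
  by rewrite R0 horner0 hornerX hornerC a0 => <-.
have : 'X * pev iop (lpt iop 'X b%:P) p != 0 by rewrite mulf_neq0 ?polyX_eq0.
move=> /closed_nonroot[t]; rewrite hornerM hornerX mulf_eq0 negb_or E hornerX hornerC.
move=> /andP[t0 pt]; apply: (key (b / t)).
by rewrite -(mhomog_zero _ (fun i => at_i0_neq0 i t0) hp) -lpt_scale mulr1 mulrC divfK.
Qed.

Lemma lpt_in a b : (a != 0) || (b != 0) -> lcurve (lK a b).
Proof.
move=> ab; exists a, b, (fun=> 1); split=> // [i|]; first exact: oner_neq0.
by apply/matrixP => i l; rewrite [RHS]mxE mul1r.
Qed.

Lemma line_sep Z : zclosed Z -> ~ lcurve `<=` Z -> exists2 P : {poly K}, P != 0 &
  forall t, Z (lK 1 t) -> P.[t] = 0.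
Proof.
move=> cZ nZ; have [z Dz nz] : exists2 z, lcurve z & ~ Z z.
  apply: contrapT => H; apply: nZ => z Dz; apply: contrapT => nz; by apply: H; exists z.
have [d [p [hp Zp pz]]] := zclosed_sep cZ (zclosed_ppoint zclosed_lcurve Dz) nz.
have [P P0 HP] := lpt_poly hp (ex_intro2 _ _ z Dz pz).
by exists P => // t Zt; rewrite HP Zp.
Qed.

Lemma irred_lcurve : irred_closed lcurve.
Proof.
split; [exact: zclosed_lcurve|by exists (lK 1 0); apply: lpt_in; rewrite oner_neq0|].
move=> Z1 Z2 c1 c2 DZ; apply: contrapT => /not_orP[n1 n2].
have [P1 P10 H1] := line_sep c1 n1; have [P2 P20 H2] := line_sep c2 n2.
have : P1 * P2 != 0 by rewrite mulf_neq0.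
move=> /closed_nonroot[t]; rewrite hornerM mulf_eq0 negb_or => /andP[t1 t2].
have [|Zt|Zt] := DZ (lK 1 t); first by apply: lpt_in; rewrite oner_neq0.
  by move: t1; rewrite H1 // eqxx.
by move: t2; rewrite H2 // eqxx.
Qed.

(** A closed subset that does not contain the line meets it in finitely many
    points, being cut out by a nonzero polynomial on the affine line ([line_sep]). *)
Lemma line_curve : is_curve lcurve.
Proof.
split; first exact: irred_lcurve.
  move=> [z pz E]; have H1 : lcurve (lK 1 0) by apply: lpt_in; rewrite oner_neq0.
  have H2 : lcurve (lK 0 1) by apply: lpt_in; rewrite oner_neq0 orbT.
  rewrite E in H1 H2; have /eqmxP E1 := H1 i0; have /eqmxP E2 := H2 i0.
  have /andP[+ _] : (row i0 (lK 1 0) == row i0 (lK 0 1))%MS.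
    by apply/eqmxP; apply: (eqmx_trans E1 (eqmx_sym E2)).
  rewrite !lpt_row !scale0r !scale1r addr0 add0r => /sub_rVP[c uE].
  have [|c1 _] := @ind 1 (- c); first by rewrite scale1r uE scaleNr subrr.
  by move/eqP: c1; rewrite oner_eq0.
move=> Z hZ ZD; have [DZ|nZ] := pselect (lcurve `<=` Z); first by left; apply/seteqP.
right; have [cZ _ _] := hZ; have [P P0 HP] := line_sep cZ nZ.
have [rs PE] := closed_field_poly_normal P.
apply: (@irred_finite _ _ _ _ (lK 0 1 :: [seq lK 1 t | t <- rs]) hZ).
  move=> z; rewrite inE => /predU1P[->|/mapP[t _ ->]]; apply: lpt_ppoint.
    by rewrite oner_neq0 orbT.
  by rewrite oner_neq0.
move=> w Zw; have [a [b [c [ab c0 wE]]]] := ZD w Zw.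
have [a0|a0] := eqVneq a 0.
  have b0 : b != 0 by move: ab; rewrite a0 eqxx.
  exists (lK 0 1); first exact: mem_head.
  have -> : w = rscale (fun i => c i * at_i0 b i) (lK 0 1).
    have {1}-> : w = rscale c (rscale (at_i0 b) (lK 0 1)).
      by rewrite -lpt_scale mulr0 mulr1 wE a0.
    by apply/matrixP => i l; rewrite !mxE mulrA.
  by move=> i; apply: rscale_eqmx => j; rewrite mulf_neq0 ?at_i0_neq0.
have wE' : w = rscale (fun i => c i * at_i0 a i) (lK 1 (b / a)).
  have {1}-> : w = rscale c (rscale (at_i0 a) (lK 1 (b / a))).
    by rewrite -lpt_scale mulr1 [a * _]mulrC divfK.
  by apply/matrixP => i l; rewrite !mxE mulrA.
have cn i : c i * at_i0 a i != 0 by rewrite mulf_neq0 ?at_i0_neq0.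
exists (lK 1 (b / a)); last by rewrite wE' => i; apply: rscale_eqmx.
rewrite inE; apply/orP; right; apply: map_f.
have : P.[b / a] = 0.
  by apply: HP; move: Zw; rewrite wE' => /(closed_rscale_iff _ cZ cn).
rewrite PE hornerZ horner_prod => /eqP; rewrite mulf_eq0 lead_coef_eq0 (negbTE P0) /=.
rewrite prodf_seq_eq0 => /hasP[x xr]; rewrite /= hornerXsubC subr_eq0 => /eqP ->.
by [].
Qed.

Lemma lcurve_row z : lcurve z -> exists a b c, [/\ (a != 0) || (b != 0), c != 0 &
  row i0 z = c *: (a *: u + b *: v)].
Proof.
by move=> [a [b [c [ab c0 ->]]]]; exists a, b, (c i0); rewrite row_rscale lpt_row.
Qed.

Lemma line_degree (hD : irred_closed lcurve) :
  (forall i, i != i0 -> fdeg hD i = 0) /\ 0 < fdeg hD i0.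
Proof.
apply: (one_component_degree hD line_curve q0) => z [a [b [c [_ _ ->]]]] i ii l l'.
by rewrite !mxE (negbTE ii) /=; ring.
Qed.

End LineCurve.

(** * Strict transforms of curves *)

Section StrictTransform.
Variables (K : closedFieldType) (r N : nat) (p : 'I_r -> 'rV[K]_N).
Variable C : set 'rV[K]_N.
Hypothesis curveC : is_curve C.
Let hC : irred_closed C := let: And3 h _ _ := curveC in h.
Notation F := (rfield hC).
Notation io := (io hC).
Notation gpt := (gpt hC).
Notation D := (strict_transform p C).

Lemma curve_not_const (q : 'rV[K]_N) :
  ~ generically C (fun x => (x <= q)%MS).
Proof.
move=> H; have [_ np _] := curveC; apply: np; apply: (const_gpt_point (hZ := hC)) => i.
rewrite ord1; have [cC _ _] := hC.
have q0 : q != 0.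
  have [x Cx xq] := gen_ex H; apply/eqP => qE; move: xq => /sub_rVP[t xE].
  have := zclosed_ppoint cC Cx 0; by rewrite row_id xE qE scaler0 eqxx.
have G : generically C (fun x : 'M[K]_(1, N) => forall l l', q 0 l * x 0 l' = q 0 l' * x 0 l).
  by apply: gen_mono H => x _ /sub_rVP[t ->] l l'; rewrite !mxE; ring.
exact: (@const_row K 1 N C hC 0 q q0 G).
Qed.

Lemma gen_away a : exists2 l, generically C (fun x => (x *m cokermx (p a)) 0 l != 0) &
  (gpt *m map_mx io (cokermx (p a))) 0 l != 0.
Proof.
have [x [Cx xn]] : exists x, C x /\ ~~ (x <= p a)%MS.
  apply: contrapT => H; apply: (@curve_not_const (p a)); apply: (genT hC) => x Cx.
  by apply/negPn/negP => xn; apply: H; exists x.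
have [l xl] : exists l, (x *m cokermx (p a)) 0 l != 0 by apply: rowP_neq0; rewrite -submxE.
have E (R : comNzRingType) (ir : {rmorphism K -> R}) (w : 'rV[R]_N) :
    pev ir w (linear_form (col l (cokermx (p a))) 0) = (w *m map_mx ir (cokermx (p a))) 0 l.
  by rewrite pev_linear_form row_id map_col !colE mulmxA -colE mxE.
have hl := @mhomog_linear_form K 1 N (col l (cokermx (p a))) 0.
have ex : exists2 x, C x & mevalM (linear_form (col l (cokermx (p a))) 0) x != 0.
  by exists x => //; rewrite mevalM_pev E map_idrm.
exists l; last by rewrite -E; apply: (gpt_neq0 hC hl ex).
apply: gen_mono (gen_neq0 hC hl ex) => y _; by rewrite mevalM_pev E map_idrm.
Qed.

(** The graph of the projections from the centers, over any K-algebra. It turns the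
    generic point of C into one of the strict transform. *)
Definition stgr (R : comNzRingType) (ir : {rmorphism K -> R}) (x : 'rV[R]_N) : 'M[R]_(1 + r, N) :=
  stack x (fun a => x *m map_mx ir (cokermx (p a))).

Lemma stgr_graph (x : 'rV[K]_N) : stgr (idrm K) x = graph_pt p x.
Proof. by congr col_mx; apply/matrixP => a l; rewrite !mxE map_idrm. Qed.

Definition pullback (P : mpolyM K (1 + r) N) : mpolyM K 1 N :=
  pev (mpolyCm K 1 N) (stgr (mpolyCm K 1 N) (univ K 1 N)) P.

Lemma pev_pullback (R : comNzRingType) (ir : {rmorphism K -> R}) (x : 'rV[R]_N) P :
  pev ir x (pullback P) = pev ir (stgr ir x) P.
Proof.
rewrite -pevmE pev_comp (@eq_pev_io _ _ _ ir) => [|e]; last exact: pevm_C.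
congr (pev _ _ _); apply: stack_ext => [|a].
  by rewrite -map_usubmx !stack_u pevm_univ.
by rewrite -map_row !stack_row map_mxM pevm_univ map_pevm_C.
Qed.

Lemma mhomog_pullback d P : mhomog d P -> mhomog (fun=> \sum_i d i)%N (pullback P).
Proof.
move=> hP; apply: mhomog_criterion => c z; rewrite !mevalM_pev !pev_pullback big_ord1.
have -> : stgr (idrm K) (rscale c z) = rscale (fun=> c 0) (stgr (idrm K) z).
  apply: stack_ext => [|a].
    by rewrite usubmx_rscale !stack_u; apply/matrixP => i j; rewrite ord1 !mxE.
  rewrite row_rscale !stack_row scalemxAl; congr (_ *m _).
  by apply/matrixP => i j; rewrite ord1 !mxE.
by rewrite (pev_rscale _ _ _ hP) prodrXr.
Qed.

Lemma gen_graph : generically C (fun x => forall a, ~~ (x <= p a)%MS).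
Proof.
apply: (gen_forall hC) => a; have [l H _] := gen_away a; apply: gen_mono H => x _.
by rewrite submxE; apply: contraNneq => ->; rewrite mxE.
Qed.

Lemma graph_ppointP x : C x -> (forall a, ~~ (x <= p a)%MS) -> ppoint (graph_pt p x).
Proof.
move=> Cx nx; have [cC _ _] := hC; rewrite -stgr_graph; apply: ppoint_stack => [|a].
  by rewrite stack_u; have := zclosed_ppoint cC Cx 0; rewrite row_id.
by rewrite stack_row map_idrm -submxE.
Qed.

Lemma zclosed_strict : zclosed D.
Proof. by apply: zclosureP => w [x [Cx nx] <-]; apply: graph_ppointP. Qed.

Lemma strict_generic : generic_point io (stgr io gpt) D.
Proof.
split=> [i|d P hP].
  case: (splitP i) => [j ij|a ia].
    have -> : i = lshift r 0 by apply: val_inj; rewrite /= ij [j]ord1.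
    have -> : row (lshift r 0) (stgr io gpt) = usubmx (stgr io gpt).
      by apply/rowP => l; rewrite !mxE.
    by rewrite stack_u; have := gpt_row_neq0 hC 0; rewrite row_id.
  have -> : i = rshift 1 a by apply: val_inj.
  rewrite stack_row; have [l _] := gen_away a; by apply: contraNneq => ->; rewrite mxE.
have hp := mhomog_pullback hP; have [_ /(_ _ _ hp) G] := gpt_generic hC.
rewrite -pev_pullback; split=> [/G H z Dz|H].
  suff [] : [set z | ppoint z /\ mevalM P z = 0] z by [].
  apply: (zclosure_min (zclosed_zero hP) _ Dz) => w [x [Cx nx] <-]; split.
    exact: graph_ppointP.
  by rewrite -stgr_graph mevalM_pev -pev_pullback -mevalM_pev H.
apply/G/(gen_eq0 hC hp); apply: gen_mono gen_graph => x Cx nx.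
rewrite mevalM_pev pev_pullback stgr_graph -mevalM_pev; apply: H.
by apply: sub_zclosure; exists x.
Qed.

Lemma strict_irred : irred_closed D.
Proof.
apply: generic_irred zclosed_strict _ strict_generic.
have [x Cx nx] := gen_ex gen_graph; exists (graph_pt p x).
by apply: sub_zclosure; exists x.
Qed.

(** The strict transform has a generic point over the function field of C, by
    [strict_generic]; so it is irreducible, and a curve by [curve_criterion]. *)
Theorem strict_curve : is_curve D.
Proof.
apply: (curve_criterion strict_irred _ strict_generic (curve_algdep curveC)).
move=> [z pz E]; apply: (@curve_not_const (usubmx z)); apply: gen_mono gen_graph => x Cx nx.
have : D (graph_pt p x) by apply: sub_zclosure; exists x.
rewrite E => /(_ (lshift r 0)) /andP[+ _]; congr (_ <= _)%MS.
  by rewrite row_u -stgr_graph stack_u.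
by rewrite row_u.
Qed.

End StrictTransform.

(** * Schubert lines *)

Lemma mul_col_mx2 (R : comNzRingType) n (D : 'rV[R]_(1 + 1)) (u v : 'rV[R]_n) :
  D *m col_mx u v = D 0 (lshift 1 0) *: u + D 0 (rshift 1 0) *: v.
Proof.
rewrite -{1}(hsubmxK D) mul_row_col.
have s1 (d : 'M[R]_1) : d = (d 0 0)%:M by rewrite [LHS]mx11_scalar.
by rewrite [lsubmx D]s1 [rsubmx D]s1 !mul_scalar_mx !mxE.
Qed.

Section Pencil.
Variables (K : fieldType) (k n : nat) (Phi : 'M[K]_(k, n)) (Lam : 'M[K]_(k.+2, n)).
Hypotheses (fPhi : row_free Phi) (fLam : row_free Lam) (PL : (Phi <= Lam)%MS).

Definition pencil (w : 'rV[K]_n) : 'M[K]_(k.+1, n) := col_mx w Phi.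

(** A complement of Phi in Lam is a plane; every A between Phi and Lam meets it in
    a line. *)
Lemma pencil_basis : exists u v : 'rV[K]_n,
  [/\ (u <= Lam)%MS, (v <= Lam)%MS,
     forall a b, ((a *: u + b *: v)%R <= Phi)%MS -> a = 0 /\ b = 0 &
     forall A : 'M[K]_(k.+1, n), row_free A -> (Phi <= A)%MS -> (A <= Lam)%MS ->
       exists a b, [/\ a *: u + b *: v != 0 & ((a *: u + b *: v)%R <= A)%MS]].
Proof.
pose W := (Lam :\: Phi)%MS.
have rW : \rank W = 2%N.
  have := mxrank_cap_compl Lam Phi; have -> : \rank (Lam :&: Phi)%MS = k.
    by rewrite (capmx_idPr PL); apply/eqP.
  by rewrite (eqP fLam) -/W => /eqP; rewrite -addn2 eqn_add2l => /eqP.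
pose V : 'M[K]_(1 + 1, n) := castmx (rW, erefl n) (row_base W).
have VW : (V :=: W)%MS by apply: (eqmx_trans (eqmx_cast _ _)); apply: eq_row_base.
have fV : row_free V by rewrite /row_free VW rW.
have comb (D : 'rV[K]_(1 + 1)) : D *m V = D 0 (lshift 1 0) *: usubmx V + D 0 (rshift 1 0) *: dsubmx V.
  by rewrite -{1}(vsubmxK V) mul_col_mx2.
have uV : (usubmx V <= V)%MS by rewrite -{2}(vsubmxK V) -addsmxE addsmxSl.
have vV : (dsubmx V <= V)%MS by rewrite -{2}(vsubmxK V) -addsmxE addsmxSr.
have WL : (W <= Lam)%MS by apply: diffmxSl.
exists (usubmx V), (dsubmx V); split.
- by apply: submx_trans uV _; rewrite VW.
- by apply: submx_trans vV _; rewrite VW.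
- move=> a b sub; pose D : 'rV[K]_(1 + 1) := row_mx a%:M b%:M.
  have DV : D *m V = a *: usubmx V + b *: dsubmx V.
    by rewrite comb row_mxEl row_mxEr !mxE eqxx.
  have : (D *m V <= W :&: Phi)%MS by rewrite sub_capmx -{1}VW submxMl DV sub.
  rewrite capmx_diff submx0 => /eqP D0.
  have /eq_row_mx : D = row_mx 0 0.
    by apply: (row_free_inj fV); rewrite D0 row_mx0 mul0mx.
  by move=> [/matrixP/(_ 0 0) + /matrixP/(_ 0 0)]; rewrite !mxE !eqxx !mulr1n.
move=> A fA PA AL; have := mxrank_sum_cap A W; rewrite rW (eqP fA).
have AW : (A + W <= Lam)%MS by rewrite addsmx_sub AL.
move=> E; have := mxrankS AW; rewrite (eqP fLam) => le.
have cap0 : (A :&: W)%MS != 0.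
  by rewrite -mxrank_eq0; apply: contraTneq le => c0; rewrite c0 addn0 in E; rewrite E -ltnNge addn2.
have := nz_row_sub (A :&: W)%MS; rewrite sub_capmx => /andP[wA wW].
have : (nz_row (A :&: W)%MS <= V)%MS by rewrite VW.
move=> /submxP[D wE]; rewrite comb in wE.
by exists (D 0 (lshift 1 0)), (D 0 (rshift 1 0)); rewrite -wE nz_row_eq0.
Qed.

Lemma pencil_sub m (B : 'M[K]_(m, n)) w : (pencil w <= B)%MS = (w <= B)%MS && (Phi <= B)%MS.
Proof. rewrite -addsmx_sub -[LHS]/((col_mx w Phi <= B)%MS); apply/esym; by rewrite addsmxE. Qed.

Lemma pencil_free w : ~~ (w <= Phi)%MS -> row_free (pencil w).
Proof.
move=> nw; have cap0 : (w :&: Phi)%MS = 0.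
  apply/eqP; rewrite -mxrank_eq0; apply: contraR nw => c0.
  have le := mxrankS (capmxSl w Phi); have w1 := rank_leq_row w.
  have rc : \rank (w :&: Phi)%MS = \rank w.
    by apply/eqP; rewrite eqn_leq le (leq_trans w1) // lt0n.
  have := mxrank_leqif_eq (capmxSl w Phi); rewrite rc => -[_ /esym]; rewrite eqxx.
  by move=> /andP[_ wc]; apply: submx_trans wc (capmxSr _ _).
have w0 : w != 0 by apply: contraNneq nw => ->; rewrite sub0mx.
have := mxrank_disjoint_sum cap0; rewrite (eqP fPhi) rank_rV w0 addsmxE => E.
by rewrite /row_free /pencil E.
Qed.

(** Determinants are linear in the first row: this is why the Schubert line is a
    line. *)
Lemma plk_pencil a b u v : plk (pencil (a *: u + b *: v)) = a *: plk (pencil u) + b *: plk (pencil v).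
Proof.
have R w (i : 'I_(1 + k)) : i != lshift k 0 -> forall w', row i (pencil w) = row i (pencil w').
  move=> ni w'; apply/rowP => l; rewrite !mxE /pencil; case: (splitP i) ni => [j ij|j ij] ni.
    by case/negP: ni; rewrite -val_eqE /= ij [j]ord1.
  by [].
have R0 w : row (lshift k 0 : 'I_(1 + k)) (pencil w : 'M[K]_(1 + k, n)) = w.
  by apply/rowP => l; rewrite mxE col_mxEu.
apply: (@plk_row_linear _ _ _ _ _ _ (lshift k 0 : 'I_(1 + k))); first by rewrite !R0.
  by move=> i ni; apply: R.
by move=> i ni; apply: R.
Qed.

End Pencil.

Lemma schubert_line_lcurve (K : closedFieldType) k n (Phi : 'M[K]_(k.-1, n)) (Lam : 'M[K]_(k.+1, n)) :
  (0 < k)%N -> schubert_flag Phi Lam -> exists u v : 'rV[K]_#|increasing k n|,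
  (forall a b, a *: u + b *: v = 0 -> a = 0 /\ b = 0) /\
  schubert_line Phi Lam = lcurve (0 : 'I_1) 0 u v.
Proof.
case: k Phi Lam => // k Phi Lam _ [fP fL PL]; rewrite /= in Phi fP PL *.
have [u [v [uL vL ind H]]] := pencil_basis fP fL PL.
have fr a b : (a != 0) || (b != 0) -> row_free (pencil Phi (a *: u + b *: v)).
  move=> ab; apply: (pencil_free fP); apply/negP => sub; have [a0 b0] := ind a b sub.
  by move: ab; rewrite a0 b0 eqxx.
exists (plk (pencil Phi u)), (plk (pencil Phi v)); split=> [a b|].
  rewrite -plk_pencil => E; have [ab|] := boolP ((a != 0) || (b != 0)).
    by have := free_plk_neq0 (fr a b ab); rewrite E eqxx.
  by rewrite negb_or !negbK => /andP[/eqP-> /eqP->].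
have row0 (z : 'rV[K]_#|increasing k.+1 n|) : row 0 z = z by rewrite row_id.
apply/seteqP; split => x.
  move=> [A [c [fA /andP[PA AL] c0 ->]]]; have [a [b [w0 wA]]] := H A fA PA AL.
  have ab : (a != 0) || (b != 0).
    by apply: contraNT w0; rewrite negb_or !negbK => /andP[/eqP-> /eqP->]; rewrite !scale0r addr0.
  have sub : (pencil Phi (a *: u + b *: v)%R <= A)%MS by rewrite pencil_sub wA.
  have : (A <= pencil Phi (a *: u + b *: v)%R)%MS.
    have := mxrank_leqif_eq sub; rewrite (eqP fA) (eqP (fr a b ab)) => -[_ /esym].
    by rewrite eqxx => /andP[].
  move=> /submxP[D AE]; have pA := free_plk_neq0 fA; rewrite AE plk_mul in pA.
  have d0 : \det D != 0 by apply: contraNneq pA => ->; rewrite scale0r.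
  exists a, b, (fun=> c * \det D); split=> // [i|]; first by rewrite mulf_neq0.
  rewrite -[RHS]row0 row_rscale (lpt_row 0) plueckerE AE plk_mul scalerA plk_pencil.
  by [].
move=> [a [b [c [ab c0 xE]]]]; exists (pencil Phi (a *: u + b *: v)), (c 0); split.
- exact: fr.
- have := submx_refl (pencil Phi (a *: u + b *: v)%R); rewrite pencil_sub => /andP[_ ->] /=.
  by rewrite pencil_sub PL andbT; apply: addmx_sub; apply: scalemx_sub.
- exact: c0.
- by rewrite xE -[LHS]row0 row_rscale (lpt_row 0) plueckerE plk_pencil.
Qed.

(** ** The strict transform of a line through the centers *)

(** A line is contracted to a point by the projection from any of its points. *)
Lemma project_pencil (K : fieldType) N (g u v : 'rV[K]_N) :
  (forall a b, a *: u + b *: v = 0 -> a = 0 /\ b = 0) ->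
  (exists a b, g = a *: u + b *: v) -> g != 0 ->
  exists2 q : 'rV[K]_N, q != 0 & forall a b, exists c, (a *: u + b *: v) *m cokermx g = c *: q.
Proof.
have step (u' v' : 'rV[K]_N) a b : (forall a b, a *: u' + b *: v' = 0 -> a = 0 /\ b = 0) ->
    g = a *: u' + b *: v' -> a != 0 ->
    exists2 q : 'rV[K]_N, q != 0 & forall x y, exists c, (x *: u' + y *: v') *m cokermx g = c *: q.
  move=> ind gE a0; exists (v' *m cokermx g).
    rewrite -submxE; apply/negP => /sub_rVP[t vE].
    have [|_ t1] := ind (t * a) (t * b - 1).
      by rewrite scalerBl scale1r -!scalerA addrA -scalerDr -gE -vE subrr.
    have [|ta _] := ind (t * a) (t * b - 1).
      by rewrite scalerBl scale1r -!scalerA addrA -scalerDr -gE -vE subrr.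
    move/eqP: ta; rewrite mulf_eq0 (negbTE a0) orbF => /eqP t0.
    by move/eqP: t1; rewrite t0 mul0r sub0r oppr_eq0 oner_eq0.
  have uE : u' *m cokermx g = - (b / a) *: (v' *m cokermx g).
    have : g *m cokermx g = 0 by apply: mulmx_coker.
    rewrite {1}gE mulmxDl -!scalemxAl => /eqP; rewrite addr_eq0 => /eqP E.
    apply: (scalerI a0); rewrite E scalerA mulrN mulrC divfK // scaleNr //.
  move=> x y; exists (x * - (b / a) + y).
  by rewrite mulmxDl -!scalemxAl uE scalerA -scalerDl.
move=> ind [a [b gE]] g0; have [a0|a0] := eqVneq a 0; last exact: (step u v a b).
have b0 : b != 0 by apply: contraNneq g0 => b0; rewrite gE a0 b0 !scale0r addr0.
have [||//|q q0 H] := step v u b a.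
- by move=> x y E; have [] := ind y x; rewrite // addrC.
- by rewrite gE addrC.
by exists q => // x y; have [c E] := H y x; exists c; rewrite addrC.
Qed.

(** All centers lie on the line, so all components but the first one are constant
    on its strict transform. *)
Lemma strict_line_degree (K : closedFieldType) (r N : nat) (p : 'I_r -> 'rV[K]_N) (u v : 'rV[K]_N)
  (ind : forall a b, a *: u + b *: v = 0 -> a = 0 /\ b = 0) :
  (forall a, lcurve (0 : 'I_1) 0 u v (p a)) ->
  forall hD : irred_closed (strict_transform p (lcurve (0 : 'I_1) 0 u v)),
  (forall i, i != lshift r (0 : 'I_1) -> fdeg hD i = 0) /\ 0 < fdeg hD (lshift r (0 : 'I_1)).
Proof.
move=> pL hD; have q0 (i : 'I_1) : i != 0 -> row i (0 : 'rV[K]_N) != 0 by rewrite ord1 eqxx.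
have curveL := line_curve q0 ind; have cL := zclosed_lcurve q0 ind.
have lrow x : lcurve (0 : 'I_1) 0 u v x -> exists a b, x = a *: u + b *: v.
  move=> /lcurve_row[a [b [c [_ _ E]]]]; exists (c * a), (c * b).
  by rewrite row_id in E; rewrite E scalerDr !scalerA.
have Hq a : exists q : 'rV[K]_N, q != 0 /\
    forall x y, exists c, (x *: u + y *: v) *m cokermx (p a) = c *: q.
  have [||q qn H] := @project_pencil K N (p a) u v ind; last by exists q.
    exact: lrow.
  by have := zclosed_ppoint cL (pL a) 0; rewrite row_id.
have [q Hq'] := choice Hq.
pose Q : 'M[K]_(1 + r, N) := stack 0 q.
apply: (one_component_degree (q := Q) hD (strict_curve p curveL)) => [i|z Dz i].
  have [->|[a ->]] := row_cases i; first by rewrite eqxx.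
  by move=> _; rewrite stack_row; case: (Hq' a).
have [->|[a ->]] := row_cases i; first by rewrite eqxx.
move=> _ l l'; have QE m : Q (rshift 1 a) m = q a 0 m.
  by have /rowP/(_ m) := stack_row 0 q a; rewrite mxE.
pose P := minor2 (q a) (rshift 1 a) l l'.
have [_ P0] : [set z | ppoint z /\ mevalM P z = 0] z.
  have cP : zclosed [set z | ppoint z /\ mevalM P z = 0].
    by apply: zclosed_zero; apply: mhomog_minor2.
  apply: (zclosure_min cP _ Dz).
  move=> w [x [Lx nx] <-]; split; first exact: (graph_ppointP curveL Lx nx).
  have [s [t xE]] := lrow x Lx; have [_ /(_ s t)[c]] := Hq' a; rewrite -xE => cE.
  have E m : graph_pt p x (rshift 1 a) m = c * q a 0 m.
    by rewrite col_mxEd mxE cE mxE.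
  by rewrite mevalM_pev pev_minor2 !E /=; ring.
move: P0; rewrite mevalM_pev pev_minor2 !QE => /eqP; rewrite subr_eq0 => /eqP E.
exact: E.
Qed.

(** * Lines in the exceptional divisors *)

Section Exceptional.
Variables (K : closedFieldType) (k n r : nat).
Notation N := #|increasing k n|.
Variables (idx : 'I_r -> 'I_N) (Aa : 'I_r -> 'M[K]_(k, n)) (Gam : 'I_r -> 'rV[K]_N).
Notation I a := (enum_val (idx a) : {ffun 'I_k -> 'I_n}).
Hypothesis k_gt0 : (0 < k)%N.
Hypothesis kn : (k.+1 < n)%N.
Hypothesis Aa1 : forall a, colsub (I a) (Aa a) = 1%:M.
Hypothesis GamE : forall a, exists2 c, c != 0 & Gam a = c *: plk (Aa a).
Hypothesis Gam_inj : forall a b, a != b -> ~~ (Gam a == Gam b)%MS.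
Notation G := (grassmannian K k n).
Notation X := (blowup G Gam).
Notation idK := (idrm K).

Lemma ch0_u a Y : usubmx (ch Aa Gam a idK 0 Y) = plk (Aa a).
Proof. by rewrite stack_u scale0r addr0 map_idrm. Qed.

Lemma ch0_row a b Y : row (rshift 1 b) (ch Aa Gam a idK 0 Y) =
  (if b == a then Tel (Aa a) Y (Aa a) else plk (Aa a)) *m cok Gam b.
Proof. by rewrite stack_row scale0r addr0 !map_idrm. Qed.

(** Two columns outside I a, which exist because k + 1 < n, give two independent
    tangent directions at the center. *)
Lemma fibre_pencil a : exists (Z : K -> K -> 'M[K]_(1 + r, N)) (u v : 'rV[K]_N),
  [/\ forall x y, (x != 0) || (y != 0) -> ppoint (Z x y) /\ X (Z x y),
      forall x y, row (rshift 1 a) (Z x y) = x *: u + y *: v,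
      forall x y i, i != rshift 1 a -> row i (Z x y) = row i (Z 1 0) &
      forall x y, usubmx (Z x y) = plk (Aa a)].
Proof.
have [l1 [l2 [n1 n2 l12]]] : exists l1 l2 : 'I_n,
    [/\ l1 \notin codom (I a), l2 \notin codom (I a) & l1 != l2].
  have : (1 < #|[predC codom (I a)]|)%N.
    have := cardC (mem (codom (I a))); rewrite card_ord => E.
    have le : (#|codom (I a)| <= k)%N by rewrite (leq_trans (leq_image_card _ _)) // card_ord.
    by move: kn E le; move: #|_| #|_| => x y; clear; lia.
  by move=> /card_gt1P[x [y [xA yA xy]]]; exists x, y.
pose i0 : 'I_k := Ordinal k_gt0.
pose Y x y : 'M[K]_(k, n) := x *: delta_mx i0 l1 + y *: delta_mx i0 l2.
have YI x y : colsub (I a) (Y x y) = 0.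
  apply/matrixP => i j; rewrite !mxE; have [h1|h1] := eqVneq (I a j) l1.
    by move: n1; rewrite -h1 codom_f.
  have [h2|h2] := eqVneq (I a j) l2; first by move: n2; rewrite -h2 codom_f.
  by rewrite !andbF !mulr0 addr0.
have Y0 x y : (x != 0) || (y != 0) -> Y x y != 0.
  apply: contraTneq => E; have /matrixP/(_ i0 l1) := E; have /matrixP/(_ i0 l2) := E.
  rewrite !mxE !eqxx /= [l2 == l1]eq_sym (negbTE l12) !mulr0 !mulr1 add0r addr0 => -> ->.
  by rewrite eqxx.
exists (fun x y => ch Aa Gam a idK 0 (Y x y)).
exists (Tel (Aa a) (delta_mx i0 l1) (Aa a) *m cok Gam a).
exists (Tel (Aa a) (delta_mx i0 l2) (Aa a) *m cok Gam a); split.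
- move=> x y xy; have pZ : ppoint (ch Aa Gam a idK 0 (Y x y)).
    by apply: (ch_fibre k_gt0 Aa1 GamE Gam_inj); [apply: YI|apply: Y0].
  by split=> //; apply: (ch_X GamE).
- by move=> x y; rewrite ch0_row eqxx Tel_lin mulmxDl !scalemxAl.
- move=> x y i; have [->|[b ->]] := row_cases i; first by rewrite !row_u !ch0_u.
  by rewrite eq_rshift !ch0_row => /negbTE->.
- by move=> x y; rewrite ch0_u.
Qed.

Lemma exceptional_line_ex a : exists C, exceptional_line G Gam a C /\
  forall hC : irred_closed C, (forall i, i != rshift 1 a -> fdeg hC i = 0) /\
    0 < fdeg hC (rshift 1 a).
Proof.
have [Z [u [v [HZ rowZ rowZ' ZU]]]] := fibre_pencil a.
have q0 i : i != rshift 1 a -> row i (Z 1 0) != 0.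
  by move=> _; have [|+ _] := HZ 1 0; [rewrite oner_neq0|apply].
have ind x y : x *: u + y *: v = 0 -> x = 0 /\ y = 0.
  rewrite -rowZ => E; have [xy|] := boolP ((x != 0) || (y != 0)).
    by have [/(_ (rshift 1 a)) + _] := HZ x y xy; rewrite E eqxx.
  by rewrite negb_or !negbK => /andP[/eqP-> /eqP->].
have ZE x y : lpt (rshift 1 a) (Z 1 0) u v idK x y = Z x y.
  apply/row_matrixP => i; have [->|ia] := eqVneq i (rshift 1 a).
    by rewrite lpt_row rowZ.
  by rewrite lpt_row' // rowZ'.
exists (lcurve (rshift 1 a) (Z 1 0) u v); split; last by move=> hC; apply: line_degree.
split; first exact: line_curve.
  move=> z [x [y [c [xy c0 ->]]]]; rewrite ZE; split.
    by apply: zclosed_rscale (zclosed_blowup Gam) c0 _; case: (HZ x y xy).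
  rewrite usubmx_rscale ZU; have [d d0 ->] := GamE a.
  by rewrite scalemx_sub // eqmx_scale.
exists (col_mx u v : 'M[K]_(1 + 1, N)).
  rewrite -kermx_eq0; apply/eqP/row_matrixP => i; rewrite row0.
  pose D : 'rV[K]_(1 + 1) := row i (kermx (col_mx u v)).
  have D0 : D *m col_mx u v = 0 by rewrite /D -row_mul mulmx_ker row0.
  rewrite mul_col_mx2 in D0; have [d1 d2] := ind _ _ D0.
  rewrite -/D; apply/rowP => j; rewrite [RHS]mxE.
  by case: (split_ordP (j : 'I_(1 + 1))) => m ->; rewrite ord1.
apply/seteqP; split => w /=.
  move=> [z Dz <-]; have [x [y [c [xy c0 E]]]] := lcurve_row Dz.
  have cz := zclosed_ppoint (zclosed_lcurve q0 ind) Dz.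
  split; first exact: cz.
  have uU : (u <= col_mx u v)%MS by rewrite -addsmxE addsmxSl.
  have vU : (v <= col_mx u v)%MS by rewrite -addsmxE addsmxSr.
  by rewrite E; apply: scalemx_sub; apply: addmx_sub; apply: scalemx_sub.
move=> [w0 /submxP[D wE]]; rewrite (mul_col_mx2 (D : 'rV_(1 + 1)))%R in wE.
move: (D 0 (lshift 1 0 : 'I_(1 + 1))) (D 0 (rshift 1 0 : 'I_(1 + 1))) wE => x y wE.
have xy : (x != 0) || (y != 0).
  by apply: contraNT w0; rewrite negb_or !negbK wE => /andP[/eqP-> /eqP->]; rewrite !scale0r addr0.
exists (lpt (rshift 1 a) (Z 1 0) u v idK x y); first exact: lpt_in.
by rewrite lpt_row.
Qed.

End Exceptional.

Import numFieldNormedType.Exports.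

(** * The cone of curves *)

Lemma eval_continuous (T : Type) (R : realType) (t : T) :
  continuous (fun g : {ptws T -> R} => g t).
Proof. exact: (@proj_continuous {classic T} (fun=> R) t). Qed.

Lemma closure_closed (T : topologicalType) (A C : set T) x :
  closure A x -> closed C -> A `<=` C -> C x.
Proof. by rewrite closureEbigcap => H cC AC; apply: H. Qed.

Lemma combination_continuous (T : topologicalType) (R : realType) (I : Type) (r : seq I)
    (g : I -> T -> R) (c : I -> R) (h : T -> R) :
  continuous h -> (forall i, continuous (g i)) ->
  continuous (fun y => h y - \sum_(i <- r) g i y * c i).
Proof.
move=> ch cg; have cs : continuous (fun y => \sum_(i <- r) g i y * c i).
  elim: r => [|i r IH]; first by under eq_fun do rewrite big_nil; apply: cst_continuous.
  under eq_fun do rewrite big_cons; move=> y; apply: cvgD; last exact: IH.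
  by apply: cvgMl; apply: cg.
by move=> y; apply: cvgB; [apply: ch|apply: cs].
Qed.

(** The elements of S are nonnegative combinations of the b i whose coefficients
    can be read off by evaluation at the t i. Both properties are closed conditions
    for pointwise convergence, and pass to the cone and to its closure. *)
Lemma closure_cone (R : realType) (T : Type) (S : set (T -> R)) (I : finType)
    (b : I -> T -> R) (t : I -> T) (m : I -> R) : (forall i, 0 < m i) ->
  (forall x, S x -> (forall i, 0 <= x (t i)) /\ forall s, x s = \sum_i x (t i) / m i * b i s) ->
  forall x, closure (cone_of S : set {ptws T -> R}) x ->
  (forall i, 0 <= x (t i)) /\ forall s, x s = \sum_i x (t i) / m i * b i s.
Proof.
move=> m0 HS x clx.
have HC y : cone_of S y ->
    (forall i, 0 <= y (t i)) /\ forall s, y s = \sum_i y (t i) / m i * b i s.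
  move=> [n [c [g [c0 Sg ->]]]]; split=> [i|s].
    by apply: sumr_ge0 => j _; apply: mulr_ge0 => //; have [] := HS _ (Sg j).
  under [RHS]eq_bigr => i _ do rewrite !mulr_suml.
  rewrite exchange_big; apply: eq_bigr => j _ /=.
  have [_ ->] := HS _ (Sg j); rewrite mulr_sumr; apply: eq_bigr => i _.
  by rewrite !mulrA.
split=> [i|s].
  have cC : closed ((fun g : {ptws T -> R} => g (t i)) @^-1` [set z | 0 <= z]).
    have cg : continuous (fun g : {ptws T -> R} => g (t i)) by apply: eval_continuous.
    apply: (@preimage_closed _ _ (fun g : {ptws T -> R} => g (t i)) [set z | 0 <= z]).
      by move=> y _; apply: cg.
    exact: closed_ge.
  by apply: (closure_closed clx cC) => y /HC[+ _]; apply.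
pose f (y : {ptws T -> R}) : R := y s - \sum_i y (t i) * ((m i)^-1 * b i s).
have cf : continuous f.
  by apply: combination_continuous => [|i]; apply: eval_continuous.
have cC : closed (f @^-1` [set z | z = 0]).
  apply: (@preimage_closed _ _ f [set z | z = 0]); last exact: closed_eq.
  by move=> y _; apply: cf.
have fE y : f y = y s - \sum_i y (t i) / m i * b i s.
  by congr (_ - _); apply: eq_bigr => i _; rewrite mulrA.
suff : f x = 0 by move/eqP; rewrite fE subr_eq0 => /eqP.
by apply: (closure_closed clx cC) => y /HC[_ E]; rewrite /= fE -E subrr.
Qed.

Theorem proposition6p7 (R : realType) (K : closedFieldType)
    (charK0 : [pchar K] =i pred0)
    (k n r : nat) (k_ge2 : (2 <= k)%N) (nk_ge2 : (2 <= n - k)%N)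
    (Phi : 'M[K]_(k.-1, n)) (Lam : 'M[K]_(k.+1, n))
    (flag : schubert_flag Phi Lam)
    (Gamma : 'I_r -> 'rV[K]_#|increasing k n|)
    (Gamma_line : forall a, schubert_line Phi Lam (Gamma a))
    (Gamma_inj : forall a b, a != b -> ~~ (Gamma a == Gamma b)%MS) :
  S_generated R Gamma.
Proof.
have k0 : (0 < k)%N by apply: leq_trans k_ge2.
have kn : (k.+1 < n)%N by move: nk_ge2; clear; lia.
set G := grassmannian K k n; set X := blowup G Gamma.
have LG : schubert_line Phi Lam `<=` G by move=> x [A [c [fA _ c0 xE]]]; exists A, c.
have HG a : exists d : 'I_#|increasing k n| * 'M[K]_(k, n),
    colsub (enum_val d.1 : {ffun 'I_k -> 'I_n}) d.2 = 1%:M /\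
    exists2 c, c != 0 & Gamma a = c *: plk d.2.
  have [i [A [c [A1 c0 E]]]] := grassmannian_normal (LG _ (Gamma_line a)).
  by exists (i, A); split=> //; exists c.
have [d Hd] := choice HG; pose idx a := (d a).1; pose Aa a := (d a).2.
have Aa1 a : colsub (enum_val (idx a) : {ffun 'I_k -> 'I_n}) (Aa a) = 1%:M by case: (Hd a).
have GamE a : exists2 c, c != 0 & Gamma a = c *: plk (Aa a) by case: (Hd a).
have cX : zclosed X := zclosed_blowup Gamma.
have [u [v [ind LE]]] := schubert_line_lcurve k0 flag.
have curveL : is_curve (schubert_line Phi Lam).
  by rewrite LE; apply: line_curve ind => i; rewrite ord1 eqxx.
have strictX C : C `<=` G -> strict_transform Gamma C `<=` X.
  move=> CG; apply: (zclosure_min cX) => _ [x [Cx nx] <-]; apply: sub_zclosure.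
  by exists x => //; split=> //; apply: CG.
rewrite /S_generated -/G -/X; set GS := (X in cone_of X).
have GSc : GS `<=` curve_classes R X.
  move=> _ [[C [a [cC CE _]] <-]|[C [cC CG _] <-]].
    by exists C => //; split=> // z /CE[].
  by exists (strict_transform Gamma C) => //; split; [apply: strict_curve|apply: strictX].
have gens i : exists b : set 'M[K]_(1 + r, #|increasing k n|),
    [/\ is_curve b, b `<=` X, GS (curve_class R X b) & forall hb : irred_closed b,
      (forall j, j != i -> fdeg hb j = 0) /\ 0 < fdeg hb i].
  have [->|[a ->]] := row_cases i; last first.
    have [C [eC dC]] := exceptional_line_ex k0 kn Aa1 GamE Gamma_inj a.
    have [cC CE _] := eC; exists C; split=> //; first by move=> z /CE[].
    by left; exists C => //; exists a.
  exists (strict_transform Gamma (schubert_line Phi Lam)); split.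
  - exact: strict_curve.
  - exact: strictX.
  - right; exists (schubert_line Phi Lam) => //; split=> //.
    by exists Phi, Lam.
  - rewrite LE => hb; apply: (strict_line_degree ind) => a; rewrite -LE.
    exact: Gamma_line.
have [b Hb] := choice gens.
have cb i : is_curve (b i) by case: (Hb i).
have irr (C : set 'M[K]_(1 + r, #|increasing k n|)) : is_curve C -> irred_closed C by case.
pose O i := O1 cX i; pose m i : R := (fdeg (irr _ (cb i)) i)%:~R.
have m0 i : 0 < m i.
  by rewrite ltr0z; have [_ _ _ /(_ (irr _ (cb i)))[]] := Hb i.
(* degrees on the curves b i separate the coefficients of the degree formula *)
have classE x : curve_classes R X x -> (forall i, 0 <= x (O i)) /\
    forall LB, x LB = \sum_i x (O i) / m i * curve_class R X (b i) LB.
  move=> [C [cC CX] <-]; have dO i : degree (O i) C = fdeg (irr _ cC) i by apply: degree_O1.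
  split=> [i|LB]; first by rewrite /curve_class dO ler0z; apply: fdeg_ge0; apply: curve_algdep.
  have [a aE] := degree_formula k0 kn Aa1 GamE Gamma_inj LB.
  rewrite /curve_class (aE _ (irr _ cC) cC CX) rmorph_sum; apply: eq_bigr => i _ /=.
  have [_ bX _ /(_ (irr _ (cb i)))[bj bi]] := Hb i.
  rewrite (aE _ (irr _ (cb i)) (cb i) bX) (bigD1 i) //= big1 => [|j ji]; last by rewrite bj ?mulr0.
  rewrite dO addr0 !rmorphM /= [X in _ = _ * X]mulrC mulrA divfK; first exact: mulrC.
  by rewrite gt_eqF // ltr0z.
apply/seteqP; split => x.
  move=> [_ clx]; have [x0 xE] := closure_cone m0 classE clx.
  exists (1 + r)%N, (fun i => x (O i) / m i), (fun i => curve_class R X (b i)); split.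
  - by move=> i; rewrite divr_ge0 // ltW.
  - by move=> i; case: (Hb i).
  - exact/funext.
move=> [p [c [g [c0 gS ->]]]]; split.
  by exists p, c, g; split=> // i; apply: GSc.
by apply: subset_closure; exists p, c, g; split=> // i; apply: GSc.
Qed.
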